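(* Let $R$ be a rational map of degree $d\ge 2$, and let $\mathcal{S}(D(R))$ be the associated semigroup of piecewise holomorphic maps with its Ruelle representation $\rho$ on $L_1(\overline{\mathbb{C}})$ (defined in the context). Assume that the action of $\mathcal{S}(D(R))$ on $L_1(\overline{\mathbb{C}})$ is left amenable, i.e. that $\mathcal{S}(D(R))$ is $\rho$-left-amenable. Then the following conditions are equivalent: (1) The Ruelle operator $R_*$ has non-zero fixed points in $L_1(\overline{\mathbb{C}})$. (2) $R$ is Möbius conjugate to a flexible Lattès map.
   Context: $L_1(\overline{\mathbb{C}})$ is taken with respect to planar Lebesgue measure. The Ruelle operator of $R$ is $R_*(\phi)(y)=\sum_{R(x)=y}\frac{\phi(x)}{(R'(x))^2}$ acting on $L_1(\overline{\mathbb{C}})$. Full deck group. Fix an analytic arc $\sigma\subset\overline{\mathbb{C}}$ containing all critical values of $R$. Let $U=\overline{\mathbb{C}}\setminus\sigma$; then $R^{-1}(U)=\bigcup_{i=1}^{d}D_i$ with $D_i$ disjoint, simply connected, and $R_i=R|_{D_i}:D_i\to U$ a holomorphic homeomorphism. Define $h_{i,j}$ to be $R_j^{-1}\circ R_i$ on $D_i$, $R_i^{-1}\circ R_j$ on $D_j$, and the identity elsewhere ($h_{i,i}=Id$). $D(R)$ is the group generated by the $h_{i,j}$ (maps defined up to measure zero); it is isomorphic to the symmetric group on $d$ symbols and $R\circ\gamma=R$ a.e. for $\gamma\in D(R)$. It acts on $L_1$ by $\gamma_*(f)=f(\gamma)(\gamma')^2$. For $\gamma\in D(R)$ put $R_\gamma=\gamma\circ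 R\circ\gamma^{-1}=\gamma\circ R$, and let $\mathcal{S}(D(R))$ be the semigroup generated under composition by $\{R_\gamma:\gamma\in D(R)\}$. The Ruelle representation $\rho:\mathcal{S}(D(R))\to End(L_1(\overline{\mathbb{C}}))$ is the homomorphism given on generators by $\rho(R_\gamma)=\gamma_*\circ R_*$. $\rho$-left-amenability. For a semigroup $S$, $L_\infty(S)$ is the space of bounded complex functions on $S$ with the sup norm; a mean is a continuous linear functional $M$ with $M(\phi)\ge0$ for $\phi\ge0$ and $\|M\|=M(\chi_S)=1$; $l_s(\phi)(x)=\phi(sx)$. For a bounded homomorphism $\rho:S\to End(B)$, $B$ a Banach space, let $f_{(b,b^* )}(s)=b^*(\rho(s)(b))$ for $(b,b^* )\in B\times B^*$, $Y_\rho$ the closed linear span of these functions in $L_\infty(S)$ and $X_\rho$ the space generated by $Y_\rho$ and constants. $S$ is $\rho$-left-amenable if there is a mean $M$ on $L_\infty(S)$ with $M(l_s\phi)=M(\phi)$ for all $\phi\in X_\rho$, $s\in S$. A flexible Lattès map is a rational map $f$ with $f\circ\Theta=\Theta\circ L$ where $\Theta:\mathbb{C}/\Lambda\to\overline{\mathbb{C}}$ is the degree-two quotient by $z\sim -z$ of a complex torus and $L(z)=az+b$ with $a\in\mathbb{Z}$, $|a|\ge2$, $2b\in\Lambda$. *)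

(* Defs.v *)
From HB Require Import structures.
From mathcomp Require Import all_boot all_order all_algebra.
From mathcomp Require Import generic_quotient ring_quotient.
From mathcomp Require Import complex.
From mathcomp Require Import all_classical all_reals all_analysis.
From mathcomp Require Import measurable_realfun.

Set Implicit Arguments.
Unset Strict Implicit.
Unset Printing Implicit Defensive.

Import Order.TTheory GRing.Theory Num.Theory.
Import numFieldNormedType.Exports.

Local Open Scope classical_set_scope.
Local Open Scope ring_scope.
Local Open Scope complex_scope.
Local Open Scope quotient_scope.

Local Notation normc := Normc.normc.
Local Notation Re := complex.Re.
Local Notation Im := complex.Im.

HB.instance Definition _ (R : realType) := NormedModule.copy R[i] R[i]^o.

(* [None] is the point at infinity. *)
Definition sphere (R : realType) := one_point_compactification R[i].
HB.instance Definition _ (R : realType) := Topological.on (sphere R).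
HB.instance Definition _ (R : realType) := Pointed.on (sphere R).

Section Sphere.
Variable R : realType.
Local Notation C := R[i].
Local Notation S := (sphere R).
Implicit Types (f : S -> S) (g : C -> S) (p q x : S) (z : C).

Definition fin x : C := if x is Some z then z else 0.

Definition sinv x : S :=
  if x is Some z then (if z == 0 then None else Some z^-1) else Some 0.

(* Affine coordinate: z around finite points, 1/z around infinity.
   [param p] and [coord p] are inverse to each other near [p]. *)
Definition param p : C -> S := if p is Some _ then Some else sinv \o Some.
Definition coord p : S -> C := if p is Some _ then fin else fin \o sinv.

(* [f] read in the coordinates at [p] and at [f p]. *)
Definition local_expr f p : C -> C := coord (f p) \o f \o param p.

(* Meaningful for open [A]. *)
Definition holomorphic_on (A : set S) f := forall p, A p ->
  {for p, continuous f} /\ derivable (local_expr f p) (coord p p) 1.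

Definition local_derive f p : C := derive1 (local_expr f p) (coord p p).

(* Same notions for sphere-valued maps on the plane. *)
Definition plane_holomorphic_on (V : set C) g := forall z, V z ->
  {for z, continuous g} /\ derivable (coord (g z) \o g) z 1.

Definition plane_local_derive g z : C := derive1 (coord (g z) \o g) z.

(* The derivative in the affine coordinate; it is only ever used almost
   everywhere, away from infinity and from the poles. *)
Definition planar_derive f z : C := derive1 (fin \o f \o Some) z.

(* A regular simple arc whose parametrization by [0, 1] is analytic, i.e. is
   the restriction of a map holomorphic on a complex neighbourhood. *)
Definition analytic_arc (sigma : set S) := exists (V : set C) g,
  let I := [set t%:C | t in `[(0 : R), 1]] in
  [/\ open V /\ I `<=` V, plane_holomorphic_on V g,
      (forall z, I z -> plane_local_derive g z != 0),
      {in I &, injective g} & sigma = g @` I].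

Definition simply_connected (A : set S) :=
  [/\ A !=set0,
      (forall x y, A x -> A y -> exists c : R -> S,
         [/\ {within `[0, 1], continuous c}, c 0 = x, c 1 = y &
             c @` `[0, 1] `<=` A]) &
      (forall c : R -> S, {within `[0, 1], continuous c} -> c 0 = c 1 ->
         c @` `[0, 1] `<=` A -> exists H : R * R -> S,
         [/\ {within `[0, 1] `*` `[0, 1], continuous H},
             H @` (`[0, 1] `*` `[0, 1]) `<=` A,
             (forall t, 0 <= t <= 1 -> H (0, t) = c t),
             (forall t, 0 <= t <= 1 -> H (1, t) = c 0) &
             (forall s, 0 <= s <= 1 -> H (s, 0) = c 0 /\ H (s, 1) = c 0)])].

End Sphere.

Record ratmap (R : realType) := RatMap {
  rnum : {poly R[i]};
  rden : {poly R[i]};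
  rcoprime : coprimep rnum rden }.

Section RatMap.
Variable R : realType.
Implicit Types f g m : ratmap R.

Definition rdeg f : nat := (maxn (size (rnum f)) (size (rden f))).-1.

(* At infinity: the ratio of the coefficients of degree [rdeg f]. *)
Definition reval f (x : sphere R) : sphere R :=
  let: (a, b) := if x is Some z then ((rnum f).[z], (rden f).[z])
                 else ((rnum f)`_(rdeg f), (rden f)`_(rdeg f)) in
  if b == 0 then None else Some (a / b).

Definition critical_values f : set (sphere R) :=
  [set reval f c | c in [set c | local_derive (reval f) c = 0]].

Definition lattice (L : set R[i]) := exists w1 w2 : R[i],
  (forall s t : R, s%:C * w1 + t%:C * w2 = 0 -> s = 0 /\ t = 0) /\
  L = [set z | exists m n : int, z = m%:~R * w1 + n%:~R * w2].

(* [Theta] is given as a map on the plane; the last clause says that it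
   factors through the torus and that the induced map identifies exactly the
   pairs {z, -z}. *)
Definition torus_quotient (L : set R[i]) (Theta : R[i] -> sphere R) :=
  [/\ plane_holomorphic_on setT Theta, set_surj setT setT Theta &
      forall z w, Theta z = Theta w <-> L (z - w) \/ L (z + w)].

Definition flexible_lattes f := exists (L : set R[i]) Theta (a : int) (b : R[i]),
  [/\ lattice L, torus_quotient L Theta, 2 <= `|a|, L (2 * b) &
      forall z, reval f (Theta z) = Theta (a%:~R * z + b)].

Definition moebius_conjugate f g := exists m,
  rdeg m = 1%N /\ reval m \o reval f = reval g \o reval m.

End RatMap.

Section Planar.
Variable R : realType.
Local Notation C := R[i].
Local Notation mR := (measurableTypeR R).

Definition planar_measure := (@lebesgue_measure R \x @lebesgue_measure R)%E.
Local Notation mu := planar_measure.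

Definition to_plane (u : mR * mR) : C := u.1 +i* u.2.

Definition null (A : set (sphere R)) :=
  mu.-negligible [set u | A (Some (to_plane u))].

Definition cintegrable (f : C -> C) :=
  mu.-integrable setT (fun u => (Re (f (to_plane u)))%:E) /\
  mu.-integrable setT (fun u => (Im (f (to_plane u)))%:E).

Definition cae_eq (f g : C -> C) :=
  \forall u \ae mu, f (to_plane u) = g (to_plane u).

Definition cintegrable_pred : pred (C -> C) := fun f => `[< cintegrable f >].

Lemma cintegrable_submod : submod_closed cintegrable_pred.
Proof.
have ReE (a x y : C) :
    Re (a * x + y) = Re a * Re x + (- Im a * Im x + Re y).
  by case: a x y => [a1 a2] [x1 x2] [y1 y2] /=; rewrite mulNr addrA.
have ImE (a x y : C) : Im (a * x + y) = Re a * Im x + (Im a * Re x + Im y).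
  by case: a x y => [a1 a2] [x1 x2] [y1 y2] /=; rewrite addrA.
split.
- apply/asboolP; split; apply: (eq_integrable _ (cst 0%E)) => //;
    exact: integrable0.
- move=> a f g /asboolP[fr fi] /asboolP[gr gi]; apply/asboolP; split.
  + apply: (eq_integrable _
      (fun u => ((Re a)%:E * (Re (f (to_plane u)))%:E
        + ((- Im a)%:E * (Im (f (to_plane u)))%:E + (Re (g (to_plane u)))%:E))%E))
      => //.
      by move=> u _; rewrite -!EFinM -!EFinD -ReE.
    apply: integrableD => //; first exact: integrableZl.
    by apply: integrableD => //; exact: integrableZl.
  + apply: (eq_integrable _
      (fun u => ((Re a)%:E * (Im (f (to_plane u)))%:E
        + ((Im a)%:E * (Re (f (to_plane u)))%:E + (Im (g (to_plane u)))%:E))%E))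
      => //.
      by move=> u _; rewrite -!EFinM -!EFinD -ImE.
    apply: integrableD => //; first exact: integrableZl.
    by apply: integrableD => //; exact: integrableZl.
Qed.

HB.instance Definition _ := GRing.isSubmodClosed.Build C (C -> C)
  cintegrable_pred cintegrable_submod.

Record cintegrable_fun := CIntegrableFun {
  cfun :> C -> C;
  _ : cfun \in cintegrable_pred }.

HB.instance Definition _ := [isSub for cfun].
HB.instance Definition _ := [Choice of cintegrable_fun by <:].
HB.instance Definition _ :=
  [SubChoice_isSubLmodule of cintegrable_fun by <:].

Definition ae_zero : pred cintegrable_fun := fun f => `[< cae_eq f (cst 0) >].

Lemma ae_zero_submod : submod_closed ae_zero.
Proof.
split; first by apply/asboolP/aeW.
move=> a f g /asboolP f0 /asboolP g0; apply/asboolP.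
apply: filterS2 f0 g0 => u fu gu.
have -> : (a *: f + g) (to_plane u) = a * f (to_plane u) + g (to_plane u) by [].
by rewrite fu gu /= mulr0 addr0.
Qed.

HB.instance Definition _ := GRing.isSubmodClosed.Build C cintegrable_fun
  ae_zero ae_zero_submod.

(* Integrable functions modulo a.e. equality.  The point at infinity is null,
   so this is L_1 of the sphere for the planar measure. *)
Definition L1 : Type := 
  Quotient.quot (GRing.ZmodClosed.clone _ ae_zero _).
HB.instance Definition _ := GRing.Zmodule.on L1.
HB.instance Definition _ := EqQuotient.on L1.

Lemma L1_eqP (f g : cintegrable_fun) :
  (\pi_L1 f = \pi_L1 g) <-> cae_eq f g.
Proof.
have fgE u : (f - g) (to_plane u) = f (to_plane u) - g (to_plane u) by [].
split=> [/eqP|] fg.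
- move: fg; rewrite -[_ == _]Quotient.idealrBE => /asboolP fg.
  by apply: filterS fg => u; rewrite fgE /= => /eqP; rewrite subr_eq0 => /eqP.
- apply/eqP; rewrite -[_ == _]Quotient.idealrBE; apply/asboolP.
  by apply: filterS fg => u; rewrite fgE /= => ->; rewrite subrr.
Qed.

Lemma L1_reprP (f : cintegrable_fun) : cae_eq (repr (\pi_L1 f)) f.
Proof. by apply/L1_eqP; rewrite reprK. Qed.

Lemma L1_piD (f g : cintegrable_fun) : \pi_L1 (f + g) = \pi_L1 f + \pi_L1 g.
Proof. by rewrite piE. Qed.

Definition L1_scale (a : C) (u : L1) : L1 := \pi_L1 (a *: repr u).

Lemma L1_scale_pi a (f : cintegrable_fun) :
  L1_scale a (\pi_L1 f) = \pi_L1 (a *: f).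
Proof.
apply/L1_eqP; apply: filterS (L1_reprP f) => u fu.
have fE h : (a *: h : cintegrable_fun) (to_plane u) = a * h (to_plane u) by [].
by rewrite !fE fu.
Qed.

Lemma L1_scaleA a b u : L1_scale a (L1_scale b u) = L1_scale (a * b) u.
Proof. by rewrite /L1_scale -/(L1_scale _ _) L1_scale_pi scalerA. Qed.

Lemma L1_scale1 : left_id 1 L1_scale.
Proof. by move=> u; rewrite /L1_scale scale1r reprK. Qed.

Lemma L1_scaleDr : right_distributive L1_scale +%R.
Proof.
move=> a u v; rewrite -[u]reprK -[v]reprK -L1_piD !L1_scale_pi -L1_piD.
by rewrite scalerDr.
Qed.

Lemma L1_scaleDl u : {morph L1_scale^~ u : a b / a + b}.
Proof. by move=> a b; rewrite /L1_scale scalerDl L1_piD. Qed.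

HB.instance Definition _ := GRing.Zmodule_isLmodule.Build C L1
  L1_scaleA L1_scale1 L1_scaleDr L1_scaleDl.

Definition norm1 (f : C -> C) : R := \int[mu]_u normc (f (to_plane u)).

Lemma measurable_normc (f : cintegrable_fun) :
  measurable_fun setT (fun u => normc (f (to_plane u))).
Proof.
case: f => f /= /asboolP[/integrableP[fr _] /integrableP[fi _]].
rewrite (_ : (fun u => _) = Num.sqrt \o
    ((fun u => Re (f (to_plane u)) ^+ 2) \+ (fun u => Im (f (to_plane u)) ^+ 2))).
  apply: measurableT_comp; last first.
    by apply: measurable_funD; apply: measurable_funX; exact/measurable_EFinP.
  by apply: continuous_measurable_fun; exact: sqrt_continuous.
by apply/funext => u /=; case: (f _).
Qed.

Lemma normc_le_ReIm (z : C) : normc z <= `|Re z| + `|Im z|.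
Proof.
case: z => a b /=; rewrite -[leRHS]ger0_norm ?addr_ge0// -sqrtr_sqr.
rewrite ler_wsqrtr// sqrrD !real_normK ?num_real// lerD2r lerDl.
by rewrite mulrn_wge0// mulr_ge0.
Qed.

Lemma integrable_normc (f : cintegrable_fun) :
  mu.-integrable setT (EFin \o (fun u => normc (f (to_plane u)))).
Proof.
have mf := measurable_normc f.
case: f mf => f /= /asboolP[fr fi] mf.
apply: (@le_integrable _ _ _ mu _ measurableT _
  (fun u => (`|(Re (f (to_plane u)))%:E| + `|(Im (f (to_plane u)))%:E|)%E)).
- exact/measurable_EFinP.
- move=> u _ /=; rewrite lee_fin ger0_norm; last first.
    by case: (f _) => a b /=; exact: sqrtr_ge0.
  rewrite [leRHS]ger0_norm ?addr_ge0//; exact: normc_le_ReIm.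
- by apply: integrableD => //; exact: integrable_abse.
Qed.

Lemma norm1_ae (f g : cintegrable_fun) : cae_eq f g -> norm1 f = norm1 g.
Proof.
move=> fg; rewrite /norm1 /Rintegral; congr fine.
apply: ae_eq_integral => //.
- by move/measurable_EFinP: (measurable_normc f).
- by move/measurable_EFinP: (measurable_normc g).
- by apply: filterS fg => u fgu _; rewrite fgu.
Qed.

Definition L1_norm (u : L1) : C := (norm1 (repr u))%:C.

Lemma L1_norm_pi (f : cintegrable_fun) : L1_norm (\pi_L1 f) = (norm1 f)%:C.
Proof. by congr (_%:C); apply: norm1_ae; exact: L1_reprP. Qed.

Lemma L1_ler_normD u v : L1_norm (u + v) <= L1_norm u + L1_norm v.
Proof.
rewrite -[u]reprK -[v]reprK -L1_piD !L1_norm_pi -rmorphD lecR /norm1.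
rewrite -RintegralD//; try exact: integrable_normc.
apply: le_Rintegral => //; first exact: integrable_normc.
  have := integrableD measurableT (integrable_normc (repr u))
    (integrable_normc (repr v)).
  exact: eq_integrable.
move=> x _ /=; exact: (@le_normcD R).
Qed.

Lemma L1_normZ a u : L1_norm (a *: u) = `|a| * L1_norm u.
Proof.
have -> : a *: u = \pi_L1 (a *: repr u) by [].
rewrite L1_norm_pi /L1_norm.
have -> : `|a| = (normc a)%:C by case: a.
rewrite -rmorphM /norm1 -RintegralZl//; last exact: integrable_normc.
by congr (_%:C); apply: eq_Rintegral => x _; rewrite -Normc.normcM.
Qed.

Lemma L1_norm0_eq0 u : L1_norm u = 0 -> u = 0.
Proof.
rewrite -[u]reprK L1_norm_pi => -[] u0.
rewrite (_ : 0 = \pi_L1 0); last by rewrite piE.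
apply/L1_eqP.
have iu := integrable_normc (repr u).
have mu1 : measurable_fun setT (EFin \o (fun x => normc (repr u (to_plane x)))).
  by move/measurable_EFinP: (measurable_normc (repr u)).
have [+ _] := ae_eq_integral_abs mu measurableT mu1.
have -> : (\int[mu]_x `|(EFin \o (fun x => normc (repr u (to_plane x)))) x| = 0)%E.
  rewrite -[RHS]/(0%R%:E) -[in RHS]u0 fineK; last exact: integrable_fin_num.
  apply: eq_integral => x _ /=; rewrite ger0_norm//.
  by case: (repr u _) => a b; exact: sqrtr_ge0.
move=> /(_ erefl); apply: filterS => x /(_ I) [].
exact: Normc.eq0_normc.
Qed.

HB.instance Definition _ := Lmodule_isNormed.Build C L1
  L1_ler_normD L1_normZ L1_norm0_eq0.

End Planar.

(* The class of an integrable function a.e. equal to [f]; [0] if none. *)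
Definition L1_of (R : realType) (f : R[i] -> R[i]) : L1 R :=
  xget (0 : L1 R) [set u : L1 R | cae_eq (repr u) f].

Section AeMaps.
Variable R : realType.
Local Notation S := (sphere R).

Definition ae_same (f g : S -> S) := null [set x | f x <> g x].

(* Preimages of null sets are null: this makes composition compatible with
   a.e. equality. *)
Definition nonsingular (f : S -> S) := forall N, null N -> null (f @^-1` N).

Record nsmap := NsMap { ns_fun :> S -> S; _ : `[< nonsingular ns_fun >] }.
HB.instance Definition _ := [isSub for ns_fun].
HB.instance Definition _ := [Choice of nsmap by <:].

Lemma ns_comp_subproof (f g : nsmap) : `[< nonsingular (f \o g) >].
Proof.
case: f g => f /= /asboolP nf [g /= /asboolP ng]; apply/asboolP => N /nf.
exact: ng.
Qed.

Definition ns_comp (f g : nsmap) : nsmap := NsMap (ns_comp_subproof f g).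

Lemma null_sub (A B : set S) : A `<=` B -> null B -> null A.
Proof. by move=> AB; apply: negligibleS => u; exact: AB. Qed.

Lemma nullU (A B : set S) : null A -> null B -> null (A `|` B).
Proof. exact: negligibleU. Qed.

Definition ns_eq (f g : nsmap) : bool := `[< ae_same f g >].

Lemma ns_eq_equiv : equiv_class_of ns_eq.
Proof.
split=> [f|f g|f g h].
- apply/asboolP; rewrite /ae_same (_ : [set x | _] = set0).
    exact: negligible_set0.
  by apply/seteqP; split => x //=; exact.
- by apply/asboolP/asboolP; apply: null_sub => x /=; apply: contra_not.
- move=> /asboolP gf /asboolP fh; apply/asboolP.
  apply: null_sub (nullU gf fh) => x /= gh.
  by have [e|] := pselect (g x = f x); [right; rewrite -e | left].
Qed.

Canonical ns_equiv := EquivRelPack ns_eq_equiv.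
Canonical ns_encModRel := defaultEncModRel ns_eq.

Definition aemap := {eq_quot ns_eq}.
HB.instance Definition _ := EqQuotient.on aemap.
HB.instance Definition _ := Choice.on aemap.

Definition aemap_mul (a b : aemap) : aemap :=
  \pi_aemap (ns_comp (repr a) (repr b)).

Lemma aemapP (f g : nsmap) : \pi_aemap f = \pi_aemap g <-> ae_same f g.
Proof.
split=> [/eqmodP/asboolP//|fg]; apply/eqmodP; exact/asboolP.
Qed.

Lemma aemap_mul_pi (f g : nsmap) :
  aemap_mul (\pi_aemap f) (\pi_aemap g) = \pi_aemap (ns_comp f g).
Proof.
have ff' : ae_same (repr (\pi_aemap f)) f by apply/aemapP; rewrite reprK.
have gg' : ae_same (repr (\pi_aemap g)) g by apply/aemapP; rewrite reprK.
apply/aemapP; have /asboolP ng := valP (repr (\pi_aemap g)).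
apply: null_sub (nullU (ng _ ff') gg') => x /= h.
case: (pselect (repr (\pi_aemap g) x = g x)) => [e|]; last by right.
by left=> e'; apply: h; rewrite e' e.
Qed.

Lemma aemap_mulA : associative aemap_mul.
Proof.
move=> a b c; elim/quotW: a => a; elim/quotW: b => b; elim/quotW: c => c.
rewrite (aemap_mul_pi b c) (aemap_mul_pi a b) !aemap_mul_pi.
by congr (\pi_aemap _); exact: val_inj.
Qed.

HB.instance Definition _ := isSemigroup.Build aemap aemap_mulA.

Definition represents (c : aemap) (f : S -> S) := ae_same (repr c) f.

End AeMaps.

Section Generated.
Variables (T : semigroupType) (G : set T).

Definition mul_stable (A : set T) := forall a b, A a -> A b -> A (a * b)%g.

Definition gen_pred : pred T := fun c => `[< smallest mul_stable G c >].

Lemma gen_pred_mul : mulg_closed gen_pred.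
Proof.
move=> a b /asboolP Ga /asboolP Gb; apply/asboolP => A AG.
by apply: AG.1; [exact: Ga | exact: Gb].
Qed.

Record gen_semigroup := GenSemigroup { gen_val : T; _ : gen_val \in gen_pred }.
HB.instance Definition _ := [isSub for gen_val].
HB.instance Definition _ := [Choice of gen_semigroup by <:].
HB.instance Definition _ :=
  SubChoice_isSubSemigroup.Build T gen_pred gen_semigroup gen_pred_mul.

End Generated.

Section Amenability.
Variables (R : realType) (S : semigroupType).
Local Notation C := R[i].
Implicit Types (phi psi : S -> C) (M : (S -> C) -> C).

Definition Linfty : set (S -> C) :=
  [set phi | has_ubound (range (fun s => normc (phi s)))].

Definition sup_norm phi : R := sup (range (fun s => normc (phi s))).

(* Only the values of [M] on [Linfty] matter. *)
Definition is_mean M :=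
  [/\ (forall a phi psi, Linfty phi -> Linfty psi ->
         M (a *: phi + psi) = a * M phi + M psi),
      (exists k : R, forall phi, Linfty phi -> normc (M phi) <= k * sup_norm phi),
      (forall phi, Linfty phi -> (forall s, 0 <= phi s) -> 0 <= M phi),
      sup [set normc (M phi) | phi in
            [set phi | Linfty phi /\ sup_norm phi <= 1]] = 1 &
      M (cst 1) = 1].

Definition left_translate (s : S) phi : S -> C := fun x => phi (s * x)%g.

Definition subspace (V : set (S -> C)) :=
  V 0 /\ forall a phi psi, V phi -> V psi -> V (a *: phi + psi).

Variables (B : normedModType C) (rho : S -> B -> B).

Definition bounded_endo (T : B -> B) := linear T /\ continuous T.
Definition bounded_functional (l : B -> C) := scalar l /\ continuous l.

Definition bounded_representation :=
  [/\ (forall s, bounded_endo (rho s)),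
      (forall s t b, rho (s * t)%g b = rho s (rho t b)) &
      exists k : R, forall s b, `|rho s b| <= k%:C * `|b|].

Definition matrix_coefficients : set (S -> C) :=
  [set phi | exists b l, bounded_functional l /\ phi = fun s => l (rho s b)].

(* Closure, for the sup norm, of the linear span. *)
Definition Y_space : set (S -> C) :=
  [set phi | Linfty phi /\ forall e : R, 0 < e -> exists2 psi,
     smallest subspace matrix_coefficients psi & sup_norm (phi - psi) < e].

Definition X_space : set (S -> C) :=
  smallest subspace (Y_space `|` range (fun c : C => cst c)).

Definition left_amenable := exists2 M, is_mean M &
  forall phi s, X_space phi -> M (left_translate s phi) = M phi.

End Amenability.

Section Deck.
Variable R : realType.
Local Notation S := (sphere R).
Variable f : ratmap R.
Local Notation "'F'" := (reval f).

Definition ruelle (u : L1 R) : L1 R := L1_of (fun y =>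
  \sum_(x \in [set x | F (Some x) = Some y]) repr u x / planar_derive F x ^+ 2).

(* The components D_i of the preimage of U = ~` sigma; [pinv (D i) F] is the
   inverse branch R_i^-1 on U. *)
Definition sheets (sigma : set S) (D : 'I_(rdeg f) -> set S) :=
  [/\ F @^-1` (~` sigma) = \bigcup_i D i, trivIset setT D,
      (forall i, open (D i) /\ simply_connected (D i)) &
      forall i, [/\ set_bij (D i) (~` sigma) F, holomorphic_on (D i) F &
                    holomorphic_on (~` sigma) (pinv (D i) F)]].

Variable D : 'I_(rdeg f) -> set S.

Definition deck_swap (i j : 'I_(rdeg f)) (x : S) : S :=
  if x \in D i then pinv (D j) F (F x)
  else if x \in D j then pinv (D i) F (F x) else x.

(* The h_{i,j} being defined everywhere, the elements of D(R) are taken as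
   honest bijections of the sphere: derivatives require a representative. *)
Inductive deck_group : (S -> S) -> Prop :=
| deck_gen i j : deck_group (deck_swap i j)
| deck_id : deck_group id
| deck_comp g h : deck_group g -> deck_group h -> deck_group (g \o h)
| deck_inv g h : deck_group g -> cancel g h -> cancel h g -> deck_group h.

(* gamma_*; the value infinity is only taken on a null set. *)
Definition deck_act (gamma : S -> S) (u : L1 R) : L1 R := L1_of (fun z =>
  if gamma (Some z) is Some w then repr u w * planar_derive gamma z ^+ 2 else 0).

Definition ruelle_generators : set (aemap R) :=
  [set c | exists2 gamma, deck_group gamma & represents c (gamma \o F)].

Definition deck_semigroup : semigroupType := gen_semigroup ruelle_generators.

Definition ruelle_representation (rho : deck_semigroup -> L1 R -> L1 R) :=
  bounded_representation rho /\
  forall (c : gen_semigroup ruelle_generators) gamma, deck_group gamma ->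
    represents (val c) (gamma \o F) -> rho c = deck_act gamma \o ruelle.

End Deck.

(* Main.v *)
(** Let phi be a nonzero fixed point of the Ruelle operator.  For a deck map k,
    the function s |-> rho(s) phi is constant on the left translates by R and by
    k R, with values phi and k phi; the invariant mean makes them equal.  So
    the d terms of the Ruelle sum coincide: phi(R z) R'(z)^2 = d phi(z).

    Iterates of R read at scale d^(-n/2) around a Lebesgue point of phi nearly
    satisfy phi(g) g'^2 = c.  The values they omit have small area, an
    Ahlfors-Beurling argument makes them a normal family, and a limit is a
    meromorphic h on the plane with phi(h) h'^2 = c.  By this equation, when
    h(z1) = h(z2), a translation or a point reflection exchanging z1 and z2
    leaves h invariant.  As phi is integrable, the periods form a lattice, and
    R o h = h o (a z + b) with a^2 = d.  A point with fewer than d preimages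
    provides a reflection, so h is the degree-two quotient of a torus; the real
    number a preserves the lattice, hence is an integer.

    Conversely, the density Theta'^(-2) is well defined on the sphere because
    Theta' is determined up to sign, and it is fixed by the Ruelle operator. *)

Require Import Defs.
From HB Require Import structures.
From mathcomp Require Import all_boot all_order all_algebra.
From mathcomp Require Import generic_quotient ring_quotient complex.
From mathcomp Require Import all_classical all_reals all_analysis.
From mathcomp Require Import measurable_realfun zify ring lra.

Set Implicit Arguments.
Unset Strict Implicit.
Unset Printing Implicit Defensive.

Import Order.TTheory GRing.Theory Num.Theory.
Import numFieldNormedType.Exports.

Local Open Scope classical_set_scope.
Local Open Scope ring_scope.
Local Open Scope complex_scope.
Local Open Scope quotient_scope.

Local Notation Re := complex.Re.
Local Notation Im := complex.Im.

Notation cnorm := Normc.normc.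

(** * Area and integration in the plane *)

(** The density phi is only an integrable class, so its equations hold almost everywhere. Iterating
    gives phi(R^n) ((R^n)')^2 = d^n phi, hence the scale d^(-n/2); at a Lebesgue point the
    right-hand side becomes nearly constant. A limit could still degenerate: the base point is
    chosen so that infinitely many iterates bring it back to a region where the point and phi are
    bounded, which bounds the derivatives of the zoomed maps at 0 from below. Compactness comes from
    area: on a ball of small fixed radius the equation lets a zoomed iterate cover only part of the
    mass of phi, so the omitted values include a bounded set of area bounded below. As phi cannot be
    composed with a convergent sequence, the equation passes to the limit on the target side, in the
    form phi = c q'^2 for a local inverse q of the limit. Areas of images are needed only up to
    constant factors, so crude Lipschitz bounds replace the exact change of variables. Cauchy's
    formula comes from averages over roots of unity, without contour integrals, and compactness
    arguments take limits along an ultrafilter. *)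

Lemma eqW d (T : porderType d) (x y : T) : x = y -> (x <= y)%O.
Proof. by move=> ->. Qed.

Section ComplexNorm.
Variable R : realType.
Local Notation C := R[i].
Implicit Types x y z : C.

Lemma cnorm_ge0 x : 0 <= cnorm x.
Proof. by case: x => a b; exact: sqrtr_ge0. Qed.

Lemma cnormM x y : cnorm (x * y) = cnorm x * cnorm y.
Proof. exact: Normc.normcM. Qed.

Lemma cnormN x : cnorm (- x) = cnorm x.
Proof. by case: x => a b /=; rewrite !sqrrN. Qed.

Lemma cnormB x y : cnorm (x - y) = cnorm (y - x).
Proof. by rewrite -cnormN opprB. Qed.

Lemma ler_cnormD x y : cnorm (x + y) <= cnorm x + cnorm y.
Proof. exact: (@le_normcD R). Qed.

Lemma cnorm_dist z x y : cnorm (x - y) <= cnorm (x - z) + cnorm (z - y).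
Proof. by rewrite -{1}(subrK z x) -addrA ler_cnormD. Qed.

Lemma cnorm0 : cnorm (0 : C) = 0.
Proof. exact: Normc.normc0. Qed.

Lemma cnorm1 : cnorm (1 : C) = 1.
Proof. exact: Normc.normc1. Qed.

Lemma cnorm_eq0 x : (cnorm x == 0) = (x == 0).
Proof.
by apply/eqP/eqP => [/Normc.eq0_normc//|->]; exact: cnorm0.
Qed.

Lemma cnorm_le0_eq x y : cnorm (x - y) <= 0 -> x = y.
Proof. by move=> h; apply/eqP; rewrite -subr_eq0 -cnorm_eq0 eq_le h cnorm_ge0. Qed.

Lemma cnorm_small_eq x y : (forall e : R, 0 < e -> cnorm (x - y) <= e) -> x = y.
Proof. by move=> h; apply/cnorm_le0_eq/ler_addgt0Pr => e /h; rewrite add0r. Qed.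

Lemma cnorm_gt0 x : (0 < cnorm x) = (x != 0).
Proof. by rewrite lt_def cnorm_eq0 cnorm_ge0 andbT. Qed.

Lemma cnormV x : cnorm x^-1 = (cnorm x)^-1.
Proof. exact: Normc.normcV. Qed.

Lemma cnormX x n : cnorm (x ^+ n) = cnorm x ^+ n.
Proof.
by elim: n => [|n IH]; rewrite ?expr0 ?cnorm1// !exprS cnormM IH.
Qed.

Lemma cnorm_real (r : R) : cnorm r%:C = `|r|.
Proof. by rewrite /= expr0n /= addr0 sqrtr_sqr. Qed.

Lemma cnorm_nat n : cnorm (n%:R : C) = n%:R.
Proof.
have -> : (n%:R : C) = (n%:R : R)%:C by rewrite rmorph_nat.
by rewrite cnorm_real ger0_norm.
Qed.

Lemma ler_cnormB x y : cnorm x - cnorm y <= cnorm (x - y).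
Proof. by rewrite lerBlDr -{1}(subrK y x) ler_cnormD. Qed.

Lemma ler_cnorm_Re x : `|Re x| <= cnorm x.
Proof.
by case: x => a b /=; rewrite -sqrtr_sqr ler_wsqrtr// lerDl sqr_ge0.
Qed.

Lemma ler_cnorm_Im x : `|Im x| <= cnorm x.
Proof.
by case: x => a b /=; rewrite -sqrtr_sqr ler_wsqrtr// lerDr sqr_ge0.
Qed.

Lemma ler_cnorm_sum (I : Type) (r : seq I) (P : pred I) (F : I -> C) :
  cnorm (\sum_(i <- r | P i) F i) <= \sum_(i <- r | P i) cnorm (F i).
Proof.
elim/big_ind2: _ => [|x1 x2 y1 y2 h1 h2|//]; first by rewrite cnorm0.
by rewrite (le_trans (ler_cnormD _ _))// lerD.
Qed.

Lemma normC_cnorm x : `|x| = (cnorm x)%:C.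
Proof. by case: x. Qed.

End ComplexNorm.

Section PlanarArea.
Variable R : realType.
Local Notation C := R[i].
Local Notation mR := (measurableTypeR R).
Local Notation T := (mR * mR)%type.
Local Notation mu := (@planar_measure R).
Local Notation tp := (@to_plane R).
Implicit Types (A B S U : set C) (z w : C) (g : C -> C).

Definition cmeas A := measurable (tp @^-1` A : set T).

(** The outer measure, so that the image of a set has an area before any measurability is known. *)
Definition area A : \bar R := mu_ext mu (tp @^-1` A).

(** The radius is a real number, whereas the norm of [C] as a normed module takes complex values. *)
Definition cball z (r : R) : set C := [set w | cnorm (w - z) < r].

Definition copen U := forall z, U z -> exists2 r : R, 0 < r & cball z r `<=` U.

Lemma cmeasC A : cmeas A -> cmeas (~` A).
Proof. by move=> mA; rewrite /cmeas preimage_setC; exact: measurableC. Qed.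

Lemma cmeasU A B : cmeas A -> cmeas B -> cmeas (A `|` B).
Proof. by move=> mA mB; rewrite /cmeas preimage_setU; exact: measurableU. Qed.

Lemma cmeasI A B : cmeas A -> cmeas B -> cmeas (A `&` B).
Proof. by move=> mA mB; rewrite /cmeas preimage_setI; exact: measurableI. Qed.

Lemma cmeasD A B : cmeas A -> cmeas B -> cmeas (A `\` B).
Proof. by move=> mA mB; apply: cmeasI => //; exact: cmeasC. Qed.

Lemma cmeas0 : cmeas set0.
Proof. exact: measurable0. Qed.

Lemma cmeasT : cmeas setT.
Proof. exact: measurableT. Qed.

Lemma cmeas_bigcup (F : nat -> set C) :
  (forall n, cmeas (F n)) -> cmeas (\bigcup_n F n).
Proof.
by move=> mF; rewrite /cmeas preimage_bigcup; apply: bigcup_measurable => n _; exact: mF.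
Qed.

Lemma cmeas_bigcap (F : nat -> set C) :
  (forall n, cmeas (F n)) -> cmeas (\bigcap_n F n).
Proof.
by move=> mF; rewrite /cmeas preimage_bigcap; apply: bigcap_measurable => // n _; exact: mF.
Qed.

Lemma area_ge0 A : (0 <= area A)%E.
Proof. exact: outer_measure_ge0. Qed.

Lemma area0 : area set0 = 0%E.
Proof. by rewrite /area preimage_set0 outer_measure0. Qed.

Lemma le_area A B : A `<=` B -> (area A <= area B)%E.
Proof. by move=> AB; apply: le_outer_measure; exact: preimage_subset. Qed.

Lemma areaE A : cmeas A -> area A = mu (tp @^-1` A).
Proof. by move=> mA; rewrite /area measurable_mu_extE. Qed.

Lemma area_bigcup (F : nat -> set C) :
  (area (\bigcup_n F n) <= \sum_(n <oo) area (F n))%E.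
Proof.
by rewrite /area preimage_bigcup; exact: outer_measure_sigma_subadditive.
Qed.

Lemma areaU A B : (area (A `|` B) <= area A + area B)%E.
Proof. by rewrite /area preimage_setU; exact: outer_measureU2. Qed.

Lemma area_bigcup0 (F : nat -> set C) :
  (forall n, area (F n) = 0%E) -> area (\bigcup_n F n) = 0%E.
Proof.
move=> F0; apply/eqP; rewrite eq_le area_ge0 andbT.
by rewrite (le_trans (area_bigcup F))// eseries0.
Qed.

Lemma area_sub0 A B : A `<=` B -> area B = 0%E -> area A = 0%E.
Proof.
by move=> AB B0; apply/eqP; rewrite eq_le area_ge0 andbT -B0 le_area.
Qed.

Lemma areaU0 A B : area A = 0%E -> area B = 0%E -> area (A `|` B) = 0%E.
Proof.
move=> A0 B0; apply/eqP; rewrite eq_le area_ge0 andbT.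
by rewrite (le_trans (areaU _ _))// A0 B0 adde0.
Qed.

(** The hull is an intersection of measurable covers with excess 1/(n+1). Through it, facts about
    measurable sets extend to arbitrary ones. *)
Lemma area_hull A : exists B, [/\ cmeas B, A `<=` B & area B = area A].
Proof.
have [Aoo|Afin] := eqVneq (area A) +oo%E.
  exists setT; split => //; first exact: cmeasT.
  by apply/eqP; rewrite Aoo eq_le leey -Aoo le_area.
have fA : area A \is a fin_num by rewrite ge0_fin_numE ?area_ge0// ltey.
have cov (n : nat) : exists B, [/\ cmeas B, A `<=` B &
    (area B <= area A + (n.+1%:R^-1)%:E)%E].
  have n0 : (0 : R) < n.+1%:R^-1 by rewrite invr_gt0.
  have [x [F [mF AF] <-] Fl] := lb_ereal_inf_adherent n0 fA.
  have cF k : exists B, tp @^-1` B = F k.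
    exists [set z | F k (Re z, Im z)].
    by apply/seteqP; split => -[a b].
  have [B BF] := choice cF.
  exists (\bigcup_k B k); split.
  - by apply: cmeas_bigcup => k; rewrite /cmeas BF.
  - move=> z Az; have /(AF (Re z, Im z)) [k _ Fk] :
        (tp @^-1` A) (Re z, Im z) by rewrite /= /to_plane /=; case: z Az.
    exists k => //.
    move: Fk; rewrite -BF /= /to_plane /=.
    by rewrite -[B k z]/(B k z); case: z {Az}.
  - rewrite (le_trans (area_bigcup _))// (le_trans _ (ltW Fl))//.
    by apply: lee_nneseries => k _; rewrite ?area_ge0// areaE /cmeas BF.
have [B BP] := choice cov.
exists (\bigcap_n B n); split.
- by apply: cmeas_bigcap => n; case: (BP n).
- by move=> z Az n _; case: (BP n) => _ /(_ z Az).
- apply/eqP; rewrite eq_le; apply/andP; split; last first.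
    by apply: le_area => z Az n _; case: (BP n) => _ /(_ z Az).
  apply/lee_addgt0Pr => e e0.
  have [n ne] : exists n : nat, n.+1%:R^-1 < e.
    have [n _ /= nP] := near_infty_natSinv_lt (PosNum e0).
    by exists n; exact: (nP n (leqnn n)).
  apply: (@le_trans _ _ (area (B n))); first by apply: le_area => z; exact.
  case: (BP n) => _ _ /le_trans; apply.
  by rewrite leeD2l// lee_fin ltW.
Qed.

(** Continuity from below survives for the outer measure. The hulls [B n] need not increase, but the
    intersections [D n] of all later hulls do, and they keep the area of [F n]. *)
Lemma area_nondecreasing_bigcup (F : nat -> set C) (M : \bar R) :
  {homo F : m n / (m <= n)%N >-> m `<=` n} ->
  (forall n, (area (F n) <= M)%E) -> (area (\bigcup_n F n) <= M)%E.
Proof.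
move=> ndF FM.
have [B BP] := choice (fun n => area_hull (F n)).
pose D n := \bigcap_(m in [set m | (n <= m)%N]) B m.
have mD n : cmeas (D n).
  by rewrite /cmeas preimage_bigcap; apply: bigcap_measurable => [|m _];
    [exists n => /=|case: (BP m)].
have FD n : F n `<=` D n.
  by move=> z Fz m nm; case: (BP m) => _ + _; apply; exact: (ndF _ _ nm).
have DM n : (area (D n) <= M)%E.
  apply: (le_trans _ (FM n)); case: (BP n) => _ _ <-.
  by apply: le_area => z; apply => /=.
have ndD : nondecreasing_seq (fun n => tp @^-1` D n : set T).
  move=> m n mn; apply/subsetPset => u /= Dm k /= nk; apply: Dm => /=.
  exact: leq_trans nk.
apply: (@le_trans _ _ (area (\bigcup_n D n))).
  by apply: le_area => z [n _ Fz]; exists n => //; exact: FD.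
rewrite areaE ?preimage_bigcup; last exact: cmeas_bigcup.
have cv := @nondecreasing_cvg_mu _ _ _ mu _ mD _ ndD.
have -> : mu (\bigcup_n (tp @^-1` D n)) =
    limn (mu \o (fun n => tp @^-1` D n)).
  apply/esym/cvg_lim => //; apply: cv.
  by apply: bigcup_measurable => n _; exact: mD.
apply: lime_le.
  apply/cvg_ex; eexists; apply: cv.
  by apply: bigcup_measurable => n _; exact: mD.
by apply: nearW => n /=; rewrite -areaE.
Qed.

Lemma negligible_area A : mu.-negligible (tp @^-1` A) <-> area A = 0%E.
Proof.
split=> [[B [mB B0 AB]]|A0].
  apply/eqP; rewrite eq_le area_ge0 andbT -B0 -[leRHS]measurable_mu_extE//.
  exact: le_outer_measure.
have [B [mB AB BA]] := area_hull A.
exists (tp @^-1` B); split => //; first by rewrite -areaE// BA A0.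
exact: preimage_subset.
Qed.

Definition cell (n : nat) z : int * int :=
  (Num.floor (Re z * n.+1%:R), Num.floor (Im z * n.+1%:R)).

(** Half-open squares of side 1/(n+1), numbered through [pickle] to allow countable unions;
    [grid n j] is empty when [j] codes no pair. *)
Definition grid (n j : nat) : set C := [set z | pickle (cell n z) = j].

Lemma floor_fiber (n : nat) (i : int) :
  [set x : R | Num.floor (x * n.+1%:R) = i] =
  `[(i%:~R / n.+1%:R), ((i + 1)%:~R / n.+1%:R)[%classic.
Proof.
have n0 : (0 : R) < n.+1%:R by [].
apply/seteqP; split => x /=; rewrite in_itv /= ler_pdivrMr// ltr_pdivlMr//.
  by move=> <-; exact: floor_itv.
by move=> /andP[h1 h2]; apply: floor_def; rewrite h1 h2.
Qed.

Lemma grid_rect n i k : tp @^-1` (grid n (pickle (i, k))) =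
  `[(i%:~R / n.+1%:R), ((i + 1)%:~R / n.+1%:R)[%classic `*`
  `[(k%:~R / n.+1%:R), ((k + 1)%:~R / n.+1%:R)[%classic.
Proof.
rewrite -!floor_fiber; apply/seteqP; split => -[x y] /=; rewrite /grid /=.
  by move/(pcan_inj pickleK) => [<- <-].
by case=> <- <-.
Qed.

Lemma grid_nonempty n j : grid n j !=set0 ->
  exists i k : int, grid n j = grid n (pickle (i, k)).
Proof. by move=> [z <-]; exists (cell n z).1, (cell n z).2. Qed.

Lemma grid_cmeas n j : cmeas (grid n j).
Proof.
have [/grid_nonempty [i [k ->]]|/nonemptyPn ->] := pselect (grid n j !=set0).
  by rewrite /cmeas grid_rect; apply: measurableX.
exact: cmeas0.
Qed.

Lemma grid_trivIset n : trivIset setT (grid n).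
Proof. by move=> i j _ _ [z [<- <-]]. Qed.

Lemma grid_dist n j z w : grid n j z -> grid n j w ->
  cnorm (z - w) < 2 / n.+1%:R.
Proof.
rewrite /grid /= => <- /(pcan_inj pickleK) [].
have n0 : (0 : R) < n.+1%:R by [].
have key (a b : R) : Num.floor (a * n.+1%:R) = Num.floor (b * n.+1%:R) ->
    `|a - b| < n.+1%:R^-1.
  move=> ab; have := floor_itv (a * n.+1%:R); have := floor_itv (b * n.+1%:R).
  rewrite ab intrD => /andP[b1 b2] /andP[a1 a2].
  rewrite -(ltr_pM2r n0) mulVf ?gt_eqF// -[X in _ * X < _]gtr0_norm// -normrM.
  by rewrite mulrBl ltr_norml; apply/andP; split; lra.
move=> /esym/key a1 /esym/key a2; rewrite (le_lt_trans (normc_le_ReIm _))//.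
have -> : Re (z - w) = Re z - Re w by case: (z) (w) => ? ? [].
have -> : Im (z - w) = Im z - Im w by case: (z) (w) => ? ? [].
by rewrite mulrDl !mul1r ltrD.
Qed.

Lemma grid_cover n z : exists j, grid n j z.
Proof. by exists (pickle (cell n z)). Qed.

Lemma area_grid n j : grid n j !=set0 -> area (grid n j) = (n.+1%:R ^- 2)%:E.
Proof.
move=> /grid_nonempty [i [k ->]].
rewrite areaE; last exact: grid_cmeas.
rewrite grid_rect [LHS]product_measure1E//.
rewrite [X in (X * _)%E](@lebesgue_measure_itv R) [X in (_ * X)%E](@lebesgue_measure_itv R) /=.
have n0 : (0 : R) < n.+1%:R by [].
rewrite !lte_fin !ltr_pM2r ?invr_gt0// !ltr_int !ltzD1 !lexx.
rewrite -!EFinB -EFinM !intrD; congr (_%:E); field.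
by rewrite nat1r pnatr_eq0.
Qed.

Lemma copen_cmeas U : copen U -> cmeas U.
Proof.
move=> oU.
pose V n j := if `[< grid n j `<=` U >] then grid n j else set0.
have -> : U = \bigcup_n \bigcup_j V n j.
  apply/seteqP; split => [z Uz|z [n _ [j _]]]; last first.
    by rewrite /V; case: asboolP => // h; exact: h.
  have [r r0 zU] := oU _ Uz.
  have [n nr] : exists n : nat, n.+1%:R^-1 < r / 2.
    have r20 : 0 < r / 2 by rewrite divr_gt0.
    have [n _ /= nP] := near_infty_natSinv_lt (PosNum r20).
    by exists n; exact: (nP n (leqnn n)).
  have [j zj] := grid_cover n z.
  exists n => //; exists j => //; rewrite /V; case: asboolP => //; case.
  move=> w wj; apply: zU; rewrite /cball /=.
  apply: (lt_trans (grid_dist wj zj)).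
  by rewrite mulrC -ltr_pdivlMr.
apply: cmeas_bigcup => n; apply: cmeas_bigcup => j; rewrite /V.
by case: asboolP => _; [exact: grid_cmeas|exact: cmeas0].
Qed.

(** Approximating from inside and outside at once makes the property stable under complement, as a
    sigma-algebra requires. *)
Definition regular_in B A := forall e : R, 0 < e -> exists U F,
  [/\ copen U, copen (~` F), F `<=` A, A `<=` U &
      (area (B `&` (U `\` F)) <= e%:E)%E].

Lemma copenU (F : nat -> set C) : (forall n, copen (F n)) -> copen (\bigcup_n F n).
Proof.
move=> oF z [n _ /oF[r r0 rF]]; exists r => // w /rF Fw; by exists n.
Qed.

Lemma copenI A B : copen A -> copen B -> copen (A `&` B).
Proof.
move=> oA oB z [/oA[r r0 rA] /oB[t t0 tB]]; exists (Num.min r t).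
  by rewrite lt_min r0.
by move=> w; rewrite /cball /= lt_min => /andP[/rA ? /tB].
Qed.

Lemma regular_inC B A : regular_in B A -> regular_in B (~` A).
Proof.
move=> rA e /rA[U [F [oU oF FA AU]]] h; exists (~` F), (~` U); split => //.
- by rewrite setCK.
- exact: subsetC.
- exact: subsetC.
by rewrite (_ : ~` F `\` ~` U = U `\` F)// setDE setCK setIC.
Qed.

Lemma area_shrink0 B (F : nat -> set C) (e : R) : cmeas B -> (area B < +oo)%E ->
  (forall n, cmeas (F n)) -> {homo F : m n / (m <= n)%N >-> n `<=` m} ->
  \bigcap_n F n = set0 -> 0 < e -> exists n, (area (B `&` F n) <= e%:E)%E.
Proof.
move=> mB Boo mF ndF F0 e0.
have mBF n : cmeas (B `&` F n) by apply: cmeasI.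
have := @nonincreasing_cvg_mu _ _ _ mu (fun n => tp @^-1` (B `&` F n)).
have -> : \bigcap_n (tp @^-1` (B `&` F n)) = set0.
  apply/seteqP; split => u //= h; suff : (\bigcap_n F n) (tp u) by rewrite F0.
  by move=> n _; case: (h n I).
rewrite measure0 => /(_ _ _ measurable0 _) cv.
have {}cv : (fun n => mu (tp @^-1` (B `&` F n))) @ \oo --> (0%E : \bar R).
  apply: cv => //.
    apply: le_lt_trans Boo; rewrite -[X in (X <= _)%E]areaE//; exact: le_area.
  move=> m n mn; apply/subsetPset => u /= [Bu Fu]; split => //.
  exact: ndF Fu.
have e0' : (0%E < e%:E)%E by rewrite lte_fin.
have [n _ /(_ n (leqnn n)) nP] := cv _ (open_ereal_lt' e0').
by exists n; rewrite areaE// ltW.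
Qed.

(** The points at distance at least 1/(n+1) from the complement of [U] form closed sets exhausting
    [U]. *)
Lemma copen_core B U (e : R) : cmeas B -> (area B < +oo)%E -> copen U -> 0 < e ->
  exists n : nat, let F := [set z | forall w, cnorm (w - z) < n.+1%:R^-1 -> U w] in
  [/\ copen (~` F), F `<=` U & (area (B `&` (U `\` F)) <= e%:E)%E].
Proof.
move=> mB Boo oU e0.
pose F n := [set z | forall w, cnorm (w - z) < n.+1%:R^-1 -> U w].
have oF n : copen (~` F n).
  move=> z /= /existsNP[w /not_implyP[wz Uw]].
  exists (n.+1%:R^-1 - cnorm (w - z)); first by rewrite subr_gt0.
  move=> z'; rewrite /cball /= => zz' /(_ w) Fz; apply: Uw; apply: Fz.
  apply: (le_lt_trans (cnorm_dist z w z')).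
  by rewrite (cnormB z) -ltrBrDl.
have FU n : F n `<=` U by move=> z; apply; rewrite subrr cnorm0 invr_gt0.
have [] := @area_shrink0 B (fun n => U `\` F n) e mB Boo _ _ _ e0.
- move=> n; apply: cmeasD; first exact: copen_cmeas.
  by rewrite -[F n]setCK; apply: cmeasC; exact: copen_cmeas.
- move=> m n mn z [Uz nF]; split => // Fz; apply: nF => w wz; apply: Fz.
  by rewrite (lt_le_trans wz)// lef_pV2 ?posrE// ler_nat.
- apply/seteqP; split => z //= h; have [Uz _] := h 0%N I.
  have [r r0 rU] := oU _ Uz.
  have [n _ /= /(_ n (leqnn n)) nr] := near_infty_natSinv_lt (PosNum r0).
  have [_ []] := h n I; move=> w wz; apply: rU; exact: lt_trans nr.
by move=> n hn; exists n; split; [exact: oF|exact: FU|exact: hn].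
Qed.

Lemma copen_regular_in B U : cmeas B -> (area B < +oo)%E -> copen U ->
  regular_in B U.
Proof.
move=> mB Boo oU e e0; have [n [oF FU hn]] := copen_core mB Boo oU e0.
by eexists; eexists; split; [exact: oU|exact: oF|exact: FU| |exact: hn].
Qed.

Lemma regular_in_bigcup B (A : nat -> set C) : cmeas B -> (area B < +oo)%E ->
  (forall n, regular_in B (A n)) -> regular_in B (\bigcup_n A n).
Proof.
move=> mB Boo rA e e0.
pose d n : R := e / 2 / (2 ^ n.+1)%:R.
have d0 n : 0 < d n by rewrite !divr_gt0// ltr0n expn_gt0.
have /choice[U /choice[F UF]] := fun n => rA n (d n) (d0 n).
have oU n : copen (U n) by case: (UF n).
have oF n : copen (~` F n) by case: (UF n).
have mU n : cmeas (U n) by exact: copen_cmeas.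
have mF n : cmeas (F n).
  by rewrite -[F n]setCK; apply: cmeasC; exact: copen_cmeas.
(* An infinite union of closed sets need not be closed. A finite union is kept, and the other half
   of [e] pays for what it misses. *)
pose G n := \bigcup_(k in [set k | (k <= n)%N]) F k.
have oG n : copen (~` G n).
  elim: n => [|n IH].
    have -> : G 0%N = F 0%N.
      apply/seteqP; split => z; last by exists 0%N.
      by move=> [k /=]; rewrite leqn0 => /eqP ->.
    exact: oF.
  have -> : G n.+1 = G n `|` F n.+1.
    apply/seteqP; split => z.
      move=> [k /=]; rewrite leq_eqVlt ltnS => /orP[/eqP -> |kn] Fz;
        [by right|by left; exists k].
    by move=> [[k /= kn] Fz|Fz]; [exists k => //=; exact: leq_trans kn _|
      exists n.+1 => /=].
  by rewrite setCU; exact: copenI.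
have mG n : cmeas (G n).
  by rewrite -[G n]setCK; apply: cmeasC; exact: copen_cmeas.
have e20 : 0 < e / 2 by rewrite divr_gt0.
have [] := @area_shrink0 B (fun n => (\bigcup_n F n) `\` G n) (e / 2) mB Boo _ _ _ e20.
- by move=> n; apply: cmeasD => //; exact: cmeas_bigcup.
- move=> m n mn z [h nG]; split => // -[k /= km Fz]; apply: nG.
  by exists k => //=; exact: leq_trans mn.
- apply/seteqP; split => z //= h; have [[k _ Fz] _] := h 0%N I.
  by have [_ []] := h k I; exists k => //=.
move=> n hn; exists (\bigcup_n U n), (G n); split => //.
- exact: copenU.
- by move=> z [k _ Fz]; exists k => //; case: (UF k) => _ _ + _ _; apply.
- by move=> z [k _ Fz]; exists k => //; case: (UF k) => _ _ _ + _; apply.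
apply: (@le_trans _ _ (area ((B `&` ((\bigcup_n F n) `\` G n)) `|`
    \bigcup_k (B `&` (U k `\` F k))))).
  apply: le_area => z [Bz [[k _ Uz] nG]].
  have [Fz|nF] := pselect ((\bigcup_n F n) z); [by left|right].
  by exists k => //; split => //; split => // Fz; apply: nF; exists k.
rewrite (le_trans (areaU _ _))// [e in leRHS](splitr e) EFinD leeD//.
rewrite (le_trans (area_bigcup _))//.
apply: (@le_trans _ _ (\sum_(k <oo) (d k)%:E)%E).
  by apply: lee_nneseries => k _; rewrite ?area_ge0//; case: (UF k).
have := @epsilon_trick R (fun=> 0%E) (e / 2) xpredT (fun=> lexx _) (ltW e20).
rewrite [X in (_ <= X + _)%E]eseries0// add0e; apply: le_trans.
by apply: lee_nneseries => k *; rewrite ?add0e// lee_fin ltW.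
Qed.

(** The regular sets form a sigma-algebra containing the half planes bounded by vertical and
    horizontal lines, which generate the product structure. *)
Lemma cmeas_regular_in B A : cmeas B -> (area B < +oo)%E -> cmeas A ->
  regular_in B A.
Proof.
move=> mB Boo.
pose G := [set X : set T | regular_in B [set z | X (Re z, Im z)]].
have sG : sigma_algebra setT G.
  split.
  - move=> e e0; exists set0, set0; split => //.
      by move=> z _; exists 1 => // w _ [].
    by rewrite set0D setI0 area0 lee_fin ltW.
  - move=> X GX; rewrite /G /=.
    rewrite (_ : [set z | _] = ~` [set z | X (Re z, Im z)]); last first.
      by apply/seteqP; split => z /=; [case|split].
    exact: regular_inC.
  - move=> F GF; rewrite /G /=.
    rewrite (_ : [set z | _] = \bigcup_n [set z | F n (Re z, Im z)]) ; last first.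
      by apply/seteqP; split.
    exact: regular_in_bigcup.
have mp (p : T -> R) : (forall x : R, G (p @^-1` `]x, +oo[)) ->
    forall Y : set mR, measurable Y -> G (p @^-1` Y).
  move=> hp Y mY; have {mY} : (@RGenOInfty.G R).-sigma.-measurable Y.
    by rewrite -RGenOInfty.measurableE.
  have sY : sigma_algebra setT [set Y | G (p @^-1` Y)].
    split => /=.
    - by rewrite preimage_set0; case: sG.
    - move=> Y'; rewrite setTD preimage_setC -setTD; case: sG => _ + _; exact.
    - by move=> F GF; rewrite preimage_bigcup; case: sG => _ _; exact.
  move: Y; apply: (smallest_sub sY) => Y [x ->].
  exact: hp.
move=> mA; suff : G (tp @^-1` A).
  by rewrite /G /= (_ : [set z | _] = A)//; apply/seteqP; split => -[].
move: mA; rewrite /cmeas; move: (tp @^-1` A).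
apply: (smallest_sub sG) => X [] [Y mY <-]; rewrite setTI.
- apply: mp mY => x; apply: copen_regular_in => // z /=; rewrite in_itv /= andbT => xz.
  exists (Re z - x); first by rewrite subr_gt0.
  move=> w; rewrite /cball /= in_itv /= andbT => wz.
  have := ler_cnorm_Re (w - z); rewrite raddfB /= => /le_lt_trans /(_ wz).
  by rewrite ltr_norml => /andP[+ _]; lra.
- apply: mp mY => x; apply: copen_regular_in => // z /=; rewrite in_itv /= andbT => xz.
  exists (Im z - x); first by rewrite subr_gt0.
  move=> w; rewrite /cball /= in_itv /= andbT => wz.
  have := ler_cnorm_Im (w - z); rewrite raddfB /= => /le_lt_trans /(_ wz).
  by rewrite ltr_norml => /andP[+ _]; lra.
Qed.

Lemma cball_copen z r : copen (cball z r).
Proof.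
move=> w wz; exists (r - cnorm (w - z)); first by rewrite subr_gt0.
move=> w'; rewrite /cball /= => h; apply: (le_lt_trans (cnorm_dist w _ _)).
by rewrite -ltrBrDr.
Qed.

Lemma cball_cmeas z r : cmeas (cball z r).
Proof. by apply: copen_cmeas; exact: cball_copen. Qed.

Lemma area_rect (a b c d : R) : a <= b -> c <= d ->
  cmeas [set z | a <= Re z <= b /\ c <= Im z <= d] /\
  area [set z | a <= Re z <= b /\ c <= Im z <= d] = ((b - a) * (d - c))%:E.
Proof.
move=> ab cd; set A := [set z | _].
have AE : tp @^-1` A = `[a, b]%classic `*` `[c, d]%classic.
  by apply/seteqP; split => -[x y] /=; rewrite !in_itv.
have mA : cmeas A by rewrite /cmeas AE; exact: measurableX.
split => //; rewrite areaE// AE [LHS]product_measure1E//.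
rewrite [X in (X * _)%E](@lebesgue_measure_itv R) [X in (_ * X)%E](@lebesgue_measure_itv R) /=.
rewrite !lte_fin; move: ab cd; rewrite !le_eqVlt.
move=> /orP[/eqP <-|ab]; first by rewrite ltxx mul0e subrr mul0r.
by move=> /orP[/eqP <-|cd]; rewrite ?ltxx ?mule0 ?subrr ?mulr0// ab cd.
Qed.

(** The constant 4 is that of the circumscribed square. *)
Lemma area_cball z r : 0 <= r -> (area (cball z r) <= (4 * r ^+ 2)%:E)%E.
Proof.
move=> r0; have ar x : x - r <= x + r by lra.
have [_] := area_rect (ar (Re z)) (ar (Im z)).
rewrite (_ : _ * _ = 4 * r ^+ 2); last by ring.
move=> <-; apply: le_area => w; rewrite /cball /= => wz.
have := ler_cnorm_Re (w - z); have := ler_cnorm_Im (w - z).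
rewrite !raddfB /= => /le_lt_trans /(_ wz) + /le_lt_trans /(_ wz).
by rewrite !ltr_norml => /andP[? ?] /andP[? ?]; split; apply/andP; split; lra.
Qed.

Lemma area_cball_fin z r : (area (cball z r) < +oo)%E.
Proof.
have [r0|r0] := leP 0 r; first by rewrite (le_lt_trans (area_cball _ r0))// ltry.
rewrite (_ : cball z r = set0) ?area0//; apply/seteqP; split => w //.
by rewrite /cball /= => /(le_lt_trans (cnorm_ge0 _)) /lt_trans /(_ r0); rewrite ltxx.
Qed.

(** [A] may have infinite area, so regularity is applied inside each ball of radius n, with errors
    adding up to [e]. *)
Lemma area_outer_regular A (e : R) : 0 < e ->
  exists U, [/\ copen U, A `<=` U & (area U <= area A + e%:E)%E].
Proof.
move=> e0; have [A' [mA' AA' <-]] := area_hull A.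
pose d n : R := e / (2 ^ n.+1)%:R.
have d0 n : 0 < d n by rewrite divr_gt0// ltr0n expn_gt0.
pose B (n : nat) := cball (0 : C) n%:R.
have /choice[U /choice[F UF]] := fun n =>
  cmeas_regular_in (cball_cmeas _ _) (area_cball_fin 0 n%:R) mA' (d0 n).
exists (\bigcup_n (U n `&` B n)); split.
- apply: copenU => n; apply: copenI; last exact: cball_copen.
  by case: (UF n).
- move=> z Az; have [n zn] : exists n : nat, cnorm z < n%:R.
    by exists (Num.bound (cnorm z)); exact: archi_boundP (cnorm_ge0 _).
  exists n => //; split; last by rewrite /B /cball /= subr0.
  by case: (UF n) => _ _ _ + _; apply; exact: AA'.
apply: (@le_trans _ _ (area (A' `|` \bigcup_n (B n `&` (U n `\` F n))))).
  apply: le_area => z [n _ [Uz Bz]]; have [Az|nA] := pselect (A' z); first by left.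
  right; exists n => //; split => //; split => // Fz; apply: nA.
  by case: (UF n) => _ _ + _ _; apply.
rewrite (le_trans (areaU _ _))// leeD2l// (le_trans (area_bigcup _))//.
apply: (@le_trans _ _ (\sum_(k <oo) (d k)%:E)%E).
  by apply: lee_nneseries => k _; rewrite ?area_ge0//; case: (UF k).
have := @epsilon_trick R (fun=> 0%E) e xpredT (fun=> lexx _) (ltW e0).
rewrite [X in (_ <= X + _)%E]eseries0// add0e; apply: le_trans.
by apply: lee_nneseries => k *; rewrite ?add0e// lee_fin ltW.
Qed.

Definition cmfun A (F : C -> R) := measurable_fun (tp @^-1` A) (fun u => F (tp u)).

Definition cint A (F : C -> R) : \bar R :=
  (\int[mu]_(u in tp @^-1` A) (F (tp u))%:E)%E.

Lemma invSn_lt (e : R) : 0 < e -> exists n : nat, n.+1%:R^-1 < e.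
Proof.
move=> e0; have [n _ /(_ n (leqnn n)) nP] := near_infty_natSinv_lt (PosNum e0).
by exists n.
Qed.

(** The set is cut by a grid whose squares lie in an open set of nearly the same area. A square of
    side 1/N has diameter below 2/N, so its image fits in a square of side 4L/N: hence the factor
    16. *)
Lemma area_lipschitz A g (L d : R) : 0 < L -> 0 < d ->
  (forall z w, A z -> A w -> cnorm (w - z) < d ->
     cnorm (g w - g z) <= L * cnorm (w - z)) ->
  (area (g @` A) <= (16 * L ^+ 2)%:E * area A)%E.
Proof.
move=> L0 d0 gL.
have c0 : 0 < 16 * L ^+ 2 by rewrite mulr_gt0// exprn_gt0.
have [Aoo|Afin] := eqVneq (area A) +oo%E.
  by rewrite Aoo gt0_muley ?lte_fin// leey.
have fA : area A \is a fin_num by rewrite ge0_fin_numE ?area_ge0// ltey.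
apply/lee_addgt0Pr => e e0.
have [U [oU AU Ue]] := area_outer_regular A (divr_gt0 e0 c0).
apply: (@le_trans _ _ ((16 * L ^+ 2)%:E * area U)%E); last first.
  have -> : ((16 * L ^+ 2)%:E * area A + e%:E =
      (16 * L ^+ 2)%:E * (area A + (e / (16 * L ^+ 2))%:E))%E.
    rewrite ge0_muleDr ?area_ge0 ?lee_fin ?divr_ge0 ?ltW// -EFinM.
    by rewrite [X in (_ = _ + X%:E)%E]mulrC divfK// gt_eqF.
  by rewrite lee_pmul2l ?lte_fin.
have [n0 n0d] := invSn_lt (divr_gt0 d0 (ltr0Sn R 1)).
pose An n := A `&` [set z | cball z (2 / (n0 + n).+1%:R) `<=` U].
have -> : g @` A = \bigcup_n (g @` An n).
  rewrite -image_bigcup; congr (_ @` _); apply/seteqP; split => [z Az|z [n _ []]//].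
  have [r r0 rU] := oU z (AU z Az).
  have [n nr] := invSn_lt (divr_gt0 r0 (ltr0Sn R 1)).
  exists n => //; split => // w; rewrite /cball /= => wz; apply: rU.
  rewrite /cball /=; apply: (lt_le_trans wz).
  rewrite mulrC -ler_pdivlMr// (le_trans _ (ltW nr))//.
  by rewrite lef_pV2 ?posrE// ler_nat ltnS leq_addl.
apply: area_nondecreasing_bigcup.
  move=> m n mn _ [z [Az zU] <-]; exists z => //; split => // w wz; apply: zU.
  apply: (lt_le_trans wz); rewrite ler_wpM2l// lef_pV2 ?posrE// ler_nat ltnS.
  by rewrite leq_add2l.
move=> n; set N := (n0 + n)%N.
pose V j := if `[< grid N j `<=` U >] then @grid N j else set0.
have mV j : cmeas (V j).
  by rewrite /V; case: asboolP => _; [exact: grid_cmeas|exact: cmeas0].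
have -> : g @` An n = \bigcup_j (g @` (An n `&` grid N j)).
  rewrite -image_bigcup; congr (_ @` _); apply/seteqP; split => [z Az|z [j _ []]//].
  by have [j jz] := grid_cover N z; exists j.
apply: (le_trans (area_bigcup _)).
apply: (@le_trans _ _ (\sum_(j <oo) (16 * L ^+ 2)%:E * area (V j))%E).
  apply: lee_nneseries => [j _ _|j _]; first exact: area_ge0.
  have [[z0 [[Az0 z0U] jz0]]|/nonemptyPn ->] := pselect ((An n `&` grid N j) !=set0);
    last by rewrite image_set0 area0 mule_ge0 ?area_ge0// lee_fin ltW.
  have gU : grid N j `<=` U.
    by move=> w jw; apply: z0U; exact: grid_dist jw jz0.
  rewrite /V asboolT// area_grid; last by exists z0.
  pose r : R := 2 * L / N.+1%:R.
  apply: (@le_trans _ _ (area (cball (g z0) r `|`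
      [set w | Re (g z0) - r <= Re w <= Re (g z0) + r /\
               Im (g z0) - r <= Im w <= Im (g z0) + r]))).
    apply: le_area => _ [w [[Aw _] jw] <-]; right => /=.
    have wz := grid_dist jw jz0.
    have gr : cnorm (g w - g z0) <= r.
      apply: (le_trans (gL _ _ Az0 Aw _)).
        apply: (lt_trans wz); rewrite mulrC -ltr_pdivlMr//.
        apply: le_lt_trans n0d.
        by rewrite lef_pV2 ?posrE// ler_nat ltnS leq_addr.
      by rewrite /r -mulrA mulrCA ler_pM2l// ltW.
    have := ler_cnorm_Re (g w - g z0); have := ler_cnorm_Im (g w - g z0).
    rewrite !raddfB /= => /le_trans /(_ gr) + /le_trans /(_ gr).
    by rewrite !ler_norml => /andP[? ?] /andP[? ?]; split; apply/andP; split; lra.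
  have r0 : 0 <= r by rewrite divr_ge0// mulr_ge0// ltW.
  have rr x : x - r <= x + r by lra.
  have [_ ar] := area_rect (rr (Re (g z0))) (rr (Im (g z0))).
  rewrite (_ : _ `|` _ = [set w | Re (g z0) - r <= Re w <= Re (g z0) + r /\
               Im (g z0) - r <= Im w <= Im (g z0) + r]); last first.
    apply/seteqP; split => w; last by right.
    case=> //; rewrite /cball /= => /ltW gr.
    have := ler_cnorm_Re (w - g z0); have := ler_cnorm_Im (w - g z0).
    rewrite !raddfB /= => /le_trans /(_ gr) + /le_trans /(_ gr).
    by rewrite !ler_norml => /andP[? ?] /andP[? ?]; split; apply/andP; split; lra.
  rewrite ar lee_fin /r.
  have -> : (Re (g z0) + 2 * L / N.+1%:R - (Re (g z0) - 2 * L / N.+1%:R)) *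
      (Im (g z0) + 2 * L / N.+1%:R - (Im (g z0) - 2 * L / N.+1%:R)) =
      16 * L ^+ 2 * (N.+1%:R^-1) ^+ 2 by ring.
  by rewrite exprVn.
rewrite nneseriesZl; last by move=> j _; exact: area_ge0.
rewrite lee_pmul2l ?lte_fin//.
have -> : (\sum_(j <oo) area (V j) = area (\bigcup_j V j))%E.
  rewrite areaE; last exact: cmeas_bigcup.
  rewrite preimage_bigcup [RHS]measure_bigcup; last 2 first.
  - by move=> j _; exact: mV.
  - move=> i j _ _ [u [Vi Vj]]; apply: (grid_trivIset (n := N)) => //.
    exists (tp u); move: Vi Vj; rewrite /V /=.
    by case: asboolP => // _; case: asboolP => // _.
  transitivity (\sum_(i <oo) mu (tp @^-1` V i))%E.
    by apply: eq_eseriesr => j _; exact: areaE.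
  by apply: eq_eseriesl => j; rewrite in_setT.
by apply: le_area => z [j _]; rewrite /V; case: asboolP => // h; exact: h.
Qed.

(** The radius [d] depends on the point. The sets where 1/(n+1) is small enough increase to [A], and
    the outer area is continuous along them. *)
Lemma area_image_le A g (L : R) : 0 < L ->
  (forall z, A z -> exists2 d : R, 0 < d & forall w, A w -> cnorm (w - z) < d ->
     cnorm (g w - g z) <= L * cnorm (w - z)) ->
  (area (g @` A) <= (16 * L ^+ 2)%:E * area A)%E.
Proof.
move=> L0 gL.
pose An (n : nat) := A `&` [set z | forall w, A w -> cnorm (w - z) < n.+1%:R^-1 ->
  cnorm (g w - g z) <= L * cnorm (w - z)].
have -> : g @` A = \bigcup_n (g @` An n).
  rewrite -image_bigcup; congr (_ @` _); apply/seteqP; split => [z Az|z [n _ []]//].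
  have [d d0 dP] := gL z Az; have [n nd] := invSn_lt d0.
  by exists n => //; split => // w Aw wz; apply: dP => //; exact: lt_trans nd.
apply: area_nondecreasing_bigcup.
  move=> m n mn _ [z [Az zU] <-]; exists z => //; split => // w Aw wz; apply: zU => //.
  by apply: (lt_le_trans wz); rewrite lef_pV2 ?posrE// ler_nat.
move=> n; have n0 : (0 : R) < n.+1%:R^-1 by rewrite invr_gt0.
apply: (@le_trans _ _ ((16 * L ^+ 2)%:E * area (An n))%E).
  by apply: (area_lipschitz L0 n0) => z w [Az zP] [Aw _]; exact: zP.
rewrite lee_pmul2l ?lte_fin//; last by rewrite mulr_gt0// exprn_gt0.
by apply: le_area => z [].
Qed.

Lemma area_image0 A g : area A = 0%E ->
  (forall z, A z -> exists L d : R, 0 < d /\ forall w, A w -> cnorm (w - z) < d ->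
     cnorm (g w - g z) <= L * cnorm (w - z)) ->
  area (g @` A) = 0%E.
Proof.
move=> A0 gL.
pose An (n : nat) := A `&` [set z | exists2 d : R, 0 < d & forall w, A w ->
  cnorm (w - z) < d -> cnorm (g w - g z) <= n.+1%:R * cnorm (w - z)].
have -> : g @` A = \bigcup_n (g @` An n).
  rewrite -image_bigcup; congr (_ @` _); apply/seteqP; split => [z Az|z [n _ []]//].
  have [L [d [d0 dP]]] := gL z Az.
  exists (Num.truncn `|L|) => //; split => //; exists d => // w Aw wz.
  apply: (le_trans (dP w Aw wz)); rewrite ler_wpM2r ?cnorm_ge0//.
  rewrite (le_trans (ler_norm L))// ltW//.
  by have /andP[] := truncn_itv (normr_ge0 L).
apply: area_bigcup0 => n; apply/eqP; rewrite eq_le area_ge0 andbT.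
have h : (area (g @` An n) <= (16 * n.+1%:R ^+ 2)%:E * area (An n))%E.
  apply: area_image_le => // z [Az [d d0 dP]]; exists d => // w [Aw _].
  exact: dP.
apply: (le_trans h); rewrite (@area_sub0 (An n) A) ?mule0//.
by move=> z [].
Qed.

(** Despite the name, these are the numbers n+1 and 1/(n+1). Every positive real lies between one of
    them and its double. *)
Definition dyad (j : nat) : R :=
  if @unpickle (bool * nat)%type j is Some (b, n) then
    (if b then n.+1%:R else n.+1%:R^-1) else 1.

Lemma dyad_gt0 j : 0 < dyad j.
Proof. by rewrite /dyad; case: unpickle => [[[] n]|]//; rewrite invr_gt0. Qed.

Lemma dyad_cover (x : R) : 0 < x -> exists j, dyad j <= x <= 2 * dyad j.
Proof.
move=> x0; have [x1|x1] := leP 1 x.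
  have tx : (0 < Num.truncn x)%N by rewrite truncn_gt0.
  exists (pickle (true, (Num.truncn x).-1)); rewrite /dyad pickleK prednK//.
  have /andP[-> /ltW/le_trans ->//] := truncn_itv (ltW x0).
  rewrite -natr1 mulr2n mulrDl mul1r lerD2l.
  by rewrite ler1n.
have x1' : 1 < x^-1 by rewrite invf_gt1.
have xi0 : 0 <= x^-1 by rewrite invr_ge0 ltW.
have tx : (0 < Num.truncn x^-1)%N by rewrite truncn_gt0 ltW.
exists (pickle (false, (Num.truncn x^-1))); rewrite /dyad pickleK.
have /andP[h1 h2] := truncn_itv xi0.
apply/andP; split.
  by rewrite -[leRHS]invrK lef_pV2 ?posrE ?invr_gt0// ltW.
rewrite -[leLHS]invrK -[2]invrK -invfM lef_pV2 ?posrE ?invr_gt0//.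
rewrite ler_pdivrMl//; rewrite (le_trans _ (_ : 2 * (Num.truncn x^-1)%:R <= _))//.
  by rewrite -natr1 mulr2n mulrDl mul1r lerD2l ler1n.
by rewrite ler_pM2l.
Qed.

Lemma cint_ge0 A F : (forall z, A z -> 0 <= F z) -> (0 <= cint A F)%E.
Proof. by move=> F0; apply: integral_ge0 => u Au; rewrite lee_fin F0. Qed.

Lemma cmfunE A F : cmfun A F ->
  measurable_fun (tp @^-1` A) (fun u => (F (tp u))%:E).
Proof. by move=> mF; exact/measurable_EFinP. Qed.

Lemma cint_bigcup (B : nat -> set C) F : (forall n, cmeas (B n)) ->
  trivIset setT B -> cmfun (\bigcup_n B n) F ->
  (forall z, (\bigcup_n B n) z -> 0 <= F z) ->
  cint (\bigcup_n B n) F = (\sum_(n <oo) cint (B n) F)%E.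
Proof.
move=> mB tB mF F0; rewrite /cint preimage_bigcup ge0_integral_bigcup//.
- by rewrite -preimage_bigcup; exact: cmfunE.
- by move=> u [n _ Bu]; rewrite lee_fin F0//; exists n.
- by move=> i j _ _ [u [Bi Bj]]; apply: tB => //; exists (tp u).
Qed.

Lemma cint_subset A B F : cmeas A -> cmeas B -> A `<=` B -> cmfun B F ->
  (forall z, B z -> 0 <= F z) -> (cint A F <= cint B F)%E.
Proof.
move=> mA mB AB mF F0; apply: ge0_subset_integral => //.
- exact: cmfunE.
- by move=> u Bu; rewrite lee_fin F0.
- exact: preimage_subset.
Qed.

Lemma cint_cst A (c : R) : cmeas A -> cint A (fun=> c) = (c%:E * area A)%E.
Proof. by move=> mA; rewrite /cint integral_cst// areaE. Qed.

Lemma cint_le A F G : cmeas A -> cmfun A F -> cmfun A G ->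
  (forall z, A z -> 0 <= F z <= G z) -> (cint A F <= cint A G)%E.
Proof.
move=> mA mF mG FG; apply: ge0_le_integral => //.
- by move=> u /FG/andP[]; rewrite lee_fin.
- exact: cmfunE.
- exact: cmfunE.
- by move=> u /FG/andP[]; rewrite lee_fin.
Qed.

Lemma cintZl A (c : R) F : cmeas A -> cmfun A F -> (forall z, A z -> 0 <= F z) ->
  0 <= c -> (c%:E * cint A F = cint A (fun z => c * F z)%R)%E.
Proof.
move=> mA mF F0 c0; rewrite /cint -ge0_integralZl_EFin//.
  by move=> u Au; rewrite lee_fin F0.
exact: (cmfunE mF).
Qed.

Lemma cmfun_cst A (c : R) : cmfun A (fun=> c).
Proof. exact: measurable_cst. Qed.

Lemma cmfunS A B F : cmeas B -> A `<=` B -> cmfun B F -> cmfun A F.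
Proof. by move=> mB AB; apply: measurable_funS => //; exact: preimage_subset. Qed.

Lemma cmfun_sub A F : cmfun setT F -> cmfun A F.
Proof. exact: cmfunS cmeasT (@subsetT _ _). Qed.

(** The intervals from [dyad j] to its double overlap, hence the disjointification by [seqDU]. *)
Definition level A (h : C -> R) : nat -> set C :=
  seqDU (fun j => A `&` [set z | dyad j <= h z <= 2 * dyad j]).

Lemma level_cmeas A h j : cmeas A -> cmfun A h -> cmeas (level A h j).
Proof.
move=> mA mh; pose V j := A `&` [set z | dyad j <= h z <= 2 * dyad j].
have mV k : cmeas (V k).
  have := mh mA _ (measurable_itv `[dyad k, 2 * dyad k]).
  by congr measurable; apply/seteqP; split => u /= [Au]; rewrite in_itv.
rewrite /cmeas /level -/V /seqDU; apply: cmeasD => //.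
have -> : \big[setU/set0]_(k < j) V k = \bigcup_(k in [set k | (k < j)%N]) V k.
  exact: (esym (bigcup_mkord _ _)).
by rewrite /cmeas preimage_bigcup; apply: bigcup_measurable => k _; exact: mV.
Qed.

Lemma level_trivIset A h : trivIset setT (level A h).
Proof. exact: trivIset_seqDU. Qed.

Lemma level_bigcup A h : \bigcup_j level A h j = A `&` [set z | 0 < h z].
Proof.
rewrite -seqDU_bigcup_eq; apply/seteqP; split => [z [j _ [Az /andP[h1 _]]]|z [Az h0]].
  by split => //=; apply: lt_le_trans h1; exact: dyad_gt0.
by have [j jz] := dyad_cover h0; exists j.
Qed.

Lemma levelP A h j z : level A h j z -> A z /\ dyad j <= h z <= 2 * dyad j.
Proof. by move=> zh; have [] := subset_seqDU zh. Qed.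

(** [J] plays the role of the modulus of the derivative: it bounds the dilatation of [g] at each
    point, relatively to [A]. *)
Definition plip A g (J : C -> R) := forall z, A z -> forall e : R, 0 < e ->
  exists2 d : R, 0 < d & forall w, A w -> cnorm (w - z) < d ->
     cnorm (g w - g z) <= (J z + e) * cnorm (w - z).

Lemma plipS A B g J : A `<=` B -> plip B g J -> plip A g J.
Proof.
move=> AB gJ z Az e e0; have [d d0 dP] := gJ z (AB _ Az) e e0.
by exists d => // w Aw; apply: dP; exact: AB.
Qed.

(** Sard's argument: on a bounded piece, [area_image_le] applies with an arbitrarily small Lipschitz
    constant. *)
Lemma area_image_critical A g J : plip A g J -> (forall z, A z -> J z = 0) ->
  area (g @` A) = 0%E.
Proof.
move=> gJ J0.
have -> : g @` A = \bigcup_n (g @` (A `&` cball (0%R : C) n%:R)).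
  rewrite -image_bigcup; congr (_ @` _); apply/seteqP; split => [z Az|z [n _ []]//].
  exists (Num.bound (cnorm z)) => //; split => //.
  by rewrite /cball /= subr0; exact: archi_boundP (cnorm_ge0 _).
apply: area_bigcup0 => n; apply/eqP; rewrite eq_le area_ge0 andbT.
have n4 : 0 <= 4 * n%:R ^+ 2 :> R by rewrite mulr_ge0// exprn_ge0.
suff key (e : R) : 0 < e -> (area (g @` (A `&` cball (0%R : C) n%:R)) <= e%:E)%E.
  by apply/lee_addgt0Pr => e /key; rewrite add0e.
(* [L] is at most 1, so its square is at most [L], and the second bound then absorbs the area of the
   ball. *)
move=> e0; pose L := Num.min 1 (e / (16 * (4 * n%:R ^+ 2 + 1))).
have L0 : 0 < L.
  by rewrite lt_min ltr01 /= divr_gt0// mulr_gt0// ltr_wpDl.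
apply: (@le_trans _ _ ((16 * L ^+ 2)%:E * area (A `&` cball (0%R : C) n%:R))%E).
  apply: area_image_le => // z [Az _].
  have [d d0 dP] := gJ z Az L L0; exists d => // w [Aw _] wz.
  by have := dP w Aw wz; rewrite J0// add0r.
apply: (@le_trans _ _ ((16 * L ^+ 2)%:E * (4 * n%:R ^+ 2)%:E)%E).
  rewrite lee_pmul2l ?lte_fin ?mulr_gt0 ?exprn_gt0//.
  rewrite (le_trans (_ : _ <= area (cball (0%R : C) n%:R))%E)//.
    by apply: le_area => z [].
  exact: area_cball.
rewrite -EFinM lee_fin.
have L1 : L <= 1 by rewrite ge_min lexx.
have L2 : L <= e / (16 * (4 * n%:R ^+ 2 + 1)) by rewrite ge_min lexx orbT.
rewrite ler_pdivlMr in L2; last by rewrite mulr_gt0// ltr_wpDl.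
apply: le_trans L2; rewrite mulrAC mulrA.
nra.
Qed.

(** On a level of [J] the Lipschitz constant is at most four times the lower value [dyad j], which
    turns 16 into 16 * 4^2 = 256. The zeros of [J] are handled by [area_image_critical]. *)
Lemma area_image_int A g J : cmeas A -> cmfun A J ->
  (forall z, A z -> 0 <= J z) -> plip A g J ->
  (area (g @` A) <= 256%:E * cint A (fun z => J z ^+ 2)%R)%E.
Proof.
move=> mA mJ J0 gJ.
pose A0 := A `&` [set z | J z = 0].
have -> : g @` A = g @` A0 `|` \bigcup_j (g @` level A J j).
  rewrite -image_bigcup level_bigcup -image_setU; congr (_ @` _).
  apply/seteqP; split => [z Az|z [[]|[]]//].
  have := J0 z Az; rewrite le_eqVlt => /orP[/eqP Jz|Jz]; [left|right]; split => //.
rewrite (le_trans (areaU _ _))// (@area_image_critical A0 g J); last 2 first.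
- by apply: plipS gJ => z [].
- by move=> z [].
rewrite add0e (le_trans (area_bigcup _))//.
have mB j : cmeas (level A J j) by exact: level_cmeas.
have mJ2 : cmfun A (fun z => J z ^+ 2) by exact: measurable_funX.
have BA j : level A J j `<=` A by move=> z /levelP[].
apply: (@le_trans _ _ (\sum_(j <oo) 256%:E * cint (level A J j) (fun z => (J z ^+ 2)%R))%E).
  apply: lee_nneseries => [j _ _|j _]; first exact: area_ge0.
  have d0 := dyad_gt0 j.
  apply: (@le_trans _ _ ((16 * (4 * dyad j) ^+ 2)%:E * area (level A J j))%E).
    apply: area_image_le => [|z /levelP[Az /andP[_ Jz]]]; first by rewrite mulr_gt0.
    have [d d1 dP] := gJ z Az (2 * dyad j) (mulr_gt0 (ltr0Sn R 1) d0).
    exists d => // w /levelP[Aw _] wz; apply: (le_trans (dP w Aw wz)).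
    by rewrite ler_wpM2r ?cnorm_ge0//; lra.
  have -> : 16 * (4 * dyad j) ^+ 2 = 256 * (dyad j ^+ 2) by ring.
  rewrite EFinM -muleA; apply: lee_wpmul2l; first by rewrite lee_fin ler0n.
  rewrite -cint_cst//.
  apply: cint_le => //; [exact: cmfun_cst|exact: cmfunS mJ2|].
  move=> z /levelP[Az /andP[h _]]; apply/andP; split; first exact: exprn_ge0 (ltW d0).
  by rewrite ler_sqr ?nnegrE ?(ltW d0)// (le_trans (ltW d0)).
rewrite nneseriesZl; last by move=> j _; apply: cint_ge0 => z _; exact: sqr_ge0.
apply: lee_wpmul2l; first by rewrite lee_fin ler0n.
rewrite -cint_bigcup//; last 3 first.
- exact: level_trivIset.
- by apply: cmfunS mJ2 => //; rewrite level_bigcup => z [].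
- by move=> z _; exact: sqr_ge0.
apply: cint_subset => //; first exact: cmeas_bigcup.
- by rewrite level_bigcup => z [].
- by move=> z _; exact: sqr_ge0.
Qed.

(* Half of the change of variables formula, up to a constant factor; the map
   need not be injective. *)
Lemma cint_image A g J S H : cmeas A -> cmfun A J ->
  (forall z, A z -> 0 <= J z) -> plip A g J ->
  (forall B, cmeas B -> cmeas (A `&` g @^-1` B)) ->
  cmeas S -> S `<=` g @` A -> cmfun setT H -> (forall z, 0 <= H z) ->
  (cint S H <= 512%:E * cint A (fun z => H (g z) * J z ^+ 2)%R)%E.
Proof.
move=> mA mJ J0 gJ mg mS SA mH H0.
have mHS := @cmfunS S setT H cmeasT (@subsetT _ S) mH.
have mHg : cmfun A (fun z => H (g z)).
  move=> _ Y mY; have mHY : cmeas (H @^-1` Y).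
    by have := mH measurableT _ mY; rewrite setTI.
  by have := mg _ mHY.
pose Tj j := level setT H j.
have mT j : cmeas (Tj j) by exact: level_cmeas cmeasT mH.
have mST j : cmeas (S `&` Tj j) by exact: cmeasI.
have mAT j : cmeas (A `&` g @^-1` Tj j) by exact: mg.
have TE : \bigcup_j Tj j = [set z | 0 < H z] by rewrite level_bigcup setTI.
have SE : cint S H = cint (\bigcup_j (S `&` Tj j)) H.
  rewrite -setI_bigcupr TE /cint [LHS]integral_mkcond [RHS]integral_mkcond.
  apply: eq_integral => u _; rewrite /patch; case: ifPn; case: ifPn => //.
    rewrite notin_setE inE /= => nS Su; apply/eqP; rewrite eqe eq_le H0 andbT.
    by rewrite leNgt; apply/negP => Hu; apply: nS.
  by rewrite notin_setE inE /= => -[Su _] nS.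
have tT (B : set C) (k : C -> C) : trivIset setT (fun j => B `&` k @^-1` Tj j).
  by move=> i j _ _ [z [[_ zi] [_ zj]]]; apply: (@level_trivIset setT H) => //; exists (k z).
rewrite SE cint_bigcup//; last 2 first.
- exact: (tT S id).
- by apply: cmfunS mHS => // z [j _ []].
have mJ2 : cmfun A (fun z => J z ^+ 2) by exact: measurable_funX.
have mHJ : cmfun A (fun z => H (g z) * J z ^+ 2) by exact: measurable_funM.
have HJ0 z : 0 <= H (g z) * J z ^+ 2 by rewrite mulr_ge0// sqr_ge0.
apply: (@le_trans _ _ (\sum_(j <oo) 512%:E *
    cint (A `&` g @^-1` Tj j) (fun z => H (g z) * J z ^+ 2)%R)%E).
  apply: lee_nneseries => [j _ _|j _]; first by apply: cint_ge0 => z _; exact: H0.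
  have d0 := dyad_gt0 j.
  have AT : A `&` g @^-1` Tj j `<=` A by move=> z [].
  have mJ2T := cmfunS mA AT mJ2; have mHJT := cmfunS mA AT mHJ.
  apply: (@le_trans _ _ ((2 * dyad j)%:E * area (S `&` Tj j))%E).
    rewrite -cint_cst//; apply: cint_le => //; [|exact: cmfun_cst|].
      by apply: cmfunS mHS => // z [].
    by move=> z [_ /levelP[_ /andP[_ ->]]]; rewrite H0.
  apply: (@le_trans _ _ ((2 * dyad j)%:E * area (g @` (A `&` g @^-1` Tj j)))%E).
    rewrite lee_pmul2l ?lte_fin ?mulr_gt0//; apply: le_area => y [Sy Ty].
    by have [z Az zy] := SA y Sy; exists z => //; split => //=; rewrite zy.
  apply: (@le_trans _ _ ((2 * dyad j)%:E * (256%:E * cint (A `&` g @^-1` Tj j)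
      (fun z => J z ^+ 2)%R))%E).
    rewrite lee_pmul2l ?lte_fin ?mulr_gt0//; apply: area_image_int => //.
    - by apply: cmfunS mJ => // z [].
    - by move=> z [Az _]; exact: J0.
    - by apply: plipS gJ => z [].
  (* The levels of [H] lose a factor 2 on top of the 256 of [area_image_int]. *)
  rewrite muleA -EFinM (_ : 2 * dyad j * 256 = 512 * dyad j); last by ring.
  rewrite EFinM -muleA; apply: lee_wpmul2l; first by rewrite lee_fin ler0n.
  rewrite (cintZl (mAT j) mJ2T _ (ltW d0)); last by move=> z _; exact: sqr_ge0.
  apply: (cint_le (mAT j)) => //.
    exact: measurable_funM (measurable_cst _) mJ2T.
  move=> z [_ /levelP[_ /andP[h _]]]; rewrite mulr_ge0 ?sqr_ge0 ?(ltW d0)//=.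
  by rewrite ler_wpM2r// sqr_ge0.
rewrite nneseriesZl; last by move=> j _; exact: cint_ge0.
apply: lee_wpmul2l; first by rewrite lee_fin ler0n.
rewrite -cint_bigcup//; last first.
  by apply: cmfunS mHJ => // z [j _ []].
apply: cint_subset => //; first exact: cmeas_bigcup.
by move=> z [j _ []].
Qed.

End PlanarArea.

(** * Holomorphic functions *)

Section Hol.
Variable R : realType.
Local Notation C := R[i].
Implicit Types (z w : C) (r : R) (u v : C -> C).

(* Holomorphy with a uniform quadratic Taylor error, which survives limits. *)
Definition hol z0 r u u' := exists2 L : R, 0 <= L & forall z, cball z0 r z ->
  [/\ cnorm (u z) <= L, cnorm (u' z) <= L & forall w, cball z0 r w ->
      cnorm (u w - u z - u' z * (w - z)) <= L * cnorm (w - z) ^+ 2].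

Lemma hol_sub z0 r z1 r1 u u' : cball z1 r1 `<=` cball z0 r ->
  hol z0 r u u' -> hol z1 r1 u u'.
Proof.
move=> h [L L0 H]; exists L => // z /h/H[a b c]; split => // w /h; exact: c.
Qed.

Lemma cball_sub z1 z0 r1 r : cnorm (z1 - z0) + r1 <= r -> cball z1 r1 `<=` cball z0 r.
Proof.
move=> h w; rewrite /cball /= => wz; apply: (le_lt_trans (cnorm_dist z1 _ _)).
by apply: lt_le_trans h; rewrite addrC ltrD2l.
Qed.

Lemma eq_hol z0 r u u' v v' : (forall z, cball z0 r z -> u z = v z) ->
  (forall z, cball z0 r z -> u' z = v' z) -> hol z0 r u u' -> hol z0 r v v'.
Proof.
move=> uv uv' [L L0 H]; exists L => // z zr; rewrite -uv// -uv'//.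
by have [a b c] := H z zr; split => // w wr; rewrite -uv//; exact: c.
Qed.

Lemma hol_cst z0 r (c : C) : hol z0 r (fun=> c) (fun=> 0).
Proof.
exists (cnorm c); first exact: cnorm_ge0.
move=> z _; rewrite cnorm0 cnorm_ge0; split => // w _.
by rewrite mul0r !subrr cnorm0 mulr_ge0 ?cnorm_ge0// sqr_ge0.
Qed.

Lemma hol_id z0 r : hol z0 r id (fun=> 1).
Proof.
have L0 : 0 <= cnorm z0 + `|r| + 1.
  by rewrite !addr_ge0 ?cnorm_ge0.
exists (cnorm z0 + `|r| + 1) => // z zr; split.
- have := ler_cnormB z z0; move: zr; rewrite /cball /=.
  have := ler_norm r; lra.
- by rewrite cnorm1 lerDr addr_ge0 ?cnorm_ge0.
- by move=> w _; rewrite mul1r subrr cnorm0 mulr_ge0// sqr_ge0.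
Qed.

Lemma holD z0 r u u' v v' : hol z0 r u u' -> hol z0 r v v' ->
  hol z0 r (fun z => u z + v z) (fun z => u' z + v' z).
Proof.
move=> [L L0 H] [M M0 K]; exists (L + M); first exact: addr_ge0.
move=> z zr; have [a b c] := H z zr; have [a' b' c'] := K z zr; split.
- by rewrite (le_trans (ler_cnormD _ _))// lerD.
- by rewrite (le_trans (ler_cnormD _ _))// lerD.
- move=> w wr; rewrite mulrDl (_ : _ - _ - _ =
    (u w - u z - u' z * (w - z)) + (v w - v z - v' z * (w - z))); last by ring.
  by rewrite (le_trans (ler_cnormD _ _))// mulrDl lerD ?c ?c'.
Qed.

Lemma hol_lip z0 r u u' : hol z0 r u u' -> exists2 K : R, 0 <= K &
  forall z w, cball z0 r z -> cball z0 r w -> cnorm (u w - u z) <= K * cnorm (w - z).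
Proof.
move=> [L L0 H]; exists (L + L * (2 * `|r|)).
  by rewrite addr_ge0// mulr_ge0// mulr_ge0.
move=> z w zr wr; have [a b c] := H z zr.
rewrite -[u w - u z](subrK (u' z * (w - z))) (le_trans (ler_cnormD _ _))//.
rewrite mulrDl addrC lerD ?cnormM ?ler_wpM2r ?cnorm_ge0//.
rewrite (le_trans (c w wr))// expr2 mulrA ler_wpM2r ?cnorm_ge0// ler_wpM2l//.
have := cnorm_dist z0 w z; rewrite (cnormB z0 z).
move: zr wr (ler_norm r); rewrite /cball /=; lra.
Qed.

Lemma holM z0 r u u' v v' : hol z0 r u u' -> hol z0 r v v' ->
  hol z0 r (fun z => u z * v z) (fun z => u' z * v z + u z * v' z).
Proof.
move=> hu hv; have [K1 K10 lu] := hol_lip hu; have [K2 K20 lv] := hol_lip hv.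
move: hu hv => [L L0 H] [M M0 K].
exists (L * M + L * M + L * K2); first by rewrite !addr_ge0 ?mulr_ge0.
move=> z zr; have [a b c] := H z zr; have [a' b' c'] := K z zr.
have LM : cnorm (u z * v z) <= L * M by rewrite cnormM ler_pM ?cnorm_ge0.
have LM0 : 0 <= L * M by rewrite mulr_ge0.
have LK0 : 0 <= L * K2 by rewrite mulr_ge0.
split.
- by rewrite (le_trans LM)// -addrA lerDl addr_ge0.
- rewrite (le_trans (ler_cnormD _ _))// -[leLHS]addr0 lerD// !cnormM.
  by rewrite lerD// ler_pM ?cnorm_ge0.
- move=> w wr; have [a2 _ _] := K w wr.
  have -> : u w * v w - u z * v z - (u' z * v z + u z * v' z) * (w - z) =
    (u w - u z - u' z * (w - z)) * v w + u z * (v w - v z - v' z * (w - z))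
    + u' z * (w - z) * (v w - v z) by ring.
  rewrite (le_trans (ler_cnormD _ _))// [leRHS]mulrDl lerD//.
    rewrite (le_trans (ler_cnormD _ _))// [leRHS]mulrDl lerD// cnormM.
      by rewrite mulrAC ler_pM ?cnorm_ge0 ?c.
    by rewrite -mulrA ler_pM ?cnorm_ge0 ?c'.
  rewrite !cnormM expr2 mulrACA ler_pM ?mulr_ge0 ?cnorm_ge0//.
    by rewrite ler_wpM2r ?cnorm_ge0.
  by rewrite lv.
Qed.

Lemma holN z0 r u u' : hol z0 r u u' ->
  hol z0 r (fun z => - u z) (fun z => - u' z).
Proof.
move=> hu; have := holM (hol_cst z0 r (-1)) hu; apply: eq_hol => z _ /=.
  by rewrite mulN1r.
by rewrite mul0r add0r mulN1r.
Qed.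

Lemma holB z0 r u u' v v' : hol z0 r u u' -> hol z0 r v v' ->
  hol z0 r (fun z => u z - v z) (fun z => u' z - v' z).
Proof. by move=> hu hv; exact: holD (holN hv). Qed.

Lemma holV z0 r u u' (m : R) : 0 < m -> (forall z, cball z0 r z -> m <= cnorm (u z)) ->
  hol z0 r u u' -> hol z0 r (fun z => (u z)^-1) (fun z => - u' z / u z ^+ 2).
Proof.
move=> m0 um hu; have [K K0 lu] := hol_lip hu; move: hu => [L L0 H].
have u0 z : cball z0 r z -> u z != 0.
  by move=> /um h; rewrite -cnorm_gt0 (lt_le_trans m0).
have mV z : cball z0 r z -> cnorm (u z)^-1 <= m^-1.
  by move=> zr; rewrite cnormV lef_pV2 ?posrE ?um// (lt_le_trans m0)// um.
have m1 : 0 <= m^-1 by rewrite invr_ge0 ltW.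
exists (m^-1 + L * m^-1 ^+ 2 + (K * K * m^-1 ^+ 3 + L * m^-1 ^+ 2)).
  by rewrite !addr_ge0 ?mulr_ge0 ?exprn_ge0.
move=> z zr; have [a b c] := H z zr.
have h1 : 0 <= L * m^-1 ^+ 2 by rewrite mulr_ge0 ?exprn_ge0.
have h2 : 0 <= K * K * m^-1 ^+ 3 by rewrite mulr_ge0 ?exprn_ge0// mulr_ge0.
split.
- have := mV z zr; lra.
- have : cnorm (- u' z / u z ^+ 2) <= L * m^-1 ^+ 2.
    rewrite cnormM cnormN -exprVn cnormX ler_pM ?exprn_ge0 ?cnorm_ge0//.
    by rewrite lerXn2r ?nnegrE ?cnorm_ge0 ?mV.
  lra.
- move=> w wr.
  have -> : (u w)^-1 - (u z)^-1 - - u' z / u z ^+ 2 * (w - z) =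
    (u w - u z) * (u w - u z) * ((u z)^-1 * (u z)^-1 * (u w)^-1)
    - (u w - u z - u' z * (w - z)) * ((u z)^-1 * (u z)^-1).
    by field; rewrite !u0.
  apply: (@le_trans _ _ ((K * K * m^-1 ^+ 3 + L * m^-1 ^+ 2) * cnorm (w - z) ^+ 2)).
    rewrite (le_trans (ler_cnormD _ _))// cnormN !cnormM mulrDl lerD//.
      have -> : K * K * m^-1 ^+ 3 * cnorm (w - z) ^+ 2 =
        (K * cnorm (w - z)) * (K * cnorm (w - z)) * (m^-1 * m^-1 * m^-1) by ring.
      by rewrite !ler_pM ?mulr_ge0 ?cnorm_ge0 ?lu ?mV.
    rewrite mulrAC expr2 ler_pM ?mulr_ge0 ?cnorm_ge0 ?c//.
    by rewrite ler_pM ?cnorm_ge0 ?mV.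
  by rewrite ler_wpM2r ?sqr_ge0//; lra.
Qed.

Lemma hol_poly z0 r (p : {poly C}) : hol z0 r (horner p) (horner p^`()).
Proof.
elim/poly_ind: p => [|p c IH].
  by rewrite derivC; apply: eq_hol (hol_cst z0 r 0) => z _; rewrite horner0.
have := holD (holM IH (hol_id z0 r)) (hol_cst z0 r c).
apply: eq_hol => z _; first by rewrite hornerMXaddC.
by rewrite derivD derivC derivM derivX !hornerE.
Qed.

(** Adding the Taylor estimates centred at the two points leaves (u' w - u' z)(w - z) with a
    quadratic error. *)
Lemma hol_deriv_lip z0 r u u' : hol z0 r u u' -> exists2 K : R, 0 <= K &
  forall z w, cball z0 r z -> cball z0 r w -> cnorm (u' w - u' z) <= K * cnorm (w - z).
Proof.
move=> [L L0 H]; exists (L + L); first exact: addr_ge0.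
move=> z w zr wr.
have [_ _ /(_ w wr) c] := H z zr; have [_ _ /(_ z zr) c'] := H w wr.
have [->|wz] := eqVneq w z; first by rewrite !subrr cnorm0 mulr0.
have wz0 : 0 < cnorm (w - z) by rewrite cnorm_gt0 subr_eq0.
rewrite -(ler_pM2r wz0) -cnormM -mulrA -expr2.
have -> : (u' w - u' z) * (w - z) =
  (u w - u z - u' z * (w - z)) + (u z - u w - u' w * (z - w)) by ring.
by rewrite (le_trans (ler_cnormD _ _))// mulrDl lerD// (cnormB w z).
Qed.

End Hol.

(** * Cauchy's formula as a limit of averages over roots of unity *)

Section RootsOfUnity.
Variable R : realType.
Local Notation C := R[i].

(* [omega k] is a primitive [2 ^ k]-th root of unity; successive square roots
   are chosen in the right half plane, so that [omega k] tends to 1. *)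
Fixpoint omega (k : nat) : C := match k with
  | 0%N => 1
  | 1%N => -1
  | k'.+1 => let s := sqrtc (omega k') in if 0 <= Re s then s else - s
  end.

Lemma omegaSS k : omega k.+2 =
  if 0 <= Re (sqrtc (omega k.+1)) then sqrtc (omega k.+1) else - sqrtc (omega k.+1).
Proof. by []. Qed.

Lemma omegaS k : omega k.+1 ^+ 2 = omega k.
Proof.
case: k => [|k]; first by rewrite /= sqrrN expr1n.
by rewrite omegaSS; case: ifP => _; rewrite ?sqrrN sqr_sqrtc.
Qed.

Lemma omega_exp2 k : omega k ^+ (2 ^ k) = 1.
Proof.
by elim: k => [|k IH]; rewrite ?expr1n// expnS exprM omegaS.
Qed.

Lemma cnorm_omega k : cnorm (omega k) = 1.
Proof.
elim: k => [|k IH]; first by rewrite cnorm1.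
have : cnorm (omega k.+1) ^+ 2 = 1 by rewrite -cnormX omegaS.
by move/eqP; rewrite sqrp_eq1 ?cnorm_ge0// => /eqP.
Qed.

Lemma omega_half k : omega k.+1 ^+ (2 ^ k) = -1.
Proof.
by elim: k => [|k IH]; [rewrite expn0 expr1|rewrite expnS exprM omegaS].
Qed.

Lemma omega_prim k : (2 ^ k).-primitive_root (omega k).
Proof.
case: k => [|k].
  have [m pm] := @prim_order_exists C 1 1 isT (expr1n _ _).
  by rewrite dvdn1 => /eqP m1; move: pm; rewrite m1.
have N0 : (0 < 2 ^ k.+1)%N by rewrite expn_gt0.
have [m pm /(dvdn_pfactor _ _ (isT : prime 2)) [i ik mi]] :=
  prim_order_exists N0 (omega_exp2 k.+1).
move: pm; rewrite mi; move: ik; rewrite leq_eqVlt => /orP[/eqP -> //|].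
rewrite ltnS => ik pm; have : omega k.+1 ^+ (2 ^ k) = 1.
  have e : omega k.+1 ^+ (2 ^ i) = 1 := prim_expr_order pm.
  have -> : (2 ^ k = 2 ^ i * 2 ^ (k - i))%N by rewrite -expnD subnKC.
  by rewrite exprM e expr1n.
rewrite omega_half => /eqP; rewrite eq_sym -subr_eq0 opprK.
by rewrite -(natrD _ 1 1) pnatr_eq0.
Qed.

Lemma omega_neq0 k : omega k != 0.
Proof. by rewrite -cnorm_gt0 cnorm_omega. Qed.

(** In the right half plane |omega + 1|^2 is at least 2. Since the previous root minus 1 factors as
    (omega - 1)(omega + 1), each square root at least halves the squared distance to 1. *)
Lemma omega_dist k : cnorm (omega k.+1 - 1) ^+ 2 <= 4 / 2 ^+ k.
Proof.
elim: k => [|k IH].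
  have -> : omega 1 - 1 = - 2%:R :> C by rewrite -[omega 1]/(-1) -opprD.
  by rewrite cnormN cnorm_nat expr0 divr1 -natrX.
have Re0 : 0 <= Re (omega k.+2).
  rewrite omegaSS; case: ifPn => //; rewrite -ltNge => h.
  by rewrite raddfN /= oppr_ge0 ltW.
have e : cnorm (omega k.+1 - 1) = cnorm (omega k.+2 - 1) * cnorm (omega k.+2 + 1).
  by rewrite -cnormM -omegaS; congr cnorm; ring.
have n1 : cnorm (omega k.+2) ^+ 2 = 1 by rewrite cnorm_omega expr1n.
have p2 : 2 <= cnorm (omega k.+2 + 1) ^+ 2.
  case: (omega k.+2) Re0 n1 => a b /= a0.
  rewrite !sqr_sqrtr ?addr_ge0 ?sqr_ge0// => h.
  by have := h; rewrite addr0; nra.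
rewrite [2 ^+ k.+1]exprS invfM mulrCA ler_pdivlMl// mulrC mulrC (le_trans _ IH)// e exprMn.
by rewrite [leLHS]mulrC ler_wpM2l// sqr_ge0.
Qed.

Lemma omega_lim (e : R) : 0 < e ->
  exists k0, forall k, (k0 <= k)%N -> cnorm (omega k - 1) < e.
Proof.
move=> e0; have [n ne] := invSn_lt (divr_gt0 (exprn_gt0 2 e0) (ltr0Sn R 3)).
exists n.+2 => -[//|k] nk; rewrite -(ltr_pXn2r (ltn0Sn 1)) ?nnegrE ?cnorm_ge0 ?ltW//.
apply: (le_lt_trans (omega_dist k)); rewrite mulrC -ltr_pdivlMr//.
apply: le_lt_trans ne; rewrite lef_pV2 ?posrE ?exprn_gt0//.
rewrite -natrX ler_nat (leq_trans _ (ltn_expl _ (ltnSn 1)))//.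
exact: leq_trans (ltnW nk).
Qed.

Lemma omega_sum0 k m : (0 < m < 2 ^ k)%N ->
  \sum_(j < 2 ^ k) (omega k ^+ m) ^+ j = 0.
Proof.
move=> /andP[m0 mk]; have x1 : omega k ^+ m - 1 != 0.
  rewrite subr_eq0 -(prim_order_dvd (omega_prim k)).
  by apply/negP => /dvdn_leq -/(_ m0); rewrite leqNgt mk.
apply: (mulfI x1); rewrite mulr0 -subrX1 -exprM mulnC exprM.
by rewrite omega_exp2 expr1n subrr.
Qed.

Definition circle r k j : C := r * omega k ^+ j.

(** A Riemann sum for the mean of [F] over the circle of radius [r]. *)
Definition cavg k (F : C -> C) (r : C) : C :=
  (2 ^+ k)^-1 * \sum_(j < 2 ^ k) F (circle r k j).

Lemma cnorm_circle (r : R) k j : 0 <= r -> cnorm (circle r%:C k j) = r.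
Proof.
by move=> r0; rewrite cnormM cnormX cnorm_omega expr1n mulr1 cnorm_real ger0_norm.
Qed.

(** Each term is a truncated geometric series divided by 1 - x^N, because the N-th power of x /
    omega^j does not depend on j. Summing over j kills every power but the zeroth. *)
Lemma kernel_sum k (x : C) : cnorm x < 1 ->
  \sum_(j < 2 ^ k) (1 - x / omega k ^+ j)^-1 = 2 ^+ k / (1 - x ^+ (2 ^ k)).
Proof.
move=> x1; have N0 : (0 < 2 ^ k)%N by rewrite expn_gt0.
set w := (omega k)^-1.
have wN : w ^+ (2 ^ k) = 1 by rewrite exprVn omega_exp2 invr1.
have nw j : cnorm (x * w ^+ j) < 1.
  by rewrite cnormM cnormX cnormV cnorm_omega invr1 expr1n mulr1.
have xN : 1 - x ^+ (2 ^ k) != 0.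
  rewrite subr_eq0; apply/eqP => /(congr1 (@cnorm R)); rewrite cnorm1 cnormX.
  by apply/eqP; rewrite gt_eqF// exprn_ilt1 ?cnorm_ge0// -lt0n.
have term (j : 'I_(2 ^ k)) : (1 - x / omega k ^+ j)^-1 =
    (\sum_(m < 2 ^ k) x ^+ m * (w ^+ m) ^+ j) / (1 - x ^+ (2 ^ k)).
  have -> : x / omega k ^+ j = x * w ^+ j by rewrite exprVn.
  have y1 : 1 - x * w ^+ j != 0.
    rewrite subr_eq0; apply/eqP => /(congr1 (@cnorm R)); rewrite cnorm1.
    by apply/eqP; rewrite gt_eqF.
  apply: (mulfI y1); rewrite divff// mulrA.
  have -> : \sum_(m < 2 ^ k) x ^+ m * (w ^+ m) ^+ j =
      \sum_(m < 2 ^ k) (x * w ^+ j) ^+ m.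
    by apply: eq_bigr => m _; rewrite exprMn -!exprM mulnC.
  have := subrX1 (x * w ^+ j) (2 ^ k).
  rewrite exprMn -exprM mulnC exprM wN expr1n mulr1 => h.
  by rewrite -[1 - x * _]opprB mulNr -h opprB divff.
rewrite (eq_bigr _ (fun j _ => term j)) -mulr_suml exchange_big /=; congr (_ / _).
have e0 : \sum_(j < 2 ^ k) x ^+ (Ordinal N0) * (w ^+ (Ordinal N0)) ^+ j = 2 ^+ k.
  rewrite (eq_bigr (fun=> 1)) => [|j _]; last by rewrite /= !expr0 expr1n mul1r.
  by rewrite sumr_const card_ord natrX.
rewrite (bigD1 (Ordinal N0)) //= e0 big1 ?addr0 => [//|m m0].
rewrite -mulr_sumr; have -> : \sum_(j < 2 ^ k) (w ^+ m) ^+ j = 0; last by rewrite mulr0.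
have m1 : (0 < 2 ^ k - m < 2 ^ k)%N.
  rewrite subn_gt0 ltn_ord ltn_subrL N0 andbT lt0n.
  by move: m0; rewrite -val_eqE.
apply: etrans (omega_sum0 m1); apply: eq_bigr => j _; congr (_ ^+ _).
rewrite /w exprVn; apply: (mulIf (expf_neq0 m (omega_neq0 k))).
by rewrite mulVf ?expf_neq0 ?omega_neq0// -exprD subnK ?omega_exp2// ltnW.
Qed.

(** The discrete Cauchy integral of the constant 1; its defect from 1 is exponentially small in the
    number of nodes. *)
Lemma cavg_kernel k (r : R) (z : C) : 0 < r -> cnorm z < r ->
  cavg k (fun s => s / (s - z)) r%:C = (1 - (z / r%:C) ^+ (2 ^ k))^-1.
Proof.
move=> r0 zr; have r0' : r%:C != 0 by rewrite -cnorm_gt0 cnorm_real normr_gt0 gt_eqF.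
have x1 : cnorm (z / r%:C) < 1.
  by rewrite cnormM cnormV cnorm_real gtr0_norm// ltr_pdivrMr// mul1r.
rewrite /cavg (eq_bigr (fun j : 'I__ => (1 - z / r%:C / omega k ^+ j)^-1)) => [|j _].
  by rewrite kernel_sum// mulKf// expf_neq0// pnatr_eq0.
have w0 := expf_neq0 j (omega_neq0 k).
have sz : circle r%:C k j - z != 0.
  rewrite subr_eq0; apply/eqP => e; move: zr; by rewrite -e (cnorm_circle _ _ (ltW r0)) ltxx.
have rw0 : r%:C * omega k ^+ j != 0 by rewrite mulf_neq0.
have -> : 1 - z / r%:C / omega k ^+ j = (circle r%:C k j - z) / circle r%:C k j.
  by rewrite mulrBl divff// /circle invfM mulrA.
by rewrite invfM invrK mulrC.
Qed.

Lemma cavgB k F G r : cavg k F r - cavg k G r = cavg k (fun s => F s - G s) r.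
Proof. by rewrite /cavg -mulrBr -sumrB. Qed.

Lemma cavgD k F G r : cavg k F r + cavg k G r = cavg k (fun s => F s + G s) r.
Proof. by rewrite /cavg -mulrDr -big_split. Qed.

Lemma eq_cavg k F G r : (forall j, F (circle r k j) = G (circle r k j)) ->
  cavg k F r = cavg k G r.
Proof. by move=> FG; rewrite /cavg; congr (_ * _); apply: eq_bigr => j _. Qed.

Lemma cavgZ k F (a r : C) : cavg k (fun s => a * F s) r = a * cavg k F r.
Proof. by rewrite /cavg -mulr_sumr mulrCA. Qed.

Lemma cnorm_cavg k F (r : C) :
  cnorm (cavg k F r) <= (2 ^+ k)^-1 * \sum_(j < 2 ^ k) cnorm (F (circle r k j)).
Proof.
rewrite /cavg cnormM cnormV cnormX cnorm_nat ler_wpM2l ?invr_ge0 ?exprn_ge0//.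
exact: ler_cnorm_sum.
Qed.

Lemma cnorm_cavg_le k F (r : C) (M : R) :
  (forall j, cnorm (F (circle r k j)) <= M) -> cnorm (cavg k F r) <= M.
Proof.
move=> FM; rewrite (le_trans (cnorm_cavg _ _ _))// ler_pdivrMl ?exprn_gt0//.
apply: (@le_trans _ _ (\sum_(j < 2 ^ k) M)); first exact: ler_sum.
by rewrite sumr_const card_ord -[leLHS]mulr_natl natrX.
Qed.

Section Cauchy.
Variables (u u' : C -> C) (r r1 L : R).
Hypotheses (r0 : 0 < r) (rr1 : r < r1) (L0 : 0 <= L).
Hypothesis H : forall z w, cball 0 r1 z -> cball 0 r1 w ->
  cnorm (u w - u z - u' z * (w - z)) <= L * cnorm (w - z) ^+ 2.
Variables (k : nat) (z : C).
Hypothesis zr : cnorm z < r.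

Let s j := circle r%:C k.+1 j.
Let p (t : R) j := z + t%:C * (s j - z).
Let w1 : R := cnorm (omega k.+1 - 1).

Let cnorm_s j : cnorm (s j) = r.
Proof. by rewrite cnorm_circle// ltW. Qed.

Let p_ball (t : R) j : 0 <= t <= 1 -> cball 0 r1 (p t j).
Proof.
move=> /andP[t0 t1]; rewrite /cball /= subr0.
have -> : p t j = (1 - t)%:C * z + t%:C * s j.
  by rewrite /p rmorphB rmorph1; ring.
apply: (le_lt_trans (ler_cnormD _ _)); rewrite (cnormM _ z) (cnormM _ (s j)) !cnorm_real cnorm_s.
rewrite !ger0_norm ?subr_ge0//; apply: le_lt_trans rr1.
have : (1 - t) * cnorm z <= (1 - t) * r by rewrite ler_wpM2l ?subr_ge0// ltW.
lra.
Qed.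

Let sS j : s j.+1 = omega k.+1 * s j.
Proof. by rewrite /s /circle exprS mulrCA. Qed.

(* The derivative in [t] of the averages of [u] over the circles interpolating
   between [z] and the circle of radius [r]; it telescopes up to a quadratic
   error. *)
Let D t := cavg k.+1 (fun s => u' (z + t%:C * (s - z)) * s) r%:C.

Let D_small (t : R) : 0 <= t <= 1 -> cnorm (D t) <= L * r ^+ 2 * w1.
Proof.
move=> t01; have /andP[t0 t1] := t01.
have w10 : omega k.+1 - 1 != 0.
  rewrite subr_eq0; apply/eqP => /(congr1 (fun x => x ^+ (2 ^ k))).
  rewrite omega_half expr1n => /eqP; rewrite eq_sym -subr_eq0 opprK.
  by rewrite -(natrD _ 1 1) pnatr_eq0.
have LL : 0 <= L * r ^+ 2 * w1 by rewrite mulr_ge0 ?cnorm_ge0// mulr_ge0// sqr_ge0.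
(* At t = 0 the interpolating circle is a point, and [D 0] is a multiple of the sum of all the roots
   of unity. *)
have [->|tn0] := eqVneq t 0.
  rewrite /D (_ : cavg _ _ _ = 0) ?cnorm0// /cavg.
  have -> : \sum_(j < 2 ^ k.+1) u' (z + (0 : R)%:C * (circle r%:C k.+1 j - z)) *
      circle r%:C k.+1 j = u' z * r%:C * \sum_(j < 2 ^ k.+1) (omega k.+1 ^+ 1) ^+ j.
    rewrite mulr_sumr; apply: eq_bigr => j _.
    by rewrite mul0r addr0 /circle expr1 mulrA.
  have h1 : (0 < 1 < 2 ^ k.+1)%N by rewrite /= (leq_trans _ (ltn_expl k.+1 (ltnSn 1))).
  by rewrite (omega_sum0 h1) !mulr0.
have tp : 0 < t by rewrite lt_def tn0.
have tele : \sum_(j < 2 ^ k.+1) (u (p t j.+1) - u (p t j)) = 0.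
  rewrite -(big_mkord xpredT (fun j => u (p t j.+1) - u (p t j))) telescope_sumr//.
  by rewrite /p /s /circle omega_exp2 expr0 subrr.
have tw : 0 < t * w1 by rewrite mulr_gt0// cnorm_gt0.
rewrite -(ler_pM2l tw).
have -> : t * w1 * cnorm (D t) = cnorm (cavg k.+1 (fun s =>
    u (z + t%:C * (omega k.+1 * s - z)) - u (z + t%:C * (s - z)) -
    u' (z + t%:C * (s - z)) * (t%:C * (omega k.+1 - 1) * s)) r%:C).
  have -> : cavg k.+1 (fun s =>
    u (z + t%:C * (omega k.+1 * s - z)) - u (z + t%:C * (s - z)) -
    u' (z + t%:C * (s - z)) * (t%:C * (omega k.+1 - 1) * s)) r%:C =
    - (t%:C * (omega k.+1 - 1) * D t).
    rewrite /D -cavgZ -[RHS]add0r.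
    have <- : cavg k.+1 (fun s => u (z + t%:C * (omega k.+1 * s - z)) -
        u (z + t%:C * (s - z))) r%:C = 0.
      rewrite /cavg (eq_bigr (fun j : 'I__ => u (p t j.+1) - u (p t j))).
        by rewrite tele mulr0.
      by move=> j _; rewrite /p sS.
    rewrite cavgB; congr cavg; apply/funext => x; congr (_ - _).
    by rewrite mulrCA.
  by rewrite cnormN !cnormM cnorm_real gtr0_norm.
apply: cnorm_cavg_le => j; rewrite -/(s j) -sS -/(p t j) -/(p t j.+1).
have -> : t%:C * (omega k.+1 - 1) * s j = p t j.+1 - p t j.
  by rewrite /p sS; ring.
apply: (le_trans (H (p_ball j t01) (p_ball j.+1 t01))).
have -> : p t j.+1 - p t j = t%:C * (omega k.+1 - 1) * s j.
  by rewrite /p sS; ring.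
rewrite (cnormM _ (s j)) (cnormM t%:C) cnorm_real cnorm_s gtr0_norm// -/w1.
have -> : t * w1 * (L * r ^+ 2 * w1) = L * (t * w1 * r) ^+ 2 / t.
  by field; rewrite gt_eqF.
have X0 : 0 <= L * (t * w1 * r) ^+ 2 by rewrite mulr_ge0// sqr_ge0.
by rewrite ler_peMr// invf_ge1.
Qed.

(** The circle is shrunk to the point [z]. The kernel average of [u] changes at rate [D], which is
    small, so its value on the circle is close to its value at [z]. *)
Lemma cauchy_discrete :
  cnorm (cavg k.+1 (fun s => u s * (s / (s - z))) r%:C
         - u z * (1 - (z / r%:C) ^+ (2 ^ k.+1))^-1) <= L * r ^+ 2 * w1.
Proof.
pose c (t : R) := cavg k.+1 (fun s => u (z + t%:C * (s - z)) * (s / (s - z))) r%:C.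
have -> : u z * (1 - (z / r%:C) ^+ (2 ^ k.+1))^-1 = c 0.
  rewrite -(cavg_kernel _ r0 zr) -cavgZ /c; congr cavg; apply/funext => x.
  by rewrite mul0r addr0.
have -> : cavg k.+1 (fun s => u s * (s / (s - z))) r%:C = c 1.
  rewrite /c; congr cavg; apply/funext => x.
  by rewrite (_ : z + _ = x)// rmorph1 mul1r addrC subrK.
have sz j : s j - z != 0.
  rewrite subr_eq0; apply/eqP => e; move: zr.
  by rewrite -e cnorm_s ltxx.
have step (t h : R) : 0 <= t -> 0 < h -> t + h <= 1 ->
    cnorm (c (t + h) - c t) <= h * (L * r ^+ 2 * w1) + h ^+ 2 * (2 * L * r ^+ 2).
  move=> t0 h0 th1.
  have t01 : 0 <= t <= 1 by rewrite t0; lra.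
  have th01 : 0 <= t + h <= 1 by rewrite th1 andbT; lra.
  have -> : c (t + h) - c t = h%:C * D t + cavg k.+1 (fun s =>
      (u (z + (t + h)%:C * (s - z)) - u (z + t%:C * (s - z)) -
       u' (z + t%:C * (s - z)) * (h%:C * (s - z))) * (s / (s - z))) r%:C.
    rewrite /D -cavgZ cavgD /c cavgB; apply: eq_cavg => j; rewrite -/(s j).
    by field; exact: sz.
  apply: (le_trans (ler_cnormD _ _)); apply: lerD.
    by rewrite cnormM cnorm_real gtr0_norm// ler_pM2l// D_small.
  apply: cnorm_cavg_le => j; rewrite -/(s j) -/(p t j) -/(p (t + h) j).
  have hp : p (t + h) j - p t j = h%:C * (s j - z) by rewrite /p rmorphD; ring.
  rewrite -hp cnormM; have := H (p_ball j t01) (p_ball j th01).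
  move=> /(ler_wpM2r (cnorm_ge0 (s j / (s j - z)))) /le_trans; apply.
  have sz0 : 0 < cnorm (s j - z) by rewrite cnorm_gt0 sz.
  rewrite hp (cnormM h%:C) cnorm_real gtr0_norm// (cnormM (s j)) cnormV cnorm_s.
  have -> : L * (h * cnorm (s j - z)) ^+ 2 * (r / cnorm (s j - z)) =
    h ^+ 2 * (L * r * cnorm (s j - z)) by field; rewrite gt_eqF.
  rewrite ler_wpM2l ?sqr_ge0// (_ : 2 * L * r ^+ 2 = L * r * (2 * r)); last by ring.
  rewrite ler_wpM2l ?mulr_ge0 ?(ltW r0)//.
  rewrite (le_trans (ler_cnormD _ _))// cnormN cnorm_s.
  by rewrite mulrDl mul1r lerD2l ltW.
set E := L * r ^+ 2 * w1; set K := 2 * L * r ^+ 2.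
(* The interval is cut into M + 1 steps, whose second order errors add up to K / (M + 1). *)
have bound (M : nat) : cnorm (c 1 - c 0) <= E + K / M.+1%:R.
  have M0 : (0 : R) < M.+1%:R by [].
  pose t (m : nat) : R := m%:R / M.+1%:R.
  have -> : c 1 - c 0 = \sum_(0 <= m < M.+1) (c (t m.+1) - c (t m)).
    by rewrite telescope_sumr// /t divff ?gt_eqF// mul0r.
  apply: (le_trans (ler_cnorm_sum _ _ _)).
  apply: (@le_trans _ _ (\sum_(0 <= m < M.+1) (M.+1%:R^-1 * E + M.+1%:R^-1 ^+ 2 * K))).
    apply: ler_sum_nat => m /andP[_ mM].
    have tS : t m.+1 = t m + M.+1%:R^-1.
      by rewrite /t -natr1 mulrDl mul1r.
    rewrite tS; apply: step; rewrite ?divr_ge0 ?invr_gt0// -tS /t.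
    by rewrite ler_pdivrMr// mul1r ler_nat.
  rewrite sumr_const_nat subn0 -mulr_natl.
  apply: eqW.
  by field; rewrite nat1r; rewrite pnatr_eq0.
apply/ler_addgt0Pr => e e0.
have K1 : 0 < K + 1 by rewrite ltr_wpDl// /K mulr_ge0 ?sqr_ge0// mulr_ge0.
have [M Me] := invSn_lt (divr_gt0 e0 K1).
apply: (le_trans (bound M)); rewrite lerD2l.
move: Me; rewrite ltr_pdivlMr// => Me; apply: le_trans (ltW Me).
by rewrite mulrC ler_wpM2l ?invr_ge0// lerDl.
Qed.

End Cauchy.

End RootsOfUnity.

(** * Limits along an ultrafilter *)

Section UltraLimit.
Variable R : realType.
Local Notation C := R[i].
Variables (U : set_system nat) (UU : UltraFilter U).
Implicit Types (x y : nat -> C) (l m : C).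

(** Every bounded sequence has a limit along [U], so a sequence of functions acquires a limit at all
    points at once, with no extraction of subsequences. *)
Definition ucvg x l := forall e : R, 0 < e -> U [set n | cnorm (x n - l) < e].

Let UF : ProperFilter U := ultra_proper.

(** The limit is the supremum of the reals lying below [x n] for [U]-almost all [n]; the ultrafilter
    property decides the opposite inequality. *)
Lemma ucvg_real (x : nat -> R) (M : R) : U [set n | `|x n| <= M] ->
  exists l : R, forall e : R, 0 < e -> U [set n | `|x n - l| < e].
Proof.
move=> xM; pose S := [set t : R | U [set n | t < x n]].
have S0 : S (- M - 1).
  apply: filterS xM => n /=; rewrite ler_norml => /andP[h _]; lra.
have SM : ubound S M.
  move=> t St; rewrite leNgt; apply/negP => Mt.
  have [n [/= h]] := filter_ex (filterI xM St).
  by move: h; rewrite ler_norml => /andP[_ h]; lra.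
have supS : has_sup S by split; [exists (- M - 1)|exists M].
exists (sup S) => e e0.
have [t St lt] := sup_adherent e0 supS.
have nS : ~ S (sup S + e / 2).
  move=> /(ub_le_sup (proj2 supS)); lra.
have [//|nU] := in_ultra_setVsetC [set n | sup S + e / 2 < x n] UU.
apply: filterS (filterI St nU) => n [/= h1 /negP]; rewrite -leNgt => h2.
by rewrite ltr_norml; apply/andP; split; lra.
Qed.

Lemma ucvg_bounded x (M : R) : U [set n | cnorm (x n) <= M] ->
  exists l, ucvg x l.
Proof.
move=> xM.
have [a ha] : exists a : R, forall e : R, 0 < e -> U [set n | `|Re (x n) - a| < e].
  apply: (@ucvg_real _ M); apply: filterS xM => n /=.
  exact: le_trans (ler_cnorm_Re _).
have [b hb] : exists b : R, forall e : R, 0 < e -> U [set n | `|Im (x n) - b| < e].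
  apply: (@ucvg_real _ M); apply: filterS xM => n /=.
  exact: le_trans (ler_cnorm_Im _).
exists (a +i* b) => e e0; have e2 : 0 < e / 2 by rewrite divr_gt0.
apply: filterS (filterI (ha _ e2) (hb _ e2)) => n [/= h1 h2].
apply: (le_lt_trans (normc_le_ReIm _)).
by move: h1 h2; case: (x n) => c d /= h1 h2; lra.
Qed.

Lemma ucvg_unique x l m : ucvg x l -> ucvg x m -> l = m.
Proof.
move=> xl xm; apply: cnorm_small_eq => e e0.
have e2 : 0 < e / 2 by rewrite divr_gt0.
have [n [/= h1 h2]] := filter_ex (filterI (xl _ e2) (xm _ e2)).
have := cnorm_dist (x n) l m; rewrite (cnormB l (x n)); lra.
Qed.

Lemma ucvg_cst l : ucvg (fun=> l) l.
Proof. by move=> e e0; apply: filterE => n /=; rewrite subrr cnorm0. Qed.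

Lemma eq_ucvg x y l : U [set n | x n = y n] -> ucvg x l -> ucvg y l.
Proof.
by move=> xy xl e e0; apply: filterS (filterI xy (xl e e0)) => n [/= ->].
Qed.

Lemma ucvgD x y l m : ucvg x l -> ucvg y m -> ucvg (fun n => x n + y n) (l + m).
Proof.
move=> xl ym e e0; have e2 : 0 < e / 2 by rewrite divr_gt0.
apply: filterS (filterI (xl _ e2) (ym _ e2)) => n [/= h1 h2].
rewrite (_ : x n + y n - (l + m) = (x n - l) + (y n - m)); last by ring.
by apply: (le_lt_trans (ler_cnormD _ _)); lra.
Qed.

Lemma ucvgM x y l m : ucvg x l -> ucvg y m -> ucvg (fun n => x n * y n) (l * m).
Proof.
move=> xl ym e e0.
pose d := Num.min 1 (e / (cnorm l + cnorm m + 2)).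
have s0 : 0 < cnorm l + cnorm m + 2 by have := cnorm_ge0 l; have := cnorm_ge0 m; lra.
have d0 : 0 < d by rewrite lt_min ltr01 divr_gt0.
apply: filterS (filterI (xl _ d0) (ym _ d0)) => n [/= h1 h2].
rewrite (_ : x n * y n - l * m = (x n - l) * (y n - m) + l * (y n - m) + (x n - l) * m);
  last by ring.
have d1 : d <= 1 by rewrite ge_min lexx.
have d2 : d * (cnorm l + cnorm m + 2) <= e by rewrite -ler_pdivlMr// ge_min lexx orbT.
have t1 : cnorm ((x n - l) * (y n - m)) <= d.
  rewrite cnormM -[leRHS]mul1r ler_pM ?cnorm_ge0 ?(ltW h2)//; lra.
have t2 : cnorm (l * (y n - m)) <= cnorm l * d.
  by rewrite cnormM ler_wpM2l ?cnorm_ge0 ?ltW.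
have t3 : cnorm ((x n - l) * m) <= d * cnorm m.
  by rewrite cnormM ler_wpM2r ?cnorm_ge0 ?ltW.
have := ler_cnormD ((x n - l) * (y n - m) + l * (y n - m)) ((x n - l) * m).
have := ler_cnormD ((x n - l) * (y n - m)) (l * (y n - m)); nra.
Qed.

Lemma ucvg_sum (I : Type) (r : seq I) (F : I -> nat -> C) (G : I -> C) :
  (forall i, ucvg (F i) (G i)) ->
  ucvg (fun n => \sum_(i <- r) F i n) (\sum_(i <- r) G i).
Proof.
move=> FG; elim: r => [|i r IH].
  rewrite big_nil (_ : (fun n => _) = fun=> 0); first exact: ucvg_cst.
  by apply/funext => n; rewrite big_nil.
rewrite big_cons (_ : (fun n => _) = fun n => F i n + \sum_(i <- r) F i n).
  exact: ucvgD.
by apply/funext => n; rewrite big_cons.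
Qed.

Lemma ucvg_le x l (M : R) : ucvg x l -> U [set n | cnorm (x n) <= M] -> cnorm l <= M.
Proof.
move=> xl xM; apply/ler_addgt0Pr => e e0.
have [n [/= h1 h2]] := filter_ex (filterI (xl _ e0) xM).
have := cnorm_dist (x n) l 0; rewrite !subr0 (cnormB l); lra.
Qed.

Lemma ucvgN x l : ucvg x l -> ucvg (fun n => - x n) (- l).
Proof.
by move=> xl e e0; apply: filterS (xl e e0) => n /=; rewrite -opprD cnormN.
Qed.

Lemma ucvgB x y l m : ucvg x l -> ucvg y m -> ucvg (fun n => x n - y n) (l - m).
Proof. by move=> xl ym; apply: ucvgD => //; exact: ucvgN. Qed.

Lemma ucvg_ge x l (M : R) : ucvg x l -> U [set n | M <= cnorm (x n)] -> M <= cnorm l.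
Proof.
move=> xl xM; apply/ler_addgt0Pr => e e0.
have [n [/= h1 h2]] := filter_ex (filterI (xl _ e0) xM).
have := cnorm_dist l (x n) 0; rewrite !subr0; lra.
Qed.

Lemma ucvgV x l : l != 0 -> ucvg x l -> ucvg (fun n => (x n)^-1) l^-1.
Proof.
move=> l0 xl e e0; have nl : 0 < cnorm l by rewrite cnorm_gt0.
have e1 : 0 < e * cnorm l ^+ 2 / 2 by rewrite divr_gt0// mulr_gt0// exprn_gt0.
have e2 : 0 < cnorm l / 2 by rewrite divr_gt0.
apply: filterS (filterI (xl _ e1) (xl _ e2)) => n [/= h1 h2].
have h3 : cnorm l / 2 < cnorm (x n).
  have := cnorm_dist (x n) l 0; rewrite !subr0 (cnormB l); lra.
have xn : 0 < cnorm (x n) by lra.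
have x0 : x n != 0 by rewrite -cnorm_gt0.
have -> : (x n)^-1 - l^-1 = (l - x n) / (x n * l) by field; rewrite l0 x0.
rewrite cnormM cnormV cnormM (cnormB l) ltr_pdivrMr ?mulr_gt0//.
apply: (lt_le_trans h1); rewrite -mulrA ler_pM2l// expr2 mulrAC ler_pM2r//.
exact: ltW.
Qed.

End UltraLimit.

(** * Power series, normal limits, zeros and open mappings *)

Section Analytic.
Variable R : realType.
Local Notation C := R[i].
Implicit Types (z w : C) (u v : C -> C) (a : nat -> C).

Lemma small_exp (q e : R) : 0 <= q < 1 -> 0 < e ->
  exists n0, forall n, (n0 <= n)%N -> q ^+ n < e.
Proof.
move=> /andP[q0 q1] e0.
have : (fun n => q ^+ n) @ \oo --> (0 : R) by apply: cvg_expr; rewrite ger0_norm.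
move=> /cvgrPdist_lt /(_ e e0) [n0 _ h]; exists n0 => n /h /=.
by rewrite sub0r normrN ger0_norm// exprn_ge0.
Qed.

(** In [cauchy_discrete] the error carries the factor |omega - 1| and the kernel is off by a high
    power of (z - z0) / r; both tend to 0. *)
Lemma cauchy_formula z0 (r r1 : R) u u' z : 0 < r -> r < r1 -> hol z0 r1 u u' ->
  cnorm (z - z0) < r -> forall e : R, 0 < e -> exists k0, forall k, (k0 <= k)%N ->
  cnorm (u z - cavg k (fun s => u (z0 + s) * (s / (s - (z - z0)))) r%:C) < e.
Proof.
move=> r0 rr1 [L L0 H] zr e e0.
pose v s := u (z0 + s); pose v' s := u' (z0 + s); set y := z - z0.
have Hv s t : cball 0 r1 s -> cball 0 r1 t ->
    cnorm (v t - v s - v' s * (t - s)) <= L * cnorm (t - s) ^+ 2.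
  rewrite /cball /= !subr0 => sr tr.
  have [|_ _ /(_ (z0 + t))] := H (z0 + s); first by rewrite /cball /= addrC addKr.
  have -> : z0 + t - (z0 + s) = t - s by ring.
  by apply; rewrite /cball /= addrC addKr.
have q0 : 0 <= cnorm y / r by rewrite divr_ge0 ?cnorm_ge0 ?ltW.
have q1 : cnorm y / r < 1 by rewrite ltr_pdivrMr// mul1r.
have d0 : 0 < Num.min (1 / 2) (e / (4 * (cnorm (u z) + 1))).
  by rewrite lt_min !divr_gt0//= mulr_gt0// ltr_wpDl// cnorm_ge0.
have q01 : 0 <= cnorm y / r < 1 by rewrite q0 q1.
have [n0 n0P] := small_exp q01 d0.
have LK : 0 < 2 * (L * r ^+ 2 + 1).
  by rewrite mulr_gt0// ltr_wpDl// mulr_ge0// sqr_ge0.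
have [k1 k1P] := omega_lim (divr_gt0 e0 LK).
exists (maxn n0 k1).+1 => -[//|k]; rewrite ltnS geq_max => /andP[n0k k1k].
have := cauchy_discrete r0 rr1 L0 Hv k zr; rewrite -/y.
have := k1P k.+1 (leqW k1k); set w1 := cnorm (omega R k.+1 - 1) => w1e.
have := n0P (2 ^ k.+1)%N (leq_trans (leqW n0k) (ltnW (ltn_expl k.+1 (ltnSn 1)))).
rewrite lt_min => /andP[x1 x2] h.
set A := cavg _ _ _ in h; rewrite -/A.
have vz : v y = u z by rewrite /v /y addrC subrK.
set X := (y / r%:C) ^+ (2 ^ k.+1) in h.
have nX : cnorm X = (cnorm y / r) ^+ (2 ^ k.+1).
  by rewrite cnormX cnormM cnormV cnorm_real gtr0_norm.
rewrite -nX in x1 x2.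
have X1 : 1 / 2 < cnorm (1 - X) by have := ler_cnormB 1 X; rewrite cnorm1; lra.
have X0 : 1 - X != 0 by rewrite -cnorm_gt0; lra.
have -> : u z - A = - (A - v y * (1 - X)^-1) - u z * X / (1 - X).
  by rewrite vz; field.
apply: (le_lt_trans (ler_cnormD _ _)); rewrite !cnormN.
have t1 : L * r ^+ 2 * w1 < e / 2.
  move: w1e; rewrite ltr_pdivlMr// => w1e.
  have w0 : 0 <= w1 by exact: cnorm_ge0.
  have : 0 <= L * r ^+ 2 by rewrite mulr_ge0// sqr_ge0.
  nra.
have t2 : cnorm (u z * X / (1 - X)) <= e / 2.
  rewrite !cnormM cnormV ler_pdivrMr; last by lra.
  move: x2; rewrite ltr_pdivlMr; last by rewrite mulr_gt0// ltr_wpDl// cnorm_ge0.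
  have := cnorm_ge0 (u z); have := cnorm_ge0 X; nra.
lra.
Qed.

Lemma mean_value_le z0 (r r1 M : R) u u' : 0 < r -> r < r1 -> hol z0 r1 u u' ->
  (forall z, cnorm (z - z0) = r -> cnorm (u z) <= M) -> cnorm (u z0) <= M.
Proof.
move=> r0 rr1 hu uM; apply/ler_addgt0Pr => e e0.
have zz : cnorm (z0 - z0) < r by rewrite subrr cnorm0.
have [k0 /(_ k0 (leqnn _))] := cauchy_formula r0 rr1 hu zz e0.
set A := cavg _ _ _ => h; have : cnorm A <= M.
  apply: cnorm_cavg_le => j.
  have sr : cnorm (circle r%:C k0 j) = r by rewrite cnorm_circle// ltW.
  rewrite subrr subr0 divff ?mulr1; last by rewrite -cnorm_gt0 sr.
  by apply: uM; rewrite addrC addKr.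
have := cnorm_dist A (u z0) 0; rewrite !subr0; lra.
Qed.

(** The bound is by the mean of |u| over the circle rather than its supremum: a mean can be
    integrated over a parameter on which [u] depends. *)
Lemma cauchy_lip z0 (r r1 : R) u u' z w : 0 < r -> r < r1 -> hol z0 r1 u u' ->
  cnorm (z - z0) <= r / 2 -> cnorm (w - z0) <= r / 2 ->
  forall e : R, 0 < e -> exists k0, forall k, (k0 <= k)%N ->
  cnorm (u z - u w) < 4 * cnorm (z - w) / r *
    ((2 ^+ k)^-1 * \sum_(j < 2 ^ k) cnorm (u (z0 + circle r%:C k j))) + e.
Proof.
move=> r0 rr1 hu zr wr e e0; have e2 : 0 < e / 2 by rewrite divr_gt0.
have r2 : r / 2 < r by lra.
have [k1 k1P] := cauchy_formula r0 rr1 hu (le_lt_trans zr r2) e2.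
have [k2 k2P] := cauchy_formula r0 rr1 hu (le_lt_trans wr r2) e2.
exists (maxn k1 k2) => k; rewrite geq_max => /andP[/k1P h1 /k2P h2].
move: h1 h2; set A := cavg _ _ _; set B := cavg _ _ _ => h1 h2.
have AB : cnorm (A - B) <= 4 * cnorm (z - w) / r *
    ((2 ^+ k)^-1 * \sum_(j < 2 ^ k) cnorm (u (z0 + circle r%:C k j))).
  rewrite /A /B cavgB (le_trans (cnorm_cavg _ _ _))// mulrCA ler_wpM2l ?invr_ge0 ?exprn_ge0//.
  rewrite mulr_sumr ler_sum// => j _.
  move: (@cnorm_circle R r k j (ltW r0)); move: (circle r%:C k j) => s sr.
  have sx x : cnorm (x - z0) <= r / 2 -> r / 2 <= cnorm (s - (x - z0)).
    by move=> xr; have := ler_cnormB s (x - z0); rewrite sr; lra.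
  have s0 x : cnorm (x - z0) <= r / 2 -> s - (x - z0) != 0.
    by move=> /sx h; rewrite -cnorm_gt0; lra.
  have -> : u (z0 + s) * (s / (s - (z - z0))) - u (z0 + s) * (s / (s - (w - z0))) =
     u (z0 + s) * (s * (z - w) / ((s - (z - z0)) * (s - (w - z0)))).
    by field; rewrite !s0.
  rewrite cnormM mulrC ler_wpM2r ?cnorm_ge0// !cnormM cnormV cnormM sr.
  have p1 := sx _ zr; have p2 := sx _ wr.
  have p : r / 2 * (r / 2) <= cnorm (s - (z - z0)) * cnorm (s - (w - z0)).
    by rewrite ler_pM// divr_ge0// ltW.
  rewrite ler_pdivrMr; last by apply: lt_le_trans p; rewrite mulr_gt0// divr_gt0.
  apply: (@le_trans _ _ (4 * cnorm (z - w) / r * (r / 2 * (r / 2)))).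
    apply: eqW; field.
    by rewrite gt_eqF.
  by rewrite ler_wpM2l// divr_ge0 ?mulr_ge0 ?cnorm_ge0// ltW.
have := cnorm_dist A (u z) (u w); have := cnorm_dist B A (u w).
rewrite (cnormB B (u w)); lra.
Qed.

Definition psum a m s : C := \sum_(i < m) a i * s ^+ i.

(* [u] is the sum of the power series [a] on the ball; [M] is a Cauchy bound. *)
Definition pseries z0 (r M : R) a u := (forall i, cnorm (a i) <= M / r ^+ i) /\
  forall s, cnorm s < r -> forall m,
    cnorm (u (z0 + s) - psum a m s) <= M * (cnorm s / r) ^+ m * (r / (r - cnorm s)).

Lemma ex_ultra : exists V : set_system nat, UltraFilter V /\ \oo `<=` V.
Proof.
have [V] := @ultraFilterLemma nat \oo eventually_filter.
by exists V.
Qed.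

(** The coefficients are limits of discrete Cauchy coefficients. Before the limit, the truncated
    geometric series gives the remainder in closed form. *)
Lemma hol_pseries z0 (r r1 M : R) u u' : 0 < r -> r < r1 -> hol z0 r1 u u' ->
  (forall z, cnorm (z - z0) = r -> cnorm (u z) <= M) ->
  exists a, pseries z0 r M a u.
Proof.
move=> r0 rr1 hu uM; have [V [VV Voo]] := ex_ultra.
have uc k j : cnorm (u (z0 + circle r%:C k j)) <= M.
  by apply: uM; rewrite addrC addKr cnorm_circle// ltW.
have M0 : 0 <= M by exact: le_trans (cnorm_ge0 _) (uc 0%N 0%N).
pose a k i := cavg k (fun s => u (z0 + s) / s ^+ i) r%:C.
have aM k i : cnorm (a k i) <= M / r ^+ i.
  apply: cnorm_cavg_le => j; rewrite cnormM cnormV cnormX cnorm_circle ?(ltW r0)//.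
  by rewrite ler_wpM2r ?invr_ge0 ?exprn_ge0 ?(ltW r0)//.
have /choice[b ab] i : exists l, ucvg V (fun k => a k i) l.
  by apply: (@ucvg_bounded _ _ VV _ (M / r ^+ i)); apply: filterE => k; exact: aM.
exists b; split => [i|s sr m].
  by apply: (ucvg_le VV (ab i)); apply: filterE => k; exact: aM.
pose A k := cavg k (fun t => u (z0 + t) * (t / (t - s))) r%:C.
have Au : ucvg V A (u (z0 + s)).
  move=> e e0; apply: Voo.
  have zz : cnorm (z0 + s - z0) < r by rewrite addrC addKr.
  have [k0 k0P] := cauchy_formula r0 rr1 hu zz e0.
  exists k0 => // k /k0P; rewrite cnormB.
  by rewrite (_ : z0 + s - z0 = s)// addrC addKr.
have := ucvgB VV Au (ucvg_sum VV (index_enum 'I_m)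
  (fun i : 'I_m => ucvgM VV (ab i) (ucvg_cst VV (s ^+ i)))).
move=> /(ucvg_le VV); apply; apply: filterE => k /=.
have -> : A k - \sum_(i < m) a k i * s ^+ i =
    cavg k (fun t => u (z0 + t) * (s ^+ m / t ^+ m * (t / (t - s)))) r%:C.
  have -> : \sum_(i < m) a k i * s ^+ i =
      cavg k (fun t => u (z0 + t) * \sum_(i < m) (s / t) ^+ i) r%:C.
    elim: m => [|m IH].
      by rewrite big_ord0 /cavg big1 ?mulr0// => j _; rewrite big_ord0 mulr0.
    rewrite big_ord_recr /= IH mulrC /a -cavgZ cavgD; apply: eq_cavg => j.
    by move: (circle _ _ _) => t; rewrite big_ord_recr /= mulrDr expr_div_n mulrCA.
  rewrite /A cavgB; apply: eq_cavg => j.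
  move: (@cnorm_circle R r k j (ltW r0)); move: (circle r%:C k j) => t tr.
  have t0 : t != 0 by rewrite -cnorm_gt0 tr.
  have ts : t - s != 0.
    by rewrite subr_eq0; apply/eqP => e; move: sr; rewrite -e tr ltxx.
  rewrite -mulrBr; congr (_ * _).
  have s1 : s / t - 1 != 0.
    by rewrite -(divff t0) -mulrBl mulf_neq0 ?invr_eq0// -opprB oppr_eq0.
  have := subrX1 (s / t) m => /(congr1 (fun x => x / (s / t - 1))).
  rewrite [X in _ = X -> _]mulrC mulKf// => <-.
  rewrite exprMn exprVn; field.
  by rewrite ts expf_neq0// t0 mulN1r -opprB oppr_eq0 ts.
apply: cnorm_cavg_le => j; have := uc k j.
move: (@cnorm_circle R r k j (ltW r0)); move: (circle r%:C k j) => t tr ut.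
rewrite !cnormM !cnormV !cnormX tr -[leRHS]mulrA; apply: ler_pM.
- exact: cnorm_ge0.
- by rewrite !mulr_ge0 ?invr_ge0 ?exprn_ge0 ?cnorm_ge0 ?(ltW r0).
- exact: ut.
rewrite -exprVn -exprMn ler_wpM2l ?exprn_ge0 ?divr_ge0 ?cnorm_ge0 ?(ltW r0)//.
rewrite ler_wpM2l ?(ltW r0)// lef_pV2 ?posrE ?subr_gt0//.
  by have := ler_cnormB t s; rewrite tr.
by have := ler_cnormB t s; rewrite tr; lra.
Qed.

Lemma hol_deriv_unique z0 (r : R) u u' (b : C) (K : R) : hol z0 r u u' -> 0 < r ->
  (forall s, cnorm s < r -> cnorm (u (z0 + s) - u z0 - b * s) <= K * cnorm s ^+ 2) ->
  b = u' z0.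
Proof.
move=> [L L0 H] r0 ub; apply: cnorm_small_eq => e e0.
have KL : 0 < `|K| + L + 1 by rewrite ltr_wpDl// addr_ge0.
pose t : R := Num.min (r / 2) (e / (`|K| + L + 1)).
have t0 : 0 < t by rewrite lt_min !divr_gt0.
have tr : t < r by rewrite gt_min; apply/orP; left; lra.
have te : t * (`|K| + L + 1) <= e by rewrite -ler_pdivlMr// ge_min lexx orbT.
have nt : cnorm (t%:C : C) = t by rewrite cnorm_real gtr0_norm.
have zz : cball z0 r z0 by rewrite /cball /= subrr cnorm0.
have [_ _ /(_ (z0 + t%:C))] := H z0 zz.
rewrite /cball /= (_ : z0 + t%:C - z0 = t%:C); last by rewrite addrC addKr.
rewrite nt => /(_ tr) h1.
have := ub t%:C; rewrite nt => /(_ tr) h2.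
have : t * cnorm (b - u' z0) <= (`|K| + L) * t ^+ 2.
  rewrite -{1}nt -cnormM.
  have -> : t%:C * (b - u' z0) = (u (z0 + t%:C) - u z0 - u' z0 * t%:C)
      - (u (z0 + t%:C) - u z0 - b * t%:C) by ring.
  rewrite (le_trans (ler_cnormD _ _))// cnormN [leRHS]mulrDl addrC lerD//.
  by rewrite (le_trans h2)// ler_wpM2r ?sqr_ge0// ler_norm.
rewrite expr2 mulrA [leRHS]mulrC ler_pM2l// => /le_trans; apply.
by rewrite (le_trans _ te)// mulrC ler_wpM2l ?(ltW t0)// lerDl.
Qed.

(** The Taylor constants depend only on the radius and on a bound for [u], which is what makes [hol]
    stable under limits. Two points of the ball of radius r/8 are at distance at most r/4, half the
    radius r/2 of the power series, so its remainder costs a factor at most 2. *)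
Lemma hol_quant z0 (r M : R) u u' : 0 < r -> hol z0 r u u' ->
  (forall z, cball z0 r z -> cnorm (u z) <= M) ->
  forall z, cball z0 (r / 8) z -> cnorm (u' z) <= 2 * M / r /\
    forall w, cball z0 (r / 8) w ->
    cnorm (u w - u z - u' z * (w - z)) <= 8 * M / r ^+ 2 * cnorm (w - z) ^+ 2.
Proof.
move=> r0 hu uM z zr.
have r2 : 0 < r / 2 by rewrite divr_gt0.
have r23 : r / 2 < 3 / 4 * r by lra.
have sub : cball z (3 / 4 * r) `<=` cball z0 r.
  by apply: cball_sub; move: zr; rewrite /cball /=; lra.
have [|a [aM aP]] := hol_pseries (M := M) r2 r23 (hol_sub sub hu).
  by move=> w wz; apply: uM; apply: sub; rewrite /cball /= wz.
have M0 : 0 <= M.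
  by apply: le_trans (uM z0 _); rewrite ?cnorm_ge0// /cball /= subrr cnorm0.
have a0 : a 0%N = u z.
  have := aP 0 _ 1%N; rewrite cnorm0 => /(_ r2); rewrite mul0r expr1 mulr0 mul0r addr0.
  rewrite /psum big_ord1 expr0 mulr1 => h.
  by apply/esym/eqP; rewrite -subr_eq0 -cnorm_eq0 eq_le h cnorm_ge0.
have ps2 s : cnorm s <= r / 4 ->
    cnorm (u (z + s) - u z - a 1%N * s) <= 8 * M / r ^+ 2 * cnorm s ^+ 2.
  move=> sr; have := aP s _ 2%N; rewrite /psum !big_ord_recr big_ord0 /= add0r.
  rewrite expr0 mulr1 expr1 a0 opprD addrA => /(_ _)/le_trans; apply; first by lra.
  have -> : 8 * M / r ^+ 2 * cnorm s ^+ 2 = M * (cnorm s / (r / 2)) ^+ 2 * 2.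
    by field; rewrite gt_eqF.
  have p0 : 0 <= M * (cnorm s / (r / 2)) ^+ 2 by apply: mulr_ge0 => //; exact: sqr_ge0.
  apply: (ler_wpM2l p0); rewrite ler_pdivrMr; lra.
have a1 : a 1%N = u' z.
  apply: (@hol_deriv_unique z (r / 4) u u' _ (8 * M / r ^+ 2)).
  - by apply: hol_sub (hol_sub sub hu) => w; rewrite /cball /= => ?; lra.
  - by rewrite divr_gt0.
  - by move=> s /ltW; exact: ps2.
split.
  by rewrite -a1 (le_trans (aM 1%N))// expr1 invf_div mulrA [M * 2]mulrC.
move=> w wr; rewrite -a1; have := ps2 (w - z); rewrite (addrC z) subrK; apply.
have := cnorm_dist z0 w z; rewrite (cnormB z0 z).
by move: zr wr; rewrite /cball /=; lra.
Qed.

(** The constants of [hol_quant] are common to almost all [u n], so the derivatives converge as well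
    and the Taylor estimate passes to the limit. *)
Lemma hol_ulim (V : set_system nat) (VV : UltraFilter V) z0 (r M : R)
  (u u' : nat -> C -> C) v : 0 < r ->
  V [set n | hol z0 r (u n) (u' n) /\ forall z, cball z0 r z -> cnorm (u n z) <= M] ->
  (forall z, cball z0 (r / 8) z -> ucvg V (u ^~ z) (v z)) ->
  exists v', [/\ hol z0 (r / 8) v v' &
    forall z, cball z0 (r / 8) z -> ucvg V (u' ^~ z) (v' z)].
Proof.
move=> r0 Vu uv.
have Vq : V [set n | forall z, cball z0 (r / 8) z -> cnorm (u' n z) <= 2 * M / r /\
    forall w, cball z0 (r / 8) w ->
    cnorm (u n w - u n z - u' n z * (w - z)) <= 8 * M / r ^+ 2 * cnorm (w - z) ^+ 2].
  by apply: filterS Vu => n [hu uM] z zr; exact: hol_quant hu uM z zr.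
have M0 : 0 <= M.
  have [n [_ /(_ z0)]] := filter_ex Vu.
  by rewrite /cball /= subrr cnorm0 => /(_ r0); apply: le_trans; exact: cnorm_ge0.
have sub : cball z0 (r / 8) `<=` cball z0 r.
  by move=> z; rewrite /cball /=; lra.
have /choice[v' v'P] z : exists l, cball z0 (r / 8) z -> ucvg V (u' ^~ z) l.
  have [zr|nz] := pselect (cball z0 (r / 8) z); last by exists 0.
  have [l ul] : exists l, ucvg V (u' ^~ z) l.
    apply: (@ucvg_bounded _ _ VV _ (2 * M / r)).
    by apply: filterS Vq => n /(_ z zr)[].
  by exists l.
exists v'; split => //.
have p1 : 0 <= 2 * M / r by rewrite divr_ge0 ?mulr_ge0// ltW.
have p2 : 0 <= 8 * M / r ^+ 2 by apply: divr_ge0; [exact: mulr_ge0|exact: sqr_ge0].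
exists (M + 2 * M / r + 8 * M / r ^+ 2); first by rewrite !addr_ge0.
move=> z zr; split.
- have : cnorm (v z) <= M.
    apply: (ucvg_le VV (uv z zr)); apply: filterS Vu => n [_]; apply; exact: sub.
  lra.
- have : cnorm (v' z) <= 2 * M / r.
    by apply: (ucvg_le VV (v'P z zr)); apply: filterS Vq => n /(_ z zr)[].
  lra.
- move=> w wr; apply: (@le_trans _ _ (8 * M / r ^+ 2 * cnorm (w - z) ^+ 2)).
    have := ucvgB VV (ucvgB VV (uv w wr) (uv z zr))
      (ucvgM VV (v'P z zr) (ucvg_cst VV (w - z))).
    move=> /(ucvg_le VV); apply; apply: filterS Vq => n /(_ z zr)[_].
    exact.
  by rewrite ler_wpM2r ?sqr_ge0//; lra.
Qed.

(** The derivative is the limit of the difference quotients, which are holomorphic and bounded by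
    the Lipschitz constant. The radius r/16 is r/2 divided by the 8 of [hol_ulim]. *)
Lemma hol_deriv z0 (r : R) u u' : 0 < r -> hol z0 r u u' ->
  exists u'', hol z0 (r / 16) u' u''.
Proof.
move=> r0 hu; have [V [VV Voo]] := ex_ultra.
have [K K0 lu] := hol_lip hu; have [L L0 H] := hu.
have r2 : 0 < r / 2 by rewrite divr_gt0.
pose h (n : nat) : C := (n.+1%:R^-1 : R)%:C.
have nh n : cnorm (h n) = n.+1%:R^-1 by rewrite cnorm_real gtr0_norm// invr_gt0.
have h0 n : h n != 0 by rewrite -cnorm_gt0 nh invr_gt0.
have h_lt (e : R) : 0 < e -> V [set n | cnorm (h n) < e].
  move=> e0; apply: Voo; have [n ne] := invSn_lt e0; exists n => // m nm.
  by change (is_true (cnorm (h m) < e)); rewrite nh (le_lt_trans _ ne)// lef_pV2 ?posrE// ler_nat.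
pose q n z := (u (z + h n) - u z) / h n.
pose q' n z := (u' (z + h n) - u' z) / h n.
have subh n : cnorm (h n) < r / 2 -> forall z, cball z0 (r / 2) z ->
    cball z0 r z /\ cball z0 r (z + h n).
  move=> hn z; rewrite /cball /= => zr; split; first by lra.
  have := ler_cnormD (z - z0) (h n).
  by rewrite (_ : z - z0 + h n = z + h n - z0); [lra|ring].
have e16 : r / 16 = r / 2 / 8 by field.
rewrite e16; suff [v' [hv _]] : exists v', [/\ hol z0 (r / 2 / 8) u' v' &
    forall z, cball z0 (r / 2 / 8) z -> ucvg V (q' ^~ z) (v' z)] by exists v'.
apply: (@hol_ulim V VV z0 (r / 2) K q q') => //.
  apply: filterS (h_lt _ r2) => n hn; split; last first.
    move=> z zr; have [z1 z2] := subh n hn z zr.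
    rewrite /q cnormM cnormV ler_pdivrMr ?cnorm_gt0// (le_trans (lu _ _ z1 z2))//.
    by rewrite addrC addKr.
  have hs : hol z0 (r / 2) (fun z => u (z + h n)) (fun z => u' (z + h n)).
    exists L => // z zr; have [_ z2] := subh n hn z zr.
    have [a b c] := H _ z2; split => // w wr; have [_ w2] := subh n hn w wr.
    have := c _ w2; rewrite (_ : w + h n - (z + h n) = w - z)//.
    by ring.
  have hu2 : hol z0 (r / 2) u u'.
    by apply: hol_sub hu => z; rewrite /cball /=; lra.
  have := holM (holB hs hu2) (hol_cst z0 (r / 2) (h n)^-1).
  by apply: eq_hol => z _ //; rewrite mulr0 addr0.
move=> z zr8 e e0.
have zr : cball z0 (r / 2) z by move: zr8; rewrite /cball /=; lra.
have eL : 0 < e / (L + 1) by rewrite divr_gt0// ltr_wpDl.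
apply: filterS (filterI (h_lt _ r2) (h_lt _ eL)) => n [hn hn2] /=.
have [z1 z2] := subh n hn z zr; have [_ _ /(_ _ z2)] := H z z1.
rewrite (_ : z + h n - z = h n); last by rewrite addrC addKr.
move=> hh; have -> : q n z - u' z = (u (z + h n) - u z - u' z * h n) / h n.
  by rewrite /q [RHS]mulrBl (mulfK (h0 n)).
have hp : 0 < cnorm (h n) by rewrite cnorm_gt0.
rewrite cnormM cnormV ltr_pdivrMr//; apply: (le_lt_trans hh).
rewrite expr2 mulrA ltr_pM2r//.
move: hn2 => /=; rewrite ltr_pdivlMr; last by rewrite ltr_wpDl.
by apply: le_lt_trans; rewrite mulrC ler_wpM2l ?cnorm_ge0// lerDl.
Qed.

(** The alternative is whether all coefficients of the power series vanish; otherwise the first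
    nonzero term dominates near the centre. *)
Lemma hol_zero_order z0 (r : R) u u' : 0 < r -> hol z0 r u u' ->
  (exists2 d : R, 0 < d & forall z, cball z0 d z -> u z = 0) \/
  (exists k (c d : R), [/\ 0 < c, 0 < d & forall z, cball z0 d z ->
     c * cnorm (z - z0) ^+ k <= cnorm (u z)]).
Proof.
move=> r0 hu; have [L L0 H] := hu.
have r2 : 0 < r / 2 by rewrite divr_gt0.
have r2r : r / 2 < r by lra.
have [|a [aM aP]] := hol_pseries (M := L) r2 r2r hu.
  by move=> z zr; have [] := H z; rewrite /cball /= ?zr.
have [[k ak]|na] := pselect (exists k, a k != 0); last first.
  left; exists (r / 2) => // z zr; have a0 i : a i = 0.
    by apply/eqP; apply: contra_notT na => ai; exists i.
  have q01 : 0 <= cnorm (z - z0) / (r / 2) < 1.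
    by rewrite divr_ge0 ?cnorm_ge0 ?(ltW r2)//= ltr_pdivrMr// mul1r.
  have C0 : 0 < L * (r / 2 / (r / 2 - cnorm (z - z0))) + 1.
    rewrite ltr_wpDl// mulr_ge0// divr_ge0 ?(ltW r2)// subr_ge0.
    by move: zr; rewrite /cball /=; lra.
  apply/eqP; rewrite -cnorm_eq0 eq_le cnorm_ge0 andbT.
  apply/ler_addgt0Pr => e e0; rewrite add0r.
  have [m /(_ m (leqnn m)) mP] := small_exp q01 (divr_gt0 e0 C0).
  have := aP _ zr m; rewrite (addrC z0) subrK.
  rewrite /psum big1 ?subr0 => [|i _]; last by rewrite a0 mul0r.
  move=> /le_trans; apply; rewrite mulrAC.
  move: mP; rewrite ltr_pdivlMr// => mP; rewrite (le_trans _ (ltW mP))//.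
  by rewrite [leRHS]mulrC ler_wpM2r ?exprn_ge0 ?lerDl//; case/andP: q01.
right; have [k' ak' kmin] := ex_minnP (ex_intro (fun k => a k != 0) k ak).
have na : 0 < cnorm (a k') by rewrite cnorm_gt0.
pose K : R := L / (r / 2) ^+ k'.+1 * 2.
have K0 : 0 <= K by rewrite mulr_ge0// divr_ge0// exprn_ge0// ltW.
have K1 : 0 < K + 1 by rewrite ltr_wpDl.
exists k', (cnorm (a k') / 2), (Num.min (r / 4) (cnorm (a k') / 2 / (K + 1))).
split; rewrite ?lt_min ?divr_gt0// => z; rewrite /cball /= lt_min => /andP[z1 z2].
have zr : cnorm (z - z0) < r / 2 by lra.
have := aP _ zr k'.+1; rewrite (addrC z0) subrK /psum big_ord_recr /=.
rewrite big1 ?add0r => [h|i _]; last first.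
  have := ltn_ord i; apply: contraTeq => ai; rewrite -leqNgt kmin//.
  by apply: contra_neq ai => ->; rewrite mul0r.
have {}h : cnorm (u z - a k' * (z - z0) ^+ k') <= K * cnorm (z - z0) ^+ k'.+1.
  apply: (le_trans h); rewrite expr_div_n /K.
  rewrite [leRHS](_ : _ = L * (cnorm (z - z0) ^+ k'.+1 / (r / 2) ^+ k'.+1) * 2); last by ring.
  have p0 : 0 <= L * (cnorm (z - z0) ^+ k'.+1 / (r / 2) ^+ k'.+1).
    by apply: mulr_ge0 => //; apply: divr_ge0; apply: exprn_ge0; rewrite ?cnorm_ge0 ?(ltW r2).
  by apply: (ler_wpM2l p0); rewrite ler_pdivrMr; lra.
have := ler_cnormB (a k' * (z - z0) ^+ k') (u z); rewrite (cnormB _ (u z)).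
rewrite cnormM cnormX => h2.
have h3 : K * cnorm (z - z0) ^+ k'.+1 <= cnorm (a k') / 2 * cnorm (z - z0) ^+ k'.
  rewrite exprS mulrA ler_wpM2r ?exprn_ge0 ?cnorm_ge0//.
  move: z2; rewrite ltr_pdivlMr// => /ltW; apply: le_trans.
  by rewrite mulrC ler_wpM2l ?cnorm_ge0// lerDl.
lra.
Qed.

(** Compactness: points where |u| is arbitrarily small would have a limit in the closed ball, and
    [u] would vanish there. *)
Lemma closed_ball_lower z0 (r d : R) u u' : 0 <= d -> d < r -> hol z0 r u u' ->
  (forall z, cnorm (z - z0) <= d -> u z != 0) ->
  exists2 m : R, 0 < m & forall z, cnorm (z - z0) <= d -> m <= cnorm (u z).
Proof.
move=> d0 dr hu u0; apply: contrapT => nm.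
have /choice[x xP] (n : nat) : exists z, cnorm (z - z0) <= d /\ cnorm (u z) < n.+1%:R^-1.
  apply: contrapT => h; apply: nm; exists n.+1%:R^-1; first by rewrite invr_gt0.
  by move=> z zd; rewrite leNgt; apply/negP => uz; apply: h; exists z.
have [V [VV Voo]] := ex_ultra.
have [l xl] : exists l, ucvg V x l.
  apply: (@ucvg_bounded _ _ VV _ (d + cnorm z0)); apply: filterE => n /=.
  have [h _] := xP n; have := ler_cnormB (x n) z0; lra.
have ld : cnorm (l - z0) <= d.
  apply: (ucvg_le VV (ucvgB VV xl (ucvg_cst VV z0))).
  by apply: filterE => n; case: (xP n).
have [K K0 lu] := hol_lip hu.
have : cnorm (u l) <= 0.
  apply/ler_addgt0Pr => e e0; rewrite add0r.
  have e1 : 0 < e / (2 * (K + 1)) by rewrite divr_gt0// mulr_gt0// ltr_wpDl.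
  have [n1 n1e] := invSn_lt (divr_gt0 e0 (ltr0Sn R 1)).
  have Vn : V [set n | (n1 <= n)%N] by apply: Voo; exists n1.
  have [n [/= h1 n1n]] := filter_ex (filterI (xl _ e1) Vn).
  have [xd un] := xP n.
  have lr : cball z0 r l by rewrite /cball /=; lra.
  have xr : cball z0 r (x n) by rewrite /cball /=; lra.
  have := lu _ _ xr lr; have := cnorm_dist (u (x n)) (u l) 0; rewrite !subr0.
  have un2 : cnorm (u (x n)) < e / 2.
    by rewrite (lt_trans un)// (le_lt_trans _ n1e)// lef_pV2 ?posrE// ler_nat.
  move: h1; rewrite cnormB ltr_pdivlMr; last by rewrite mulr_gt0// ltr_wpDl.
  have := cnorm_ge0 (l - x n); nra.
by rewrite leNgt cnorm_gt0 u0.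
Qed.

(** If the value [w] were missed, 1 / (u - w) would be holomorphic with modulus larger at the centre
    than on the circle, against [mean_value_le]. *)
Lemma open_mapping_quant z0 (r d e : R) u u' : 0 < d -> d < r -> hol z0 r u u' ->
  0 < e -> (forall z, cnorm (z - z0) = d -> 2 * e <= cnorm (u z - u z0)) ->
  forall w, cnorm (w - u z0) < e -> exists2 z, cnorm (z - z0) <= d & u z = w.
Proof.
move=> d0 dr hu e0 ud w we; apply: contrapT => nw.
have hv := holB hu (hol_cst z0 r w).
have [|m m0 mP] := closed_ball_lower (ltW d0) dr hv.
  by move=> z zd; rewrite subr_eq0; apply/eqP => uz; apply: nw; exists z.
have [K K0 lu] := hol_lip hu.
have hi : hol z0 d (fun z => (u z - w)^-1) (fun z => - (u' z - 0) / (u z - w) ^+ 2).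
  apply: (holV m0) => [z zd|]; first by apply: mP; exact: ltW.
  by apply: hol_sub hv => z; rewrite /cball /= => /lt_trans; exact.
(* The inverse is holomorphic only on the open ball of radius [d], so the mean value is taken on a
   circle of radius d - t; [t] is small enough for the Lipschitz bound to transfer the hypothesis to
   it. *)
pose t : R := Num.min (d / 2) ((e - cnorm (w - u z0)) / (K + 1)).
have t0 : 0 < t.
  by rewrite lt_min divr_gt0//= divr_gt0 ?subr_gt0// ltr_wpDl.
have td : t <= d / 2 by rewrite ge_min lexx.
have tK : t * (K + 1) <= e - cnorm (w - u z0).
  by rewrite -ler_pdivlMr ?ltr_wpDl// ge_min lexx orbT.
have dt0 : 0 < d - t by lra.
have dtd : d - t < d by lra.
have uz0w : u z0 - w != 0.
  rewrite subr_eq0; apply/eqP => uz; apply: nw; exists z0 => //.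
  by rewrite subrr cnorm0 ltW.
have p0 : 0 < cnorm (u z0 - w) by rewrite cnorm_gt0.
have := mean_value_le (M := e^-1) dt0 dtd hi.
have Hc z : cnorm (z - z0) = d - t -> cnorm (u z - w)^-1 <= e^-1.
  move=> zd; rewrite cnormV lef_pV2 ?posrE//; last first.
    by rewrite cnorm_gt0; apply/eqP => /eqP h; apply: nw; exists z;
      [rewrite zd; lra|apply/eqP; rewrite -subr_eq0].
  pose y := z0 + (d / (d - t))%:C * (z - z0).
  have yd : cnorm (y - z0) = d.
    rewrite /y (addrC z0) addrK cnormM cnorm_real zd gtr0_norm ?divr_gt0//.
    by rewrite divfK// gt_eqF.
  have yz : cnorm (z - y) = t.
    have -> : z - y = - (t / (d - t))%:C * (z - z0).
      have e1 : d / (d - t) = 1 + t / (d - t) by field; rewrite gt_eqF.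
      by rewrite /y e1 rmorphD rmorph1; ring.
    rewrite cnormM cnormN cnorm_real zd gtr0_norm ?divr_gt0//.
    by rewrite divfK// gt_eqF.
  have yr : cball z0 r y by rewrite /cball /= yd.
  have zr : cball z0 r z by rewrite /cball /= zd; lra.
  have := lu _ _ yr zr; rewrite yz; have := ud y yd.
  have := cnorm_dist (u z) (u y) (u z0); have := cnorm_dist w (u z) (u z0).
  rewrite (cnormB (u y) (u z)); lra.
move=> /(_ Hc); rewrite cnormV lef_pV2 ?posrE// (cnormB (u z0)); lra.
Qed.

Lemma open_mapping z0 (r : R) u u' : 0 < r -> hol z0 r u u' ->
  ~ (exists2 d : R, 0 < d & forall z, cball z0 d z -> u z = u z0) ->
  forall d : R, 0 < d -> exists2 e : R, 0 < e & forall w, cnorm (w - u z0) < e ->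
    exists2 z, cnorm (z - z0) < d & u z = w.
Proof.
move=> r0 hu nc d d0; have hv := holB hu (hol_cst z0 r (u z0)).
have [[d' d'0 uz]|[k [c [d' [c0 d'0 uk]]]]] := hol_zero_order r0 hv.
  case: nc; exists d' => // z /uz /eqP; by rewrite subr_eq0 => /eqP.
pose t := Num.min (d / 2) (Num.min (r / 2) (d' / 2)).
have t0 : 0 < t by rewrite !lt_min !divr_gt0.
have tr : t < r.
  have : t <= r / 2 by rewrite !ge_min lexx orbT.
  lra.
have td : t < d.
  have : t <= d / 2 by rewrite !ge_min lexx.
  lra.
have td' : t < d'.
  have : t <= d' / 2 by rewrite !ge_min lexx !orbT.
  lra.
have e0 : 0 < c * t ^+ k / 2 by rewrite divr_gt0// mulr_gt0// exprn_gt0.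
exists (c * t ^+ k / 2) => // w we.
have [|z zt uz] := open_mapping_quant t0 tr hu e0 _ we.
  move=> z zt; have := uk z; rewrite /cball /= zt => /(_ td'); lra.
by exists z => //; exact: le_lt_trans td.
Qed.

(** Along a segment cut into M + 1 pieces, the quadratic errors add up to a multiple of 1 / (M +
    1). *)
Lemma hol_const_ball z0 (r : R) u : hol z0 r u (fun=> 0) ->
  forall z w, cball z0 r z -> cball z0 r w -> u z = u w.
Proof.
move=> [L L0 H] z w zr wr; apply: cnorm_le0_eq.
have quad (x y : C) : cball z0 r x -> cball z0 r y ->
    cnorm (u y - u x) <= L * cnorm (y - x) ^+ 2.
  by move=> xr yr; have [_ _ /(_ y yr)] := H x xr; rewrite mul0r subr0.
pose p (t : R) := w + t%:C * (z - w).
have pr (t : R) : 0 <= t <= 1 -> cball z0 r (p t).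
  move=> /andP[t0 t1]; rewrite /cball /=.
  have -> : p t - z0 = (1 - t)%:C * (w - z0) + t%:C * (z - z0).
    by rewrite /p rmorphB rmorph1; ring.
  apply: (le_lt_trans (ler_cnormD _ _)); rewrite !cnormM !cnorm_real.
  rewrite !ger0_norm ?subr_ge0//; move: zr wr; rewrite /cball /= => zr wr.
  have [->|tn] := eqVneq t 0; first by rewrite subr0 mul1r mul0r addr0.
  have tp : 0 < t by rewrite lt_def tn.
  have h1 : t * cnorm (z - z0) < t * r by rewrite ltr_pM2l.
  have h2 : (1 - t) * cnorm (w - z0) <= (1 - t) * r.
    by apply: ler_wpM2l (ltW wr); rewrite subr_ge0.
  lra.
have bound (M : nat) : cnorm (u z - u w) <= L * cnorm (z - w) ^+ 2 / M.+1%:R.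
  have M0 : (0 : R) < M.+1%:R by [].
  pose t (m : nat) : R := m%:R / M.+1%:R.
  have -> : u z - u w = \sum_(0 <= m < M.+1) (u (p (t m.+1)) - u (p (t m))).
    rewrite telescope_sumr// /t divff ?gt_eqF// mul0r /p mul0r addr0.
    by rewrite (_ : w + _ = z)// rmorph1 mul1r addrC subrK.
  apply: (le_trans (ler_cnorm_sum _ _ _)).
  apply: (@le_trans _ _ (\sum_(0 <= m < M.+1) (M.+1%:R^-1 ^+ 2 * (L * cnorm (z - w) ^+ 2)))).
    apply: ler_sum_nat => m /andP[_ mM].
    have t01 k : (k <= M.+1)%N -> 0 <= t k <= 1.
      by move=> kM; rewrite /t divr_ge0//= ler_pdivrMr// mul1r ler_nat.
    apply: (le_trans (quad _ _ (pr _ (t01 m (ltnW mM))) (pr _ (t01 m.+1 mM)))).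
    have -> : p (t m.+1) - p (t m) = (M.+1%:R^-1 : R)%:C * (z - w).
      have -> : t m.+1 = t m + M.+1%:R^-1 by rewrite /t -natr1 mulrDl mul1r.
      by rewrite /p rmorphD; ring.
    rewrite cnormM cnorm_real gtr0_norm ?invr_gt0// exprMn.
    by rewrite mulrCA.
  rewrite sumr_const_nat subn0 -[leLHS]mulr_natl; apply: eqW.
  by field; rewrite nat1r; rewrite pnatr_eq0.
apply/ler_addgt0Pr => e e0; rewrite add0r.
have K0 : 0 <= L * cnorm (z - w) ^+ 2 by rewrite mulr_ge0// sqr_ge0.
have K1 : 0 < L * cnorm (z - w) ^+ 2 + 1 by rewrite ltr_wpDl.
have [M Me] := invSn_lt (divr_gt0 e0 K1).
apply: (le_trans (bound M)).
move: Me; rewrite ltr_pdivlMr// => Me; apply: le_trans (ltW Me).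
by rewrite mulrC ler_wpM2l ?invr_ge0// lerDl.
Qed.

(** Otherwise there would be bad points [x n] for almost all [n]. At their limit the common
    Lipschitz constant contradicts pointwise convergence. *)
Lemma ulim_uniform (V : set_system nat) (VV : UltraFilter V) z0 (r d K : R)
  (u : nat -> C -> C) v : 0 <= d -> d < r -> 0 <= K ->
  V [set n | forall z w, cball z0 r z -> cball z0 r w ->
      cnorm (u n w - u n z) <= K * cnorm (w - z)] ->
  (forall z, cball z0 r z -> ucvg V (u ^~ z) (v z)) ->
  forall e : R, 0 < e -> V [set n | forall z, cnorm (z - z0) <= d -> cnorm (u n z - v z) < e].
Proof.
move=> d0 dr K0 Vu uv e e0; apply: contrapT => nV.
have VN : V (~` [set n | forall z, cnorm (z - z0) <= d -> cnorm (u n z - v z) < e]).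
  have [//|] := in_ultra_setVsetC [set n | forall z, cnorm (z - z0) <= d ->
    cnorm (u n z - v z) < e] VV.
  by [].
have /choice[x xP] n : exists z, (~` [set n | forall z, cnorm (z - z0) <= d ->
    cnorm (u n z - v z) < e]) n -> cnorm (z - z0) <= d /\ e <= cnorm (u n z - v z).
  have [[z zP]|h] := pselect (exists z, cnorm (z - z0) <= d /\ e <= cnorm (u n z - v z)).
    by exists z.
  exists z0 => hn; exfalso; apply: hn => z zd; rewrite ltNge; apply/negP => ez.
  by apply: h; exists z.
have [l xl] : exists l, ucvg V x l.
  apply: (@ucvg_bounded _ _ VV _ (d + cnorm z0)); apply: filterS VN => n /xP [h _] /=.
  have := ler_cnormB (x n) z0; lra.
have ld : cnorm (l - z0) <= d.
  apply: (ucvg_le VV (ucvgB VV xl (ucvg_cst VV z0))).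
  by apply: filterS VN => n /xP [].
have lr : cball z0 r l by rewrite /cball /=; lra.
have vlip z w : cball z0 r z -> cball z0 r w -> cnorm (v w - v z) <= K * cnorm (w - z).
  move=> zr wr; apply: (ucvg_le VV (ucvgB VV (uv w wr) (uv z zr))).
  by apply: filterS Vu => n; exact.
have e1 : 0 < e / (3 * (K + 1)) by rewrite divr_gt0// mulr_gt0// ltr_wpDl.
have e3 : 0 < e / 3 by rewrite divr_gt0.
have [n [[/xP [xd ex] /= h1] [h2 h3]]] :=
  filter_ex (filterI (filterI VN (xl _ e1)) (filterI (uv l lr _ e3) Vu)).
have xr : cball z0 r (x n) by rewrite /cball /=; lra.
have := h3 _ _ lr xr; have := vlip _ _ xr lr.
have := cnorm_dist (u n l) (u n (x n)) (v (x n)).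
have := cnorm_dist (v l) (u n l) (v (x n)).
move: h1; rewrite (cnormB l (x n)) ltr_pdivlMr; last by rewrite mulr_gt0// ltr_wpDl.
move: h2 => /=; have := cnorm_ge0 (x n - l); nra.
Qed.

End Analytic.

(** * Meromorphic maps *)

Section Mero.
Variable R : realType.
Local Notation C := R[i].
Local Notation S := (sphere R).
Implicit Types (z w a b : C) (u v A B : C -> C) (g h : C -> S) (f : ratmap R) (p : {poly C}).

Definition holx z0 (r : R) u := exists u', hol z0 r u u'.

Lemma holx_cst z0 (r : R) a : holx z0 r (fun=> a).
Proof. by eexists; exact: hol_cst. Qed.

Lemma holxD z0 (r : R) u v : holx z0 r u -> holx z0 r v -> holx z0 r (fun z => u z + v z).
Proof. by move=> [u' hu] [v' hv]; eexists; exact: (holD hu hv). Qed.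

Lemma holxB z0 (r : R) u v : holx z0 r u -> holx z0 r v -> holx z0 r (fun z => u z - v z).
Proof. by move=> [u' hu] [v' hv]; eexists; exact: (holB hu hv). Qed.

Lemma holxM z0 (r : R) u v : holx z0 r u -> holx z0 r v -> holx z0 r (fun z => u z * v z).
Proof. by move=> [u' hu] [v' hv]; eexists; exact: (holM hu hv). Qed.

Lemma holxX z0 (r : R) u n : holx z0 r u -> holx z0 r (fun z => u z ^+ n).
Proof.
move=> hu; elim: n => [|n IH]; first exact: holx_cst.
by under eq_fun do rewrite exprS; exact: holxM.
Qed.

Lemma holx_sum z0 (r : R) n (F : nat -> C -> C) : (forall i, holx z0 r (F i)) ->
  holx z0 r (fun z => \sum_(i < n) F i z).
Proof.
move=> hF; elim: n => [|n IH].
  by under eq_fun do rewrite big_ord0; exact: holx_cst.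
by under eq_fun do rewrite big_ord_recr; exact: holxD.
Qed.

Lemma holx_affine z0 (r : R) a b : holx z0 r (fun z => a * z + b).
Proof. by apply: holxD (holx_cst _ _ _); apply: holxM (holx_cst _ _ _) _; eexists; exact: hol_id. Qed.

Lemma holx_sub z0 (r : R) z1 (r1 : R) u : cball z1 r1 `<=` cball z0 r ->
  holx z0 r u -> holx z1 r1 u.
Proof. by move=> s [u' hu]; exists u'; exact: hol_sub hu. Qed.

Lemma cball_center z0 (r : R) : 0 < r -> cball z0 r z0.
Proof. by rewrite /cball /= subrr cnorm0. Qed.

Lemma cball_le z0 (r r' : R) : r <= r' -> cball z0 r `<=` cball z0 r'.
Proof. by move=> rr; apply: cball_sub; rewrite subrr cnorm0 add0r. Qed.

Lemma hol_shrink z0 (r r' : R) u u' : r' <= r -> hol z0 r u u' -> hol z0 r' u u'.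
Proof. by move=> rr; apply: hol_sub; exact: cball_le. Qed.

Lemma cball_inner z0 (r : R) z : cball z0 r z -> exists2 d : R, 0 < d & cball z d `<=` cball z0 r.
Proof. exact: cball_copen. Qed.

Lemma hol_cont z0 (r : R) u u' : 0 < r -> hol z0 r u u' -> forall e : R, 0 < e ->
  exists2 d : R, 0 < d <= r & forall z, cball z0 d z -> cnorm (u z - u z0) < e.
Proof.
move=> r0 hu e e0; have [K K0 lu] := hol_lip hu.
have K1 : 0 < K + 1 by rewrite ltr_wpDl.
exists (Num.min r (e / (K + 1))); first by rewrite lt_min r0 divr_gt0//= ge_min lexx.
move=> z; rewrite {1}/cball /= lt_min => /andP[zr ze].
apply: (le_lt_trans (lu _ _ (cball_center _ r0) zr)).
move: ze; rewrite ltr_pdivlMr// => ze; apply: le_lt_trans ze.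
by rewrite mulrC ler_wpM2l ?cnorm_ge0// lerDl.
Qed.

Lemma hol_neq0 z0 (r : R) u u' : 0 < r -> hol z0 r u u' -> u z0 != 0 ->
  exists2 d : R, 0 < d <= r & forall z, cball z0 d z -> cnorm (u z0) / 2 <= cnorm (u z).
Proof.
move=> r0 hu uz0; have uz0' : 0 < cnorm (u z0) / 2 by rewrite divr_gt0// cnorm_gt0.
have [d dr dP] := hol_cont r0 hu uz0'; exists d => // z /dP.
by have := ler_cnormB (u z0) (u z); rewrite (cnormB (u z0)); lra.
Qed.

Lemma hol_comp z0 (r s : R) u u' v v' : 0 < r -> 0 < s -> hol z0 r v v' ->
  hol (v z0) s u u' -> exists2 d : R, 0 < d <= r &
  (forall z, cball z0 d z -> cball (v z0) s (v z)) /\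
  hol z0 d (fun z => u (v z)) (fun z => u' (v z) * v' z).
Proof.
move=> r0 s0 hv hu; have [d /andP[d0 dr] dP] := hol_cont r0 hv s0.
exists d; first by rewrite d0.
split => //; have {}hv := hol_shrink dr hv.
have [K K0 lv] := hol_lip hv; move: hu hv => [L L0 H] [M M0 N].
exists (L + L * M + (L * M + L * K ^+ 2)).
  by rewrite !addr_ge0 ?mulr_ge0// sqr_ge0.
have p1 : 0 <= L * M by rewrite mulr_ge0.
have p2 : 0 <= L * K ^+ 2 by apply: mulr_ge0 => //; exact: sqr_ge0.
move=> z zd; have [a1 a2 a3] := H _ (dP z zd); have [b1 b2 b3] := N z zd; split.
- lra.
- have : cnorm (u' (v z) * v' z) <= L * M by rewrite cnormM ler_pM ?cnorm_ge0.
  lra.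
- move=> w wd; have {}a3 := a3 _ (dP w wd); have {}b3 := b3 w wd.
  have -> : u (v w) - u (v z) - u' (v z) * v' z * (w - z) =
    (u (v w) - u (v z) - u' (v z) * (v w - v z))
    + u' (v z) * (v w - v z - v' z * (w - z)) by ring.
  have s1 : cnorm (u' (v z) * (v w - v z - v' z * (w - z))) <= L * M * cnorm (w - z) ^+ 2.
    by rewrite cnormM -mulrA ler_pM ?cnorm_ge0.
  have s2 : L * cnorm (v w - v z) ^+ 2 <= L * K ^+ 2 * cnorm (w - z) ^+ 2.
    rewrite -mulrA -exprMn ler_wpM2l// lerXn2r ?nnegrE ?cnorm_ge0 ?mulr_ge0 ?cnorm_ge0//.
    exact: lv.
  apply: (le_trans (ler_cnormD _ _)).
  have : 0 <= (L + L * M) * cnorm (w - z) ^+ 2.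
    by apply: mulr_ge0; [rewrite addr_ge0|exact: sqr_ge0].
  lra.
Qed.

(* The point of homogeneous coordinates [a : b]. *)
Definition projS a b : S := if b == 0 then None else Some (a / b).

Lemma projS_fin a b : b != 0 -> projS a b = Some (a / b).
Proof. by rewrite /projS => /negPf ->. Qed.

Lemma projS_None a : projS a 0 = None.
Proof. by rewrite /projS eqxx. Qed.

Lemma projS1 a : projS a 1 = Some a.
Proof. by rewrite projS_fin ?oner_eq0// divr1. Qed.

Lemma projS_Some a b w : projS a b = Some w -> b != 0 /\ a = w * b.
Proof. by rewrite /projS; case: eqVneq => // b0 [<-]; rewrite divfK. Qed.

Lemma projS_eq a b a' b' : (a != 0) || (b != 0) -> (a' != 0) || (b' != 0) ->
  projS a b = projS a' b' <-> a * b' = a' * b.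
Proof.
rewrite /projS; have [-> /=|b0 _] := eqVneq b 0; have [-> /=|b'0] := eqVneq b' 0.
- by rewrite !mulr0.
- rewrite orbF => a0 _; split => //; rewrite mulr0 => /eqP.
  by rewrite mulf_eq0 (negPf a0) (negPf b'0).
- rewrite orbF => a0; split => //; rewrite mulr0 => /esym/eqP.
  by rewrite mulf_eq0 (negPf a0) (negPf b0).
- move=> _; split=> [[] /eqP|/eqP h]; first by rewrite eqr_div// => /eqP.
  by congr Some; apply/eqP; rewrite eqr_div.
Qed.

Lemma sinv_projS a b : (a != 0) || (b != 0) -> sinv (projS a b) = projS b a.
Proof.
rewrite /projS; have [->|b0] /= := eqVneq b 0.
  by rewrite orbF => /negPf ->; rewrite mul0r.
rewrite mulf_eq0 invr_eq0 (negPf b0) orbF; case: eqVneq => // a0 _.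
by rewrite invf_div.
Qed.

Lemma sinvK : involutive (@sinv R).
Proof.
case=> [z|] /=; last by rewrite eqxx.
by case: eqVneq => [->|z0] //=; rewrite invr_eq0 (negPf z0) invrK.
Qed.

(** The homogenization of [p] in degree [n]: rational maps are evaluated in homogeneous coordinates
    without a special case at infinity. *)
Definition hom p n a b := \sum_(i < n.+1) p`_i * (a ^+ i * b ^+ (n - i)).

Lemma hom_a1 p n a : (size p <= n.+1)%N -> hom p n a 1 = p.[a].
Proof.
move=> sp; rewrite (horner_coef_wide _ sp); apply: eq_bigr => i _.
by rewrite expr1n mulr1.
Qed.

Lemma hom_a0 p n a : hom p n a 0 = p`_n * a ^+ n.
Proof.
rewrite /hom big_ord_recr /= subnn expr0 mulr1 big1 ?add0r// => i _.
by rewrite expr0n subn_eq0 leqNgt ltn_ord !mulr0.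
Qed.

Lemma homZ p n a b (c : C) : hom p n (c * a) (c * b) = c ^+ n * hom p n a b.
Proof.
rewrite /hom mulr_sumr; apply: eq_bigr => i _.
have le_in : (i <= n)%N by rewrite -ltnS; exact: ltn_ord.
rewrite !exprMn mulrACA -exprD subnKC//.
exact: mulrCA.
Qed.

Lemma hom_div p n a b : (size p <= n.+1)%N -> b != 0 ->
  hom p n a b = b ^+ n * p.[a / b].
Proof.
move=> sp b0; rewrite -(hom_a1 _ sp) -homZ mulr1; congr hom.
by rewrite mulrCA divff ?mulr1.
Qed.

Lemma rdeg_size f : (size (rnum f) <= (rdeg f).+1)%N /\ (size (rden f) <= (rdeg f).+1)%N.
Proof.
by rewrite /rdeg; split; apply: leq_trans (leqSpred _); rewrite leq_max leqnn ?orbT.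
Qed.

Lemma ratmap_coprime f z : ((rnum f).[z] != 0) || ((rden f).[z] != 0).
Proof.
have [p0|//] := eqVneq (rnum f).[z] 0; rewrite /=.
by apply: (coprimep_root (rcoprime f)); exact/rootP.
Qed.

Lemma ratmap_infty f : ((rnum f)`_(rdeg f) != 0) || ((rden f)`_(rdeg f) != 0).
Proof.
rewrite /rdeg; have [sp|sp] := leqP (size (rnum f)) (size (rden f)).
  rewrite -lead_coefE lead_coef_eq0; apply/orP; right; apply/eqP => q0.
  have := rcoprime f; rewrite q0 coprimep0; move: sp; rewrite q0 size_poly0 leqn0.
  by rewrite size_poly_eq0 => /eqP ->; rewrite -size_poly_eq1 size_poly0.
rewrite -lead_coefE lead_coef_eq0 -size_poly_eq0 -lt0n.
by rewrite (leq_ltn_trans _ sp).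
Qed.

Lemma hom_neq0 f a b : (a != 0) || (b != 0) ->
  (hom (rnum f) (rdeg f) a b != 0) || (hom (rden f) (rdeg f) a b != 0).
Proof.
have [sp sq] := rdeg_size f.
have [-> /=|b0 _] := eqVneq b 0.
  rewrite orbF => a0; rewrite !hom_a0 !mulf_eq0 expf_eq0 (negPf a0) andbF !orbF.
  exact: ratmap_infty.
by rewrite !hom_div// !mulf_eq0 expf_eq0 (negPf b0) andbF /= ratmap_coprime.
Qed.

Lemma reval_Some f z : reval f (Some z) = projS (rnum f).[z] (rden f).[z].
Proof. by []. Qed.

Lemma reval_projS f a b : (a != 0) || (b != 0) ->
  reval f (projS a b) = projS (hom (rnum f) (rdeg f) a b) (hom (rden f) (rdeg f) a b).
Proof.
have [sp sq] := rdeg_size f => ab.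
have [b0|b0] := eqVneq b 0.
  move: ab; rewrite b0 eqxx orbF => a0; rewrite projS_None !hom_a0.
  rewrite -[LHS]/(projS _ _); apply/projS_eq; last by rewrite mulrA mulrAC.
    exact: ratmap_infty.
  by rewrite !mulf_eq0 expf_eq0 (negPf a0) andbF !orbF; exact: ratmap_infty.
rewrite projS_fin// reval_Some !hom_div//; apply/projS_eq; last by rewrite mulrCA mulrA.
  exact: ratmap_coprime.
by rewrite !mulf_eq0 expf_eq0 (negPf b0) andbF /= ratmap_coprime.
Qed.

Lemma holx_hom z0 (r : R) p n A B : holx z0 r A -> holx z0 r B ->
  holx z0 r (fun z => hom p n (A z) (B z)).
Proof.
move=> hA hB.
apply: (holx_sum n.+1 (F := fun i z => p`_i * (A z ^+ i * B z ^+ (n - i)))) => i.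
by apply: holxM; [exact: holx_cst|apply: holxM; exact: holxX].
Qed.

(** Holomorphic homogeneous coordinates: poles become ordinary points, and composition with a
    rational map stays defined on the same ball. *)
Definition pairhol z0 (r : R) g A B := [/\ holx z0 r A, holx z0 r B &
  forall z, cball z0 r z -> ((A z != 0) || (B z != 0)) /\ g z = projS (A z) (B z)].

Definition mero g := forall z0, exists (r : R) A B, 0 < r /\ pairhol z0 r g A B.

Lemma pairhol_reval f z0 (r : R) g A B : pairhol z0 r g A B ->
  exists A1 B1, pairhol z0 r (reval f \o g) A1 B1.
Proof.
move=> [hA hB gAB]; 
exists (fun z => hom (rnum f) (rdeg f) (A z) (B z)), (fun z => hom (rden f) (rdeg f) (A z) (B z)).
split; [exact: holx_hom|exact: holx_hom|].
move=> z /gAB[ab gz]; split; first exact: hom_neq0.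
by rewrite /= gz reval_projS.
Qed.

Lemma mero_reval f g : mero g -> mero (reval f \o g).
Proof.
move=> mg z0; have [r [A [B [r0 h]]]] := mg z0.
by have [A1 [B1 h1]] := pairhol_reval f h; exists r, A1, B1.
Qed.

Lemma pairhol_Some z0 (r : R) u : holx z0 r u ->
  pairhol z0 r (fun z => Some (u z)) u (fun=> 1).
Proof.
move=> hu; split => //; first exact: holx_cst.
by move=> z _; rewrite oner_eq0 orbT projS1.
Qed.

Lemma mero_affine g a b : mero g -> mero (fun z => g (a * z + b)).
Proof.
move=> mg z0; have [s [A [B [s0 [[A' hA] [B' hB] gAB]]]]] := mg (a * z0 + b).
have [v' hv] := holx_affine z0 1 a b.
have [d1 /andP[d10 _] [sd1 h1]] := hol_comp (ltr01 : (0 : R) < 1) s0 hv hA.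
have [d2 /andP[d20 _] [_ h2]] := hol_comp (ltr01 : (0 : R) < 1) s0 hv hB.
exists (Num.min d1 d2), (fun z => A (a * z + b)), (fun z => B (a * z + b)).
split; first by rewrite lt_min d10.
split.
- by eexists; apply: hol_shrink h1; rewrite ge_min lexx.
- by eexists; apply: hol_shrink h2; rewrite ge_min lexx orbT.
- move=> z; rewrite /cball /= lt_min => /andP[zd _]; apply: gAB; exact: sd1.
Qed.

Lemma mero_sinv g : mero g -> mero (@sinv R \o g).
Proof.
move=> mg z0; have [r [A [B [r0 [hA hB gAB]]]]] := mg z0; exists r, B, A.
split => //; split => // z /gAB[ab gz]; rewrite orbC; split => //.
by rewrite /= gz sinv_projS.
Qed.

Definition hasd g z D := exists r u u',
  [/\ 0 < r, hol z r u u', (forall w, cball z r w -> g w = Some (u w)) & u' z = D].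

Lemma hasd_fin g z D : hasd g z D -> exists v : C, g z = Some v.
Proof. by move=> [r [u [u' [r0 _ gu _]]]]; exists (u z); rewrite gu//; exact: cball_center. Qed.

Lemma hasd_eq g h z D (r : R) : 0 < r -> (forall w, cball z r w -> g w = h w) ->
  hasd g z D -> hasd h z D.
Proof.
move=> r0 gh [s [u [u' [s0 hu gu uD]]]]; exists (Num.min r s), u, u'; split => //.
- by rewrite lt_min r0.
- by apply: hol_shrink hu; rewrite ge_min lexx orbT.
- by move=> w; rewrite /cball /= lt_min => /andP[wr ws]; rewrite -gh// gu.
Qed.

Lemma hasd_unique g z D D' : hasd g z D -> hasd g z D' -> D = D'.
Proof.
move=> [r [u [u' [r0 hu gu <-]]]] [s [v [v' [s0 hv gv <-]]]].
have m0 : 0 < Num.min r s by rewrite lt_min r0.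
have {}hu : hol z (Num.min r s) u u' by apply: hol_shrink hu; rewrite ge_min lexx.
have uv w : cball z (Num.min r s) w -> v w = u w.
  rewrite {1}/cball /= lt_min => /andP[wr ws].
  have e : Some (v w) = Some (u w) :> S by rewrite -gv// -gu.
  by case: e.
have {}hv : hol z (Num.min r s) u v'.
  apply: (eq_hol uv (fun w _ => erefl (v' w))).
  by apply: hol_shrink hv; rewrite ge_min lexx orbT.
have zz := cball_center z m0; have [L L0 /(_ z zz)[_ _ H]] := hu.
apply: (hol_deriv_unique (K := L) hv m0) => t tm.
have := H (z + t); rewrite (_ : z + t - z = t); last by rewrite addrC addKr.
by apply; rewrite /cball /= (_ : z + t - z = t)// addrC addKr.
Qed.

Lemma hasd_ball g z0 (r : R) u u' : hol z0 r u u' ->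
  (forall w, cball z0 r w -> g w = Some (u w)) ->
  forall z, cball z0 r z -> hasd g z (u' z).
Proof.
move=> hu gu z zr; have [d d0 dr] := cball_inner zr; exists d, u, u'; split => //.
  exact: hol_sub hu.
by move=> w /dr; exact: gu.
Qed.

Lemma hasd_comp g v v' z (r : R) D : 0 < r -> hol z r v v' -> hasd g (v z) D ->
  hasd (g \o v) z (D * v' z).
Proof.
move=> r0 hv [s [u [u' [s0 hu gu <-]]]].
have [d /andP[d0 _] [dP h]] := hol_comp r0 s0 hv hu.
by do 3 eexists; split; [exact: d0|exact: h| |] => // w /dP /gu.
Qed.

Lemma hasd_compS (k : S -> S) g z (v D D' : C) : hasd g z D -> g z = Some v ->
  hasd (k \o Some) v D' -> hasd (k \o g) z (D' * D).
Proof.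
move=> [r [u [u' [r0 hu gu <-]]]] gv hk.
have uv : u z = v by have := gu _ (cball_center z r0); rewrite gv => -[].
rewrite -uv in hk; apply: hasd_eq r0 _ (hasd_comp r0 hu hk) => w wr.
by rewrite /= gu.
Qed.

Lemma hasd_affine g a b z D : hasd g (a * z + b) D ->
  hasd (fun z => g (a * z + b)) z (D * a).
Proof.
move=> h; have hv : hol z 1 (fun z => a * z + b) (fun=> a).
  apply: eq_hol (holD (holM (hol_cst z 1 a) (hol_id z 1)) (hol_cst z 1 b)) => w _ //=.
  by ring.
exact: (hasd_comp ltr01 hv).
Qed.

Lemma mero_chart g z0 (v : C) : mero g -> g z0 = Some v -> exists r u u',
  [/\ 0 < r, hol z0 r u u' & forall w, cball z0 r w -> g w = Some (u w)].
Proof.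
move=> mg gv; have [r [A [B [r0 [[A' hA] [B' hB] gAB]]]]] := mg z0.
have [_] := gAB _ (cball_center z0 r0); rewrite gv => /esym/projS_Some[Bz0 _].
have [d /andP[d0 dr] dB] := hol_neq0 r0 hB Bz0.
have b0 : 0 < cnorm (B z0) / 2 by rewrite divr_gt0// cnorm_gt0.
have hi := holV b0 dB (hol_shrink dr hB).
have := holM (hol_shrink dr hA) hi => hu; do 3 eexists; split; [exact: d0|exact: hu|].
move=> w wd; have [_ ->] := gAB _ (cball_le dr wd).
by rewrite projS_fin// -cnorm_gt0 (lt_le_trans b0)// dB.
Qed.

Lemma mero_hasd g z (v : C) : mero g -> g z = Some v -> exists D, hasd g z D.
Proof.
move=> mg gv; have [r [u [u' [r0 hu gu]]]] := mero_chart mg gv.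
by exists (u' z); apply: hasd_ball hu gu _ _; exact: cball_center.
Qed.

(** In homogeneous coordinates equality is the vanishing of A B1 - A1 B, to which [hol_zero_order]
    applies. *)
Lemma mero_local_eq g h z0 : mero g -> mero h ->
  (exists2 r : R, 0 < r & forall z, cball z0 r z -> g z = h z) \/
  (exists2 r : R, 0 < r & forall z, cball z0 r z -> z != z0 -> g z <> h z).
Proof.
move=> /(_ z0)[r [A [B [r0 [hA hB gAB]]]]] /(_ z0)[s [A1 [B1 [s0 [hA1 hB1 hAB]]]]].
pose m := Num.min r s.
have m0 : 0 < m by rewrite lt_min r0.
have mr : m <= r by rewrite ge_min lexx.
have ms : m <= s by rewrite ge_min lexx orbT.
have sub1 := cball_le (z0 := z0) mr; have sub2 := cball_le (z0 := z0) ms.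
have [u' hu] := holxB (holxM (holx_sub sub1 hA) (holx_sub sub2 hB1))
  (holxM (holx_sub sub2 hA1) (holx_sub sub1 hB)).
have ghE z : cball z0 m z -> g z = h z <-> A z * B1 z - A1 z * B z = 0.
  move=> zm; have [ab ->] := gAB _ (sub1 _ zm); have [ab1 ->] := hAB _ (sub2 _ zm).
  by rewrite projS_eq//; split=> [->|/eqP]; [rewrite subrr|rewrite subr_eq0 => /eqP].
have [[d d0 dP]|[k [c [d [c0 d0 dP]]]]] := hol_zero_order m0 hu.
  left; exists (Num.min d m); first by rewrite lt_min d0.
  by move=> z; rewrite /cball /= lt_min => /andP[zd zm]; apply/ghE => //; exact: dP.
right; exists (Num.min d m); first by rewrite lt_min d0.
move=> z; rewrite /cball /= lt_min => /andP[zd zm] zz0 /(ghE z zm) e.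
have := dP z zd; rewrite e cnorm0 leNgt mulr_gt0// exprn_gt0// cnorm_gt0 subr_eq0//.
Qed.

(** Continuation along the segment from [z0] to [z1], up to the supremum of the parameters until
    which the two maps agree locally. *)
Lemma mero_identity g h z0 (r : R) : mero g -> mero h -> 0 < r ->
  (forall z, cball z0 r z -> g z = h z) -> forall z, g z = h z.
Proof.
move=> mg mh r0 gh z1.
pose p (t : R) := z0 + t%:C * (z1 - z0).
pose W z := exists2 d : R, 0 < d & forall w, cball z d w -> g w = h w.
pose T := [set t : R | 0 <= t <= 1 /\ forall s : R, 0 <= s <= t -> W (p s)].
have T0 : T 0.
  split; first by rewrite lexx ler01.
  move=> s s0; have -> : s = 0 by apply/eqP; rewrite eq_le andbC.
  by exists r => //; rewrite /p mul0r addr0.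
have hsT : has_sup T by split; [exists 0|exists 1 => t [/andP[]]].
have pdist (s t : R) : cnorm (p s - p t) = `|s - t| * cnorm (z1 - z0).
  by rewrite -cnorm_real -cnormM /p rmorphB; congr cnorm; ring.
have t01 : 0 <= sup T <= 1.
  by apply/andP; split; [apply: sup_ubound => //; case: hsT|apply: sup_le_ub; [exists 0|move=> t [/andP[]]]].
have K1 : 0 < cnorm (z1 - z0) + 1 by rewrite ltr_wpDl ?cnorm_ge0.
have Wlt (s : R) : 0 <= s -> s < sup T -> W (p s).
  move=> s0 st; have st' : 0 < sup T - s by rewrite subr_gt0.
  have [t [_ tW] tt] := sup_adherent st' hsT.
  by apply: tW; rewrite s0 /= ltW//; move: tt; rewrite subKr.
have Wopen (t : R) : W (p t) -> exists2 d : R, 0 < d & forall s, `|s - t| < d -> W (p s).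
  move=> [d d0 dP]; exists (d / (cnorm (z1 - z0) + 1)); first by rewrite divr_gt0.
  move=> s; rewrite ltr_pdivlMr// => sd.
  have pd : cball (p t) d (p s).
    rewrite /cball /= pdist; apply: le_lt_trans sd.
    by rewrite ler_wpM2l// lerDl.
  by have [e e0 eP] := cball_inner pd; exists e => // w /eP; exact: dP.
(* At the supremum, the other alternative of [mero_local_eq] would separate the maps on a punctured
   ball, which contains earlier points of the segment. *)
have Wsup : W (p (sup T)).
  have [//|[d d0 dP]] := mero_local_eq (p (sup T)) mg mh.
  have [z1E|z10] := eqVneq z1 z0.
    by exists r => //; rewrite /p z1E subrr mulr0 addr0.
  have [s0|s0] := eqVneq (sup T) 0.
    by rewrite s0; case: T0 => _; apply; rewrite lexx.
  have sp : 0 < sup T by rewrite lt_def s0; case/andP: t01.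
  pose s := Num.max (sup T / 2) (sup T - d / 2 / (cnorm (z1 - z0) + 1)).
  have ss : s < sup T.
    rewrite gt_max; apply/andP; split; first by lra.
    by rewrite gtrBl divr_gt0// divr_gt0.
  have sge0 : 0 <= s by rewrite le_max; apply/orP; left; lra.
  have [e e0 eP] := Wlt s sge0 ss.
  have := eP _ (cball_center _ e0) => gh'; exfalso; move: gh'; apply: dP.
    rewrite /cball /= pdist distrC ger0_norm; last by rewrite subr_ge0 ltW.
    have : sup T - s <= d / 2 / (cnorm (z1 - z0) + 1).
      by rewrite lerBlDr addrC -lerBlDr le_max lexx orbT.
    rewrite ler_pdivlMr// => h1.
    have : (sup T - s) * cnorm (z1 - z0) <= (sup T - s) * (cnorm (z1 - z0) + 1).
      by rewrite ler_wpM2l ?lerDl// subr_ge0 ltW.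
    lra.
  rewrite -subr_eq0 -cnorm_eq0 pdist mulf_neq0//.
    by rewrite normr_eq0 subr_eq0 lt_eqF.
  by rewrite cnorm_eq0 subr_eq0.
have [d d0 dP] := Wopen _ Wsup.
have sup1 : sup T = 1.
  apply/eqP; rewrite eq_le; case/andP: (t01) => s0 -> /=; rewrite leNgt; apply/negP => s1.
  pose t := Num.min 1 (sup T + d / 2).
  have tT : T t.
    split; first by rewrite ge_min lexx le_min ler01 addr_ge0// divr_ge0// ltW.
    move=> s /andP[s00 st]; have [sl|sl] := ltP s (sup T); first exact: Wlt.
    apply: dP; rewrite ger0_norm ?subr_ge0//.
    have : s <= sup T + d / 2 by rewrite (le_trans st)// ge_min lexx orbT.
    lra.
  have : t <= sup T by apply: sup_ubound => //; case: hsT.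
  by rewrite leNgt lt_min s1 ltrDl divr_gt0.
have [e e0 eP] := Wsup; have := eP _ (cball_center _ e0).
by rewrite sup1 /p mul1r addrC subrK.
Qed.

Lemma hol_inverse z0 (r : R) u u' : 0 < r -> hol z0 r u u' -> u' z0 != 0 ->
  exists (d s c : R) v v', [/\ 0 < d <= r, 0 < s & 0 < c] /\ [/\
    forall z w, cball z0 d z -> cball z0 d w -> c * cnorm (w - z) <= cnorm (u w - u z),
    forall z, cball z0 d z -> u' z != 0,
    hol (u z0) s v v' &
    forall w, cball (u z0) s w -> [/\ cball z0 d (v w), u (v w) = w & v' w = (u' (v w))^-1]].
Proof.
move=> r0 hu uz0; have m0 : 0 < cnorm (u' z0) by rewrite cnorm_gt0.
set m : R := cnorm (u' z0) in m0.
have [K K0 lu'] := hol_deriv_lip hu; have [L L0 H] := hu.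
have K1 : 0 < K + 1 by rewrite ltr_wpDl.
have L1 : 0 < L + 1 by rewrite ltr_wpDl.
(* The first bound keeps |u'| above m/2; the second keeps the Taylor error below m/4 times the
   distance. Hence [u] multiplies distances by at least m/4. *)
pose d := Num.min r (Num.min (m / 2 / (K + 1)) (m / 8 / (L + 1))).
have d0 : 0 < d by rewrite !lt_min r0 !divr_gt0.
have dr : d <= r by rewrite ge_min lexx.
have dK : d * (K + 1) <= m / 2 by rewrite -ler_pdivlMr// !ge_min lexx orbT.
have dL : d * (L + 1) <= m / 8 by rewrite -ler_pdivlMr// !ge_min lexx !orbT.
have um z : cball z0 d z -> m / 2 <= cnorm (u' z).
  move=> zd; have := lu' _ _ (cball_center z0 r0) (cball_le dr zd).
  have := ler_cnormB (u' z0) (u' z); rewrite (cnormB (u' z0)).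
  move: zd; rewrite /cball /= => zd; have := cnorm_ge0 (z - z0).
  by rewrite -/m; nra.
have low z w : cball z0 d z -> cball z0 d w -> m / 4 * cnorm (w - z) <= cnorm (u w - u z).
  move=> zd wd; have [_ _ /(_ w (cball_le dr wd)) h] := H z (cball_le dr zd).
  have := ler_cnormB (u' z * (w - z)) (u' z * (w - z) - (u w - u z)).
  rewrite subKr (cnormB (u' z * _)) cnormM.
  have wz : cnorm (w - z) < 2 * d.
    have := cnorm_dist z0 w z; rewrite (cnormB z0).
    by move: zd wd; rewrite /cball /=; lra.
  have := um z zd; have := cnorm_ge0 (w - z); move: h; rewrite expr2.
  set x := cnorm (w - z) in wz *; set y := cnorm (u' z); set e := cnorm (_ - _ - _).
  move=> h x0 my h2.
  have h3 : L * (x * x) <= m / 4 * x.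
    rewrite mulrA ler_wpM2r//; apply: (@le_trans _ _ (L * (2 * d))).
      by rewrite ler_wpM2l// ltW.
    nra.
  nra.
pose t := d / 2.
have t0 : 0 < t by rewrite divr_gt0.
have td : t < d by rewrite /t; lra.
have s0 : 0 < m / 8 * t by rewrite !mulr_gt0.
have inv w : exists z, cball (u z0) (m / 8 * t) w -> cball z0 d z /\ u z = w.
  have [ws|nw] := pselect (cball (u z0) (m / 8 * t) w); last by exists 0.
  have [|z zt uz] := open_mapping_quant t0 td (hol_shrink dr hu) s0 _ ws.
    move=> z zt; rewrite -[in leRHS](subrK z0 z).
    have := low z0 z (cball_center _ d0); rewrite /cball /= zt => /(_ td).
    by rewrite subrK; lra.
  by exists z => _; split => //; exact: le_lt_trans td.
have [v vP] := choice inv.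
exists d, (m / 8 * t), (m / 4), v, (fun w => (u' (v w))^-1); split.
  by rewrite d0 dr s0 divr_gt0.
have u'0 z : cball z0 d z -> u' z != 0.
  by move=> /um h; rewrite -cnorm_gt0 (lt_le_trans _ h)// divr_gt0.
split => //; last by move=> w /vP[].
exists (cnorm z0 + d + 2 / m + 2 / m * L * (4 / m) ^+ 2).
  by rewrite !addr_ge0 ?cnorm_ge0 ?(ltW d0)//; [apply: divr_ge0 => //; exact: ltW|
    apply: mulr_ge0; [apply: mulr_ge0 => //; apply: divr_ge0 => //; exact: ltW|exact: sqr_ge0]].
have M0 : 0 <= 2 / m by apply: divr_ge0 => //; exact: ltW.
have P0 : 0 <= 2 / m * L * (4 / m) ^+ 2.
  by apply: mulr_ge0; [exact: mulr_ge0|exact: sqr_ge0].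
have vV w : cball z0 d (v w) -> cnorm (u' (v w))^-1 <= 2 / m.
  move=> /um h; rewrite cnormV -[2 / m]invf_div lef_pV2 ?posrE// ?divr_gt0//.
  by rewrite (lt_le_trans _ h)// divr_gt0.
move=> w1 /vP[vd uv]; split.
- have := ler_cnormB (v w1) z0; move: vd; rewrite /cball /=; lra.
- have := vV _ vd; have := cnorm_ge0 z0; lra.
- move=> w2 /vP[vd2 uv2].
  have l := low _ _ vd vd2; rewrite uv uv2 in l.
  have [_ _ /(_ _ (cball_le dr vd2))] := H _ (cball_le dr vd); rewrite uv uv2 => q.
  have -> : v w2 - v w1 - (u' (v w1))^-1 * (w2 - w1) =
     - (u' (v w1))^-1 * (w2 - w1 - u' (v w1) * (v w2 - v w1)).
    by field; exact: u'0.
  rewrite cnormM cnormN.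
  have l2 : cnorm (v w2 - v w1) <= 4 / m * cnorm (w2 - w1).
    by rewrite mulrAC ler_pdivlMr//; lra.
  apply: (@le_trans _ _ (2 / m * (L * (4 / m * cnorm (w2 - w1)) ^+ 2))).
    apply: ler_pM; rewrite ?cnorm_ge0 ?vV//; apply: (le_trans q).
    rewrite ler_wpM2l// lerXn2r ?nnegrE ?cnorm_ge0//.
    by apply: mulr_ge0 (cnorm_ge0 _); apply: divr_ge0 => //; exact: ltW.
  rewrite (exprMn _ (4 / m)) (mulrA L) (mulrA (2 / m)) (mulrA (2 / m)).
  by apply: ler_wpM2r; [exact: sqr_ge0|rewrite lerDr !addr_ge0 ?cnorm_ge0 ?(ltW d0)].
Qed.

Definition gen g z := exists2 D, D != 0 & hasd g z D.

(** [nlc] stands for nowhere locally constant. *)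
Definition nlc g := forall z0 (r : R), 0 < r -> exists2 z, cball z0 r z & g z <> g z0.

Lemma mero_cst (y : S) : mero (fun=> y).
Proof.
move=> z0; case: y => [v|].
  by exists 1, (fun=> v), (fun=> 1); split => //; exact: pairhol_Some (holx_cst _ _ _).
exists 1, (fun=> 1), (fun=> 0); split => //; split; [exact: holx_cst|exact: holx_cst|].
by move=> z _; rewrite oner_eq0 projS_None.
Qed.

Lemma gen_nlc g z : mero g -> gen g z -> nlc g.
Proof.
move=> mg [D D0 gD] z0 r r0; apply: contrapT => h.
have gc : forall w, g w = g z0.
  apply: (mero_identity (z0 := z0) mg (mero_cst (g z0)) r0) => w wr.
  by apply: contrapT => gw; apply: h; exists w.
have [v gv] := hasd_fin gD.
have : hasd g z 0.
  exists 1, (fun=> v), (fun=> 0); split => //; first exact: hol_cst.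
  by move=> w _; rewrite gc -gv gc.
by move=> /(hasd_unique gD) /eqP; rewrite (negPf D0).
Qed.

Lemma nlc_isolated g z0 : mero g -> nlc g ->
  exists2 r : R, 0 < r & forall z, cball z0 r z -> z != z0 -> g z <> g z0.
Proof.
move=> mg ng; have [[r r0 rP]|//] := mero_local_eq z0 mg (mero_cst (g z0)).
by have [z /rP] := ng z0 _ r0.
Qed.

Lemma nlc_sinv g : nlc g -> nlc (@sinv R \o g).
Proof.
move=> ng z0 r r0; have [z zr gz] := ng z0 _ r0; exists z => //=.
by move=> /(congr1 (@sinv R)); rewrite !sinvK.
Qed.

Lemma hasd_sinv g z D (v : C) : hasd g z D -> g z = Some v -> v != 0 ->
  hasd (@sinv R \o g) z (- D / v ^+ 2).
Proof.
move=> [r [u [u' [r0 hu gu <-]]]] gv v0.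
have uv : u z = v by have := gu _ (cball_center z r0); rewrite gv => -[].
rewrite -uv in v0 *.
have [d /andP[d0 dr] dB] := hol_neq0 r0 hu v0.
have b0 : 0 < cnorm (u z) / 2 by rewrite divr_gt0// cnorm_gt0.
have hi := holV b0 dB (hol_shrink dr hu).
exists d, (fun z => (u z)^-1), (fun z => - u' z / u z ^+ 2); split => // w wd.
rewrite /= gu /=; last exact: cball_le wd.
by rewrite ifN// -cnorm_gt0 (lt_le_trans b0)// dB.
Qed.

(** Zeros of the derivative are isolated by [hol_zero_order]. A pole is treated through the inverse
    map, which is finite there and nonzero at nearby points. *)
Lemma mero_generic g : mero g -> nlc g -> forall z0,
  exists2 r : R, 0 < r & forall z, cball z0 r z -> z != z0 -> gen g z.
Proof.
have main g0 z0 (v : C) : mero g0 -> nlc g0 -> g0 z0 = Some v ->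
    exists2 r : R, 0 < r & forall z, cball z0 r z -> z != z0 -> gen g0 z.
  move=> mg ng gv; have [r [u [u' [r0 hu gu]]]] := mero_chart mg gv.
  have [u'' hu'] := hol_deriv r0 hu.
  have r16 : 0 < r / 16 by rewrite divr_gt0.
  have rr : r / 16 <= r by lra.
  have [[d d0 dP]|[k [c [d [c0 d0 dP]]]]] := hol_zero_order r16 hu'.
    pose m := Num.min d r.
    have m0 : 0 < m by rewrite lt_min d0.
    have hm : hol z0 m u (fun=> 0).
      apply: (eq_hol (fun w _ => erefl (u w)) _ (hol_shrink _ hu)).
        by move=> w wm; apply: dP; apply: cball_le wm; rewrite ge_min lexx.
      by rewrite ge_min lexx orbT.
    have [z zm gz] := ng z0 m m0; case: gz.
    have mr : m <= r by rewrite ge_min lexx orbT.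
    rewrite !gu ?(hol_const_ball hm zm (cball_center z0 m0))//.
      exact: cball_center.
    exact: cball_le mr _ zm.
  exists (Num.min d r); first by rewrite lt_min d0.
  move=> z; rewrite /cball /= lt_min => /andP[zd zr] zz0.
  exists (u' z); last exact: hasd_ball hu gu _ zr.
  by rewrite -cnorm_gt0 (lt_le_trans _ (dP z zd))// mulr_gt0// exprn_gt0// cnorm_gt0 subr_eq0.
move=> mg ng z0; case gv: (g z0) => [v|]; first exact: main gv.
have [|r r0 rP] := main _ z0 0 (mero_sinv mg) (nlc_sinv ng); first by rewrite /= gv.
have [s s0 sP] := nlc_isolated z0 (mero_sinv mg) (nlc_sinv ng).
exists (Num.min r s); first by rewrite lt_min r0.
move=> z; rewrite /cball /= lt_min => /andP[zr zs] zz0.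
have [D D0 hD] := rP z zr zz0; have [v ev] := hasd_fin hD.
have v0 : v != 0.
  by apply/eqP => v0; apply: (sP z zs zz0); rewrite ev v0 /= gv.
exists (- D / v ^+ 2).
  by rewrite mulf_neq0 ?oppr_eq0 ?invr_eq0 ?expf_neq0.
by apply: hasd_eq ltr01 _ (hasd_sinv hD ev v0) => w _; rewrite /= sinvK.
Qed.

(** The open mapping theorem, with target points given as values of a second meromorphic map; this
    dispenses with neighbourhoods on the sphere and treats infinity like any other value. *)
Lemma mero_open g h z0 z1 (d : R) : mero g -> nlc g -> mero h -> g z0 = h z1 -> 0 < d ->
  exists2 e : R, 0 < e & forall z, cball z1 e z -> exists2 w, cball z0 d w & g w = h z.
Proof.
have main g0 h0 (v : C) : mero g0 -> nlc g0 -> mero h0 -> g0 z0 = Some v -> g0 z0 = h0 z1 ->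
    0 < d -> exists2 e : R, 0 < e & forall z, cball z1 e z -> exists2 w, cball z0 d w & g0 w = h0 z.
  move=> mg ng mh gv gh d0; have [r [u [u' [r0 hu gu]]]] := mero_chart mg gv.
  have hv : h0 z1 = Some v by rewrite -gh.
  have [s [w [w' [s0 hw hw1]]]] := mero_chart mh hv.
  have uv : u z0 = v by have := gu _ (cball_center z0 r0); rewrite gv => -[].
  have wv : w z1 = v by have := hw1 _ (cball_center z1 s0); rewrite hv => -[].
  have m0 : 0 < Num.min d r by rewrite lt_min d0.
  have [|e e0 eP] := open_mapping r0 hu _ m0.
    move=> [q q0 qP]; have q1 : 0 < Num.min q r by rewrite lt_min q0.
    have [x xm gx] := ng z0 _ q1; case: gx.
    rewrite !gu; [congr Some; apply: qP| exact: cball_center|].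
      by apply: cball_le xm; rewrite ge_min lexx.
    by apply: cball_le xm; rewrite ge_min lexx orbT.
  have [q /andP[q0 qs] qP] := hol_cont s0 hw e0.
  exists q => // z zq; have [|x] := eP (w z); first by rewrite uv -wv; exact: qP.
  rewrite lt_min => /andP[xd xr] ux; exists x => //.
  by rewrite gu// ux -hw1//; exact: cball_le qs _ zq.
move=> mg ng mh gh d0; case gv: (g z0) => [v|]; first exact: main gv gh d0.
have [|e e0 eP] := main _ _ 0 (mero_sinv mg) (nlc_sinv ng) (mero_sinv mh) _ (congr1 (@sinv R) gh) d0.
  by rewrite /= gv.
exists e => // z /eP[w wd gw]; exists w => //.
by rewrite -[LHS]sinvK -[RHS]sinvK; congr sinv.
Qed.

End Mero.

(** * Pointwise derivatives and null sets under rational maps *)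

Section NullSets.
Variable R : realType.
Local Notation C := R[i].
Local Notation S := (sphere R).
Implicit Types (z w a D : C) (u v : C -> C) (g h : C -> S) (f : ratmap R) (A : set C).

(** Complex derivative with real epsilons; [pd_derive] and [derivable_pd] translate to and from
    [derive1]. *)
Definition pd u z D := forall e : R, 0 < e -> exists2 d : R, 0 < d &
  forall w, cnorm (w - z) < d -> cnorm (u w - u z - D * (w - z)) <= e * cnorm (w - z).

Lemma nbhs_cball z (P : set C) : nbhs z P <-> exists2 r : R, 0 < r & cball z r `<=` P.
Proof.
split.
  move=> /nbhs_ballP[e /= e0 eP]; exists (Re e).
    by move: e0; rewrite ltcE => /andP[_].
  move=> w wz; apply: eP; rewrite /ball /= distrC normC_cnorm ltcE /=.
  by move: e0 wz; rewrite /cball /= ltcE => /andP[/eqP -> _] ->; rewrite eqxx.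
move=> [r r0 rP]; apply/nbhs_ballP; exists r%:C => /=; first by rewrite ltcR.
move=> w; rewrite /ball /= distrC normC_cnorm ltcR => wz; exact: rP.
Qed.

Lemma pd_derive u z D : pd u z D -> derivable u z 1 /\ derive1 u z = D.
Proof.
move=> H.
have cv : (fun h : C => h^-1 *: (u (h + z) - u z)) @ 0^' --> D.
  apply/cvgrPdist_le => e e0.
  have re0 : 0 < Re e by move: e0; rewrite ltcE => /andP[_].
  have [d d0 dP] := H _ re0.
  apply/(nbhs_cball (0 : C)); exists d => // h; rewrite /cball /= subr0 => hd h0.
  have := dP (h + z); rewrite addrK => /(_ hd) hh.
  rewrite normC_cnorm (_ : e = (Re e)%:C); last first.
    by move: e0; rewrite ltcE => /andP[/eqP]; case: (e) => x y /= ->.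
  rewrite lecR cnormB (_ : h^-1 *: (u (h + z) - u z) - D =
     h^-1 * (u (h + z) - u z - D * h)); last first.
    change (h^-1 * (u (h + z) - u z) - D = h^-1 * (u (h + z) - u z - D * h)).
    by rewrite [RHS]mulrBr [X in _ = _ - X]mulrCA mulVf// mulr1.
  by rewrite cnormM cnormV mulrC ler_pdivrMr ?cnorm_gt0.
split.
  apply/cvg_ex; exists D; apply: cvg_trans cv; apply: near_eq_cvg.
  by apply: nearW => h /=; rewrite /GRing.scale /= mulr1.
by rewrite /derive1; apply: cvg_lim cv.
Qed.

Lemma derivable_pd u z : derivable u z 1 -> pd u z (derive1 u z).
Proof.
move=> du.
have cv : (fun h : C => h^-1 *: (u (h + z) - u z)) @ 0^' --> derive1 u z.
  rewrite /derive1; move: du => /cvg_ex[l lP].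
  apply/cvg_ex; exists l; apply: cvg_trans lP; apply: near_eq_cvg.
  by apply: nearW => h /=; rewrite /GRing.scale /= mulr1.
move=> e e0; move/cvgrPdist_le: cv => /(_ e%:C); rewrite ltcR => /(_ e0).
move=> /(nbhs_cball (0 : C))[d d0 dP]; exists d => // w wd.
have [->|wz] := eqVneq w z; first by rewrite !subrr mulr0 subrr cnorm0 mulr0.
have wz0 : w - z != 0 by rewrite subr_eq0.
have := dP (w - z); rewrite /cball /= subr0 => /(_ wd wz0).
rewrite normC_cnorm lecR subrK => h.
have {}h : cnorm ((w - z)^-1 * (u w - u z) - derive1 u z) <= e by rewrite cnormB.
move: h; rewrite (_ : (w - z)^-1 * (u w - u z) - derive1 u z =
     (w - z)^-1 * (u w - u z - derive1 u z * (w - z))); last first.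
  by rewrite [RHS]mulrBr [X in _ = _ - X]mulrCA mulVf// mulr1.
by rewrite cnormM cnormV mulrC ler_pdivrMr ?cnorm_gt0.
Qed.

Lemma pd_growth u z D (e : R) : pd u z D -> 0 < e -> exists2 d : R, 0 < d &
  forall w, cnorm (w - z) < d -> cnorm (u w - u z) <= (cnorm D + e) * cnorm (w - z).
Proof.
move=> h e0; have [d d0 dP] := h e e0; exists d => // w /dP {}h.
rewrite -[u w - u z](subrK (D * (w - z))) (le_trans (ler_cnormD _ _))//.
by rewrite mulrDl addrC lerD// cnormM.
Qed.

Lemma pd_lip u z D : pd u z D -> exists2 d : R, 0 < d &
  forall w, cnorm (w - z) < d -> cnorm (u w - u z) <= (cnorm D + 1) * cnorm (w - z).
Proof. by move=> h; exact: pd_growth h ltr01. Qed.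

Lemma pd_eq u v z D (r : R) : 0 < r -> (forall w, cball z r w -> u w = v w) ->
  pd u z D -> pd v z D.
Proof.
move=> r0 uv H e /H[d d0 dP]; exists (Num.min d r); first by rewrite lt_min d0.
by move=> w; rewrite lt_min => /andP[wd wr]; rewrite -!uv// ?dP//; exact: cball_center.
Qed.

Lemma pd_comp u v z D D' : pd v z D -> pd u (v z) D' -> pd (u \o v) z (D' * D).
Proof.
move=> hv hu e e0; have [d1 d10 d1P] := pd_lip hv.
have K0 : 0 < 2 * (cnorm D + 1) by rewrite mulr_gt0// ltr_wpDl ?cnorm_ge0.
have K1 : 0 < 2 * (cnorm D' + 1) by rewrite mulr_gt0// ltr_wpDl ?cnorm_ge0.
have [d2 d20 d2P] := hu _ (divr_gt0 e0 K0); have [d3 d30 d3P] := hv _ (divr_gt0 e0 K1).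
have Kp : 0 < cnorm D + 1 by rewrite ltr_wpDl ?cnorm_ge0.
exists (Num.min d1 (Num.min d3 (d2 / (cnorm D + 1)))).
  by rewrite !lt_min d10 d30 divr_gt0.
move=> w; rewrite !lt_min => /and3P[w1 w3 w2].
have h1 := d1P w w1; have h3 := d3P w w3.
have vd2 : cnorm (v w - v z) < d2.
  by apply: (le_lt_trans h1); move: w2; rewrite ltr_pdivlMr// mulrC.
have h2 := d2P _ vd2; rewrite /= (_ : _ - _ - _ =
  (u (v w) - u (v z) - D' * (v w - v z)) + D' * (v w - v z - D * (w - z))); last by ring.
apply: (le_trans (ler_cnormD _ _)); rewrite cnormM.
have s1 : e / (2 * (cnorm D + 1)) * cnorm (v w - v z) <= e / 2 * cnorm (w - z).
  apply: (@le_trans _ _ (e / (2 * (cnorm D + 1)) * ((cnorm D + 1) * cnorm (w - z)))).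
    by apply: ler_wpM2l => //; rewrite ltW// divr_gt0.
  by apply: eqW; field; rewrite gt_eqF.
have s2 : cnorm D' * cnorm (v w - v z - D * (w - z)) <= e / 2 * cnorm (w - z).
  apply: (@le_trans _ _ ((cnorm D' + 1) * (e / (2 * (cnorm D' + 1)) * cnorm (w - z)))).
    by apply: ler_pM; rewrite ?cnorm_ge0// lerDl.
  apply: eqW; field.
  by rewrite gt_eqF// ltr_wpDl ?cnorm_ge0.
lra.
Qed.

Lemma pd_unique u z D D' : pd u z D -> pd u z D' -> D = D'.
Proof. by move=> /pd_derive[_ <-] /pd_derive[_ <-]. Qed.

Lemma hol_pd z0 (r : R) u u' z : hol z0 r u u' -> cball z0 r z -> pd u z (u' z).
Proof.
move=> [L L0 H] zr e e0; have [_ _ {}H] := H z zr.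
have [d d0 dr] := cball_inner zr; have L1 : 0 < L + 1 by rewrite ltr_wpDl.
exists (Num.min d (e / (L + 1))); first by rewrite lt_min d0 divr_gt0.
move=> w; rewrite lt_min => /andP[wd we]; apply: (le_trans (H w (dr _ wd))).
rewrite expr2 mulrA ler_wpM2r ?cnorm_ge0//.
move: we; rewrite ltr_pdivlMr// => /ltW; apply: le_trans.
by rewrite mulrC ler_wpM2l ?cnorm_ge0// lerDl.
Qed.

Lemma hasd_pd g z D : hasd g z D -> pd (@fin R \o g) z D.
Proof.
move=> [r [u [u' [r0 hu gu <-]]]]; apply: (pd_eq r0) (hol_pd hu (cball_center z r0)).
by move=> w /gu /= ->.
Qed.

Lemma planar_derive_hasd (k : S -> S) z D : hasd (k \o Some) z D -> planar_derive k z = D.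
Proof. by move=> /hasd_pd /pd_derive[]. Qed.

Lemma null_area (N : set S) : null N <-> area [set z | N (Some z)] = 0%E.
Proof. exact: negligible_area. Qed.

Lemma area1 z : area [set z] = 0%E.
Proof.
apply/eqP; rewrite eq_le area_ge0 andbT; apply/lee_addgt0Pr => e e0.
have e1 : 0 < Num.min 1 (e / 4) by rewrite lt_min ltr01 divr_gt0.
have zz : [set z] `<=` cball z (Num.min 1 (e / 4)) by move=> w ->; exact: cball_center.
apply: (le_trans (le_area zz)); apply: (le_trans (area_cball _ (ltW e1))).
rewrite add0e lee_fin expr2.
have : Num.min 1 (e / 4) <= 1 by rewrite ge_min lexx.
have : Num.min 1 (e / 4) <= e / 4 by rewrite ge_min lexx orbT.
nra.
Qed.

Lemma area_roots (p : {poly C}) : p != 0 -> area [set z | p.[z] = 0] = 0%E.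
Proof.
move=> p0; have [s sP] := closed_field_poly_normal p.
apply: (@area_sub0 _ _ [set z | z \in s]).
  move=> z /= /eqP; rewrite sP hornerZ mulf_eq0 lead_coef_eq0 (negPf p0) /=.
  by rewrite -[X in X == 0 -> _]/(_.[z]) -rootE root_prod_XsubC.
elim: s {sP} => [|a s IH].
  by rewrite (_ : [set z | _] = set0) ?area0//; apply/seteqP; split => z.
apply: (@area_sub0 _ _ ([set a] `|` [set z | z \in s])).
  by move=> z /=; rewrite in_cons => /orP[/eqP|]; [left|right].
by apply: areaU0 => //; exact: area1.
Qed.

(** A lower bound on distances makes the inverse Lipschitz. As the bound is only local, [A] is cut
    into countably many pieces on which [u] is injective with a Lipschitz inverse. *)
Lemma area_preimage0 A u : area (u @` A) = 0%E ->
  (forall z, A z -> exists c d : R, [/\ 0 < c, 0 < d & forall w, A w ->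
     cnorm (w - z) < d -> c * cnorm (w - z) <= cnorm (u w - u z)]) ->
  area A = 0%E.
Proof.
move=> uA0 H.
pose An (n : nat) := [set z | A z /\ forall w, A w -> cnorm (w - z) < n.+1%:R^-1 ->
   cnorm (w - z) <= n.+1%:R * cnorm (u w - u z)].
(* With this mesh, two points of one cell are closer than 1/(n+1), as membership in [An n]
   requires. *)
have cov : A `<=` \bigcup_n \bigcup_j (An n `&` grid (2 * n.+1)%N j).
  move=> z Az; have [c [d [c0 d0 cd]]] := H z Az.
  have m0 : 0 < Num.min c d by rewrite lt_min c0.
  have [n nm] := invSn_lt m0; exists n => //.
  have [j zj] := grid_cover (2 * n.+1) z; exists j => //; split => //; split => // w Aw wz.
  have := cd w Aw; move: nm; rewrite lt_min => /andP[nc nd].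
  move=> /(_ (lt_trans wz nd)) h; rewrite mulrC -ler_pdivrMr// mulrC.
  by rewrite (le_trans _ h)// ler_wpM2r ?cnorm_ge0// ltW.
apply: area_sub0 cov _; apply: area_bigcup0 => n; apply: area_bigcup0 => j.
set E := An n `&` _.
have Elip z w : E z -> E w -> cnorm (w - z) <= n.+1%:R * cnorm (u w - u z).
  move=> [[Az zP] gz] [[Aw _] gw]; apply: zP => //.
  apply: (lt_le_trans (grid_dist gw gz)); rewrite ler_pdivrMr// mulrC.
  by rewrite ler_pdivlMr// -natrM ler_nat ltnW// mulnC.
have /choice[v vP] y : exists z, (u @` E) y -> E z /\ u z = y.
  have [[z Ez <-]|nE] := pselect ((u @` E) y); first by exists z.
  by exists 0.
have vu z : E z -> v (u z) = z.
  move=> Ez; have [Ev uv] := vP _ (ex_intro2 _ _ _ Ez (erefl (u z))).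
  by apply: cnorm_le0_eq; have := Elip _ _ Ez Ev; rewrite uv subrr cnorm0 mulr0.
apply: (@area_sub0 _ _ (v @` (u @` E))); first by move=> z Ez; exists (u z); [exists z|exact: vu].
apply: area_image0.
  by apply: area_sub0 uA0 => y [z [[Az _] _] <-]; exists z.
move=> y /vP[Ey <-]; exists n.+1%:R, 1; split => // w /vP[Ew <-] _.
by rewrite !vu//; exact: Elip.
Qed.

(** The Wronskian, numerator of the derivative of the rational map; its roots are critical points or
    common with the denominator. *)
Definition wron f : {poly C} := (rnum f)^`() * rden f - rnum f * (rden f)^`().

(** If p' q = p q' with p and q coprime, then p divides p', which has smaller degree; in
    characteristic 0 this makes p constant, and likewise q. *)
Lemma wron_neq0 f : (0 < rdeg f)%N -> wron f != 0.
Proof.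
move=> d0; apply/eqP => /eqP; rewrite subr_eq0 => /eqP w0.
have small (p q : {poly C}) : coprimep p q -> p^`() * q = p * q^`() -> (size p <= 1)%N.
  move=> cpq e; rewrite leqNgt; apply/negP => sp.
  have pd : (p %| p^`())%R by rewrite -(Gauss_dvdpl _ cpq) e dvdp_mulr.
  have p'0 : p^`() != 0.
    apply/eqP => /(congr1 (fun r : {poly C} => r`_(size p).-2)); rewrite coef_deriv coef0.
    have -> : (size p).-2.+1 = (size p).-1 by move: sp; case: (size p) => [|[]].
    move/eqP; rewrite mulrn_eq0 -lead_coefE lead_coef_eq0 -size_poly_eq0.
    by move: sp; case: (size p) => [|[]].
  have := dvdp_leq p'0 pd; rewrite leqNgt lt_size_deriv//.
  by rewrite -size_poly_eq0 -lt0n ltnW.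
have s1 := small _ _ (rcoprime f) w0.
have s2 : (size (rden f) <= 1)%N.
  apply: (small _ (rnum f)); first by rewrite coprimep_sym rcoprime.
  by rewrite mulrC -w0 mulrC.
have sm : (maxn (size (rnum f)) (size (rden f)) <= 1)%N by rewrite geq_max s1.
by move: d0 sm; rewrite /rdeg; case: (maxn _ _) => [|[]].
Qed.

Lemma hasd_reval f z : (rden f).[z] != 0 ->
  hasd (reval f \o Some) z ((wron f).[z] / (rden f).[z] ^+ 2).
Proof.
move=> q0; have hq := hol_poly z 1 (rden f); have hp := hol_poly z 1 (rnum f).
have [d /andP[d0 d1] dB] := hol_neq0 ltr01 hq q0.
have b0 : 0 < cnorm (rden f).[z] / 2 by rewrite divr_gt0// cnorm_gt0.
have := holM (hol_shrink d1 hp) (holV b0 dB (hol_shrink d1 hq)) => h.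
do 3 eexists; split; [exact: d0|exact: h| |].
  move=> w wd; change (projS (rnum f).[w] (rden f).[w] = Some ((rnum f).[w] / (rden f).[w])).
  by rewrite projS_fin// -cnorm_gt0 (lt_le_trans b0)//; exact: dB.
by rewrite /= /wron hornerD hornerN !hornerM; field.
Qed.

Lemma mero_Some : mero (fun z => Some z : S).
Proof.
move=> z0; exists 1, id, (fun=> 1); split => //.
by apply: pairhol_Some; eexists; exact: hol_id.
Qed.

Definition crit f : set C := [set z | (rden f).[z] = 0 \/ (wron f).[z] = 0].

Lemma area_crit f : (0 < rdeg f)%N -> area (crit f) = 0%E.
Proof.
move=> d0; have w0 := wron_neq0 d0.
have q0 : rden f != 0.
  by apply: contra_neq w0 => q0; rewrite /wron q0 deriv0 !mulr0 subrr.
by apply: areaU0; exact: area_roots.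
Qed.

Lemma crit_gen f z : ~ crit f z -> gen (reval f \o Some) z.
Proof.
move=> nz; have q0 : (rden f).[z] != 0 by apply/eqP => q0; apply: nz; left.
exists ((wron f).[z] / (rden f).[z] ^+ 2); last exact: hasd_reval.
rewrite mulf_neq0 ?invr_eq0 ?expf_neq0//.
by apply/eqP => w0; apply: nz; right.
Qed.

Definition fimage f A : set C := [set y | exists2 z, A z & reval f (Some z) = Some y].

Definition fpreimage f A : set C := [set z | exists2 y, A y & reval f (Some z) = Some y].

Lemma area_fimage0 f A : area A = 0%E -> area (fimage f A) = 0%E.
Proof.
move=> A0; apply: (@area_sub0 _ _ ((@fin R \o reval f \o Some) @`
  [set z | A z /\ (rden f).[z] != 0])).
  move=> y [z Az e]; exists z; last by rewrite /= e.
  by split => //; move: e => /projS_Some[].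
apply: area_image0; first by apply: area_sub0 A0 => z [].
move=> z [_ /hasd_reval/hasd_pd/pd_lip[d d0 dP]].
by do 2 eexists; split; [exact: d0|] => w _; exact: dP.
Qed.

Lemma gen_lower g z : gen g z -> exists c d : R, [/\ 0 < c, 0 < d & forall w,
  cnorm (w - z) < d -> c * cnorm (w - z) <= cnorm (fin (g w) - fin (g z))].
Proof.
move=> [D D0 [r [u [u' [r0 hu gu uD]]]]].
have [|d [s [c [v [v' [[/andP[d0 dr] s0 c0] [low _ _ _]]]]]]] := hol_inverse r0 hu.
  by rewrite uD.
exists c, d; split => // w wd; rewrite !gu/=; first exact: low (cball_center z d0) wd.
  exact: cball_center.
exact: cball_le dr _ wd.
Qed.

Lemma area_fpreimage0 f A : (0 < rdeg f)%N -> area A = 0%E -> area (fpreimage f A) = 0%E.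
Proof.
move=> d0 A0; apply: (@area_sub0 _ _ (crit f `|` (fpreimage f A `\` crit f))).
  by move=> z Az; have [|] := pselect (crit f z); [left|right].
apply: areaU0; first exact: area_crit.
apply: (@area_preimage0 _ (@fin R \o reval f \o Some)).
  by apply: area_sub0 A0 => _ [z [[y Ay /= -> _] <-]].
move=> z [_ /crit_gen/gen_lower[c [d [c0 dd H]]]]; exists c, d; split => // w _; exact: H.
Qed.

Lemma reval_fin_ae f : (0 < rdeg f)%N -> area [set z | reval f (Some z) = None] = 0%E.
Proof.
move=> d0; apply: area_sub0 (area_crit d0) => z /=; rewrite reval_Some /projS.
by case: eqP => // h _; left.
Qed.

Lemma nonsingular_reval f : (0 < rdeg f)%N -> nonsingular (reval f).
Proof.
move=> d0 N /null_area N0; apply/null_area.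
apply: area_sub0 (areaU0 (reval_fin_ae d0) (area_fpreimage0 d0 N0)) => z /=.
case e: (reval f (Some z)) => [y|] Ny; last by left.
by right; exists y.
Qed.

Lemma fiber_ae f (y : S) : (0 < rdeg f)%N -> area [set z | reval f (Some z) = y] = 0%E.
Proof.
move=> d0; case: y => [y|]; last exact: reval_fin_ae.
by apply: area_sub0 (area_fpreimage0 d0 (area1 y)) => z /= e; exists y.
Qed.

(** A point that [k] sends into [N] has the same image under R as a point of [N], so the preimage of
    [N] lies in R^(-1)(R(N)) up to fibres. *)
Lemma nonsingular_deck f (k : S -> S) : (0 < rdeg f)%N ->
  (forall x, reval f (k x) = reval f x) -> nonsingular k.
Proof.
move=> d0 Fk N /null_area N0; apply/null_area.
apply: area_sub0 (areaU0 (areaU0 (reval_fin_ae d0) (fiber_ae (reval f None) d0))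
  (area_fpreimage0 d0 (area_fimage0 f N0))) => z /= Nk.
case e: (reval f (Some z)) => [y|]; last by left; left.
case kz: (k (Some z)) => [w|]; last by left; right; rewrite /= -kz Fk.
by right; exists y => //; exists w; [rewrite /= -kz|rewrite -kz Fk].
Qed.

End NullSets.

(** * The deck group and the fundamental equation *)

Section Functionals.
Variable R : realType.
Local Notation C := R[i].
Local Notation mR := (measurableTypeR R).
Local Notation T := (mR * mR)%type.
Local Notation mu := (@planar_measure R).
Local Notation tp := (@to_plane R).
Implicit Types (u v : L1 R) (A : set T).

Definition lint A (h : C -> C) : C :=
  (\int[mu]_(x in A) Re (h (tp x))) +i* (\int[mu]_(x in A) Im (h (tp x))).

Lemma cintegrableP (h : cintegrable_fun R) : cintegrable h.
Proof. by case: h => h /= /asboolP. Qed.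

Lemma cintegrable_sub A (h : C -> C) : measurable A -> cintegrable h ->
  mu.-integrable A (EFin \o (fun x => Re (h (tp x)))) /\
  mu.-integrable A (EFin \o (fun x => Im (h (tp x)))).
Proof. by move=> mA [hr hi]; split; apply: integrableS (measurableT) mA _ _. Qed.

Lemma lint_ae A (h k : C -> C) : measurable A -> cintegrable h -> cintegrable k ->
  cae_eq h k -> lint A h = lint A k.
Proof.
move=> mA /(cintegrable_sub mA)[hr hi] /(cintegrable_sub mA)[kr ki] hk.
congr (_ +i* _); rewrite /Rintegral; congr fine; apply: ae_eq_integral => //.
- by case/integrableP: hr.
- by case/integrableP: kr.
- by apply: filterS hk => x -> _.
- by case/integrableP: hi.
- by case/integrableP: ki.
- by apply: filterS hk => x -> _.
Qed.

Lemma lint_linear A (a : C) (h k : C -> C) : measurable A -> cintegrable h -> cintegrable k ->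
  lint A (fun z => a * h z + k z) = a * lint A h + lint A k.
Proof.
move=> mA /(cintegrable_sub mA)[hr hi] /(cintegrable_sub mA)[kr ki].
have ZL (c : R) (g : T -> R) : mu.-integrable A (EFin \o g) ->
    mu.-integrable A (EFin \o (fun x => c * g x)) 
    by move=> gi; apply: (eq_integrable _ (fun x => (c%:E * (EFin \o g) x)%E)) => //; exact: integrableZl.
have DL (g1 g2 : T -> R) : mu.-integrable A (EFin \o g1) -> mu.-integrable A (EFin \o g2) ->
    mu.-integrable A (EFin \o (fun x => g1 x + g2 x)) 
    by move=> i1 i2; apply: (eq_integrable _ ((EFin \o g1) \+ (EFin \o g2))%E) => //; exact: integrableD.
have comb (c1 c2 : R) (g1 g2 g3 : T -> R) : mu.-integrable A (EFin \o g1) ->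
    mu.-integrable A (EFin \o g2) -> mu.-integrable A (EFin \o g3) ->
    \int[mu]_(x in A) (c1 * g1 x + c2 * g2 x + g3 x) = c1 * (\int[mu]_(x in A) g1 x)
      + c2 * (\int[mu]_(x in A) g2 x) + \int[mu]_(x in A) g3 x.
  move=> i1 i2 i3; rewrite -!RintegralZl// -!RintegralD//; try exact: ZL.
  by apply: DL; exact: ZL.
case: a => a1 a2; rewrite /lint.
transitivity ((\int[mu]_(x in A) (a1 * Re (h (tp x)) + (- a2) * Im (h (tp x)) + Re (k (tp x)))) +i*
  (\int[mu]_(x in A) (a1 * Im (h (tp x)) + a2 * Re (h (tp x)) + Im (k (tp x))))).
  congr (_ +i* _); apply: eq_Rintegral => x _.
    by case: (h _) (k _) => [x1 x2] [y1 y2] /=; rewrite mulNr.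
  by case: (h _) (k _) => [x1 x2] [y1 y2] /=.
by rewrite !comb// mulNr.
Qed.

Lemma repr_linear (a : C) u v :
  cae_eq (repr (a *: u + v)) (fun z => a * repr u z + repr v z).
Proof.
have -> : a *: u + v = \pi_(L1 R) (a *: repr u + repr v).
  by rewrite L1_piD reprK.
exact: (L1_reprP (a *: repr u + repr v)).
Qed.

Lemma cintegrable_lin (a : C) (h k : cintegrable_fun R) :
  cintegrable (fun z => a * h z + k z).
Proof. exact: cintegrableP (a *: h + k). Qed.

(** Integration over [A]. By [lfun_inj] these bounded functionals separate the points of [L1 R], so
    equalities in [L1 R] can be tested on scalars. *)
Definition lfun A u : C := lint A (repr u).

Lemma lfun_scalar A : measurable A -> scalar (lfun A).
Proof.
move=> mA a u v; rewrite /lfun -lint_linear//; try exact: cintegrableP.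
apply: lint_ae => //; [exact: cintegrableP|exact: cintegrable_lin|exact: repr_linear].
Qed.

Lemma cnorm_lfun A u : measurable A -> cnorm (lfun A u) <= 2 * norm1 (repr u).
Proof.
move=> mA; have [hr hi] := cintegrable_sub mA (cintegrableP (repr u)).
have hn := integrable_normc (repr u).
have hnA : mu.-integrable A (EFin \o (fun x => cnorm (repr u (tp x)))).
  by apply: integrableS measurableT mA _ hn.
have sub : \int[mu]_(x in A) cnorm (repr u (tp x)) <= norm1 (repr u).
  apply: fine_le; [exact: integrable_fin_num|exact: integrable_fin_num|].
  apply: ge0_subset_integral => //; first by case/integrableP: hn.
  by move=> x _; rewrite lee_fin cnorm_ge0.
have nr (g : T -> R) : mu.-integrable A (EFin \o g) ->
    (forall x, `|g x| <= cnorm (repr u (tp x))) -> `|\int[mu]_(x in A) g x| <= norm1 (repr u).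
  move=> gi gn; apply: le_trans sub; apply: (le_trans (le_normr_Rintegral mA gi)).
  by apply: le_Rintegral => //; exact: (integrable_abse gi).
apply: (le_trans (normc_le_ReIm _)); rewrite mulr_natl mulr2n lerD// nr// => x.
  exact: ler_cnorm_Re.
exact: ler_cnorm_Im.
Qed.

Lemma lfun_bounded A : measurable A -> bounded_functional (lfun A).
Proof.
move=> mA; split; first exact: lfun_scalar.
move=> u B /nbhs_cball[e e0 eB]; apply/nbhs_ballP.
exists (e / 2)%:C => /=; first by rewrite ltcR divr_gt0.
move=> v; rewrite -ball_normE /= => uv.
apply: eB; change (cnorm (lfun A v - lfun A u) < e); rewrite cnormB.
have -> : lfun A u - lfun A v = lfun A (u - v).
  have := lfun_scalar mA (-1) v u; rewrite scaleN1r mulN1r (addrC (- v)) => ->.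
  exact: addrC.
apply: (le_lt_trans (cnorm_lfun (u - v) mA)); rewrite mulrC -ltr_pdivlMr//.
by rewrite -ltcR.
Qed.

Lemma lfun_inj u v : (forall A, measurable A -> lfun A u = lfun A v) -> u = v.
Proof.
move=> uv; rewrite -[u]reprK -[v]reprK; apply/L1_eqP.
have [ur ui] := cintegrableP (repr u); have [vr vi] := cintegrableP (repr v).
have part (g k : T -> R) : mu.-integrable setT (EFin \o g) -> mu.-integrable setT (EFin \o k) ->
    (forall A, measurable A -> \int[mu]_(x in A) g x = \int[mu]_(x in A) k x) ->
    ae_eq mu setT (EFin \o g) (EFin \o k).
  move=> gi ki gk; apply: integral_ae_eq => //; first by case/integrableP: ki.
  move=> E _ mE.
  have giE : mu.-integrable E (EFin \o g) by apply: integrableS gi.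
  have kiE : mu.-integrable E (EFin \o k) by apply: integrableS ki.
  rewrite -(fineK (integrable_fin_num mE giE)) -(fineK (integrable_fin_num mE kiE)).
  by congr _%:E; exact: gk.
have h1 := part _ _ ur vr (fun A mA => congr1 (@complex.Re R) (uv A mA)).
have h2 := part _ _ ui vi (fun A mA => congr1 (@complex.Im R) (uv A mA)).
apply: filterS2 h1 h2 => x /(_ I) [e1] /(_ I) [e2].
by move: e1 e2; case: (repr u _) (repr v _) => a b [c d] /= -> ->.
Qed.

End Functionals.

(** * Invariance under the deck group from the invariant mean *)

Section Amenable.
Variables (R : realType) (f : ratmap R) (D : 'I_(rdeg f) -> set (sphere R)).
Local Notation S := (sphere R).
Local Notation C := R[i].
Local Notation F := (reval f).
Hypothesis d0 : (0 < rdeg f)%N.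
Variable sigma : set S.
Hypothesis hD : sheets sigma D.

Lemma deck_invariant (k : S -> S) : deck_group D k -> forall x, F (k x) = F x.
Proof.
have [Fs _ _ bijD] := hD.
have swapF (i j : 'I_(rdeg f)) x : D i x -> F (pinv (D j) F (F x)) = F x.
  move=> xi; have [bi _ _] := bijD i; have [bj _ _] := bijD j.
  rewrite pinvK// inE; have [_ _ Fj] := bj; apply: Fj.
  by have [Fi _ _] := bi; exact: Fi.
elim=> {k} [i j x|x|g h _ IHg _ IHh x|g h _ IHg gh hg x] //.
- rewrite /deck_swap; case: ifPn => [|_]; first by rewrite inE; exact: swapF.
  by case: ifPn => //; rewrite inE; exact: swapF.
- by rewrite /= IHg IHh.
- by rewrite -{2}[x]hg IHg.
Qed.

Let gen_ns (k : S -> S) (kP : deck_group D k) : `[< nonsingular (k \o F) >].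
Proof.
apply/asboolP => N N0.
exact: (nonsingular_reval d0 (nonsingular_deck d0 (deck_invariant kP) N0)).
Qed.

Let gen_ae k (kP : deck_group D k) : aemap R := \pi_(aemap R) (NsMap (gen_ns kP)).

Let gen_rep k (kP : deck_group D k) : represents (gen_ae kP) (k \o F).
Proof. by apply: (aemapP (repr (gen_ae kP)) (NsMap (gen_ns kP))).1; rewrite reprK. Qed.

Let gen_in k (kP : deck_group D k) : gen_ae kP \in gen_pred (ruelle_generators D).
Proof.
by apply/asboolP => A [_ GA]; apply: GA; exists k => //; exact: gen_rep.
Qed.

Let elt k (kP : deck_group D k) : deck_semigroup D := GenSemigroup (gen_in kP).

Let E := elt (deck_id D).

(* [F \o k = F] for a deck map [k]: a product beginning with [F] is a power. *)
Lemma generator_power (a : deck_semigroup D) :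
  exists n, (E * a = iter n (fun b => E * b) E)%g.
Proof.
have [n nP] : exists n, (val E * val a = iter n (fun b => val E * b) (val E))%g; last first.
  exists n; apply: val_inj => /=; rewrite [LHS]nP.
  by elim: n {nP} => //= n ->.
have /asboolP := valP a => /(_ [set c | exists n,
  (val E * c = iter n (fun b => val E * b) (val E))%g]); apply; split.
- move=> b c [n nb] [m mc]; exists (n + m)%N; rewrite mulgA nb.
  elim: n {nb} => [|n IH] /=; first by rewrite mc.
  by rewrite -mulgA IH.
- move=> c [k kP ck]; exists 1%N => /=.
  rewrite -[c]reprK [LHS]aemap_mul_pi [RHS]aemap_mul_pi; apply/aemapP.
  apply: null_sub ck => x /=; apply: contra_not => ->.
  by rewrite (deck_invariant kP).
Qed.

Variable rho : deck_semigroup D -> L1 R -> L1 R.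
Hypothesis hrho : ruelle_representation rho.
Hypothesis hamen : left_amenable rho.

Lemma L1_of_repr (u : L1 R) (h : C -> C) : cae_eq (repr u) h -> L1_of h = u.
Proof.
move=> uh; rewrite /L1_of; case: xgetP => [v _ vh|/(_ u)//].
rewrite -[u]reprK -[v]reprK; apply/L1_eqP.
by apply: filterS2 uh vh => x <- <-.
Qed.

Lemma deck_act_id (u : L1 R) : deck_act id u = u.
Proof.
apply: L1_of_repr; apply: aeW => x /=.
have -> : planar_derive id (to_plane x) = 1.
  apply: planar_derive_hasd; exists 1, id, (fun=> 1); split => //; exact: hol_id.
by rewrite expr1n mulr1.
Qed.

Lemma sup_norm0 (G : semigroupType) (phi : G -> C) : inhabited G ->
  (forall s, phi s = 0) -> sup_norm phi = 0.
Proof.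
move=> [s0] p0; rewrite /sup_norm -[RHS]sup1; congr sup.
apply/seteqP; split => [_ [s _ <-]|_ ->]; first by rewrite p0 cnorm0.
by exists s0; rewrite // p0 cnorm0.
Qed.

(** Both translates of the matrix coefficient are constant functions, on which a mean takes the
    value of the constant; invariance equates the two constants for every integration functional. *)
Lemma amenable_deck_fixed (phi : L1 R) : ruelle f phi = phi ->
  forall k, deck_group D k -> deck_act k phi = phi.
Proof.
move=> fphi k kP; have [[endo mul [K KP]] genP] := hrho.
have [M [Mlin Mbd _ _ M1] Minv] := hamen.
have rhoE : rho E = ruelle f.
  rewrite (genP E id (deck_id D)); last exact: gen_rep.
  by apply/funext => u /=; rewrite deck_act_id.
(* Whatever [a] is, [E * a] is a power of [E], and [rho E] fixes [phi]. *)
have rhoEs (a : deck_semigroup D) : rho (E * a)%g phi = phi.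
  have [n ->] := generator_power a.
  by elim: n => [|n IH] /=; rewrite ?rhoE// mul IH rhoE.
have rhok (a : deck_semigroup D) : rho (elt kP * a)%g phi = deck_act k phi.
  rewrite mul (genP (elt kP) k kP); last exact: gen_rep.
  by rewrite /= -rhoE -mul rhoEs.
apply: lfun_inj => A mA; have lb := lfun_bounded mA.
pose xi (a : deck_semigroup D) := lfun A (rho a phi).
have xiX : X_space rho xi.
  move=> V [[V0 Vlin] GV]; apply: GV; left; split.
    exists (2 * (K * Re `|phi|)) => _ [a _ <-]; rewrite /xi.
    apply: (le_trans (cnorm_lfun _ mA)); rewrite ler_wpM2l//.
    have := KP a phi; rewrite [X in X <= _](_ : _ = (norm1 (repr (rho a phi)))%:C)//.
    by rewrite [`|phi|](_ : _ = (norm1 (repr phi))%:C)//= -rmorphM lecR.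
  move=> e e0; exists xi; last first.
    by rewrite (_ : sup_norm (xi - xi) = 0)//; apply: sup_norm0 => [|s];
      [exact: (inhabits E)|exact: subrr].
  by move=> W [_ GW]; apply: GW; exists phi, (lfun A).
have cstM c : M (cst c) = c.
  have L c' : Linfty (cst c' : deck_semigroup D -> C).
    by exists (cnorm c') => _ [s _ <-].
  have := Mlin c (cst 1) (cst 0) (L _) (L _).
  have -> : c *: cst 1 + cst 0 = cst c :> (deck_semigroup D -> C).
    by apply/funext => s; rewrite /= -[LHS]/(c * 1 + 0) mulr1 addr0.
  have := Mlin (-1) (cst 0) (cst 0) (L _) (L _).
  have -> : -1 *: cst 0 + cst 0 = cst 0 :> (deck_semigroup D -> C).
    by apply/funext => s; rewrite /= -[LHS]/(-1 * 0 + 0) mulr0 addr0.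
  by rewrite mulN1r addNr M1 => -> ->; rewrite mulr1 addr0.
have e1 := Minv xi E xiX; have e2 := Minv xi (elt kP) xiX.
have t1 : left_translate E xi = cst (lfun A phi).
  by apply/funext => a; rewrite /left_translate /xi rhoEs.
have t2 : left_translate (elt kP) xi = cst (lfun A (deck_act k phi)).
  by apply/funext => a; rewrite /left_translate /xi rhok.
by rewrite t1 cstM in e1; rewrite t2 cstM in e2; rewrite e2 -e1.
Qed.

End Amenable.

(** * The functional equation of a fixed density *)

Section FundamentalEquation.
Variable R : realType.
Local Notation C := R[i].
Local Notation S := (sphere R).
Implicit Types (z w v : C).

Lemma fsum_const (I : finType) (t : I -> C) (A : set C) (c : C) (G : C -> C) :
  injective t -> (forall x, A x <-> exists j, x = t j) -> (forall j, G (t j) = c) ->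
  \sum_(x \in A) G x = #|I|%:R * c.
Proof.
move=> tinj At Gc; rewrite (@fsbigE _ _ _ _ A [seq t j | j <- enum I]).
- rewrite big_map big_enum_cond /= (eq_bigl xpredT); last first.
    by move=> j; rewrite mem_set//; apply/At; exists j.
  by rewrite (eq_bigr (fun=> c)) => [|j _]; rewrite ?Gc// sumr_const mulr_natl.
- by rewrite map_inj_uniq ?enum_uniq.
- by move=> _ /mapP[j _ ->]; apply/At; exists j.
- move=> x /At[j ->]; rewrite map_f// mem_enum//.
Qed.

(** The parameter segment is a rectangle of height 0, and a differentiable map is Lipschitz at each
    point, so it preserves null sets. *)
Lemma null_arc (sigma : set S) : analytic_arc sigma -> null sigma.
Proof.
move=> [V [g [[_ IV] gV _ _ ->]]]; apply/null_area.
set I := [set _ | _ in _] in IV *.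
apply: (@area_sub0 _ _ ((@fin R \o g) @` [set z | I z /\ exists v : C, g z = Some v])).
  by move=> v [z Iz gz]; exists z; [split => //; exists v|rewrite /= gz].
apply: area_image0.
  have [_ r0] := area_rect (ler01 : (0 : R) <= 1) (lexx (0 : R)).
  apply: area_sub0 (_ : area [set z | 0 <= Re z <= 1 /\ 0 <= Im z <= 0] = 0%E).
    by move=> z [[t + <-] _]; rewrite /= in_itv /= lexx => ->.
  by rewrite r0 subrr mulr0.
move=> z [/IV/gV[_ dg] [v gz]]; move: dg; rewrite gz => /derivable_pd/pd_lip[d d0 dP].
by do 2 eexists; split; [exact: d0|move=> w _; exact: dP].
Qed.

Lemma open_sphere_ball (A : set S) z : open A -> A (Some z) ->
  exists2 r : R, 0 < r & forall w, cball z r w -> A (Some w).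
Proof. by move=> oA Az; have /nbhs_cball[r r0 rA] := open_nbhs_nbhs (conj oA Az); exists r. Qed.

Lemma open_sphere_copen (A : set S) : open A -> copen [set z | A (Some z)].
Proof. by move=> oA z /(open_sphere_ball oA)[r r0 rA]; exists r. Qed.

Variables (f : ratmap R) (sigma : set S) (D : 'I_(rdeg f) -> set S).
Local Notation F := (reval f).
Hypotheses (d0 : (0 < rdeg f)%N) (hD : sheets sigma D).

Lemma sheet_fiber (y : S) : ~ sigma y -> exists x : 'I_(rdeg f) -> S,
  (forall j, D j (x j) /\ F (x j) = y) /\ forall x', F x' = y -> exists j, x' = x j.
Proof.
have [Fs _ _ bij] := hD => ny; exists (fun j => pinv (D j) F y).
have h j : D j (pinv (D j) F y) /\ F (pinv (D j) F y) = y.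
  have [[_ _ Fj] _ _] := bij j; split; last by rewrite pinvK// inE; exact: Fj.
  by have [x xj <-] := Fj y ny; apply: (surjpinv_image_sub Fj); exists (F x) => //; have [[h _ _] _ _] := bij j; exact: h.
split => // x' Fx; have : (F @^-1` (~` sigma)) x' by rewrite /= Fx.
rewrite Fs => -[j _ xj]; exists j; have [[_ Finj _] _ _] := bij j.
by apply: Finj; rewrite ?inE//; [case: (h j)|case: (h j) => _ ->].
Qed.

Lemma sheet_disjoint i j x : D i x -> D j x -> i = j.
Proof. by have [_ tD _ _] := hD => xi xj; apply: (tD i j) => //; exists x. Qed.

(** The swap is a branch of R^(-1) o R: its derivative follows by differentiating R o swap = R near
    [z]. *)
Lemma deck_swap_derive i j z w a b : D i (Some z) -> D j (Some w) -> F (Some z) = F (Some w) ->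
  hasd (F \o Some) z a -> hasd (F \o Some) w b -> b != 0 ->
  deck_swap D i j (Some z) = Some w /\ planar_derive (deck_swap D i j) z = a / b.
Proof.
move=> zi wj Fzw ha hb b0; have [_ _ oD bij] := hD.
have swapE x : D i x -> deck_swap D i j x = pinv (D j) F (F x).
  by move=> xi; rewrite /deck_swap ifT// inE.
have [[_ jinj _] _ _] := bij j.
have pw : pinv (D j) F (F (Some z)) = Some w.
  by rewrite Fzw pinvKV ?inE// => x y; rewrite !inE => xj yj; apply: jinj; rewrite inE.
split; first by rewrite swapE.
have [r0 [u [u' [r00 hu uF ua]]]] := ha.
have Fz : F (Some z) = Some (u z) by apply: uF; exact: cball_center.
have nsz : ~ sigma (Some (u z)).
  by have [[h _ _] _ _] := bij i; rewrite -Fz; exact: h.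
have [_ _ holp] := bij j; have [contp _] := holp _ nsz.
rewrite Fz in pw.
have pv : pd (@fin R \o pinv (D j) F \o Some) (u z) (derive1 (@fin R \o pinv (D j) F \o Some) (u z)).
  by apply: derivable_pd; have [_] := holp _ nsz; rewrite /local_expr pw.
set D1 := derive1 _ _ in pv.
have pu : pd u z a by rewrite -ua; exact: hol_pd hu (cball_center z r00).
have ps := pd_comp pu pv.
(* Continuity keeps the inverse branch finite near [u z], so that [fin] loses no information
   there. *)
have fin_near : exists2 r : R, 0 < r & forall y, cball (u z) r y ->
    exists t : C, pinv (D j) F (Some y) = Some t.
  have : nbhs (Some (u z) : S) (pinv (D j) F @^-1` [set x | exists t : C, x = Some t]).
    apply: contp; rewrite pw; apply: filterS (@filterT _ (nbhs w) _) => t _.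
    by exists t.
  by move=> /nbhs_cball[r r1 rP]; exists r => // y /rP.
have [r1 r10 finP] := fin_near.
have [r2 /andP[r20 r20'] uP] := hol_cont r00 hu r10.
have [r3 r30 r3P] := open_sphere_ball (oD i).1 zi.
pose r := Num.min r2 r3.
have r_gt0 : 0 < r by rewrite lt_min r20.
have local z' : cball z r z' -> F (Some z') = Some (u z') /\
    deck_swap D i j (Some z') = Some ((@fin R \o pinv (D j) F \o Some) (u z')).
  rewrite /cball /= lt_min => /andP[z2 z3].
  have Fz' : F (Some z') = Some (u z') by apply: uF; exact: cball_le r20' _ z2.
  split => //; rewrite swapE; last exact: r3P.
  by rewrite Fz' /=; have [t ->] := finP _ (uP _ z2).
pose s := @fin R \o deck_swap D i j \o Some.
have pds : pd s z (D1 * a).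
  apply: (pd_eq r_gt0) ps => z' /local[_ e].
  by rewrite /s /= e.
have sz : s z = w by rewrite /s /= swapE// Fz pw.
have pF : pd (@fin R \o F \o Some) z (b * (D1 * a)).
  apply: (pd_eq r_gt0) (pd_comp pds _); last by rewrite sz; exact: hasd_pd hb.
  move=> z' zr; have [Fz' e] := local z' zr.
  rewrite /s /= e /=; congr fin.
  have zi' : D i (Some z').
    by move: zr; rewrite /cball /= lt_min => /andP[_]; exact: r3P.
  have := e; rewrite swapE// /= => <-.
  have [[_ _ Fj] _ _] := bij j; rewrite pinvK// inE; apply: Fj.
  by have [[h _ _] _ _] := bij i; exact: h.
have [_ e] := pd_derive pds.
change (derive1 s z = a / b); rewrite e.
by apply/(canRL (mulfK b0)); rewrite mulrC; exact/esym/(pd_unique (hasd_pd ha) pF).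
Qed.

Definition good_point (psi : C -> C) z := exists (v a : C), [/\ F (Some z) = Some v,
  a != 0, hasd (F \o Some) z a & psi v * a ^+ 2 = (rdeg f)%:R * psi z].

Lemma fundamental_equation (phi : L1 R) : null sigma -> phi <> 0 -> ruelle f phi = phi ->
  (forall k, deck_group D k -> deck_act k phi = phi) ->
  area [set z | ~ good_point (repr phi) z] = 0%E.
Proof.
move=> /null_area sigma0 phi0 ruephi deckphi; set psi : C -> C := repr phi.
have L1_of_ae (h : C -> C) : L1_of h = phi -> area [set z | psi z <> h z] = 0%E.
  rewrite /L1_of; case: xgetP => [u _ uh e|_ /esym//]; apply/negligible_area.
  by rewrite e in uh.
have ruelle0 := L1_of_ae _ ruephi; set N2 := [set y | _] in ruelle0.
(* The union over pairs of sheets is indexed by [nat] so that [area_bigcup0] applies. *)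
pose N1 := \bigcup_n \bigcup_m [set z | exists i j : 'I_(rdeg f), [/\ (i : nat) = n, (j : nat) = m &
  psi z <> if deck_swap D i j (Some z) is Some w
    then repr phi w * planar_derive (deck_swap D i j) z ^+ 2 else 0]].
have N10 : area N1 = 0%E.
  apply: area_bigcup0 => n; apply: area_bigcup0 => m.
  have [[i [j [ni mj]]]|h] := pselect (exists i j : 'I_(rdeg f), (i : nat) = n /\ (j : nat) = m).
    apply: area_sub0 (L1_of_ae _ (deckphi _ (deck_gen D i j))) => z [i' [j' [i'n j'm]]].
    have -> : i' = i by apply: val_inj; rewrite /= i'n.
    by have -> : j' = j by apply: val_inj; rewrite /= j'm.
  by apply: area_sub0 (@area0 R) => z [i [j [ni mj _]]]; apply: h; exists i, j.
(* All values over which some preimage is exceptional: excluding [R^(-1)(B)] controls the whole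
   fibre through [z] at once. *)
pose B := fimage f (N1 `|` crit f) `|` N2 `|` [set y | sigma (Some y)] `|`
  [set y | Some y = F None].
have B0 : area B = 0%E.
  apply: areaU0; first apply: areaU0; first apply: areaU0; rewrite ?sigma0//.
    by apply: area_fimage0; apply: areaU0 => //; exact: area_crit.
  case FN : (F None) => [v|]; last first.
    by apply: area_sub0 (@area0 R) => y.
  by apply: area_sub0 (area1 v) => y [->].
apply: area_sub0 (areaU0 (area_crit d0) (area_fpreimage0 d0 B0)) => z ngood.
have [|nc] := pselect (crit f z); first by left.
right; apply: contrapT => nB; apply: ngood.
have [a a0 ha] := crit_gen nc; have [v Fz] := hasd_fin ha.
exists v, a; split => //.
have nBv : ~ B v by move=> Bv; apply: nB; exists v.
have ns : ~ sigma (Some v) by move=> sv; apply: nBv; left; right.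
have [x [xP xall]] := sheet_fiber ns.
have xfin j : exists t : C, x j = Some t.
  case xj: (x j) => [t|]; first by exists t.
  by case: nBv; right => /=; rewrite -xj; case: (xP j).
have [t tP] := choice xfin.
have tD j : D j (Some (t j)) /\ F (Some (t j)) = Some v by rewrite -tP.
have tgood j : ~ (N1 `|` crit f) (t j).
  by move=> h; apply: nBv; left; left; left; exists (t j) => //; case: (tD j).
have /choice[b bP] j : exists b, b != 0 /\ hasd (F \o Some) (t j) b.
  have [b b0 hb] : gen (F \o Some) (t j) by apply: crit_gen => h; apply: (tgood j); right.
  by exists b.
have [i iz] := xall _ Fz; have zi : z = t i by move: iz; rewrite tP => -[].
have ab : a = b i by apply: (hasd_unique ha); rewrite zi; case: (bP i).
(* Invariance under the swap of the sheets of [t i] and [t j] makes every term of the fibre equal to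
   the one at [z]. *)
have term j : psi (t j) / b j ^+ 2 = psi z / a ^+ 2.
  have [bj0 hbj] := bP j; have [Dj Fj] := tD j; have [Di Fi] := tD i.
  have nN1 : ~ N1 (t i) by move=> h; apply: (tgood i); left.
  have [sw sd] := @deck_swap_derive i j (t i) (t j) (b i) (b j) Di Dj (etrans Fi (esym Fj))
    (bP i).2 hbj bj0.
  have : psi (t i) = psi (t j) * (b i / b j) ^+ 2.
    apply: contrapT => h; apply: nN1; exists i => //; exists j => //; exists i, j; split => //.
    by rewrite sw sd.
  rewrite -zi -ab => ->; have a0' := a0; field.
  by rewrite ?bj0 ?a0.
have tinj : injective t.
  move=> i1 i2 e; apply: (sheet_disjoint (x := Some (t i1))); first by case: (tD i1).
  by rewrite e; case: (tD i2).
have : psi v = \sum_(x \in [set x | F (Some x) = Some v]) psi x / planar_derive F x ^+ 2.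
  by apply: contrapT => h; apply: nBv; left; left; right.
rewrite (@fsum_const _ t _ (psi z / a ^+ 2)) ?card_ord//.
- by move=> ->; field.
- move=> y; split=> [/= /xall[j]|[j ->]]; last by case: (tD j).
  by rewrite tP => -[->]; exists j.
- move=> j; rewrite (planar_derive_hasd (bP j).2); exact: term.
Qed.

End FundamentalEquation.

Import HBSimple.

(** * Lebesgue points *)

Section Translation.
Variable R : realType.
Local Notation C := R[i].
Local Notation mR := (measurableTypeR R).
Local Notation T := (mR * mR)%type.
Local Notation mu := (@planar_measure R).
Local Notation tp := (@to_plane R).
Implicit Types (A B E : set C) (z w v : C) (h k : C -> R).

Definition ctop z : T := (Re z, Im z).

Lemma ctopK z : tp (ctop z) = z. Proof. by case: z. Qed.

Lemma tpK (u : T) : ctop (tp u) = u. Proof. by case: u. Qed.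

Lemma cmfun_abs A h : cmfun A h -> cmfun A (fun z => `|h z|).
Proof. exact: (measurableT_comp (@normr_measurable R setT)). Qed.

Lemma cmfunD A h k : cmfun A h -> cmfun A k -> cmfun A (fun z => h z + k z).
Proof. exact: measurable_funD. Qed.

Lemma cmfunB A h k : cmfun A h -> cmfun A k -> cmfun A (fun z => h z - k z).
Proof. exact: measurable_funB. Qed.

Lemma cmfunM A h k : cmfun A h -> cmfun A k -> cmfun A (fun z => h z * k z).
Proof. exact: measurable_funM. Qed.

Lemma measurable_affine (t : R) v :
  measurable_fun setT (fun u : T => ctop (t%:C * tp u + v)).
Proof.
have -> : (fun u : T => ctop (t%:C * tp u + v)) =
    (fun u => (t * u.1 + Re v : mR, t * u.2 + Im v : mR)).
  by apply/funext => -[a b]; case: v => v1 v2; rewrite /ctop /= !mul0r subr0 addr0.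
by apply: measurable_fun_pair; apply: measurable_funD => //; apply: measurable_funM.
Qed.

Lemma cmfun_affine (t : R) v h : cmfun setT h -> cmfun setT (fun z => h (t%:C * z + v)).
Proof.
move=> mh; rewrite /cmfun.
rewrite (_ : (fun u => _) = (fun u : T => h (tp u)) \o (fun u : T => ctop (t%:C * tp u + v))).
  by apply: measurableT_comp mh (measurable_affine t v).
by apply/funext => u /=; rewrite ctopK.
Qed.

Lemma cmeas_affine (t : R) v B : cmeas B -> cmeas [set z | B (t%:C * z + v)].
Proof.
move=> mB; rewrite /cmeas.
rewrite (_ : _ @^-1` _ = (fun u : T => ctop (t%:C * tp u + v)) @^-1` (tp @^-1` B)).
  by rewrite -[X in measurable X]setTI; apply: measurable_affine.
by apply/seteqP; split => u /=; rewrite ctopK.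
Qed.

Lemma cmfun_shift v h : cmfun setT h -> cmfun setT (fun z => h (z + v)).
Proof.
by move=> /(cmfun_affine 1 v); congr cmfun; apply/funext => z; rewrite rmorph1 mul1r.
Qed.

(** Invariance up to the factor 16 of [area_image_le] is enough below. *)
Lemma area_shift v B : (area [set z | B (z + v)%R] <= 16%:E * area B)%E.
Proof.
have := @area_image_le _ B (fun w => w - v) 1 ltr01; rewrite expr1n mulr1.
have -> : (fun w => w - v) @` B = [set z | B (z + v)%R].
  apply/seteqP; split => [_ [w Bw <-]|z Bz] /=; first by rewrite subrK.
  by exists (z + v) => //; rewrite addrK.
by apply=> z _; exists 1 => // w _ _; rewrite mul1r opprB addrA subrK.
Qed.

Lemma cintD A h k : cmeas A -> cmfun A h -> cmfun A k ->
  (forall z, A z -> 0 <= h z) -> (forall z, A z -> 0 <= k z) ->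
  cint A (fun z => h z + k z) = (cint A h + cint A k)%E.
Proof.
move=> mA mh mk h0 k0; rewrite /cint -ge0_integralD//.
- by move=> u /h0; rewrite lee_fin.
- exact: cmfunE.
- by move=> u /k0; rewrite lee_fin.
- exact: cmfunE.
Qed.

Lemma cint_shift v k : cmfun setT k -> (forall z, 0 <= k z) ->
  (cint setT (fun z => k (z + v)%R) <= 512%:E * cint setT k)%E.
Proof.
move=> mk k0.
have := @cint_image _ setT (fun w => w - v) (fun=> 1) setT (fun z => k (z + v)%R).
under [X in (_ <= 512%:E * cint _ X)%E]eq_fun do rewrite subrK expr1n mulr1.
apply=> //; [exact: cmeasT|exact: cmfun_cst| | |exact: cmeasT| |exact: cmfun_shift].
- move=> z _ e e0; exists 1 => // w _ _.
  by rewrite opprB addrA subrK ler_peMl ?cnorm_ge0// lerDl ltW.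
- move=> B mB; rewrite setTI.
  have := cmeas_affine 1 (- v) mB; congr cmeas; apply/seteqP; split => z /=;
  by rewrite rmorph1 mul1r.
- by move=> z _; exists (z + v) => //; rewrite addrK.
Qed.

(** [E] lies between an open set and a closed core of nearly the same area; a point changes status
    under a small translation only if it or its translate lies in the thin set [W]. *)
Lemma tcont_set E (e : R) : cmeas E -> (area E < +oo)%E -> 0 < e ->
  exists2 d : R, 0 < d & forall v, cnorm v < d ->
    (area [set z | ~ (E (z + v)%R <-> E z)] <= e%:E)%E.
Proof.
(* [W] has two parts of area at most e/34, and its translate costs 16 times as much: 17 * (2 * e/34)
   = e. *)
move=> mE Eoo e0; have e1 : 0 < e / 34 by rewrite divr_gt0.
have [U [oU EU UE]] := area_outer_regular E e1; have mU := copen_cmeas oU.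
have fE : area E \is a fin_num by rewrite ge0_fin_numE ?area_ge0.
have Uoo : (area U < +oo)%E by apply: le_lt_trans UE _; rewrite lte_add_pinfty// ltry.
have UEe : (area (U `\` E) <= (e / 34)%:E)%E.
  rewrite -(leeD2lE _ _ fE); apply: le_trans UE.
  have UDE : U = E `|` (U `\` E) by rewrite setDUK.
  rewrite [X in (_ <= area X)%E]UDE !areaE ?preimage_setU//; [|exact: cmeasU (cmeasD mU mE)|exact: cmeasD].
  have disj : tp @^-1` E `&` tp @^-1` (U `\` E) = set0 by apply/seteqP; split => u // [Eu []].
  have /eqP := @measureU _ _ _ mu _ _ mE (cmeasD mU mE) disj.
  by rewrite eq_le => /andP[_ h]; exact: h.
have [n [oF FU Fe]] := copen_core mU Uoo oU e1.
set G := [set z | forall w, _] in oF FU Fe.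
pose W := (U `\` E) `|` (U `&` (U `\` G)).
have We : (area W <= (e / 17)%:E)%E.
  apply: le_trans (areaU _ _) _; apply: (le_trans (leeD UEe Fe)).
  by rewrite -EFinD lee_fin; lra.
exists n.+1%:R^-1 => [|v vn]; first by rewrite invr_gt0.
have sub : [set z | ~ (E (z + v)%R <-> E z)] `<=` W `|` [set z | W (z + v)].
  move=> z /= nE; have [Ez|nEz] := pselect (E z).
    have nEv : ~ E (z + v) by move=> Ev; apply: nE.
    have [Gz|nG] := pselect (G z); last first.
      by left; right; split; [exact: EU|split => //; exact: EU].
    by right; left; split => //; apply: Gz; rewrite addrC addKr.
  have Ev : E (z + v) by apply: contrapT => nEv; apply: nE.
  have [Gz|nG] := pselect (G (z + v)); last first.
    by right; right; split; [exact: EU|split => //; exact: EU].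
  left; left; split => //; apply: Gz.
  by rewrite opprD addrA subrr add0r cnormN.
apply: (le_trans (le_area sub)); apply: (le_trans (areaU _ _)).
apply: (@le_trans _ _ ((e / 17)%:E + 16%:E * (e / 17)%:E)%E).
  by apply: leeD => //; apply: (le_trans (area_shift v W)); apply: lee_wpmul2l.
by rewrite -EFinM -EFinD lee_fin; lra.
Qed.

Lemma cint_support A B h : cmeas A -> cmeas B -> B `<=` A -> cmfun A h ->
  (forall z, A z -> 0 <= h z) -> (forall z, A z -> ~ B z -> h z = 0) ->
  cint A h = cint B h.
Proof.
move=> mA mB BA mh h0 hB; have AE : A = B `|` (A `\` B) by rewrite setDUK.
rewrite {1}/cint {1}AE preimage_setU ge0_integral_setU//.
- rewrite [X in (_ + X)%E]integral0_eq ?adde0//.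
  by move=> u [Au nB]; rewrite hB.
- exact: cmeasD.
- by rewrite -preimage_setU -AE; exact: cmfunE.
- by rewrite -preimage_setU -AE => u /h0; rewrite lee_fin.
- by rewrite disj_set2E; apply/eqP/seteqP; split => u //= [Bu []].
Qed.

(** A simple function changes only where one of its finitely many nonzero level sets does.
    Integrability gives these finite area, and the change is at most 2M. *)
Lemma tcont_sfun (s : {sfun T >-> R}) (e : R) : mu.-integrable setT (EFin \o (s : T -> R)) -> 0 < e ->
  exists2 d : R, 0 < d & forall v, cnorm v < d ->
    (cint setT (fun z => `|s (ctop (z + v)) - s (ctop z)|%R) <= e%:E)%E.
Proof.
move=> si e0.
pose E (c : R) := [set z | s (ctop z) = c].
have ms : cmfun setT (fun z => s (ctop z)).
  by rewrite /cmfun; under eq_fun do rewrite tpK; exact: measurable_funP.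
have mE c : cmeas (E c).
  rewrite /cmeas (_ : _ @^-1` _ = s @^-1` [set c]).
    exact: measurable_funPTI.
  by apply/seteqP; split => u; rewrite /E /= tpK.
have Eoo c : c != 0 -> (area (E c) < +oo)%E.
  move=> c0; case/integrableP: si => _; apply: contraTT; rewrite -!leNgt !leye_eq => /eqP Ec.
  rewrite -leye_eq; apply: (@le_trans _ _ (`|c|%:E * area (E c))%E).
    by rewrite Ec gt0_muley// lte_fin normr_gt0.
  rewrite -(cint_cst _ (mE c)).
  apply: (@le_trans _ _ (cint setT (fun z => `|s (ctop z)|%R))); last first.
    rewrite /cint; apply: eqW.
    by apply: eq_integral => u _; rewrite tpK.
  rewrite (_ : cint (E c) _ = cint (E c) (fun z => `|s (ctop z)|%R)); last first.
    by apply: eq_integral => u; rewrite inE /E /= => ->.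
  by apply: cint_subset => //; [exact: cmeasT|exact: cmfun_abs].
have [r rP] : exists r : seq R, forall u, s u \in r.
  have /finite_seqP[r rE] := fimfunP s; exists r => u.
  have : range s (s u) by exists u.
  by rewrite rE.
have small (e' : R) : 0 < e' -> exists2 d : R, 0 < d & forall v, cnorm v < d ->
    (area [set z | s (ctop (z + v)%R) != s (ctop z)] <= e'%:E)%E.
  move=> e'0; have : exists2 d : R, 0 < d & forall v, cnorm v < d ->
      (area [set z | exists c : R, [/\ c \in r, (c != 0)%R & ~ (E c (z + v)%R <-> E c z)]] <= e'%:E)%E.
    elim: r {rP} e' e'0 => [|c r IH] e' e'0.
      exists 1 => // v _; rewrite (_ : [set z | _] = set0) ?area0 ?lee_fin ?(ltW e'0)//.
      by apply/seteqP; split => z // [c []].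
    have e2 : 0 < e' / 2 by rewrite divr_gt0.
    have [d d0 dP] := IH _ e2.
    have [d' d'0 d'P] : exists2 d : R, 0 < d & forall v, cnorm v < d -> c != 0 ->
        (area [set z | ~ (E c (z + v)%R <-> E c z)] <= (e' / 2)%:E)%E.
      have [->|c0] := eqVneq c 0; first by exists 1.
      by have [q q0 qP] := tcont_set (mE c) (Eoo c c0) e2; exists q => // v /qP.
    exists (Num.min d d'); first by rewrite lt_min d0.
    move=> v; rewrite lt_min => /andP[vd vd'].
    pose X := [set z | c != 0 /\ ~ (E c (z + v)%R <-> E c z)].
    apply: (@le_trans _ _ ((e' / 2)%:E + (e' / 2)%:E)%E); last first.
      by rewrite -EFinD lee_fin; lra.
    apply: (@le_trans _ _ (area X + area [set z | exists c : R, [/\ c \in r, (c != 0)%R & ~ (E c (z + v)%R <-> E c z)]])%E).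
      apply: le_trans (areaU _ _); apply: le_area => z [c' []]; rewrite inE => /orP[/eqP ->|c'r] c'0 n.
        by left.
      by right; exists c'.
    apply: leeD; last exact: dP.
    have [c0|c0] := eqVneq c 0.
      rewrite (_ : X = set0) ?area0 ?lee_fin ?(ltW e2)//.
      by apply/seteqP; split => z // []; rewrite c0 eqxx.
    by apply: le_trans (d'P v vd' c0); apply: le_area => z [].
  move=> [d d0 dP]; exists d => // v /dP; apply: le_trans; apply: le_area => z /= sz.
  have [s0|s0] := eqVneq (s (ctop z)) 0.
    exists (s (ctop (z + v))); split => //; first by rewrite -s0.
    by move=> [h _]; move: sz; rewrite (h erefl) eqxx.
  exists (s (ctop z)); split => //.
  by move=> [_ h]; move: sz; rewrite (h erefl) eqxx.
have [M [M0 MP]] : exists M : R, 0 <= M /\ forall u, `|s u| <= M.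
  exists (\sum_(c <- r) `|c|); split; first by apply: sumr_ge0.
  by move=> u; rewrite (big_rem _ (rP u)) /= lerDl sumr_ge0.
have M1 : 0 < 2 * M + 1 by rewrite ltr_wpDl// mulr_ge0.
have [d d0 dP] := small _ (divr_gt0 e0 M1).
exists d => // v vd; have msv := cmfun_shift v ms.
have mN : cmeas [set z | s (ctop (z + v)) != s (ctop z)].
  have := (cmfunB msv ms) measurableT _ (measurableC (measurable_set1 0)); rewrite setTI.
  by congr measurable; apply/seteqP; split => u /=; rewrite -subr_eq0 => /eqP.
rewrite (@cint_support setT [set z | s (ctop (z + v)) != s (ctop z)])//.
- apply: (@le_trans _ _ (cint [set z | s (ctop (z + v)) != s (ctop z)] (fun=> 2 * M + 1))).
    apply: cint_le => //; [| exact: cmfun_cst|].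
      by apply: cmfunS (@cmeasT R) _ _ => //; exact: cmfun_abs (cmfunB msv ms).
    move=> z _; rewrite normr_ge0 /=; apply: (le_trans (ler_normB _ _)).
    have := MP (ctop (z + v)); have := MP (ctop z); lra.
  rewrite cint_cst//; apply: (@le_trans _ _ ((2 * M + 1)%:E * (e / (2 * M + 1))%:E)%E).
    by apply: lee_wpmul2l; [rewrite lee_fin ltW|exact: dP].
  by rewrite -EFinM lee_fin mulrCA divff ?mulr1// gt_eqF.
- exact: cmeasT.
- exact: cmfun_abs (cmfunB msv ms).
- by move=> z _ /negP; rewrite negbK => /eqP ->; rewrite subrr normr0.
Qed.

Lemma tcont_integrable h (e : R) : mu.-integrable setT (fun u => (h (tp u))%:E) -> 0 < e ->
  exists2 d : R, 0 < d & forall v, cnorm v < d ->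
    (cint setT (fun z => `|h (z + v) - h z|%R) <= e%:E)%E.
Proof.
move=> ih e0.
have mh : cmfun setT h by apply/measurable_EFinP; case/integrableP: ih.
have [g [ig _ gcv]] := approximation_sfun_integrable measurableT ih.
(* The approximation error is paid once at [z] and once at [z + v], where [cint_shift] multiplies it
   by 512. *)
have e1 : 0 < e / 2 / 513 by lra.
have [n gn] : exists n, (\int[mu]_z `|(h (tp z))%:E - (g n z)%:E| <= (e / 2 / 513)%:E)%E.
  have e1' : (0%E < (e / 2 / 513)%:E)%E by rewrite lte_fin.
  have [n _ /(_ n (leqnn n)) nP] := gcv _ (open_ereal_lt' e1').
  by exists n; rewrite ltW.
have e2 : 0 < e / 2 by rewrite divr_gt0.
have [d d0 dP] := tcont_sfun (ig n) e2; exists d => // v vd.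
pose k z := `|h z - g n (ctop z)|.
have mg : cmfun setT (fun z => g n (ctop z)).
  by rewrite /cmfun; under eq_fun do rewrite tpK; exact: measurable_funP.
have mk : cmfun setT k by exact: cmfun_abs (cmfunB mh mg).
have k0 z : 0 <= k z by exact: normr_ge0.
have kE : (cint setT k <= (e / 2 / 513)%:E)%E.
  by apply: le_trans gn; apply: eqW; apply: eq_integral => u _;
    rewrite /k tpK.
have mgv := cmfun_shift v mg; have mhv := cmfun_shift v mh.
apply: (@le_trans _ _ (cint setT (fun z => (k (z + v) + k z) + `|g n (ctop (z + v)) - g n (ctop z)|)%R)).
  apply: cint_le; [exact: cmeasT|exact: cmfun_abs (cmfunB mhv mh)| |].
    apply: cmfunD; first by apply: cmfunD => //; exact: cmfun_shift.
    exact: cmfun_abs (cmfunB mgv mg).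
  move=> z _; rewrite normr_ge0 /= /k.
  have -> : h (z + v) - h z = (h (z + v) - g n (ctop (z + v))) - (h z - g n (ctop z))
     + (g n (ctop (z + v)) - g n (ctop z)) by ring.
  by apply: (le_trans (ler_normD _ _)); rewrite lerD2r; exact: ler_normB.
rewrite cintD//; last 4 first.
- exact: cmeasT.
- by apply: cmfunD => //; exact: cmfun_shift.
- exact: cmfun_abs (cmfunB mgv mg).
- by move=> z _; exact: addr_ge0.
rewrite cintD//; [|exact: cmeasT|exact: cmfun_shift].
apply: (@le_trans _ _ ((512%:E * (e / 2 / 513)%:E + (e / 2 / 513)%:E) + (e / 2)%:E)%E).
  apply: leeD; last exact: dP.
  apply: leeD => //; apply: (le_trans (cint_shift v mk k0)).
  by apply: lee_wpmul2l; [rewrite lee_fin ler0n|exact: kE].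
by rewrite -EFinM -!EFinD lee_fin; lra.
Qed.

End Translation.

(** * Lebesgue points along a sequence of scales *)

Section LebesgueSequence.
Variable R : realType.
Local Notation C := R[i].
Local Notation mR := (measurableTypeR R).
Local Notation T := (mR * mR)%type.
Local Notation mu := (@planar_measure R).
Local Notation tp := (@to_plane R).
Implicit Types (A E : set C) (z v : C) (p : C -> C).

Lemma measurable_cnorm d (X : measurableType d) (E : set X) (p : X -> C) :
  measurable_fun E (fun x => Re (p x)) -> measurable_fun E (fun x => Im (p x)) ->
  measurable_fun E (fun x => cnorm (p x)).
Proof.
move=> mr mi; rewrite (_ : (fun x => cnorm (p x)) =
    Num.sqrt \o ((fun x => Re (p x) ^+ 2) \+ (fun x => Im (p x) ^+ 2))).
  apply: measurableT_comp; last by apply: measurable_funD; exact: measurable_funX.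
  by apply: continuous_measurable_fun; exact: sqrt_continuous.
by apply/funext => x /=; case: (p x).
Qed.

Definition cmfunc A p := cmfun A (fun z => Re (p z)) /\ cmfun A (fun z => Im (p z)).

Lemma cmfunc_cnorm A p : cmfunc A p -> cmfun A (fun z => cnorm (p z)).
Proof. by move=> [mr mi]; exact: measurable_cnorm. Qed.

Lemma cintegrable_cmfunc p : cintegrable p -> cmfunc setT p.
Proof.
by move=> [/integrableP[mr _] /integrableP[mi _]]; split; exact/measurable_EFinP.
Qed.

Lemma cmfunc_shift v p : cmfunc setT p -> cmfunc setT (fun z => p (z + v)).
Proof. by move=> [mr mi]; split; [exact: (cmfun_shift v mr)|exact: (cmfun_shift v mi)]. Qed.

Lemma cmfuncB A p q : cmfunc A p -> cmfunc A q -> cmfunc A (fun z => p z - q z).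
Proof.
move=> [pr pi] [qr qi]; split.
  have := cmfunB pr qr; congr cmfun; apply/funext => z.
  by case: (p z) (q z) => a b [].
have := cmfunB pi qi; congr cmfun; apply/funext => z.
by case: (p z) (q z) => a b [].
Qed.

Lemma tcont_cintegrable p (e : R) : cintegrable p -> 0 < e ->
  exists2 d : R, 0 < d & forall v, cnorm v < d ->
    (cint setT (fun z => cnorm (p (z + v) - p z))%R <= e%:E)%E.
Proof.
move=> ip e0; have e2 : 0 < e / 2 by rewrite divr_gt0.
have mp := cintegrable_cmfunc ip; have [ir ii] := ip.
have [d1 d10 d1P] := tcont_integrable (h := fun z => Re (p z)) ir e2.
have [d2 d20 d2P] := tcont_integrable (h := fun z => Im (p z)) ii e2.
exists (Num.min d1 d2); first by rewrite lt_min d10.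
move=> v; rewrite lt_min => /andP[v1 v2].
have mpv := cmfunc_shift v mp.
have m1 := cmfun_abs (cmfunB mpv.1 mp.1); have m2 := cmfun_abs (cmfunB mpv.2 mp.2).
apply: (@le_trans _ _ (cint setT (fun z => `|Re (p (z + v)) - Re (p z)|
   + `|Im (p (z + v)) - Im (p z)|)%R)).
  apply: cint_le; [exact: cmeasT|exact: cmfunc_cnorm (cmfuncB mpv mp)|exact: cmfunD|].
  move=> z _; rewrite cnorm_ge0 /=; apply: (le_trans (normc_le_ReIm _)).
  by case: (p (z + v)) (p z) => a b [].
rewrite cintD//; last exact: cmeasT.
apply: (@le_trans _ _ ((e / 2)%:E + (e / 2)%:E)%E); first exact: leeD (d1P _ v1) (d2P _ v2).
by rewrite -EFinD lee_fin; lra.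
Qed.

Definition kball (k : nat) : set C := cball 0 k%:R.

Lemma sigma_finite_planar : sigma_finite setT mu.
Proof.
exists (fun n => tp @^-1` (kball n)).
  apply/seteqP; split => // u _; exists (Num.truncn (cnorm (tp u))).+1 => //.
  by change (is_true (cnorm (tp u - 0) < (Num.truncn (cnorm (tp u))).+1%:R)); rewrite subr0 truncnS_gt.
move=> n; split; first exact: cball_cmeas.
by rewrite -areaE; [exact: area_cball_fin|exact: cball_cmeas].
Qed.

HB.instance Definition _ := Measure.on mu.
HB.instance Definition _ := Measure_isSigmaFinite.Build _ _ _ mu sigma_finite_planar.

(** The oscillation of [p] around [x], read at scale [t] on the ball of radius [k]. *)
Definition deviation p (k : nat) (t : R) x : \bar R :=
  cint (kball k) (fun z => cnorm (p (x + t%:C * z) - p x)).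

Let dev_fun p (k : nat) (t : R) (y : T * T) : \bar R :=
  (\1_(tp @^-1` (kball k)) y.2 * cnorm (p (tp y.1 + t%:C * tp y.2) - p (tp y.1)))%:E.

Let dev_fun_ge0 p k t y : (0 <= dev_fun p k t y)%E.
Proof. by rewrite lee_fin mulr_ge0 ?cnorm_ge0. Qed.

Let dev_in p k (t : R) (u y : T) : kball k (tp y) ->
  dev_fun p k t (u, y) = (cnorm (p (tp u + t%:C * tp y) - p (tp u)))%:E.
Proof. by move=> yk; rewrite /dev_fun indicE mem_set//= mul1r. Qed.

Let dev_out p k (t : R) (u y : T) : ~ kball k (tp y) -> dev_fun p k t (u, y) = 0%E.
Proof. by move=> yk; rewrite /dev_fun indicE memNset//= mul0r. Qed.

Let dev_fun_measurable p k (t : R) : cintegrable p -> measurable_fun setT (dev_fun p k t).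
Proof.
move=> /cintegrable_cmfunc[mr mi]; apply/measurable_EFinP; apply: measurable_funM.
  have mk : measurable_fun setT (\1_(tp @^-1` (kball k)) : T -> R).
    by apply: measurable_indic; exact: cball_cmeas.
  exact: (measurableT_comp mk measurable_snd).
pose g (y : T * T) : T := ctop (tp y.1 + t%:C * tp y.2).
have mg : measurable_fun setT g.
  rewrite (_ : g = (fun y => (y.1.1 + t * y.2.1 : mR, y.1.2 + t * y.2.2 : mR))).
    apply: measurable_fun_pair; apply: measurable_funD.
    - exact: measurableT_comp measurable_fst measurable_fst.
    - by apply: measurable_funM => //; exact: measurableT_comp measurable_fst measurable_snd.
    - exact: measurableT_comp measurable_snd measurable_fst.
    - by apply: measurable_funM => //; exact: measurableT_comp measurable_snd measurable_snd.
  apply/funext => -[[a b] [c d]]; rewrite /g /ctop /=.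
  by rewrite !mul0r subr0 addr0.
have split_Re (y : T * T) : Re (p (tp y.1 + t%:C * tp y.2) - p (tp y.1)) =
    Re (p (tp (g y))) - Re (p (tp y.1)).
  by rewrite /g ctopK; case: (p _) (p (tp y.1)) => a b [].
have split_Im (y : T * T) : Im (p (tp y.1 + t%:C * tp y.2) - p (tp y.1)) =
    Im (p (tp (g y))) - Im (p (tp y.1)).
  by rewrite /g ctopK; case: (p _) (p (tp y.1)) => a b [].
apply: measurable_cnorm.
  under eq_fun do rewrite split_Re.
  by apply: measurable_funB; [exact: (measurableT_comp mr mg)|exact: (measurableT_comp mr measurable_fst)].
under eq_fun do rewrite split_Im.
by apply: measurable_funB; [exact: (measurableT_comp mi mg)|exact: (measurableT_comp mi measurable_fst)].
Qed.

Lemma integral_deviation p k (t : R) : cintegrable p ->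
  measurable_fun setT (fun u => deviation p k t (tp u)) /\
  (\int[mu]_u deviation p k t (tp u) =
   \int[mu]_(y in tp @^-1` (kball k)) cint setT (fun x => cnorm (p (x + t%:C * tp y) - p x))%R)%E.
Proof.
move=> ip; have mf := dev_fun_measurable k t ip; have f0 := dev_fun_ge0 p k t.
have devE u : (\int[mu]_y dev_fun p k t (u, y) = deviation p k t (tp u))%E.
  rewrite /deviation /cint [RHS]integral_mkcond; apply: eq_integral => y _.
  rewrite /patch; have [yk|nk] := pselect (kball k (tp y)); first by rewrite mem_set// dev_in.
  by rewrite memNset// dev_out.
split.
  have := measurable_fun_fubini_tonelli_F (m2 := mu) (dev_fun p k t) mf f0.
  by rewrite /fubini_F; under eq_fun do rewrite devE.
have := fubini_tonelli (m1 := mu) (m2 := mu) (dev_fun p k t) mf f0.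
under eq_integral do rewrite devE.
move=> ->; rewrite [RHS]integral_mkcond; apply: eq_integral => y _.
rewrite /patch; have [yk|nk] := pselect (kball k (tp y)).
  by rewrite mem_set//; apply: eq_integral => x _; rewrite dev_in.
by rewrite memNset//; apply: integral0_eq => x _; rewrite dev_out.
Qed.

Lemma deviation_ge0 p k (t : R) x : (0 <= deviation p k t x)%E.
Proof. by apply: cint_ge0 => z _; exact: cnorm_ge0. Qed.

(** By Tonelli the deviation has integral over [x] equal to a mean of translation defects, small
    when [t] is; Markov's inequality concludes. *)
Lemma area_deviation p k (a e : R) : cintegrable p -> 0 < a -> 0 < e ->
  exists2 d : R, 0 < d & forall t : R, `|t| < d ->
    (area [set x | a%:E <= deviation p k t x] <= e%:E)%E.
Proof.
move=> ip a0 e0.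
have K0 : 0 < 4 * k%:R ^+ 2 + 1 :> R by rewrite ltr_wpDl// mulr_ge0// sqr_ge0.
have e1 : 0 < e * a / (4 * k%:R ^+ 2 + 1) by rewrite divr_gt0// mulr_gt0.
have [d d0 dP] := tcont_cintegrable ip e1.
have k1 : 0 < k%:R + 1 :> R by rewrite ltr_wpDl.
exists (d / (k%:R + 1)); first by rewrite divr_gt0.
move=> t; rewrite ltr_pdivlMr// => td.
have [mdev idev] := integral_deviation k t ip.
set X := [set x | _].
have mX : cmeas X.
  have := mdev measurableT _ (emeasurable_itv `[a%:E, +oo[); rewrite setTI.
  by congr measurable; apply/seteqP; split => u /=; rewrite in_itv/= andbT.
have int_le : (\int[mu]_u deviation p k t (tp u) <= (e * a)%:E)%E.
  rewrite idev; apply: (@le_trans _ _ (\int[mu]_(y in tp @^-1` (kball k))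
      (e * a / (4 * k%:R ^+ 2 + 1))%:E)%E).
    apply: ge0_le_integral.
    - exact: cball_cmeas.
    - by move=> y _; apply: cint_ge0 => z _; exact: cnorm_ge0.
    - have mf := dev_fun_measurable k t ip; have f0 := dev_fun_ge0 p k t.
      have := measurable_fun_fubini_tonelli_G (m1 := mu) (dev_fun p k t) mf f0.
      rewrite /fubini_G => mG.
      have {}mG := measurable_funTS (D := tp @^-1` (kball k)) mG.
      apply: eq_measurable_fun mG => y; rewrite inE => yk; apply: eq_integral => x _.
      by rewrite dev_in.
    - exact: measurable_cst.
    - move=> y yk; apply: dP; rewrite cnormM cnorm_real.
      apply: le_lt_trans td; apply: ler_wpM2l; first exact: normr_ge0.
      have {}yk : cnorm (tp y - 0) < k%:R by exact: yk.
      by move: yk; rewrite subr0 => /ltW/le_trans; apply; rewrite lerDl.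
  rewrite integral_cst; last exact: cball_cmeas.
  rewrite -[X in (_ * X)%E]areaE; last exact: cball_cmeas.
  apply: (@le_trans _ _ ((e * a / (4 * k%:R ^+ 2 + 1))%:E * (4 * k%:R ^+ 2)%:E)%E).
    by apply: lee_wpmul2l; [rewrite lee_fin ltW|apply: area_cball; exact: ler0n].
  rewrite -EFinM lee_fin mulrAC (ler_pdivrMr _ _ K0).
  by apply: ler_wpM2l (ltW (mulr_gt0 e0 a0)) _ _ _; rewrite lerDl ler01.
have aX : (a%:E * area X <= (e * a)%:E)%E.
  apply: le_trans int_le; rewrite (areaE mX) -(integral_cst _ mX).
  apply: (@le_trans _ _ (\int[mu]_(u in tp @^-1` X) deviation p k t (tp u))%E).
    apply: ge0_le_integral.
    - exact: mX.
    - by move=> u _; rewrite lee_fin (ltW a0).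
    - exact: measurable_cst.
    - exact: measurable_funTS mdev.
    - by move=> u; exact.
  apply: ge0_subset_integral.
  - exact: mX.
  - exact: measurableT.
  - exact: mdev.
  - by move=> u _; exact: deviation_ge0.
  - exact: subsetT.
by move: aX; rewrite mulrC EFinM lee_pmul2l// lte_fin.
Qed.

(** Since a sequence of scales may be chosen, continuity of translations and Borel-Cantelli suffice,
    in place of a covering theorem or a maximal inequality. *)
Lemma lebesgue_sequence p (t : nat -> R) : cintegrable p ->
  (forall e : R, 0 < e -> exists n0, forall n, (n0 <= n)%N -> `|t n| < e) ->
  exists2 nu : nat -> nat, (forall k, (k <= nu k)%N) &
    area [set x | ~ exists k0, forall k, (k0 <= k)%N ->
      (deviation p k (t (nu k)) x < (k.+1%:R^-1)%:E)%E] = 0%E.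
Proof.
move=> ip tlim.
have /choice[nu nuP] (k : nat) : exists n, (k <= n)%N /\
    (area [set x | (k.+1%:R^-1)%:E <= deviation p k (t n) x] <= (2^-1 ^+ k)%:E)%E.
  have k0 : 0 < k.+1%:R^-1 :> R by rewrite invr_gt0.
  have e0 : 0 < 2^-1 ^+ k :> R by rewrite exprn_gt0// invr_gt0.
  have [d d0 dP] := area_deviation k ip k0 e0.
  have [n0 n0P] := tlim _ d0; exists (maxn k n0); split; first exact: leq_maxl.
  by apply: dP; apply: n0P; exact: leq_maxr.
exists nu => [k|]; first by case: (nuP k).
pose X k := [set x | (k.+1%:R^-1)%:E <= deviation p k (t (nu k)) x]%E.
apply/eqP; rewrite eq_le area_ge0 andbT; apply/lee_addgt0Pr => e e0; rewrite add0e.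
have [N Ne] : exists N, 2 * 2^-1 ^+ N <= e.
  have h2 : `|2^-1 : R| < 1 by rewrite ger0_norm; lra.
  have e2 : 0 < e / 2 by rewrite divr_gt0.
  have /cvgrPdist_lt/(_ _ e2)[N _ /(_ N (leqnn N))] := cvg_expr h2.
  by rewrite sub0r normrN ger0_norm ?exprn_ge0 ?invr_ge0// => /ltW h; exists N; lra.
apply: (@le_trans _ _ (area (\bigcup_k X (k + N)%N))).
  apply: le_area => x /= nx; apply: contrapT => h; apply: nx; exists N => k Nk.
  by rewrite ltNge; apply/negP => Xk; apply: h; exists (k - N)%N => //; rewrite subnK.
apply: (le_trans (area_bigcup _)).
apply: (@le_trans _ _ (\sum_(k <oo) ((2 * 2^-1 ^+ N) / (2 ^ k.+1)%:R)%:E)%E).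
  apply: lee_nneseries => k _; rewrite ?area_ge0//; case: (nuP (k + N)%N) => _ /le_trans; apply.
  by rewrite lee_fin natrX exprS invfM -exprVn mulrACA divff// mul1r -exprD addnC.
apply: (le_trans (epsilon_trick0 _ _)); last by rewrite lee_fin.
by rewrite mulr_ge0// exprn_ge0// invr_ge0.
Qed.

End LebesgueSequence.

(** * Measurability and change of variables for meromorphic maps *)

Section MeroMeasure.
Variable R : realType.
Local Notation C := R[i].
Local Notation S := (sphere R).
Local Notation mR := (measurableTypeR R).
Local Notation T := (mR * mR)%type.
Local Notation mu := (@planar_measure R).
Local Notation tp := (@to_plane R).
Implicit Types (A B U X : set C) (z w v : C) (h : C -> R) (u : C -> C) (g : C -> S).

Lemma cont_cmfun U h : copen U -> (forall z, U z -> forall e : R, 0 < e ->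
  exists2 d : R, 0 < d & forall w, cnorm (w - z) < d -> `|h w - h z| < e) -> cmfun U h.
Proof.
move=> oU ch mD; apply: (measurability _ (RGenOInfty.measurableE R)) => //.
move=> /= _ [_ [a ->] <-].
have : cmeas (U `&` [set z | a < h z]); last first.
  by congr measurable; apply/seteqP; split => u [Uu]; rewrite /= in_itv/= andbT.
apply: copen_cmeas => z [Uz az].
have [r r0 rU] := oU z Uz; have az0 : 0 < h z - a by rewrite subr_gt0.
have [d d0 dP] := ch z Uz _ az0; exists (Num.min r d); first by rewrite lt_min r0.
move=> w; rewrite /cball /= lt_min => /andP[wr wd]; split; first exact: rU.
by have := dP w wd; rewrite /= ltr_norml => /andP[]; lra.
Qed.

Lemma cmfun_setT_if U h : cmeas U -> cmfun U h ->
  cmfun setT (fun z => if `[< U z >] then h z else 0).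
Proof.
move=> mU mh; rewrite /cmfun.
have := (measurable_restrictT (fun x => h (tp x)) mU).1 mh.
by apply: eq_measurable_fun => x _; rewrite /patch; case: ifPn.
Qed.

(** The map is extended by 0 outside [U], so that it becomes a measurable map on the whole plane. *)
Lemma cmeas_comp U u B : cmeas U -> cmfunc U u -> cmeas B -> cmeas (U `&` u @^-1` B).
Proof.
move=> mU [mr mi] mB; have mr' := cmfun_setT_if mU mr; have mi' := cmfun_setT_if mU mi.
have mp0 : measurable_fun setT (fun x : T =>
   (if `[< U (tp x) >] then Re (u (tp x)) else 0 : mR,
    if `[< U (tp x) >] then Im (u (tp x)) else 0 : mR)) by exact: measurable_fun_pair.
have mp := mp0 measurableT _ mB; rewrite setTI in mp.
rewrite /cmeas (_ : _ @^-1` _ = tp @^-1` U `&` (fun x : T =>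
   (if `[< U (tp x) >] then Re (u (tp x)) else 0 : mR,
    if `[< U (tp x) >] then Im (u (tp x)) else 0 : mR)) @^-1` (tp @^-1` B)).
  exact: measurableI mU mp.
by apply/seteqP; split => x [Ux Bx]; (split; first exact: Ux); move: Bx;
  rewrite /= !(asboolT Ux) /to_plane /=; case: (u _).
Qed.

Lemma cmfun_comp U u h : cmeas U -> cmfunc U u -> cmfun setT h -> cmfun U (fun z => h (u z)).
Proof.
move=> mU mu mh mD Y mY.
have mhY : cmeas [set z | Y (h z)] by have := mh measurableT Y mY; rewrite setTI.
exact: (cmeas_comp mU mu mhY).
Qed.

Definition findom g : set C := [set z | exists v : C, g z = Some v].

Lemma findom_open g : mero g -> copen (findom g).
Proof.
move=> mg z [v gz]; have [r [u [u' [r0 hu gu]]]] := mero_chart mg gz.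
by exists r => // w /gu gw; exists (u w).
Qed.

Lemma findom_cmeas g : mero g -> cmeas (findom g).
Proof. by move=> mg; exact: copen_cmeas (findom_open mg). Qed.

(** Meaningful on the open set [findom g], where [g] is finite. *)
Definition dfin g z : C := derive1 (@fin R \o g) z.

Lemma hasd_dfin g z a : hasd g z a -> dfin g z = a.
Proof. by move=> /hasd_pd/pd_derive[]. Qed.

Lemma mero_dfin g z : mero g -> findom g z -> hasd g z (dfin g z).
Proof. by move=> mg [v gz]; have [a ha] := mero_hasd mg gz; rewrite (hasd_dfin ha). Qed.

Lemma mero_cont g z : mero g -> findom g z -> forall e : R, 0 < e ->
  exists2 d : R, 0 < d & forall w, cnorm (w - z) < d ->
    cnorm (fin (g w) - fin (g z)) < e /\ cnorm (dfin g w - dfin g z) < e.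
Proof.
move=> mg [v gz] e e0; have [r [u [u' [r0 hu gu]]]] := mero_chart mg gz.
have [K K0 lu] := hol_lip hu; have [K' K'0 lu'] := hol_deriv_lip hu.
have K1 : 0 < K + K' + 1 by rewrite ltr_wpDl// addr_ge0.
exists (Num.min r (e / (K + K' + 1))); first by rewrite lt_min r0 divr_gt0.
move=> w; rewrite lt_min ltr_pdivlMr// => /andP[wr we].
have zz := cball_center z r0; have hd := hasd_ball hu gu.
rewrite !gu// (hasd_dfin (hd w wr)) (hasd_dfin (hd z zz)) /=.
have := cnorm_ge0 (w - z); have := lu z w zz wr; have := lu' z w zz wr; nra.
Qed.

Lemma mero_cmfunc g : mero g -> cmfunc (findom g) (fun z => fin (g z)).
Proof.
move=> mg; split; apply: cont_cmfun (findom_open mg) _ => z gz e e0;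
  have [d d0 dP] := mero_cont mg gz e0; exists d => // w /dP[h _];
  apply: le_lt_trans h; move: (fin (g w)) (fin (g z)) => [a b] [a' b'].
  exact: (ler_cnorm_Re ((a +i* b) - (a' +i* b'))).
exact: (ler_cnorm_Im ((a +i* b) - (a' +i* b'))).
Qed.

Lemma mero_cmfun_dfin g : mero g -> cmfun (findom g) (fun z => cnorm (dfin g z)).
Proof.
move=> mg; apply: cont_cmfun (findom_open mg) _ => z gz e e0.
have [d d0 dP] := mero_cont mg gz e0; exists d => // w /dP[_ h].
apply: le_lt_trans h; apply/ler_normlP; split; last exact: ler_cnormB.
by rewrite opprB cnormB ler_cnormB.
Qed.

Lemma cmeas_mero g (E : set S) : mero g -> cmeas [set v | E (Some v)] ->
  cmeas [set z | E (g z)].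
Proof.
move=> mg mE; have mf := findom_cmeas mg.
have m1 := cmeas_comp mf (mero_cmfunc mg) mE.
have -> : [set z | E (g z)] = (findom g `&` (fun z => fin (g z)) @^-1` [set v | E (Some v)])
    `|` (~` findom g `&` [set z | E None]).
  apply/seteqP; split => [z /=|z [[[v gz] /=]|[nf /=]]].
  - case gz: (g z) => [v|] Ez; first by left; split; [exists v|].
    by right; split => // -[v]; rewrite gz.
  - by rewrite gz.
  - by case gz: (g z) => [v|//]; case: nf; exists v.
apply: cmeasU => //; apply: cmeasI; first exact: cmeasC.
have [EN|nE] := pselect (E None).
  by rewrite (_ : [set z | _] = setT); [exact: cmeasT|apply/seteqP; split].
by rewrite (_ : [set z | _] = set0); [exact: cmeas0|apply/seteqP; split].
Qed.

Lemma mero_image g A (E : set C) (H : C -> R) : mero g -> cmeas A -> A `<=` findom g ->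
  cmeas E -> (forall y, E y -> exists2 z, A z & g z = Some y) -> cmfun setT H ->
  (forall z, 0 <= H z) ->
  (cint E H <= 512%:E * cint A (fun z => H (fin (g z)) * cnorm (dfin g z) ^+ 2)%R)%E.
Proof.
move=> mg mA Af mE Eg mH H0.
have mgA : cmfunc A (fun z => fin (g z)).
  by have [mr mi] := mero_cmfunc mg; split; exact: cmfunS (findom_cmeas mg) Af _.
apply: (cint_image (g := fun z => fin (g z)) (J := fun z => cnorm (dfin g z))) => //.
- exact: cmfunS (findom_cmeas mg) Af (mero_cmfun_dfin mg).
- by move=> z _; exact: cnorm_ge0.
- move=> z /Af gz e e0; have [d d0 dP] := pd_growth (hasd_pd (mero_dfin mg gz)) e0.
  by exists d => // w _; exact: dP.
- by move=> B mB; exact: cmeas_comp.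
- by move=> y /Eg[z Az gz]; exists z => //; rewrite gz.
Qed.

Lemma cint_eq A h k : (forall z, A z -> h z = k z) -> cint A h = cint A k.
Proof. by move=> hk; apply: eq_integral => u; rewrite inE => /hk ->. Qed.

Lemma cint_setD A X h : cmeas A -> cmeas X -> A `<=` X -> cmfun X h ->
  (forall z, X z -> 0 <= h z) -> cint X h = (cint A h + cint (X `\` A) h)%E.
Proof.
move=> mA mX AX mh h0; rewrite {1}(_ : X = A `|` (X `\` A)); last by rewrite setDUK.
rewrite {1}/cint preimage_setU ge0_integral_setU//.
- exact: cmeasD.
- by rewrite -preimage_setU setDUK//; exact: cmfunE.
- by rewrite -preimage_setU setDUK// => u /h0; rewrite lee_fin.
- by rewrite disj_set2E; apply/eqP/seteqP; split => u //= [Bu []].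
Qed.

Lemma cint_null A h : cmeas A -> cmfun A h -> area A = 0%E -> cint A h = 0%E.
Proof. by move=> mA /cmfunE mh; rewrite areaE// => A0; exact: null_set_integral. Qed.

Lemma cint_null_eq A X h : cmeas A -> cmeas X -> A `<=` X -> cmfun X h ->
  (forall z, X z -> 0 <= h z) -> area (X `\` A) = 0%E -> cint X h = cint A h.
Proof.
move=> mA mX AX mh h0 D0; rewrite (cint_setD mA mX AX mh h0) [X in (_ + X)%E]cint_null ?adde0//; first exact: cmeasD.
by apply: cmfunS mX _ mh.
Qed.

Lemma cint_disjoint_sum (I : eqType) (s : seq I) (A : I -> set C) X h : uniq s ->
  (forall i, cmeas (A i)) -> (forall i j z, A i z -> A j z -> i = j) ->
  (forall i, A i `<=` X) -> cmeas X -> cmfun X h -> (forall z, X z -> 0 <= h z) ->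
  (\sum_(i <- s) cint (A i) h <= cint X h)%E.
Proof.
move=> + mA dA.
have main Y : cmeas Y -> cmfun Y h -> (forall z, Y z -> 0 <= h z) -> uniq s ->
    (forall i, i \in s -> A i `<=` Y) -> (\sum_(i <- s) cint (A i) h <= cint Y h)%E.
  elim: s Y => [|i s IH] Y mY mh h0; first by rewrite big_nil => _ _; exact: cint_ge0.
  rewrite big_cons => /= /andP[si us] AY.
  have AiY : A i `<=` Y by apply: AY; rewrite inE eqxx.
  rewrite (cint_setD (mA i) mY AiY mh h0); apply: leeD => //; apply: IH => //.
  - exact: cmeasD.
  - exact: cmfunS mY _ mh.
  - by move=> z [/h0].
  - move=> j js z Ajz; split; first by apply: (AY j) => //; rewrite inE js orbT.
    by move=> Aiz; move: si; rewrite (dA _ _ _ Aiz Ajz) js.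
by move=> us AX mX mh h0; apply: main.
Qed.

(** Dominated convergence. Its contrapositive is a recurrence statement: sets whose mass stays
    bounded below contain some good point infinitely often. *)
Lemma cint_small (X : nat -> set C) h (N : set C) (e : R) : (forall n, cmeas (X n)) ->
  cmfun setT h -> (forall z, 0 <= h z) -> (cint setT h < +oo)%E -> area N = 0%E ->
  (forall z, ~ N z -> h z != 0 -> exists n0, forall n, (n0 <= n)%N -> ~ X n z) -> 0 < e ->
  exists n0, forall n, (n0 <= n)%N -> (cint (X n) h <= e%:E)%E.
Proof.
move=> mX mh h0 hoo N0 XN e0.
have [M [mM NM M0]] := area_hull N.
have mhE := cmfunE mh.
have ih : mu.-integrable setT (fun u : T => (h (tp u))%:E).
  apply/integrableP; split => //; apply: le_lt_trans hoo.
  apply: eqW; apply: eq_integral => u _.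
  by rewrite gee0_abs// lee_fin.
pose F n := (fun u : T => (h (tp u))%:E) \_ (tp @^-1` (X n `\` M)) : T -> \bar R.
have mF n : measurable_fun setT (F n).
  apply: (measurable_restrictT _ (cmeasD (mX n) mM)).1.
  exact: (cmfunE (cmfun_sub mh)).
have cv : (\int[mu]_u F n u)%E @[n --> \oo] --> (\int[mu]_u 0%E)%E.
  apply: (dominated_cvg measurableT mF (g := fun u : T => (h (tp u))%:E)) => //.
  - move=> u _; apply: cvg_near_cst.
    have [Mu|nMu] := pselect (M (tp u)).
      by apply: nearW => n; rewrite /F /patch memNset//= => -[].
    have [hu|hu] := eqVneq (h (tp u)) 0.
      by apply: nearW => n; rewrite /F /patch hu; case: ifP.
    have [n0 n0P] := XN (tp u) (fun Nu => nMu (NM _ Nu)) hu.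
    by exists n0 => // n /= /n0P nX; rewrite /F /patch memNset//= => -[].
  - move=> n u _; rewrite /F /patch; case: ifP => _; first by rewrite gee0_abs// lee_fin.
    by rewrite abse0 lee_fin.
rewrite integral0 in cv.
have e0' : (0%E < e%:E)%E by rewrite lte_fin.
have [n0 _ n0P] := cv _ (open_ereal_lt' e0').
exists n0 => n /n0P /= /ltW; apply: le_trans.
rewrite -integral_mkcond; apply: eqW.
have mS : cmfun (X n) h by exact: cmfunS (@cmeasT R) _ mh.
apply: (@cint_null_eq (X n `\` M) (X n)) => //; first exact: cmeasD.
apply: area_sub0 (_ : area M = 0%E); last by rewrite M0.
by move=> z [Xz nXz]; apply: contrapT => nM; apply: nXz.
Qed.

End MeroMeasure.

(** * Grand orbits, transport of mass and the choice of a base point *)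

Section Orbits.
Variable R : realType.
Local Notation C := R[i].
Local Notation S := (sphere R).
Implicit Types (z w v y : C) (A X Y : set C) (x : S) (N : set S).
Variables (f : ratmap R) (sigma : set S) (D : 'I_(rdeg f) -> set S) (phi : L1 R).
Local Notation F := (reval f).
Local Notation d := (rdeg f).
Local Notation psi := (cfun (repr phi)).
Hypotheses (d2 : (2 <= d)%N) (hD : sheets sigma D) (sigma0 : null sigma).
Hypothesis good0 : area [set z | ~ good_point f psi z] = 0%E.

Let d0 : (0 < d)%N := ltnW d2.

Lemma null_image N : null N -> null (F @` N).
Proof.
move=> /null_area N0; apply/null_area.
apply: (@area_sub0 _ _ (fimage f [set z | N (Some z)] `|` [set y | Some y = F None])).
  move=> y [[z|] Nz Fz]; first by left; exists z.
  by right; rewrite /= Fz.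
apply: areaU0; first exact: area_fimage0.
case FN : (F None) => [v|]; last by apply: area_sub0 (@area0 R) => y.
by apply: area_sub0 (area1 v) => y [->].
Qed.

Lemma null_iter_image n N : null N -> null (iter n F @` N).
Proof.
move=> N0; elim: n => [|n IH]; first by rewrite image_id.
apply: null_sub (null_image IH) => _ [x Nx <-]; exists (iter n F x) => //; exact: imageP.
Qed.

Lemma null_iter_preimage n N : null N -> null (iter n F @^-1` N).
Proof.
elim: n N => [//|n IH] N N0.
by apply: null_sub (IH _ (nonsingular_reval d0 N0)) => x.
Qed.

Definition bad : set S := [set x | x = None \/ sigma x \/
  exists2 z, x = Some z & ~ good_point f psi z].

Lemma null_bad : null bad.
Proof.
apply/null_area; have /null_area s0 := sigma0; apply: area_sub0 (areaU0 s0 good0) => z /=.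
by move=> [|[|[_ [<-]]]] //; [left|right].
Qed.

(* The grand orbit of [z] avoids the exceptional null set. *)
Definition gog z := forall n m x, iter n F x = iter m F (Some z) -> ~ bad x.

(** The exceptional points lie in countably many preimages of images of a null set, and iterates
    preserve null sets in both directions. *)
Lemma gog_ae : area [set z | ~ gog z] = 0%E.
Proof.
apply: (@area_sub0 _ _ (\bigcup_n \bigcup_m
    [set z | (iter m F @^-1` (iter n F @` bad)) (Some z)])).
  move=> z /existsNP[n /existsNP[m /existsNP[x /not_implyP[e /contrapT bx]]]].
  by exists n => //; exists m => //; exists x.
apply: area_bigcup0 => n; apply: area_bigcup0 => m; apply/null_area.
exact: null_iter_preimage (null_iter_image n null_bad).
Qed.

Lemma gog_step z y : gog z -> F (Some z) = Some y -> gog y.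
Proof. by move=> gz Fz n m x e; apply: (gz n m.+1); rewrite e iterSr Fz. Qed.

Lemma gog_pre y x : gog y -> F x = Some y -> exists2 z, x = Some z & gog z.
Proof.
move=> gy Fx; have nb : ~ bad x by apply: (gy 1%N 0%N).
case: x Fx nb => [z|] Fx nb; last by case: nb; left.
by exists z => // n m x e; apply: (gy n.+1 m); rewrite iterS e -iterS iterSr Fx.
Qed.

Lemma gog_good z : gog z -> good_point f psi z /\ ~ sigma (Some z).
Proof.
move=> gz; have nb : ~ bad (Some z) by apply: (gz 0%N 0%N).
split; last by move=> s; apply: nb; right; left.
by apply: contrapT => ng; apply: nb; right; right; exists z.
Qed.

Lemma mero_iter n : mero (iter n F \o Some).
Proof.
elim: n => [|n IH]; first exact: mero_Some.
exact: (mero_reval f IH).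
Qed.

Lemma gog_deriv z n : gog z -> exists y a, [/\ iter n F (Some z) = Some y, gog y,
  a != 0, hasd (iter n F \o Some) z a & psi y * a ^+ 2 = (d%:R : C) ^+ n * psi z].
Proof.
move=> gz; elim: n => [|n [y [a [Fz gy a0 ha E]]]].
  exists z, 1; split; rewrite ?oner_eq0//.
    by exists 1, id, (fun=> 1); split => //; exact: hol_id.
  by rewrite expr1n expr0 mulr1 mul1r.
have [[y' [b [Fy b0 hb E']]] _] := gog_good gy.
exists y', (b * a); split.
- by rewrite iterS Fz.
- exact: gog_step gy Fy.
- by rewrite mulf_neq0.
- exact: (hasd_compS (k := F) ha Fz hb).
- by rewrite exprMn mulrA E' -mulrA E exprS mulrA.
Qed.

Let i0 : 'I_d := Ordinal d0.

Lemma gog_word (w : seq 'I_d) y : gog y -> exists z, [/\ gog z,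
  iter (size w) F (Some z) = Some y &
  forall k, (k < size w)%N -> D (nth i0 w k) (iter k F (Some z))].
Proof.
elim: w y => [|i w IH] y gy; first by exists y.
have [z' [gz' Fz' zD]] := IH y gy; have [_ ns] := gog_good gz'.
have [x [xP _]] := sheet_fiber hD ns; have [xi Fx] := xP i.
have [z xz gz] := gog_pre gz' Fx; rewrite xz in xi Fx.
exists z; split => //; first by rewrite /= -iterS iterSr Fx.
case=> [_|k kw] //; rewrite iterSr Fx; exact: zD.
Qed.

Definition mass z : R := cnorm (psi z).

Lemma mass_cmfun : cmfun setT mass.
Proof. exact: cmfunc_cnorm (cintegrable_cmfunc (cintegrableP _)). Qed.

Lemma mass_ge0 z : 0 <= mass z. Proof. exact: cnorm_ge0. Qed.

Lemma mass_fin X : cmeas X -> cint X mass \is a fin_num.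
Proof.
move=> mX; rewrite ge0_fin_numE; last by apply: cint_ge0 => z _; exact: mass_ge0.
have := cint_subset mX (@cmeasT R) (@subsetT _ X) mass_cmfun (fun z _ => mass_ge0 z).
move=> /le_lt_trans; apply; have := integrable_fin_num measurableT (integrable_normc (repr phi)).
by rewrite ge0_fin_numE//; apply: integral_ge0 => u _; rewrite lee_fin cnorm_ge0.
Qed.

Definition pullback n Y : set C := [set z | exists2 y, Y y & iter n F (Some z) = Some y].

Lemma pullback_cmeas n Y : cmeas Y -> cmeas (pullback n Y).
Proof.
move=> mY; have := @cmeas_mero _ _ (Some @` Y) (mero_iter n); rewrite /=.
have -> : [set v | (Some @` Y) (Some v)] = Y.
  by apply/seteqP; split => [v [y Yy [<-]]|v Yv]; [|exists v].
move=> /(_ mY); congr cmeas; apply/seteqP; split => [z [y Yy e]|z [y Yy e]]; first by exists y.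
by exists y.
Qed.

(** Each of the d^n itineraries cuts out a set mapped over almost all of [Y], which by the iterated
    equation carries at least the mass of [Y] divided by 512 d^n. These sets are disjoint, and
    summing over them cancels d^n. *)
Lemma mass_pullback n Y : cmeas Y ->
  fine (cint Y mass) <= 512 * fine (cint (pullback n Y) mass).
Proof.
move=> mY; have [N0 [mN0 gN0 N00]] := area_hull [set z | ~ gog z].
have {}N00 : area N0 = 0%E by rewrite N00 gog_ae.
have img0 : area [set y | (iter n F @` (Some @` N0)) (Some y)] = 0%E.
  apply/null_area; apply: null_iter_image; apply/null_area.
  by apply: area_sub0 N00 => z [y Ny [<-]].
have [N1 [mN1 iN1 N10]] := area_hull [set y | (iter n F @` (Some @` N0)) (Some y)].
rewrite img0 in N10.
(* Removing [N1], the values with a preimage in [N0], keeps the points given by [gog_word] outside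
   [N0]. *)
pose E := Y `\` N0 `\` N1.
have mE : cmeas E by apply: cmeasD => //; exact: cmeasD.
have YE : cint Y mass = cint E mass.
  apply: cint_null_eq => //; first by move=> z [[]].
  - exact: cmfunS (@cmeasT R) _ mass_cmfun.
  - by move=> z _; exact: mass_ge0.
  - apply: area_sub0 (areaU0 N00 N10) => z [Yz nE].
    have [|nN0] := pselect (N0 z); first by left.
    by right; apply: contrapT => nN1; apply: nE.
pose A (w : n.-tuple 'I_d) := [set z | forall k : 'I_n, D (tnth w k) (iter k F (Some z))]
  `&` (pullback n Y `\` N0).
have mX := pullback_cmeas n mY.
have mA (w : n.-tuple 'I_d) : cmeas (A w).
  apply: cmeasI; last exact: cmeasD.
  rewrite (_ : [set z | _] = \bigcap_k [set z | forall (h : (k < n)%N),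
     D (tnth w (Ordinal h)) (iter k F (Some z))]).
    apply: cmeas_bigcap => k; have [h|h] := pselect (is_true (k < n)%N); last first.
      rewrite (_ : [set z | _] = setT); first exact: cmeasT.
      by apply/seteqP; split => // z _ h'.
    have := @cmeas_mero _ _ (D (tnth w (Ordinal h))) (mero_iter k) _.
    have oD : cmeas [set v | D (tnth w (Ordinal h)) (Some v)].
      by apply: copen_cmeas; apply: open_sphere_copen; have [_ _ oD _] := hD; case: (oD (tnth w (Ordinal h))).
    move=> /(_ oD); congr cmeas; apply/seteqP; split => z /=; last exact.
    by move=> Dz h'; rewrite (bool_irrelevance h' h).
  apply/seteqP; split => z /=; first by move=> Dz k _ h; exact: (Dz (Ordinal h)).
  by move=> Dz k; have := Dz k I (ltn_ord k); congr (D (tnth w _) _); exact: val_inj.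
have Agog (w : n.-tuple 'I_d) z : A w z -> gog z by move=> [_ [_ nN0]]; apply: contrapT => /gN0.
have dA (w w' : n.-tuple 'I_d) z : A w z -> A w' z -> w = w'.
  move=> [wz _] [wz' _]; apply: eq_from_tnth => k.
  have h1 : D (tnth w k) (iter k F (Some z)) by exact: wz.
  have h2 : D (tnth w' k) (iter k F (Some z)) by exact: wz'.
  exact: sheet_disjoint hD _ _ _ h1 h2.
have AX (w : n.-tuple 'I_d) : A w `<=` pullback n Y by move=> z [_ []].
have onA (w : n.-tuple 'I_d) : fine (cint E mass) <= 512 * (d%:R ^+ n * fine (cint (A w) mass)).
  have Afin : A w `<=` findom (iter n F \o Some).
    by move=> z /Agog/(gog_deriv n)[y [a [Fz _ _ _ _]]]; exists y.
  have := mero_image (mero_iter n) (mA w) Afin mE (H := mass).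
  have -> : cint (A w) (fun z => mass (fin ((iter n F \o Some) z)) * cnorm (dfin (iter n F \o Some) z) ^+ 2)
      = cint (A w) (fun z => d%:R ^+ n * mass z).
    apply: cint_eq => z /Agog/(gog_deriv n)[y [a [Fz _ a0 ha e]]].
    rewrite (hasd_dfin ha) /= Fz /= /mass -cnormX -cnormM e cnormM cnormX.
    by rewrite cnorm_nat.
  have mAm : cmfun (A w) mass by exact: cmfun_sub mass_cmfun.
  rewrite -(cintZl (mA w) mAm (fun z _ => mass_ge0 z) (exprn_ge0 n (ler0n R d))).
  move=> h; rewrite -lee_fin 2!EFinM !fineK ?mass_fin//.
  apply: h; [|exact: mass_cmfun|exact: mass_ge0].
  move=> y [[Yy nN0] nN1].
  have gy : gog y by apply: contrapT => /gN0.
  have [z [gz Fz zD]] := gog_word (tval w) gy; rewrite size_tuple in Fz zD.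
  exists z => //; split.
    by move=> k; rewrite (tnth_nth i0); exact: zD.
  split; first by exists y.
  by move=> Nz; apply: nN1; apply: iN1; exists (Some z) => //; exists z.
have dn0 : 0 < (d%:R : R) ^+ n by rewrite exprn_gt0// ltr0n.
have sumA : \sum_(w : n.-tuple 'I_d) fine (cint (A w) mass) <= fine (cint (pullback n Y) mass).
  rewrite -lee_fin -sumEFin fineK ?mass_fin//.
  under eq_bigr do rewrite fineK ?mass_fin//.
  have := cint_disjoint_sum (enum_uniq {: n.-tuple 'I_d}) mA dA AX mX
    (cmfun_sub mass_cmfun) (fun z _ => mass_ge0 z).
  by rewrite big_enum.
rewrite YE -(ler_pM2l dn0) mulrCA.
have -> : d%:R ^+ n * fine (cint E mass) = \sum_(w : n.-tuple 'I_d) fine (cint E mass).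
  by rewrite sumr_const card_tuple card_ord -natrX mulr_natl.
apply: (@le_trans _ _ (\sum_(w : n.-tuple 'I_d) 512 * (d%:R ^+ n * fine (cint (A w) mass)))).
  by apply: ler_sum => w _; exact: onA.
rewrite -mulr_sumr -mulr_sumr; apply: ler_wpM2l; first exact: ler0n.
by apply: ler_wpM2l sumA; exact: ltW.
Qed.

Definition scale n : R := (Num.sqrt d%:R)^-1 ^+ n.

Lemma scale_gt0 n : 0 < scale n.
Proof. by rewrite exprn_gt0// invr_gt0 sqrtr_gt0 ltr0n. Qed.

Lemma scale_sqr n : scale n ^+ 2 = (d%:R ^+ n)^-1.
Proof. by rewrite /scale -exprM mulnC exprM exprVn sqr_sqrtr ?ler0n// exprVn. Qed.

Lemma scale_lim (e : R) : 0 < e -> exists n0, forall n, (n0 <= n)%N -> `|scale n| < e.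
Proof.
move=> e0; have [||n0 n0P] := @small_exp R (Num.sqrt d%:R)^-1 e.
- have s1 : 1 < Num.sqrt (d%:R : R) by rewrite -[ltLHS]sqrtr1 ltr_sqrt ?ltr1n// ltr0n.
  by rewrite invr_ge0 sqrtr_ge0 invf_lt1// (lt_trans ltr01).
- by [].
by exists n0 => n /n0P; rewrite ger0_norm// ltW// scale_gt0.
Qed.

(** Returns to this region keep the values and derivatives of the zoomed iterates at 0 from
    degenerating. *)
Definition trap (T : R) : set C := [set y | mass y <= T /\ cnorm y <= T].

Lemma trap_cmeas T : cmeas (trap T).
Proof.
have le_meas (h : C -> R) : cmfun setT h -> cmeas [set y | h y <= T].
  move=> mh; have := mh measurableT _ (measurable_itv `]-oo, T]); rewrite setTI.
  by congr measurable; apply/seteqP; split => u /=; rewrite in_itv.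
apply: (cmeasI (A := [set y | mass y <= T]) (B := [set y | cnorm y <= T])).
  exact: le_meas mass_cmfun.
apply: le_meas; apply: cont_cmfun => [z _|z _ e e0]; first by exists 1.
exists e => // w we; apply: le_lt_trans we.
by apply/ler_normlP; split; [rewrite opprB cnormB|]; exact: ler_cnormB.
Qed.

Lemma deviation_le k k' (t : R) z : (k <= k')%N -> (deviation psi k t z <= deviation psi k' t z)%E.
Proof.
move=> kk; apply: (cint_subset (cball_cmeas _ _) (cball_cmeas _ _)).
- by apply: cball_le; rewrite ler_nat.
- have [mr mi] := cintegrable_cmfunc (cintegrableP (repr phi)).
  apply: cmfun_sub; apply: cmfunc_cnorm.
  have -> : (fun w => psi (z + t%:C * w) - psi z) = (fun w => psi (t%:C * w + z) - psi z).
    by apply/funext => w; rewrite (addrC z).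
  apply: (cmfuncB (q := fun=> psi z)); split.
  - exact: (cmfun_affine t z mr).
  - exact: (cmfun_affine t z mi).
  - exact: cmfun_cst.
  - exact: cmfun_cst.
- by move=> w _; exact: cnorm_ge0.
Qed.

Hypothesis phi0 : phi <> 0.

Definition total_mass : R := fine (cint setT mass).

Lemma total_mass_gt0 : 0 < total_mass.
Proof.
rewrite lt_def; apply/andP; split; last by apply: fine_ge0; apply: cint_ge0 => z _; exact: mass_ge0.
apply/eqP => m0; apply: phi0; apply: L1_norm0_eq0.
by rewrite /L1_norm (_ : norm1 (repr phi) = total_mass)// m0.
Qed.

(** The pullbacks of the trap have mass bounded below by [mass_pullback], so almost every point
    cannot leave them for good. Some point is then at once a Lebesgue point, good along its grand
    orbit, and recurrent. *)
Lemma orbit_point : exists (T : R) z (nu : nat -> nat), [/\ 1 <= T,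
  fine (cint (~` trap T) mass) <= total_mass / 4, gog z, psi z != 0 &
  forall k, [/\ (k <= nu k)%N, pullback (nu k) (trap T) z &
    (deviation psi k (scale (nu k)) z <= (k.+1%:R^-1)%:E)%E]].
Proof.
have m0 := total_mass_gt0.
have moo : (cint setT mass < +oo)%E.
  by have := mass_fin (@cmeasT R); rewrite ge0_fin_numE// cint_ge0// => z _; exact: mass_ge0.
have m4 : 0 < total_mass / 4 by rewrite divr_gt0.
have [|n0 n0P] := @cint_small _ (fun n => ~` trap n.+1%:R) mass set0 (total_mass / 4)
    (fun n => cmeasC (trap_cmeas _)) mass_cmfun mass_ge0 moo (@area0 R) _ m4.
  move=> z _ _; exists (Num.truncn (mass z + cnorm z)) => n ln; apply.
  have := truncnS_gt (mass z + cnorm z).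
  have : (Num.truncn (mass z + cnorm z)).+1%:R <= n.+1%:R :> R by rewrite ler_nat.
  by have := mass_ge0 z; have := cnorm_ge0 z => a b c e; split; lra.
pose T : R := n0.+1%:R.
have mc := cmeasC (trap_cmeas T).
have cT : fine (cint (~` trap T) mass) <= total_mass / 4.
  by rewrite -lee_fin fineK ?mass_fin//; exact: n0P.
have trap_big : total_mass / 2 <= fine (cint (trap T) mass).
  have := cint_setD (trap_cmeas T) (@cmeasT R) (@subsetT _ _) mass_cmfun (fun z _ => mass_ge0 z).
  have fT := mass_fin (trap_cmeas T).
  have fc : cint (setT `\` trap T) mass \is a fin_num by rewrite setTD; exact: mass_fin mc.
  move=> e; have {e} : total_mass = fine (cint (trap T) mass) + fine (cint (setT `\` trap T) mass).
    by rewrite /total_mass e; exact: fineD fT fc.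
  by rewrite setTD; lra.
have [nu nuk dev0] := lebesgue_sequence (cintegrableP (repr phi)) scale_lim.
pose Nl := [set x | ~ exists k0, forall k, (k0 <= k)%N ->
      (deviation psi k (scale (nu k)) x < (k.+1%:R^-1)%:E)%E].
have [z [gz pz [k0 k0P] inf]] : exists z, [/\ gog z, psi z != 0,
    exists k0, forall k, (k0 <= k)%N -> (deviation psi k (scale (nu k)) z < (k.+1%:R^-1)%:E)%E &
    forall k0, exists2 k, (k0 <= k)%N & pullback (nu k) (trap T) z].
  apply: contrapT => nex.
  (* Half of the total mass lies in the trap, so each pullback has mass at least total_mass / 1024;
     any smaller bound is contradictory. *)
  have m2 : 0 < total_mass / 2048 by lra.
  have [|k kP] := @cint_small _ (fun k => pullback (nu k) (trap T)) mass
     ([set z | ~ gog z] `|` Nl) (total_mass / 2048) (fun k => pullback_cmeas _ (trap_cmeas _))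
     mass_cmfun mass_ge0 moo (areaU0 gog_ae dev0) _ m2.
    move=> z nN; rewrite /mass cnorm_eq0 => pz; apply: contrapT => h; apply: nex.
    exists z; split => //.
    - by apply: contrapT => ng; apply: nN; left.
    - by apply: contrapT => ng; apply: nN; right.
    - move=> k1; apply: contrapT => nk; apply: h; exists k1 => k k1k Xk.
      by apply: nk; exists k.
  have := kP k (leqnn k); have mX := pullback_cmeas (nu k) (trap_cmeas T).
  rewrite -(fineK (mass_fin mX)) lee_fin => h.
  have := mass_pullback (nu k) (trap_cmeas T); lra.
(* A second extraction keeps only the return times; [deviation_le] brings the balls back from radius
   [j k] to radius [k]. *)
have /choice[j jP] k : exists j, [/\ (k <= j)%N, (k0 <= j)%N & pullback (nu j) (trap T) z].
  by have [j jk pj] := inf (maxn k k0); exists j; split => //; apply: leq_trans jk; rewrite leq_max leqnn ?orbT.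
exists T, z, (nu \o j); split => //; first by rewrite ler1n.
move=> k; have [kj k0j pj] := jP k; split => //=; first exact: leq_trans kj (nuk _).
apply: (le_trans (deviation_le _ _ kj)); apply: (le_trans (ltW (k0P _ k0j))).
by rewrite lee_fin lef_pV2 ?posrE// ler_nat.
Qed.

End Orbits.

(** * Zooming *)

Section OmittedSet.
Variable R : realType.
Local Notation C := R[i].
Implicit Types (z w v : C) (A B : C -> C) (Om X : set C).

Lemma cmfun_inv_dist v X : cmfun X (fun z => (cnorm (z - v))^-1).
Proof.
have oU : copen [set z | z != v].
  move=> z zv; exists (cnorm (z - v)); first by rewrite cnorm_gt0 subr_eq0.
  by move=> w; rewrite /cball /=; apply: contraTneq => ->; rewrite cnormB ltxx.
have cU : cmfun [set z | z != v] (fun z => (cnorm (z - v))^-1).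
  apply: cont_cmfun oU _ => z /= zv e e0.
  have m0 : 0 < cnorm (z - v) by rewrite cnorm_gt0 subr_eq0.
  have e1 : 0 < e * cnorm (z - v) ^+ 2 / 2 by rewrite divr_gt0// mulr_gt0// exprn_gt0.
  exists (Num.min (cnorm (z - v) / 2) (e * cnorm (z - v) ^+ 2 / 2)).
    by rewrite lt_min divr_gt0.
  move=> w; rewrite lt_min => /andP[w1 w2].
  have h1 := ler_cnormB (z - v) (w - v); have h2 := ler_cnormB (w - v) (z - v).
  have e2 : z - v - (w - v) = - (w - z) by ring.
  have e3 : w - v - (z - v) = w - z by ring.
  rewrite e2 cnormN in h1; rewrite e3 in h2.
  set m := cnorm (z - v) in m0 e1 w1 w2 h1 h2 *; set q := cnorm (w - v) in h1 h2 *.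
  have q0 : m / 2 < q by lra.
  have q1 : 0 < q by lra.
  have -> : q^-1 - m^-1 = (m - q) / (q * m) by field; rewrite !gt_eqF.
  rewrite normrM normfV (gtr0_norm (mulr_gt0 q1 m0)) ltr_pdivrMr ?mulr_gt0//.
  apply: (@le_lt_trans _ _ (cnorm (w - z))).
    by apply/ler_normlP; split; lra.
  apply: (lt_trans w2); rewrite mulrA -subr_gt0.
  have -> : e * (q * m) - e * m * m / 2 = e * m * (q - m / 2) by field.
  by rewrite !mulr_gt0// subr_gt0.
have := cmfun_setT_if (copen_cmeas oU) cU.
have -> : (fun z => if `[< [set z | z != v] z >] then (cnorm (z - v))^-1 else 0) =
    (fun z => (cnorm (z - v))^-1).
  apply/funext => z; have [->|zv] := eqVneq z v; last by rewrite asboolT.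
  by rewrite asboolF ?subrr ?cnorm0 ?invr0//= eqxx.
exact: cmfun_sub.
Qed.

(** On the annulus between radii 2^(-n-1) and 2^(-n) the function is at most 2^(n+1) and the area at
    most 4 * 4^(-n): the n-th term is 16 / 2^(n+1), with sum 16. *)
Lemma cint_inv_dist_ball v : (cint (cball v 1) (fun z => ((cnorm (z - v))^-1)%R) <= (16%R : R)%:E)%E.
Proof.
pose An (n : nat) := [set z | 2^-1 ^+ n.+1 <= cnorm (z - v) < 2^-1 ^+ n].
have q0 n : 0 < (2^-1 : R) ^+ n by rewrite exprn_gt0// invr_gt0.
have AnE n : An n = cball v (2^-1 ^+ n) `\` cball v (2^-1 ^+ n.+1).
  apply/seteqP; split => z; rewrite /An /cball /=.
    by move=> /andP[h ->]; split => //; apply/negP; rewrite -leNgt.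
  by move=> [-> /negP]; rewrite -leNgt => ->.
have mA n : cmeas (An n) by rewrite AnE; apply: cmeasD; exact: cball_cmeas.
have tA : trivIset setT An.
  apply/trivIsetP => i j _ _; wlog: i j / (i < j)%N.
    move=> h ij; have [|ji|e] := ltngtP i j; first by move/h; apply.
      by rewrite setIC; apply: h; rewrite // eq_sym.
    by rewrite e eqxx in ij.
  move=> ij _; apply/seteqP; split => // z [] /= /andP[h _] /andP[_ h'].
  have : (2^-1 : R) ^+ j <= 2^-1 ^+ i.+1 by rewrite ler_wiXn2l//; lra.
  by move=> /(lt_le_trans h')/lt_le_trans/(_ h); rewrite ltxx.
have cov : cball v 1 `\ v = \bigcup_n An n.
  apply/seteqP; split => z.
    rewrite /cball /= => -[z1 zv]; have z0 : 0 < cnorm (z - v).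
      by rewrite cnorm_gt0 subr_eq0; apply/eqP.
    have [n0 n0P] := @small_exp R 2^-1 _ (ltac:(apply/andP; split; lra)) z0.
    have ex : exists n, (2^-1 : R) ^+ n.+1 <= cnorm (z - v).
      by exists n0; rewrite ltW// n0P.
    have [n nP nmin] := ex_minnP ex; exists n => //; rewrite /An /= nP /=.
    case: n nP nmin => [|n] nP nmin; first by rewrite expr0.
    by rewrite ltNge; apply/negP => /nmin; rewrite ltnn.
  move=> [n _]; rewrite /An /cball /= => /andP[h1 h2]; split.
    by apply: lt_le_trans h2 _; rewrite exprn_ile1//; lra.
  by move=> zv; move: h1; rewrite zv subrr cnorm0 leNgt q0.
have mh X : cmfun X (fun z => (cnorm (z - v))^-1) by exact: cmfun_inv_dist.
have h0 z : 0 <= (cnorm (z - v))^-1 by rewrite invr_ge0 cnorm_ge0.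
have m1 : cmeas [set v].
  rewrite (_ : [set v] = \bigcap_n cball v n.+1%:R^-1).
    by apply: cmeas_bigcap => n; exact: cball_cmeas.
  apply/seteqP; split => [z -> n _|z h]; first by apply: cball_center; rewrite invr_gt0.
  apply: cnorm_small_eq => e e0; have [n ne] := invSn_lt e0.
  by apply: le_trans (ltW ne); exact: ltW (h n I).
have cE : cint (cball v 1) (fun z => (cnorm (z - v))^-1) =
    cint (\bigcup_n An n) (fun z => (cnorm (z - v))^-1).
  rewrite -cov; apply: cint_null_eq => //.
  - by apply: cmeasD => //; exact: cball_cmeas.
  - exact: cball_cmeas.
  - by apply: area_sub0 (area1 v) => z [zb nz]; apply: contrapT => h; apply: nz.
rewrite cE cint_bigcup//.
apply: (@le_trans _ _ (\sum_(n <oo) (16 / (2 ^ n.+1)%:R : R)%:E)%E); last exact: epsilon_trick0.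
apply: lee_nneseries => n _; first by move=> _; exact: cint_ge0.
apply: (@le_trans _ _ (cint (An n) (fun=> (2 ^+ n.+1)%R))).
  apply: cint_le => //; first exact: cmfun_cst.
  move=> z /andP[z1 _]; rewrite h0 /=.
  have zp : 0 < cnorm (z - v) by exact: lt_le_trans z1.
  by rewrite -[leRHS]invrK lef_pV2 ?posrE ?invr_gt0 ?exprn_gt0// -exprVn.
rewrite cint_cst//; apply: (@le_trans _ _ ((2 ^+ n.+1)%:E * (4 * (2^-1 ^+ n) ^+ 2)%:E)%E).
  apply: lee_wpmul2l; first by rewrite lee_fin exprn_ge0.
  apply: le_trans (area_cball v (ltW (q0 n))); apply: le_area => z.
  by rewrite /An /cball /= => /andP[].
rewrite -EFinM lee_fin natrX exprVn exprS; apply: eqW.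
by field; rewrite expf_neq0.
Qed.

Definition disk (T : R) : set C := cball 0 (T + 1).

(** The bound is uniform in the singularity [v]: within distance 1 it is the previous one, beyond it
    the integrand is at most 1. *)
Lemma cint_inv_dist v (T : R) : 0 <= T ->
  (cint (disk T) (fun z => ((cnorm (z - v))^-1)%R) <= (16 + 4 * (T + 1) ^+ 2)%:E)%E.
Proof.
move=> T0; have T1 : 0 <= T + 1 by rewrite addr_ge0.
have mh X : cmfun X (fun z => (cnorm (z - v))^-1) by exact: cmfun_inv_dist.
have h0 z : 0 <= (cnorm (z - v))^-1 by rewrite invr_ge0 cnorm_ge0.
have mD : cmeas (disk T) by exact: cball_cmeas.
have m1 := cball_cmeas v 1.
have mI : cmeas (disk T `&` cball v 1) by exact: cmeasI.
rewrite (cint_setD mI mD (@subIsetl _ _ _) (mh _) (fun z _ => h0 z)).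
rewrite EFinD; apply: leeD.
  by apply: le_trans (cint_inv_dist_ball v); apply: cint_subset => // z [].
rewrite (_ : disk T `\` _ = disk T `\` cball v 1); last first.
  by apply/seteqP; split => z [] zD nz; split => // zv; apply: nz => //; case: zv.
apply: (@le_trans _ _ (cint (disk T `\` cball v 1) (fun=> 1%R))).
  apply: cint_le => //; [exact: cmeasD|exact: cmfun_cst|].
  move=> z [_ /negP]; rewrite /= -leNgt => z1; rewrite h0 /= invf_le1//.
  exact: lt_le_trans z1.
rewrite cint_cst; last exact: cmeasD.
rewrite mul1e; by apply: le_trans (area_cball 0 T1); apply: le_area => z [].
Qed.

Lemma cint_sum (I : Type) (s : seq I) (H : I -> C -> R) X : cmeas X ->
  (forall i, cmfun X (H i)) -> (forall i z, 0 <= H i z) ->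
  cmfun X (fun z => \sum_(i <- s) H i z) /\
  cint X (fun z => \sum_(i <- s) H i z) = (\sum_(i <- s) cint X (H i))%E.
Proof.
move=> mX mH H0; elim: s => [|i s [IHm IH]].
  have e : (fun z : C => \sum_(i <- [::]) H i z) = (fun=> 0) by apply/funext => z; rewrite big_nil.
  by rewrite e big_nil; split; [exact: cmfun_cst|rewrite cint_cst// mul0e].
have e : (fun z : C => \sum_(j <- i :: s) H j z) = (fun z => H i z + \sum_(j <- s) H j z).
  by apply/funext => z; rewrite big_cons.
rewrite e big_cons; split; first exact: cmfunD.
rewrite cintD ?IH// => z _; exact: sumr_ge0.
Qed.

(* Ahlfors-Beurling: for every omitted value [v], the function [B / (A - v B)]
   is holomorphic, and its averages over circles are integrable in [v]. *)
Lemma omitted_lip z0 (r T delta : R) A B Om : 0 < r -> 0 <= T -> 0 < delta ->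
  holx z0 r A -> holx z0 r B ->
  (forall v, Om v -> cnorm v <= T) -> (delta%:E <= area Om)%E ->
  (forall v z, Om v -> cball z0 r z -> A z != v * B z) ->
  forall z w, cnorm (z - z0) <= r / 4 -> cnorm (w - z0) <= r / 4 ->
  cnorm (A z * B w - A w * B z) <= 32 * (16 + 4 * (T + 1) ^+ 2) / (delta * r) * cnorm (z - w) *
    ((cnorm (A z) + T * cnorm (B z)) * (cnorm (A w) + T * cnorm (B w))).
Proof.
move=> r0 T0 de0 [A' hA] [B' hB] OT Oarea AO z w zr wr.
set M : R := 16 + 4 * (T + 1) ^+ 2.
have M0 : 0 < M by rewrite ltr_pwDl// mulr_ge0// sqr_ge0.
set nz : R := cnorm (A z) + T * cnorm (B z); set nw : R := cnorm (A w) + T * cnorm (B w).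
have [->|zw] := eqVneq z w.
  by rewrite mulrC subrr cnorm0 subrr cnorm0 mulr0 mul0r.
have zw0 : 0 < cnorm (z - w) by rewrite cnorm_gt0 subr_eq0.
have inr y : cnorm (y - z0) <= r / 4 -> cball z0 r y.
  by move=> yr; rewrite /cball /=; lra.
have [v0 Ov0] : exists v, Om v.
  apply: contrapT => nO; move: Oarea; rewrite (_ : Om = set0) ?area0 ?lee_fin ?leNgt ?de0//.
  by apply/seteqP; split => // v Ov; apply: nO; exists v.
have nle y v : Om v -> cnorm (A y - v * B y) <= cnorm (A y) + T * cnorm (B y).
  move=> Ov; apply: (le_trans (ler_cnormD _ _)); rewrite cnormN cnormM lerD2l.
  by rewrite ler_wpM2r ?cnorm_ge0// OT.
have npos y : cball z0 r y -> 0 < cnorm (A y) + T * cnorm (B y).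
  move=> yr; apply: lt_le_trans (nle y _ Ov0).
  by rewrite cnorm_gt0 subr_eq0; exact: AO.
have nz0 : 0 < nz by exact: npos (inr _ zr).
have nw0 : 0 < nw by exact: npos (inr _ wr).
set q : R := cnorm (A z * B w - A w * B z) / (nz * nw).
have nn0 : 0 < nz * nw by rewrite mulr_gt0.
rewrite -ler_pdivrMr// -/q leNgt; apply/negP => qbig.
have q0 : 0 < q.
  apply: le_lt_trans qbig; apply: mulr_ge0 (cnorm_ge0 _); apply: divr_ge0.
    by apply: mulr_ge0 => //; exact: ltW.
  by apply: mulr_ge0; exact: ltW.
pose t k j : C := z0 + circle (r / 2)%:C k j.
have tr k j : cball z0 r (t k j).
  by rewrite /t /cball /= addrC addKr cnorm_circle; lra.
pose U v y := B y / (A y - v * B y).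
pose avg v k := (2 ^+ k)^-1 * \sum_(j < 2 ^ k) cnorm (U v (t k j)) : R.
(* If the Lipschitz bound failed, [cauchy_lip] would force the average of |U v| over the circle
   above [la] for every omitted [v]. *)
pose la : R := q * r / (16 * cnorm (z - w)).
have la0 : 0 < la by apply: divr_gt0; apply: mulr_gt0; rewrite ?ltr0n.
have ev v : Om v -> exists k0, forall k, (k0 <= k)%N -> la <= avg v k.
  move=> Ov; have hd := holB hA (holM (hol_cst z0 r v) hB).
  have r34 : 3 / 4 * r < r by lra.
  have r340 : 0 <= 3 / 4 * r by lra.
  have [|m m0 mP] := closed_ball_lower r340 r34 hd.
    by move=> y yr; rewrite subr_eq0; apply: AO => //; rewrite /cball /=; lra.
  have hi := holM (hol_shrink (ltW r34) hB) (holV m0 (fun y yb => mP y (ltW yb)) (hol_shrink (ltW r34) hd)).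
  have r2 : 0 < r / 2 by lra.
  have r23 : r / 2 < 3 / 4 * r by lra.
  have q2 : 0 < q / 2 by lra.
  have zr2 : cnorm (z - z0) <= r / 2 / 2 by lra.
  have wr2 : cnorm (w - z0) <= r / 2 / 2 by lra.
  have [k0 k0P] := cauchy_lip r2 r23 hi zr2 wr2 q2.
  exists k0 => k /k0P; rewrite -/(U v z) -/(U v w) => h.
  have dzv : A z - v * B z != 0 by rewrite subr_eq0 AO//; exact: inr.
  have dwv : A w - v * B w != 0 by rewrite subr_eq0 AO//; exact: inr.
  have Uq : q <= cnorm (U v z - U v w).
    have -> : U v z - U v w = - (A z * B w - A w * B z) / ((A z - v * B z) * (A w - v * B w)).
      by rewrite /U; field; rewrite dzv dwv.
    rewrite cnormM cnormN cnormV cnormM /q ler_wpM2l ?cnorm_ge0//.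
    rewrite lef_pV2 ?posrE ?mulr_gt0 ?cnorm_gt0//.
    by apply: ler_pM; rewrite ?cnorm_ge0// nle.
  have : q / 2 < 4 * cnorm (z - w) / (r / 2) * avg v k.
    by move: h; rewrite /avg /t /U; lra.
  rewrite (_ : 4 * cnorm (z - w) / (r / 2) = (8 * cnorm (z - w)) / r); last by field; rewrite gt_eqF.
  move=> /ltW h2; rewrite /la ler_pdivrMr ?mulr_gt0//.
  have : q / 2 * r <= 8 * cnorm (z - w) * avg v k.
    by rewrite -ler_pdivlMr//; apply: le_trans h2 _; rewrite mulrAC.
  lra.
(* The number of nodes needed depends on [v]; continuity of the outer area yields one [k] valid on
   more than half of the area. *)
pose An k := [set v | Om v /\ forall j, (k <= j)%N -> la <= avg v j].
have [k kbig] : exists k, ((delta / 2)%:E < area (An k))%E.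
  apply: contrapT => nk; have : (area (\bigcup_k An k) <= (delta / 2)%:E)%E.
    apply: area_nondecreasing_bigcup => [m n mn v [Ov vP]|n].
      by split => // j nj; apply: vP; exact: leq_trans nj.
    by rewrite leNgt; apply/negP => h; apply: nk; exists n.
  apply/negP; rewrite -ltNge; apply: (@lt_le_trans _ _ delta%:E); first by rewrite lte_fin; lra.
  apply: le_trans Oarea _; apply: le_area => v Ov; have [k kP] := ev v Ov.
  by exists k.
(* |B / (A - v B)| is the inverse distance from [v] to A/B, integrable in [v] with a bound that does
   not depend on the node; it is 0 when B vanishes. *)
pose ph (j : 'I_(2 ^ k)) (v : C) : R :=
  if B (t k j) == 0 then 0 else (cnorm (v - A (t k j) / B (t k j)))^-1.
have phE j v : Om v -> ph j v = cnorm (U v (t k j)).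
  move=> Ov; rewrite /ph /U; case: eqVneq => [->|b0]; first by rewrite mul0r cnorm0.
  rewrite -cnormV; have -> : v - A (t k j) / B (t k j) = - ((A (t k j) - v * B (t k j)) / B (t k j)).
    by field.
  by rewrite invrN cnormN invf_div.
have mph X j : cmfun X (ph j).
  by rewrite /ph; case: eqP => _; [exact: cmfun_cst|exact: cmfun_inv_dist].
have ph0 j v : 0 <= ph j v.
  by rewrite /ph; case: eqP => _ //; rewrite invr_ge0 cnorm_ge0.
have mD : cmeas (disk T) by exact: cball_cmeas.
have [ms sE] := cint_sum (index_enum 'I_(2 ^ k)) mD (mph (disk T)) ph0.
pose X := disk T `&` [set v | la * 2 ^+ k <= \sum_(j < 2 ^ k) ph j v].
have mX : cmeas X.
  have := ms mD _ (measurable_itv `[la * 2 ^+ k, +oo[).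
  by congr measurable; apply/seteqP; split => u [uD]; rewrite /= in_itv/= andbT.
have k0 : 0 < (2 : R) ^+ k by rewrite exprn_gt0.
have AX : An k `<=` X.
  move=> v [Ov vP]; split.
    by rewrite /disk /cball /= subr0; have := OT v Ov; lra.
  have := vP k (leqnn k); rewrite /avg mulrC ler_pdivlMr//.
  by under eq_bigr do rewrite -phE//.
(* Markov's inequality: the sum over the nodes has integral at most 2^k M, yet exceeds 2^k la on a
   set of area above delta/2. *)
have : ((la * 2 ^+ k)%:E * area X <= (2 ^+ k * M)%:E)%E.
  rewrite -cint_cst//; apply: (@le_trans _ _ (cint X (fun v => \sum_(j < 2 ^ k) ph j v))).
    apply: cint_le => //; [exact: cmfun_cst|by apply: cmfunS mD _ ms => v []|].
    by move=> v [_ vs]; rewrite vs mulr_ge0// ltW.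
  apply: (@le_trans _ _ (cint (disk T) (fun v => \sum_(j < 2 ^ k) ph j v))).
    by apply: cint_subset => // [v []//|v _]; apply: sumr_ge0.
  rewrite sE; apply: (@le_trans _ _ (\sum_(j < 2 ^ k) M%:E)%E).
    apply: lee_sum => j _; rewrite /ph; case: eqP => _; last exact: cint_inv_dist.
    by rewrite cint_cst// mul0e lee_fin ltW.
  by rewrite sumEFin sumr_const card_ord -[M *+ _]mulr_natl natrX.
apply/negP; rewrite -ltNge.
apply: (@lt_le_trans _ _ ((la * 2 ^+ k)%:E * (delta / 2)%:E)%E); last first.
  by apply: lee_wpmul2l; [rewrite lee_fin mulr_ge0// ltW|apply: le_trans (ltW kbig) _; exact: le_area].
rewrite -EFinM lte_fin (mulrC la) -mulrA ltr_pM2l// /la.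
rewrite -subr_gt0.
have -> : q * r / (16 * cnorm (z - w)) * (delta / 2) - M =
  (q - 32 * M / (delta * r) * cnorm (z - w)) * (delta * r / (32 * cnorm (z - w))).
  by field; rewrite !gt_eqF.
apply: mulr_gt0; first by rewrite subr_gt0.
by apply: divr_gt0; apply: mulr_gt0; rewrite ?ltr0n.
Qed.

(* A pair with this Lipschitz bound has a bounded chart on a ball whose radius
   depends only on the constants. *)
Lemma lip_chart z0 (rho T K s : R) A B : 1 <= T -> 0 <= K -> s <= rho ->
  2 * K * (1 + T) * T * s <= 1 -> ((A z0 != 0) || (B z0 != 0)) ->
  (forall z, cball z0 rho z -> ((A z != 0) || (B z != 0)) /\
   cnorm (A z * B z0 - A z0 * B z) <= K * cnorm (z - z0) *
    ((cnorm (A z) + T * cnorm (B z)) * (cnorm (A z0) + T * cnorm (B z0)))) ->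
  (forall z, cball z0 s z -> B z != 0 /\ cnorm (A z) <= 3 * cnorm (B z)) \/
  (forall z, cball z0 s z -> A z != 0 /\ cnorm (B z) <= 3 * cnorm (A z)).
Proof.
move=> T1 K0 sr sK n0 H.
have key (a b e : R) : 0 <= a -> 0 <= b -> 0 <= e -> e <= 1 / 2 ->
    a <= b + e * (a + b) -> a <= 3 * b by nra.
have ab z : cball z0 s z -> K * cnorm (z - z0) * (1 + T) * T <= 1 / 2.
  rewrite /cball /= => /ltW zs; apply: (@le_trans _ _ (K * s * (1 + T) * T)); last by lra.
  apply: ler_wpM2r; first by lra.
  by apply: ler_wpM2r; [lra|exact: ler_wpM2l].
have e0 z : 0 <= K * cnorm (z - z0) * (1 + T) * T.
  by apply: mulr_ge0; [apply: mulr_ge0; [exact: mulr_ge0 (cnorm_ge0 _)|]|]; lra.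
have grow (a b e : R) : 0 <= a -> 0 <= b -> 0 <= e -> e * (a + T * b) <= e * T * (a + b).
  move=> a0 b0 ee0; rewrite -mulrA; apply: ler_wpM2l => //; nra.
have [AB|/ltW BA] := leP (cnorm (A z0)) (cnorm (B z0)); [left|right] => z zs.
- have [nz hz] := H z (cball_le sr zs).
  have b0 : 0 < cnorm (B z0).
    rewrite cnorm_gt0; apply/eqP => b0; move: n0 AB; rewrite b0 eqxx orbF cnorm0.
    by rewrite -cnorm_gt0 => h; rewrite leNgt h.
  have le3 : cnorm (A z) <= 3 * cnorm (B z).
    apply: (key _ _ (K * cnorm (z - z0) * (1 + T) * T)); rewrite ?cnorm_ge0 ?e0 ?ab//.
    rewrite -(ler_pM2r b0) -cnormM.
    have := ler_cnormD (A z * B z0 - A z0 * B z) (A z0 * B z); rewrite subrK !cnormM => h.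
    have h1 : cnorm (A z0) * cnorm (B z) <= cnorm (B z0) * cnorm (B z).
      by rewrite ler_wpM2r ?cnorm_ge0.
    have h2 : K * cnorm (z - z0) * ((cnorm (A z) + T * cnorm (B z)) * (cnorm (A z0) + T * cnorm (B z0)))
        <= K * cnorm (z - z0) * (1 + T) * T * (cnorm (A z) + cnorm (B z)) * cnorm (B z0).
      have g := grow (cnorm (A z)) (cnorm (B z)) (K * cnorm (z - z0) * (1 + T)) (cnorm_ge0 _) (cnorm_ge0 _) _.
      apply: (@le_trans _ _ (K * cnorm (z - z0) * (1 + T) * (cnorm (A z) + T * cnorm (B z)) * cnorm (B z0))).
        rewrite -!mulrA; apply: ler_wpM2l => //; apply: ler_wpM2l; first exact: cnorm_ge0.
        rewrite [(1 + T) * _]mulrC -mulrA; apply: ler_wpM2l; last by lra.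
        by rewrite addr_ge0 ?cnorm_ge0// mulr_ge0 ?cnorm_ge0//; lra.
      apply: ler_wpM2r; first exact: cnorm_ge0.
      by apply: g; apply: mulr_ge0; [exact: mulr_ge0 (cnorm_ge0 _)|lra].
    lra.
  split => //; apply: contraTneq nz => b; move: le3; rewrite b cnorm0 mulr0 eqxx orbF.
  by rewrite -cnorm_eq0 eq_le cnorm_ge0 => ->.
- have [nz hz] := H z (cball_le sr zs).
  have a0 : 0 < cnorm (A z0).
    rewrite cnorm_gt0; apply/eqP => a0; move: n0 BA; rewrite a0 eqxx cnorm0 /=.
    by rewrite -cnorm_gt0 => h; rewrite leNgt h.
  have le3 : cnorm (B z) <= 3 * cnorm (A z).
    apply: (key _ _ (K * cnorm (z - z0) * (1 + T) * T)); rewrite ?cnorm_ge0 ?e0 ?ab//.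
    rewrite -(ler_pM2r a0) -cnormM.
    have := ler_cnormD (A z * B z0 - (A z * B z0 - A z0 * B z)) 0; rewrite addr0 cnorm0 addr0 => _.
    have := ler_cnormB (B z * A z0) (A z * B z0); rewrite !cnormM.
    rewrite (cnormB (B z * A z0)) [B z * _]mulrC => h.
    have h1 : cnorm (A z) * cnorm (B z0) <= cnorm (A z) * cnorm (A z0).
      by rewrite ler_wpM2l ?cnorm_ge0.
    have h2 : K * cnorm (z - z0) * ((cnorm (A z) + T * cnorm (B z)) * (cnorm (A z0) + T * cnorm (B z0)))
        <= K * cnorm (z - z0) * (1 + T) * T * (cnorm (A z) + cnorm (B z)) * cnorm (A z0).
      have g := grow (cnorm (A z)) (cnorm (B z)) (K * cnorm (z - z0) * (1 + T)) (cnorm_ge0 _) (cnorm_ge0 _) _.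
      apply: (@le_trans _ _ (K * cnorm (z - z0) * (1 + T) * (cnorm (A z) + T * cnorm (B z)) * cnorm (A z0))).
        rewrite -!mulrA; apply: ler_wpM2l => //; apply: ler_wpM2l; first exact: cnorm_ge0.
        rewrite [(1 + T) * _]mulrC -mulrA; apply: ler_wpM2l; last by nra.
        by rewrite addr_ge0 ?cnorm_ge0// mulr_ge0 ?cnorm_ge0//; lra.
      apply: ler_wpM2r; first exact: cnorm_ge0.
      by apply: g; apply: mulr_ge0; [exact: mulr_ge0 (cnorm_ge0 _)|lra].
    lra.
  split => //; apply: contraTneq nz => a; move: le3; rewrite a cnorm0 mulr0 eqxx /=.
  by rewrite -cnorm_eq0 eq_le cnorm_ge0 => ->.
Qed.

End OmittedSet.

(** * Normality of the zoomed iterates *)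

Section Zoom.
Variable R : realType.
Local Notation C := R[i].
Local Notation S := (sphere R).
Implicit Types (z v y : C) (A E X : set C).

Definition trapped (psi : C -> C) (T : R) : set C :=
  [set y | cnorm (psi y) <= T /\ cnorm y <= T].

(* [g k] stands for an iterate read at scale [d^(-k/2)] around a point, and [c]
   for the value of the quadratic differential [psi] there. *)
Record zooming (psi : C -> C) (T : R) (c : C) (g : nat -> C -> S) (p : nat -> C -> C) : Prop :=
  Zooming {
    zoom_psi : cintegrable psi;
    zoom_T : 1 <= T;
    zoom_mass : exists2 m : R, 0 < m & (m%:E <= cint (trapped psi T) (fun y => cnorm (psi y)))%E;
    zoom_pair : forall k z0 (r : R), exists A B : C -> C, pairhol z0 r (g k) A B;
    zoom_ode : forall k, area [set z | ~ (findom (g k) z /\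
      psi (fin (g k z)) * dfin (g k) z ^+ 2 = p k z)] = 0%E;
    zoom_meas : forall k, cmfunc setT (p k);
    zoom_dev : forall k, (cint (kball k) (fun z => cnorm (p k z - c)%R) <= (k.+1%:R^-1)%:E)%E;
    zoom_0 : forall k, exists y a, [/\ g k 0 = Some y, trapped psi T y,
      hasd (g k) 0 a & psi y * a ^+ 2 = c];
    zoom_c : c != 0 }.

Variables (psi : C -> C) (T : R) (c : C) (g : nat -> C -> S) (p : nat -> C -> C).
Hypothesis Z : zooming psi T c g p.

Lemma zoom_mero k : mero (g k).
Proof. by move=> z0; have [A [B AB]] := zoom_pair Z k z0 1; exists 1, A, B. Qed.

Lemma mass_psi : cmfun setT (fun y => cnorm (psi y)).
Proof. exact: cmfunc_cnorm (cintegrable_cmfunc (zoom_psi Z)). Qed.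

Lemma trapped_cmeas : cmeas (trapped psi T).
Proof.
have le_meas h : cmfun setT h -> cmeas [set y : C | h y <= T].
  move=> mh; have := mh measurableT _ (measurable_itv `]-oo, T]); rewrite setTI.
  by congr measurable; apply/seteqP; split => u /=; rewrite in_itv.
apply: cmeasI; first exact: le_meas mass_psi.
by apply: le_meas; apply: cmfunc_cnorm; split; [exact: measurable_fst|exact: measurable_snd].
Qed.

(** A set covered by the image of [A] has small integral: the equation holds almost everywhere on
    [A], and |p k - c| has integral at most 1/(k+1) on [kball k]. *)
Lemma zoom_image k A E H (e : R) : cmeas A -> A `<=` kball k -> A `<=` findom (g k) ->
  cmeas E -> (forall y, E y -> exists2 z, A z & g k z = Some y) ->
  cmfun setT H -> (forall y, 0 <= H y) -> 0 <= e ->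
  (forall z, A z -> psi (fin (g k z)) * dfin (g k) z ^+ 2 = p k z ->
    H (fin (g k z)) * cnorm (dfin (g k) z) ^+ 2 <= cnorm (p k z - c) + e) ->
  (cint E H <= 512%:E * ((k.+1%:R^-1)%:E + e%:E * area A))%E.
Proof.
move=> mA Ak Afin mE cov mH H0 e0 HA.
have gm := zoom_mero k.
have [N [mN bN N0]] := area_hull [set z | ~ (findom (g k) z /\
      psi (fin (g k z)) * dfin (g k) z ^+ 2 = p k z)].
rewrite (zoom_ode Z) in N0.
apply: (le_trans (mero_image gm mA Afin mE cov mH H0)).
apply: lee_wpmul2l; first by rewrite lee_fin ler0n.
have mA1 := cmeasD mA mN.
pose J z := H (fin (g k z)) * cnorm (dfin (g k) z) ^+ 2.
have mJ : cmfun A J.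
  have Jf : cmfun (findom (g k)) J.
    have m1 := cmfun_comp (findom_cmeas gm) (mero_cmfunc gm) mH.
    have m2 := mero_cmfun_dfin gm.
    exact: cmfunM m1 (cmfunM m2 m2).
  exact: cmfunS (findom_cmeas gm) Afin Jf.
have J0 z : 0 <= J z by rewrite mulr_ge0// exprn_ge0// cnorm_ge0.
have A10 : area (A `\` (A `\` N)) = 0%E.
  by apply: area_sub0 N0 => z [Az nAz]; apply: contrapT => nN; apply: nAz.
have A1A : A `\` N `<=` A by move=> z [].
rewrite -/J (cint_null_eq mA1 mA A1A mJ (fun z _ => J0 z) A10).
have mp : cmfun setT (fun z => cnorm (p k z - c)).
  by apply: cmfunc_cnorm; apply: cmfuncB (zoom_meas Z k) _; split; exact: cmfun_cst.
have mpA X : cmfun X (fun z => cnorm (p k z - c)) by exact: cmfun_sub mp.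
apply: (@le_trans _ _ (cint (A `\` N) (fun z => cnorm (p k z - c) + e)%R)).
  apply: cint_le => //.
  - exact: cmfunS mA A1A mJ.
  - by apply: cmfunD => //; exact: cmfun_cst.
  - move=> z [Az nN]; rewrite J0 /=; apply: HA => //.
    by apply: contrapT => h; apply: nN; apply: bN => -[_ /h].
rewrite (cintD mA1 (mpA _) (@cmfun_cst _ _ e)) //; last by move=> z _; exact: cnorm_ge0.
apply: leeD.
  apply: le_trans (zoom_dev Z k); apply: cint_subset => //.
  - exact: cball_cmeas.
  - by move=> z [/Ak].
  - by move=> z _; exact: cnorm_ge0.
rewrite cint_cst//; apply: lee_wpmul2l; first by rewrite lee_fin.
exact: le_area A1A.
Qed.

Definition omits k z0 (r : R) : set C :=
  [set v | trapped psi T v /\ forall z, cball z0 r z -> g k z <> Some v].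

(** On a ball of radius [q] the image covers mass at most 512 (1/(k+1) + 4 q^2 |c|), at most half of
    the trapped mass [m]. The density being at most [T] on the trapped set, the part missed has area
    at least m / (2T). *)
Lemma omitted_area : exists r delta : R, [/\ 0 < r, 0 < delta &
  forall z0, exists k1, forall k, (k1 <= k)%N -> (delta%:E <= area (omits k z0 r))%E].
Proof.
have aux (a b t : R) : a <= t / 2048 -> b <= t / 8192 -> 512 * (a + 4 * b) <= t / 2 by lra.
have [m m0 mP] := zoom_mass Z; have T0 : 0 < T by apply: lt_le_trans (zoom_T Z).
have c0 : 0 < cnorm c by rewrite cnorm_gt0 (zoom_c Z).
(* 512 (m/2048 + 4 m/8192) = m/2. *)
have [q q0 qP] : exists2 q : R, 0 < q <= 1 & q * cnorm c <= m / 8192.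
  exists (Num.min 1 (m / 8192 / cnorm c)).
    by rewrite lt_min ltr01 ge_min lexx /= !divr_gt0 ?ltr0n.
  by rewrite -ler_pdivlMr// ge_min lexx orbT.
have /andP[q00 q1] := q0.
exists q, (m / 2 / T); split => //; first by rewrite !divr_gt0 ?ltr0n.
move=> z0; have m4 : 0 < m / 2048 by rewrite divr_gt0 ?ltr0n.
have [n1 n1P] := invSn_lt m4.
exists (maxn n1 (Num.truncn (cnorm z0 + q)).+1) => k; rewrite geq_max => /andP[n1k zk].
have kb : (k.+1%:R^-1 : R) <= m / 2048.
  by apply: le_trans (ltW n1P); rewrite lef_pV2 ?posrE ?ltr0n// ler_nat.
have zqk : cnorm z0 + q <= k%:R.
  by apply: le_trans (ltW (truncnS_gt _)) _; rewrite ler_nat.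
have gm := zoom_mero k.
have [B [mB oB Ba]] := area_hull (omits k z0 q).
rewrite -Ba leNgt; apply/negP => Blt.
pose A := cball z0 q `&` findom (g k).
have mA : cmeas A by apply: cmeasI; [exact: cball_cmeas|exact: findom_cmeas].
have mY := trapped_cmeas; have mE := cmeasD mY mB.
have mm X : cmfun X (fun y => cnorm (psi y)) by exact: cmfun_sub mass_psi.
have h0 y : 0 <= cnorm (psi y) by exact: cnorm_ge0.
have mYB := cmeasI mY mB.
have split1 := cint_setD mYB mY (@subIsetl _ _ _) (mm _) (fun z _ => h0 z).
have part1 : (cint (trapped psi T `&` B) (fun y => cnorm (psi y)) < (m / 2)%:E)%E.
  apply: (@le_lt_trans _ _ (T%:E * area B)%E).
    apply: (@le_trans _ _ (cint (trapped psi T `&` B) (fun=> T))).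
      by apply: cint_le => // [|y [[h _] _]]; [exact: cmfun_cst|rewrite h0].
    rewrite cint_cst//; apply: lee_wpmul2l; first by rewrite lee_fin ltW.
    by apply: le_area => y [].
  have -> : m / 2 = T * (m / 2 / T) by field; rewrite gt_eqF.
  by rewrite EFinM lte_pmul2l// lte_fin.
have part2 : (cint (trapped psi T `\` B) (fun y => cnorm (psi y)) <= (m / 2)%:E)%E.
  apply: (@le_trans _ _ (512%:E * ((k.+1%:R^-1)%:E + (cnorm c)%:E * area A))%E).
    apply: zoom_image => //.
    - move=> z [zb _]; rewrite /kball /cball /= subr0.
      have := ler_cnormD (z - z0) z0; rewrite subrK => h; have zq : cnorm (z - z0) < q by exact: zb.
      by apply: (le_lt_trans h); apply: lt_le_trans zqk; rewrite addrC ltrD2l.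
    - by move=> z [].
    - move=> y [Yy nB]; apply: contrapT => h; apply: nB; apply: oB; split => // z zb gz.
      by apply: h; exists z => //; split => //; exists y.
    - exact: cnorm_ge0.
    - move=> z Az e; rewrite -cnormX -cnormM e.
      by have := ler_cnormD (p k z - c) c; rewrite subrK.
  have aA : (area A <= (4 * q ^+ 2)%:E)%E.
    by apply: le_trans (area_cball z0 (ltW q00)); apply: le_area => z [].
  apply: (@le_trans _ _ (512%:E * ((k.+1%:R^-1)%:E + (cnorm c)%:E * (4 * q ^+ 2)%:E))%E).
    apply: lee_wpmul2l; first by rewrite lee_fin ler0n.
    by apply: leeD => //; apply: lee_wpmul2l => //; rewrite lee_fin ltW.
  rewrite -(EFinM (cnorm c)) -EFinD -EFinM lee_fin.
  have qq : q ^+ 2 * cnorm c <= q * cnorm c by rewrite ler_wpM2r ?cnorm_ge0// expr2 ler_piMr// ltW.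
  have -> : cnorm c * (4 * q ^+ 2) = 4 * (q ^+ 2 * cnorm c) by ring.
  exact: aux kb (le_trans qq qP).
suff : (cint (trapped psi T) (fun y => cnorm (psi y)) < m%:E)%E.
  by rewrite ltNge mP.
rewrite split1 (_ : trapped psi T `\` (trapped psi T `&` B) = trapped psi T `\` B); last first.
  apply/seteqP; split => y [Yy nB]; split => //.
    by move=> By; apply: nB.
  by case=> _ /nB.
apply: (le_lt_trans (leeD2l _ part2)); rewrite [m in X in (_ < X)%E]splitr EFinD.
by rewrite lteD2rE.
Qed.

Definition chart (b : bool) : S -> S := if b then @sinv R else id.

Lemma chartK b : involutive (chart b). Proof. by case: b => //; exact: sinvK. Qed.

(** The radius depends on neither the centre nor [k]: the omitted area fixes the Lipschitz constant
    of [omitted_lip], and [lip_chart] then bounds [g k] or its inverse by 3. *)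
Lemma zoom_normal : exists2 s : R, 0 < s & forall z0, exists k1, forall k, (k1 <= k)%N ->
  exists b u u', hol z0 s u u' /\
    forall z, cball z0 s z -> cnorm (u z) <= 3 /\ chart b (g k z) = Some (u z).
Proof.
have [r [delta [r0 de0 omP]]] := omitted_area.
have T1 := zoom_T Z; have T0 : 0 <= T by lra.
pose K : R := 32 * (16 + 4 * (T + 1) ^+ 2) / (delta * r).
have K0 : 0 < K.
  apply: divr_gt0; last exact: mulr_gt0.
  by apply: mulr_gt0; rewrite ?ltr0n// ltr_pwDl ?ltr0n// mulr_ge0 ?ler0n// sqr_ge0.
have q0 : 0 < 2 * K * (1 + T) * T by apply: mulr_gt0; [apply: mulr_gt0|]; lra.
pose t : R := Num.min (r / 4) ((2 * K * (1 + T) * T)^-1).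
have t0 : 0 < t by rewrite lt_min invr_gt0 q0 andbT divr_gt0 ?ltr0n.
have tr : t <= r / 4 by rewrite ge_min lexx.
have tK : 2 * K * (1 + T) * T * t <= 1.
  by rewrite mulrC -ler_pdivlMr// div1r ge_min lexx orbT.
exists (t / 2); first by rewrite divr_gt0 ?ltr0n.
move=> z0; have [k1 k1P] := omP z0; exists k1 => k /k1P oa.
have [A [B [hA hB AB]]] := zoom_pair Z k z0 r.
have rr : r / 4 <= r by lra.
have om v z : omits k z0 r v -> cball z0 r z -> A z != v * B z.
  move=> [_ ov] zb; apply/eqP => Az; have [nz gz] := AB z zb; apply: (ov z zb).
  rewrite gz Az; have b0 : B z != 0.
    by apply: contraTneq nz => b0; rewrite Az b0 mulr0 eqxx.
  by rewrite projS_fin// mulfK.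
have z00 : cnorm (z0 - z0) <= r / 4 by rewrite subrr cnorm0; lra.
have rc : cball z0 r z0 by exact: cball_center.
have H z : cball z0 (r / 4) z -> ((A z != 0) || (B z != 0)) /\
   cnorm (A z * B z0 - A z0 * B z) <= K * cnorm (z - z0) *
    ((cnorm (A z) + T * cnorm (B z)) * (cnorm (A z0) + T * cnorm (B z0))).
  move=> zb; split; first by have [] := AB z (cball_le rr zb).
  apply: (omitted_lip r0 T0 de0 hA hB (fun v (h : omits k z0 r v) => h.1.2) oa om _ z00).
  exact: ltW zb.
have t2 : t / 2 < t by lra.
have t20 : 0 <= t / 2 by lra.
have tr1 : t <= r by lra.
have fin a b := @lip_chart R z0 (r / 4) T K t a b T1 (ltW K0) tr tK.
have mk (A1 B1 : C -> C) : holx z0 r A1 -> holx z0 r B1 ->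
    (forall z, cball z0 t z -> B1 z != 0 /\ cnorm (A1 z) <= 3 * cnorm (B1 z)) ->
    exists u u', hol z0 (t / 2) u u' /\ forall z, cball z0 (t / 2) z ->
      cnorm (u z) <= 3 /\ projS (A1 z) (B1 z) = Some (u z).
  move=> [A1' hA1] [B1' hB1] h.
  have [z zb|m m0 mP] := closed_ball_lower t20 t2 (hol_shrink tr1 hB1).
    by have [] := h z (le_lt_trans zb t2).
  have t2r : t / 2 <= r by lra.
  have hq := holM (hol_shrink t2r hA1) (holV m0 (fun y yb => mP y (ltW yb)) (hol_shrink t2r hB1)).
  do 2 eexists; split; first exact: hq.
  move=> z zb; have [b0 ab] := h z (cball_le (ltW t2) zb); split; last exact: projS_fin.
  by rewrite cnormM cnormV ler_pdivrMr ?cnorm_gt0.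
have [h|h] := fin A B (AB z0 rc).1 H.
- have [u [u' [hu uP]]] := mk A B hA hB h; exists false, u, u'; split => // z zb.
  have [u3 <-] := uP z zb; split => //=; apply: (AB z _).2.
  by apply: cball_le zb; lra.
- have [u [u' [hu uP]]] := mk B A hB hA h; exists true, u, u'; split => // z zb.
  have [u3 <-] := uP z zb; split => //=.
  have zr : cball z0 r z by apply: cball_le zb; lra.
  by have [nz ->] := AB z zr; rewrite sinv_projS.
Qed.

End Zoom.

(** * Convergence of maps to the sphere *)

Section UltraLimit.
Variable R : realType.
Local Notation C := R[i].
Local Notation S := (sphere R).
Implicit Types (z w v y : C) (A E X : set C) (b : bool).
Variables (V : set_system nat) (VV : UltraFilter V).

(** Convergence on the sphere tested in one of the two charts. The choice is immaterial, since u u'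
    = 1 wherever both charts are finite. *)
Definition slim (x : nat -> S) (y : S) := exists b (u : nat -> C) (l : C),
  [/\ V [set n | chart b (x n) = Some (u n)], ucvg V u l & chart b y = Some l].

Lemma slim_unique (x : nat -> S) (y y' : S) : slim x y -> slim x y' -> y = y'.
Proof.
have mixed u l u' l' : V [set n | chart false (x n) = Some (u n)] -> ucvg V u l ->
    V [set n | chart true (x n) = Some (u' n)] -> ucvg V u' l' ->
    sinv (Some l') = Some l :> S.
  move=> xu ul xu' ul'.
  have : ucvg V (fun n => u n * u' n) 1.
    apply: (@eq_ucvg _ _ VV (fun=> 1)); last exact: ucvg_cst.
    apply: filterS2 xu xu' => n /= -> /=; case: eqP => // /eqP u0 [<-].
    by rewrite mulfV.
  move=> /(ucvg_unique VV (ucvgM VV ul ul')) e /=.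
  have l0 : l' != 0 by apply: contra_eqN e => /eqP ->; rewrite mulr0 eq_sym oner_eq0.
  by rewrite (negbTE l0); congr Some; apply: (mulIf l0); rewrite mulVf// -e.
move=> [b [u [l [xu ul yl]]]] [b' [u' [l' [xu' ul' yl']]]].
move: b b' xu xu' yl yl' => [] [] xu xu' yl yl'.
- apply: (can_inj (@sinvK R)); have {}yl : sinv y = Some l by []; have {}yl' : sinv y' = Some l' by [].
  rewrite yl yl'; congr Some; apply: (ucvg_unique VV ul); apply: eq_ucvg ul'.
  by apply: filterS2 xu xu' => n /= -> [].
- by have := mixed _ _ _ _ xu' ul' xu ul; rewrite -yl -yl' /= sinvK => ->.
- by have := mixed _ _ _ _ xu ul xu' ul'; rewrite -yl -yl' /= sinvK.
- have {}yl : y = Some l by []; have {}yl' : y' = Some l' by [].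
  rewrite yl yl'; congr Some; apply: (ucvg_unique VV ul); apply: eq_ucvg ul'.
  by apply: filterS2 xu xu' => n /= -> [].
Qed.

(** Convergence of the maps and of their derivatives near a point where the limit is finite, with a
    common bound [M] making it uniform on smaller balls. *)
Definition converges (g : nat -> C -> S) (h : C -> S) z1 := exists (r M : R) (u u' : nat -> C -> C) (v v' : C -> C),
  [/\ 0 < r, V [set n | hol z1 r (u n) (u' n) /\
      forall z, cball z1 r z -> cnorm (u n z) <= M /\ g n z = Some (u n z)],
    hol z1 r v v' &
    forall z, cball z1 r z -> [/\ h z = Some (v z), ucvg V (u ^~ z) (v z) & ucvg V (u' ^~ z) (v' z)]].

Lemma hol_lip_quant z0 (r M : R) u u' : 0 < r -> hol z0 r u u' ->
  (forall z, cball z0 r z -> cnorm (u z) <= M) ->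
  forall z w, cball z0 (r / 8) z -> cball z0 (r / 8) w ->
  cnorm (u w - u z) <= 4 * M / r * cnorm (w - z).
Proof.
move=> r0 hu uM z w zb wb; have [d1 d2] := hol_quant r0 hu uM zb; have {}d2 := d2 w wb.
have M0 : 0 <= M by apply: le_trans (cnorm_ge0 _) (uM z0 (cball_center _ r0)).
have h := ler_cnormD (u w - u z - u' z * (w - z)) (u' z * (w - z)).
rewrite subrK cnormM in h; apply: (le_trans h).
have wz : cnorm (w - z) <= r / 4.
  apply: le_trans (cnorm_dist z0 _ _) _; rewrite (cnormB z0).
  by have := ltW zb; have := ltW wb; lra.
have q0 := cnorm_ge0 (w - z).
have h1 : cnorm (u' z) * cnorm (w - z) <= 2 * M / r * cnorm (w - z) by exact: ler_wpM2r.
have h2 : 8 * M / r ^+ 2 * cnorm (w - z) ^+ 2 <= 2 * M / r * cnorm (w - z).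
  rewrite expr2 mulrA; apply: ler_wpM2r => //.
  apply: le_trans (ler_wpM2l _ wz) _; first by rewrite divr_ge0 ?mulr_ge0 ?ler0n ?exprn_ge0 ?(ltW r0).
  by apply: eqW; field; rewrite gt_eqF.
by apply: le_trans (lerD (le_trans d2 h2) h1) _; apply: eqW; field; rewrite gt_eqF.
Qed.

(** Where the limit is finite, its inverse is nonzero; by uniform convergence so are the
    approximants on a smaller ball, and they can be inverted. *)
Lemma converges_sinv g h z1 w : converges (fun n z => sinv (g n z)) (fun z => sinv (h z)) z1 ->
  h z1 = Some w -> converges g h z1.
Proof.
move=> [r [M [u [u' [v [v' [r0 Vu hv hP]]]]]]] hw.
have [hz1 _ _] := hP z1 (cball_center _ r0).
have v0 : v z1 != 0.
  by apply/eqP => v0; move: hz1; rewrite v0 hw /=; case: eqP => // w0 [] /eqP; rewrite invr_eq0 => /eqP.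
have [d /andP[d0 dr] dP] := hol_neq0 r0 hv v0.
have r8 : 0 < r / 8 by rewrite divr_gt0 ?ltr0n.
have r16 : r / 16 < r / 8 by lra.
have r160 : 0 <= r / 16 by lra.
have q0 : 0 < cnorm (v z1) / 4 by rewrite divr_gt0 ?ltr0n// cnorm_gt0.
have M0 : 0 <= M.
  have [n [_ nP]] := @filter_ex _ V _ _ Vu.
  by apply: le_trans (cnorm_ge0 _) (nP z1 (cball_center _ r0)).1.
have K0 : 0 <= 4 * M / r by apply: divr_ge0; [apply: mulr_ge0|exact: ltW].
have Vl : V [set n | forall z y, cball z1 (r / 8) z -> cball z1 (r / 8) y ->
    cnorm (u n y - u n z) <= 4 * M / r * cnorm (y - z)].
  by apply: filterS Vu => n [hu uM]; apply: hol_lip_quant hu _ => // z zb; have [] := uM z zb.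
have uv z : cball z1 (r / 8) z -> ucvg V (u ^~ z) (v z).
  by move=> zb; have [] := hP z (cball_le (_ : r / 8 <= r) zb); first lra.
have Vu2 := ulim_uniform VV r160 r16 K0 Vl uv q0.
pose e : R := Num.min d (r / 16).
have e0 : 0 < e by rewrite lt_min d0 divr_gt0 ?ltr0n.
have er : e <= r by rewrite ge_min dr.
have ed : e <= d by rewrite ge_min lexx.
have er16 : e <= r / 16 by rewrite ge_min lexx orbT.
have m0 : 0 < cnorm (v z1) / 2 by lra.
have mv z : cball z1 e z -> cnorm (v z1) / 2 <= cnorm (v z) by move=> zb; apply: dP; exact: cball_le ed _ zb.
exists e, (cnorm (v z1) / 4)^-1, (fun n z => (u n z)^-1), (fun n z => - u' n z / u n z ^+ 2),
  (fun z => (v z)^-1), (fun z => - v' z / v z ^+ 2); split => //.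
- apply: filterS2 Vu Vu2 => n [hu uP] unif.
  have big z : cball z1 e z -> cnorm (v z1) / 4 <= cnorm (u n z).
    move=> zb; have zr : cnorm (z - z1) <= r / 16 by apply: le_trans er16; exact: ltW zb.
    have h1 := unif z zr; have h2 := mv z zb.
    by have := ler_cnormB (v z) (u n z); rewrite (cnormB (v z)) => h3; lra.
  split; first exact: holV q0 big (hol_shrink er hu).
  move=> z zb; have b := big z zb; split.
    by rewrite cnormV lef_pV2 ?posrE//; exact: lt_le_trans b.
  have [_ gz] := uP z (cball_le er zb).
  have u0 : u n z != 0 by rewrite -cnorm_gt0; exact: lt_le_trans b.
  by rewrite -[LHS]sinvK gz /= (negbTE u0).
- exact: holV m0 mv (hol_shrink er hv).
- move=> z zb; have [hz uz u'z] := hP z (cball_le er zb).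
  have vz : v z != 0 by rewrite -cnorm_gt0; exact: lt_le_trans (mv z zb).
  split; first by rewrite -[LHS]sinvK hz /= (negbTE vz).
    exact: ucvgV.
  apply: ucvgM => //; first exact: ucvgN.
  by apply: ucvgV; rewrite ?expf_neq0//; rewrite expr2; apply: ucvgM.
Qed.

End UltraLimit.

(** * The limit of the zoomed iterates *)

Section ZoomLimit.
Variable R : realType.
Local Notation C := R[i].
Local Notation S := (sphere R).
Variables (psi : C -> C) (T : R) (c : C) (g : nat -> C -> S) (p : nat -> C -> C).
Hypothesis Z : zooming psi T c g p.

(** At 0 the values stay bounded by [T], so the limit is finite there. Since psi(y) a^2 = c with
    |psi(y)| at most [T], the derivatives have modulus at least sqrt(|c| / T), so the limit is not
    constant. *)
Lemma zoom_limit : exists (V : set_system nat) (h : C -> S),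
  [/\ UltraFilter V /\ \oo `<=` V, mero h, gen h 0 &
   forall z1 w, h z1 = Some w -> converges V g h z1].
Proof.
have [s s0 sP] := zoom_normal Z; have [V [VV Voo]] := ex_ultra.
have s8 : 0 < s / 8 by rewrite divr_gt0 ?ltr0n.
have s88 : s / 8 <= s by lra.
have loc z0 : exists b, V [set n | exists u u', hol z0 s u u' /\
    forall z, cball z0 s z -> cnorm (u z) <= 3 /\ chart b (g n z) = Some (u z)].
  have [k1 k1P] := sP z0.
  have : V ([set n | exists u u', hol z0 s u u' /\
      forall z, cball z0 s z -> cnorm (u z) <= 3 /\ chart false (g n z) = Some (u z)] `|`
    [set n | exists u u', hol z0 s u u' /\
      forall z, cball z0 s z -> cnorm (u z) <= 3 /\ chart true (g n z) = Some (u z)]).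
    by apply: Voo; exists k1 => // k /= /k1P [[] h]; [right|left].
  move=> h; have [|] := in_ultra_setVsetC [set n | exists u u', hol z0 s u u' /\
      forall z, cball z0 s z -> cnorm (u z) <= 3 /\ chart false (g n z) = Some (u z)] VV.
    by exists false.
  by move=> h2; exists true; apply: filterS2 h h2 => n [|].
have loc2 z0 : exists b u u' v v', [/\ V [set n | hol z0 s (u n) (u' n) /\
      forall z, cball z0 s z -> cnorm (u n z) <= 3 /\ chart b (g n z) = Some (u n z)],
      hol z0 (s / 8) v v' & forall z, cball z0 (s / 8) z ->
      ucvg V (u ^~ z) (v z) /\ ucvg V (u' ^~ z) (v' z)].
  have [b Vb] := loc z0.
  have /choice[w wP] n : exists w : (C -> C) * (C -> C), (exists u u', hol z0 s u u' /\
    forall z, cball z0 s z -> cnorm (u z) <= 3 /\ chart b (g n z) = Some (u z)) ->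
    hol z0 s w.1 w.2 /\
    forall z, cball z0 s z -> cnorm (w.1 z) <= 3 /\ chart b (g n z) = Some (w.1 z).
    have [[u [u' h]]|h] := pselect (exists u u', hol z0 s u u' /\
      forall z, cball z0 s z -> cnorm (u z) <= 3 /\ chart b (g n z) = Some (u z)).
      by exists (u, u').
    by exists (fun=> 0, fun=> 0) => /h.
  pose u n := (w n).1; pose u' n := (w n).2.
  have Vu : V [set n | hol z0 s (u n) (u' n) /\
      forall z, cball z0 s z -> cnorm (u n z) <= 3 /\ chart b (g n z) = Some (u n z)].
    by apply: filterS Vb => n; exact: wP.
  have /choice[v vP] z : exists l, cball z0 s z -> ucvg V (u ^~ z) l.
    have [zs|zs] := pselect (cball z0 s z); last by exists 0.
    have [|l lP] := @ucvg_bounded _ _ VV (u ^~ z) 3; last by exists l.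
    by apply: filterS Vu => n [_ h]; have [] := h z zs.
  have [||v' [hv vv']] := @hol_ulim _ V VV z0 s 3 u u' v s0.
  - by apply: filterS Vu => n [hu h]; split => // z zs; have [] := h z zs.
  - by move=> z zs; apply: vP; exact: cball_le s88 _ zs.
  exists b, u, u', v, v'; split => // z zs; split; last exact: vv'.
  by apply: vP; exact: cball_le s88 _ zs.
have /choice[h hP] z : exists y, slim V (g ^~ z) y.
  have [b [u [u' [v [v' [Vu hv uv]]]]]] := loc2 z.
  have [uvz _] := uv z (cball_center z s8).
  exists (chart b (Some (v z))), b, (u ^~ z), (v z); split => //; last exact: chartK.
  by apply: filterS Vu => n [_ /(_ z (cball_center z s0))[]].
have loc3 z0 : exists b (M : R) u u' v v', [/\ V [set n | hol z0 (s / 8) (u n) (u' n) /\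
      forall z, cball z0 (s / 8) z -> cnorm (u n z) <= M /\ chart b (g n z) = Some (u n z)],
      hol z0 (s / 8) v v' & forall z, cball z0 (s / 8) z ->
      [/\ chart b (h z) = Some (v z), ucvg V (u ^~ z) (v z) & ucvg V (u' ^~ z) (v' z)]].
  have [b [u [u' [v [v' [Vu hv uv]]]]]] := loc2 z0.
  exists b, 3, u, u', v, v'; split => //.
    apply: filterS Vu => n [hu un]; split; first exact: hol_shrink s88 hu.
    by move=> z zb; apply: un; exact: cball_le s88 _ zb.
  move=> z zb; have [u1 u2] := uv z zb; split => //.
  rewrite -[RHS](chartK b); congr chart; apply: (slim_unique VV (hP z)).
  exists b, (u ^~ z), (v z); split => //; last exact: chartK.
  by apply: filterS Vu => n [_ un]; have [] := un z (cball_le s88 zb).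
have mh : mero h.
  move=> z0; have [b [M [u [u' [v [v' [Vu hv uv]]]]]]] := loc3 z0.
  have hx : holx z0 (s / 8) v by exists v'.
  case: b Vu uv => Vu uv.
    exists (s / 8), (fun=> 1), v; split => //; split => //; first exact: holx_cst.
    move=> z zb; rewrite oner_eq0; split => //; have [hz _ _] := uv z zb.
    have {}hz : sinv (h z) = Some (v z) by exact: hz.
    by rewrite -[LHS]sinvK hz -projS1 sinv_projS// oner_eq0 orbT.
  exists (s / 8), v, (fun=> 1); split => //; split => //; first exact: holx_cst.
  by move=> z zb; rewrite oner_eq0 orbT projS1; split => //; have [] := uv z zb.
have cv z1 w : h z1 = Some w -> converges V g h z1.
  move=> hz1; have [b [M [u [u' [v [v' [Vu hv uv]]]]]]] := loc3 z1.
  case: b Vu uv => Vu uv; last by exists (s / 8), M, u, u', v, v'.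
  by apply: converges_sinv hz1 => //; exists (s / 8), M, u, u', v, v'.
exists V, h; split => //.
have T0 : 0 < T by apply: lt_le_trans (zoom_T Z).
have [w0 hw0] : exists w, h 0 = Some w.
  have [b [M [u [u' [v [v' [Vu hv uv]]]]]]] := loc3 0; have c0 := cball_center (0 : C) s8.
  have [h0 uv0 _] := uv 0 c0.
  case: b Vu h0 {uv} => Vu h0; last by exists (v 0).
  have {}h0 : sinv (h 0) = Some (v 0) by exact: h0.
  have v0 : T^-1 <= cnorm (v 0).
    apply: (ucvg_ge VV uv0); apply: filterS Vu => n [_ un].
    have [_ /= gn] := un 0 c0; have [y [a [gy [_ yT] _ _]]] := zoom_0 Z n.
    move: gn; rewrite gy /=; case: eqP => // /eqP y0 [<-].
    by rewrite cnormV lef_pV2 ?posrE ?cnorm_gt0.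
  have nv : v 0 != 0 by rewrite -cnorm_gt0; apply: lt_le_trans v0; rewrite invr_gt0.
  by exists (v 0)^-1; rewrite -[LHS]sinvK h0 /= (negbTE nv).
have [r [M [u [u' [v [v' [r0 Vu hv hu]]]]]]] := cv 0 w0 hw0.
have c0 := cball_center (0 : C) r0; have [h0 _ uv0] := hu 0 c0.
exists (v' 0); last by apply: hasd_ball hv _ _ c0 => z zb; have [] := hu z zb.
rewrite -cnorm_gt0; apply: (@lt_le_trans _ _ (Num.sqrt (cnorm c / T))).
  by rewrite sqrtr_gt0 divr_gt0// cnorm_gt0 (zoom_c Z).
apply: (ucvg_ge VV uv0); apply: filterS Vu => n [hun un] /=.
have [y [a [gy [yT _] ga ca]]] := zoom_0 Z n.
have -> : u' n 0 = a.
  by apply: hasd_unique ga; apply: hasd_ball hun _ _ c0 => z zb; have [] := un z zb.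
rewrite -[leRHS]ger0_norm ?cnorm_ge0// -sqrtr_sqr ler_wsqrtr//.
by rewrite ler_pdivrMr// -ca cnormM cnormX mulrC ler_wpM2l ?exprn_ge0 ?cnorm_ge0.
Qed.

End ZoomLimit.

(** * The equation satisfied by the limit *)

Section OdeLimit.
Variable R : realType.
Local Notation C := R[i].
Local Notation S := (sphere R).
Implicit Types (z w v y : C) (A E X : set C) (h : C -> S).

Lemma cint_eq0 A (H : C -> R) : cmeas A -> cmfun A H -> (forall z, A z -> 0 <= H z) ->
  cint A H = 0%E -> area (A `&` [set z | H z != 0]) = 0%E.
Proof.
move=> mA mH H0 I0; apply: (@area_sub0 _ _ (\bigcup_j level A H j)).
  by rewrite level_bigcup => z [Az Hz]; split => //=; rewrite lt_def Hz H0.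
apply: area_bigcup0 => j; have ml := level_cmeas j mA mH.
have lA : level A H j `<=` A by move=> z /levelP[].
have dj := dyad_gt0 R j.
have : ((dyad R j)%:E * area (level A H j) <= 0)%E.
  rewrite -cint_cst// -I0; apply: (@le_trans _ _ (cint (level A H j) H)); last exact: cint_subset.
  apply: cint_le => //; [exact: cmfun_cst|exact: cmfunS mA lA mH|].
  by move=> z /levelP[_ /andP[-> _]]; rewrite ltW.
rewrite -[X in (_ <= X)%E](mule0 (dyad R j)%:E) lee_pmul2l// => h0.
by apply/eqP; rewrite eq_le h0; exact: area_ge0.
Qed.

Lemma cmfuncM X (x y : C -> C) : cmfunc X x -> cmfunc X y -> cmfunc X (fun z => x z * y z).
Proof.
move=> [x1 x2] [y1 y2]; split.
  have -> : (fun z => Re (x z * y z)) = (fun z => Re (x z) * Re (y z) - Im (x z) * Im (y z)).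
    by apply/funext => z; case: (x z) (y z) => [? ?] [? ?].
  exact: cmfunB (cmfunM x1 y1) (cmfunM x2 y2).
have -> : (fun z => Im (x z * y z)) = (fun z => Re (x z) * Im (y z) + Im (x z) * Re (y z)).
  by apply/funext => z; case: (x z) (y z) => [? ?] [? ?].
exact: cmfunD (cmfunM x1 y2) (cmfunM x2 y1).
Qed.

Lemma cmfunc_hol_deriv z0 (s : R) (q q' : C -> C) : hol z0 s q q' -> cmfunc (cball z0 s) q'.
Proof.
move=> hq; have [K K0 lip] := hol_deriv_lip hq.
have near y (e : R) : cball z0 s y -> 0 < e -> exists2 d : R, 0 < d &
    forall w, cnorm (w - y) < d -> cnorm (q' w - q' y) < e.
  move=> yU e0; have [de de0 deP] := cball_inner yU; have K1 : 0 < K + 1 by rewrite ltr_wpDl.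
  exists (Num.min de (e / (K + 1))); first by rewrite lt_min de0 divr_gt0.
  move=> w; rewrite lt_min ltr_pdivlMr// => /andP[w1 w2].
  apply: le_lt_trans (lip y w yU (deP _ w1)) _; apply: le_lt_trans w2; rewrite mulrC.
  by rewrite ler_wpM2l ?cnorm_ge0// lerDl.
split; apply: (cont_cmfun (@cball_copen _ _ _)) => y yU e e0; have [de de0 deP] := near y e yU e0;
  exists de => // w /deP; apply: le_lt_trans; rewrite -raddfB.
  exact: ler_cnorm_Re.
exact: ler_cnorm_Im.
Qed.

(** As [psi] represents a class modulo null sets, the equation is demanded almost everywhere around
    a generic point. *)
Definition odeat (psi : C -> C) (c : C) h z := gen h z /\ exists2 r : R, 0 < r &
  area (cball z r `&` [set w | psi (fin (h w)) * dfin h w ^+ 2 <> c]) = 0%E.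

Lemma hol_deriv_lip_quant z0 (r M : R) (u u' : C -> C) : 0 < r -> hol z0 r u u' ->
  (forall z, cball z0 r z -> cnorm (u z) <= M) ->
  forall z w, cball z0 (r / 8) z -> cball z0 (r / 8) w ->
  cnorm (u' w - u' z) <= 16 * M / r ^+ 2 * cnorm (w - z).
Proof.
move=> r0 hu uM z w zb wb; have [_ /(_ w wb) d1] := hol_quant r0 hu uM zb.
have [_ /(_ z zb) d2] := hol_quant r0 hu uM wb.
have [->|zw] := eqVneq w z; first by rewrite !subrr !cnorm0 mulr0.
have wz0 : 0 < cnorm (w - z) by rewrite cnorm_gt0 subr_eq0.
rewrite (cnormB z w) in d2.
rewrite -(ler_pM2r wz0) -cnormM.
have -> : (u' w - u' z) * (w - z) = (u w - u z - u' z * (w - z)) + (u z - u w - u' w * (z - w)) by ring.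
apply: le_trans (ler_cnormD _ _) _; apply: le_trans (lerD d1 d2) _.
by apply: eqW; field; rewrite gt_eqF.
Qed.

Variables (psi : C -> C) (T : R) (c : C) (g : nat -> C -> S) (p : nat -> C -> C).
Hypothesis Z : zooming psi T c g p.

(** [psi] is not continuous, so psi(g k) cannot be followed to the limit. The images of [g k] cover
    a fixed ball of the target, and on it the equation is expressed by a function that does not
    involve [k]. *)
Lemma zoom_odeat (V : set_system nat) (VV : UltraFilter V) h z1 : \oo `<=` V ->
  (forall w, h z1 = Some w -> converges V g h z1) -> gen h z1 -> odeat psi c h z1.
Proof.
move=> Voo cv [a a0 ha]; split; first by exists a.
have [w0 hw] := hasd_fin ha.
have [r [M [u [u' [v [v' [r0 Vu hv hP]]]]]]] := cv w0 hw.
have va : v' z1 = a.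
  by apply: hasd_unique ha; apply: hasd_ball hv _ _ (cball_center _ r0) => z zb; have [] := hP z zb.
rewrite -va in a0.
have [d [s [cl [q [q' [[/andP[d0 dr] s0 cl0] [low vd hq qP]]]]]]] := hol_inverse r0 hv a0.
have [Kq Kq0 qlip] := hol_deriv_lip hq.
have [Lq Lq0 qb] : exists2 L : R, 0 <= L & forall y, cball (v z1) s y -> cnorm (q' y) <= L.
  by have [L L0 LP] := hq; exists L => // y /LP[].
have [Lv Lv0 vb] : exists2 L : R, 0 <= L & forall y, cball z1 r y -> cnorm (v' y) <= L.
  by have [L L0 LP] := hv; exists L => // y /LP[].
have qv z : cball z1 d z -> cball (v z1) s (v z) -> q' (v z) * v' z = 1.
  move=> zd vs; have [qd vq ->] := qP _ vs.
  have e : q (v z) = z.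
    apply: cnorm_le0_eq.
    by rewrite -(ler_pM2l cl0) mulr0; apply: le_trans (low _ _ zd qd) _; rewrite vq subrr cnorm0.
  by rewrite e mulVf// vd.
have M0 : 0 <= M.
  have [n [_ nP]] := @filter_ex _ V _ _ Vu.
  by apply: le_trans (cnorm_ge0 _) (nP z1 (cball_center _ r0)).1.
have s2 : 0 < s / 2 by rewrite divr_gt0 ?ltr0n.
have [d1 /andP[d10 d1r] vs2] := hol_cont r0 hv s2.
pose rho : R := Num.min (Num.min d d1) (r / 16).
have rho0 : 0 < rho by rewrite !lt_min d0 d10 divr_gt0 ?ltr0n.
have rhod : rho <= d by rewrite !ge_min lexx.
have rhod1 : rho <= d1 by rewrite !ge_min lexx orbT.
have rhor : rho <= r / 16 by rewrite ge_min lexx orbT.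
have rhor1 : rho <= r by lra.
pose E0 : R := Num.min (cl * rho / 16) s.
have E00 : 0 < E0 by rewrite lt_min s0 divr_gt0 ?ltr0n// mulr_gt0.
pose E := cball (v z1) E0.
pose U := cball (v z1) s.
(* The defect of psi = c q'^2, the equation read through the local inverse [q] of the limit [v]. *)
pose H y := if `[< U y >] then cnorm (psi y - c * q' y ^+ 2) else 0.
have mU : cmeas U by exact: cball_cmeas.
have mH : cmfun setT H.
  have mq' : cmfunc U q' by exact: cmfunc_hol_deriv hq.
  apply: (cmfun_setT_if mU); apply: cmfunc_cnorm; apply: cmfuncB.
    have [m1 m2] := cintegrable_cmfunc (zoom_psi Z).
    by split; [exact: cmfun_sub m1|exact: cmfun_sub m2].
  by apply: cmfuncM; [split; exact: cmfun_cst|exact: cmfuncM].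
have H0 y : 0 <= H y by rewrite /H; case: asboolP => // _; exact: cnorm_ge0.
have mE : cmeas E by exact: cball_cmeas.
(* For a late [k], [u k] maps the ball [A] over [E], and q'(u k) u k' is close to 1; the defect
   times |u k'|^2 is then at most |p k - c| plus a small constant, as [zoom_image] requires. *)
have small (e : R) : 0 < e -> (cint E H <= (e * (512 + 2048 * rho ^+ 2))%:E)%E.
  move=> e0.
  pose e1 : R := Num.min 1 (e / (3 * (cnorm c + 1))).
  have c1 : 0 < cnorm c + 1 by rewrite ltr_wpDl ?cnorm_ge0.
  have e10 : 0 < e1 by rewrite lt_min ltr01 divr_gt0// mulr_gt0 ?ltr0n.
  have e1P : cnorm c * (3 * e1) <= e.
    have : e1 <= e / (3 * (cnorm c + 1)) by rewrite ge_min lexx orbT.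
    rewrite ler_pdivlMr ?mulr_gt0 ?ltr0n// => hh; apply: le_trans hh.
    have -> : e1 * (3 * (cnorm c + 1)) = cnorm c * (3 * e1) + 3 * e1 by ring.
    by rewrite lerDl mulr_ge0 ?ler0n// ltW.
  pose e2 : R := Num.min (Num.min (cl * rho / 16) (s / 4)) (e1 / (2 * (Kq * (Lv + 1) + Lq + 1))).
  have K1 : 0 < Kq * (Lv + 1) + Lq + 1 by rewrite ltr_wpDl// addr_ge0// mulr_ge0// addr_ge0.
  pose e3 : R := Num.min 1 e2.
  have e20 : 0 < e2.
    by rewrite !lt_min !divr_gt0 ?mulr_gt0 ?ltr0n.
  have e30 : 0 < e3 by rewrite lt_min ltr01.
  have r16 : rho < r / 8 by lra.
  have Vl1 : V [set n | forall z y, cball z1 (r / 8) z -> cball z1 (r / 8) y ->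
      cnorm (u n y - u n z) <= 4 * M / r * cnorm (y - z)].
    by apply: filterS Vu => n [hu uM]; apply: hol_lip_quant hu _ => // z zb; have [] := uM z zb.
  have Vl2 : V [set n | forall z y, cball z1 (r / 8) z -> cball z1 (r / 8) y ->
      cnorm (u' n y - u' n z) <= 16 * M / r ^+ 2 * cnorm (y - z)].
    by apply: filterS Vu => n [hu uM]; apply: hol_deriv_lip_quant hu _ => // z zb; have [] := uM z zb.
  have r8r : r / 8 <= r by lra.
  have uv z : cball z1 (r / 8) z -> ucvg V (u ^~ z) (v z).
    by move=> zb; have [] := hP z (cball_le r8r zb).
  have uv' z : cball z1 (r / 8) z -> ucvg V (u' ^~ z) (v' z).
    by move=> zb; have [] := hP z (cball_le r8r zb).
  have k10 : 0 <= 4 * M / r by apply: divr_ge0; [apply: mulr_ge0|exact: ltW].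
  have k20 : 0 <= 16 * M / r ^+ 2 by apply: divr_ge0; [apply: mulr_ge0|rewrite exprn_ge0// ltW].
  have Vs1 := ulim_uniform VV (ltW rho0) r16 k10 Vl1 uv e30.
  have Vs2 := ulim_uniform VV (ltW rho0) r16 k20 Vl2 uv' e30.
  have [n0 n0P] := invSn_lt e0.
  have Vk : V [set n | (maxn n0 (Num.truncn (cnorm z1 + rho)).+1 <= n)%N].
    by apply: Voo; exists (maxn n0 (Num.truncn (cnorm z1 + rho)).+1).
  have [k [[hu uM] [s1 s2'] kn]] : exists k, [/\ (hol z1 r (u k) (u' k) /\
      forall z, cball z1 r z -> cnorm (u k z) <= M /\ g k z = Some (u k z)),
      ((forall z, cnorm (z - z1) <= rho -> cnorm (u k z - v z) < e3) /\
       (forall z, cnorm (z - z1) <= rho -> cnorm (u' k z - v' z) < e3)) &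
      (maxn n0 (Num.truncn (cnorm z1 + rho)).+1 <= k)%N].
    have [k [h1 [h2 [h3 h4]]]] := @filter_ex _ V _ _ (filterI Vu (filterI Vs1 (filterI Vs2 Vk))).
    by exists k.
  move: kn; rewrite geq_max => /andP[n0k zk].
  have kb : (k.+1%:R^-1 : R) <= e.
    by apply: le_trans (ltW n0P); rewrite lef_pV2 ?posrE ?ltr0n// ler_nat.
  have zqk : cnorm z1 + rho <= k%:R.
    by apply: le_trans (ltW (truncnS_gt _)) _; rewrite ler_nat.
  have e31 : e3 <= 1 by rewrite ge_min lexx.
  have e3a : e3 <= cl * rho / 16 by rewrite !ge_min lexx !orbT.
  have e3b : e3 <= s / 4 by rewrite !ge_min lexx !orbT.
  have e3c : e3 * (Kq * (Lv + 1) + Lq + 1) <= e1 / 2.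
    rewrite -ler_pdivlMr//; have -> : e1 / 2 / (Kq * (Lv + 1) + Lq + 1) = e1 / (2 * (Kq * (Lv + 1) + Lq + 1)).
      by field; rewrite gt_eqF.
    by rewrite !ge_min lexx !orbT.
  pose A := cball z1 rho.
  have AU z : A z -> U (u k z) /\ U (v z).
    move=> zA; have h1 := s1 z (ltW zA).
    have h2 : cnorm (v z - v z1) < s / 2 by apply: vs2; exact: cball_le rhod1 _ zA.
    split; last by rewrite /U /cball /=; apply: lt_trans h2 _; clear - Z s0; lra.
    rewrite /U /cball /=; apply: le_lt_trans (cnorm_dist (v z) _ _) _.
    have h3 : cnorm (u k z - v z) < s / 4 by exact: lt_le_trans h1 e3b.
    by clear - Z h2 h3 s0; lra.
  have AX z : A z -> cnorm (1 - (q' (u k z) * u' k z) ^+ 2) <= 3 * e1.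
    move=> zA; have [Uu Uv] := AU z zA.
    have x1 := s1 z (ltW zA); have x2 := s2' z (ltW zA).
    have zr : cball z1 r z by exact: cball_le rhor1 _ zA.
    have qv1 := qv z (cball_le rhod zA) Uv.
    have du' : cnorm (u' k z) <= Lv + 1.
      have := ler_cnormD (u' k z - v' z) (v' z); rewrite subrK => hh.
      have h2 := vb z zr; have h3 := lt_le_trans x2 e31.
      by clear - Z hh h2 h3; lra.
    set x := q' (u k z) * u' k z.
    have xe : cnorm (1 - x) <= e1.
      have -> : 1 - x = (q' (v z) - q' (u k z)) * u' k z + q' (v z) * (v' z - u' k z).
        by rewrite -qv1 /x; ring.
      apply: le_trans (ler_cnormD _ _) _; rewrite !cnormM.
      have y1 : cnorm (q' (v z) - q' (u k z)) <= Kq * e3.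
        apply: le_trans (qlip _ _ Uu Uv) _; apply: ler_wpM2l => //.
        by rewrite cnormB ltW.
      have y2 : cnorm (v' z - u' k z) <= e3 by rewrite cnormB ltW.
      have y3 := qb _ Uv.
      have z1' : cnorm (q' (v z) - q' (u k z)) * cnorm (u' k z) <= Kq * e3 * (Lv + 1).
        by apply: ler_pM => //; exact: cnorm_ge0.
      have z2' : cnorm (q' (v z)) * cnorm (v' z - u' k z) <= Lq * e3.
        by apply: ler_pM => //; exact: cnorm_ge0.
      apply: le_trans (lerD z1' z2') _; apply: (@le_trans _ _ (e3 * (Kq * (Lv + 1) + Lq + 1))).
        have -> : e3 * (Kq * (Lv + 1) + Lq + 1) = Kq * e3 * (Lv + 1) + Lq * e3 + e3 by ring.
        by rewrite lerDl ltW.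
      by apply: le_trans e3c _; rewrite ler_pdivrMr// ler_peMr ?ltW// ltr1n.
    have e11 : e1 <= 1 by rewrite ge_min lexx.
    have -> : 1 - x ^+ 2 = (1 - x) * (2 - (1 - x)) by ring.
    rewrite cnormM mulrC; apply: ler_pM; rewrite ?cnorm_ge0//.
    have := ler_cnormD 2 (- (1 - x)); rewrite cnormN (cnorm_nat R 2) => hh.
    apply: le_trans hh _; have -> : (3 : R) = 2 + 1 by rewrite -(natrD _ 2 1).
    by rewrite lerD2l; exact: le_trans e11.
  have e0' := ltW e0.
  apply: (@le_trans _ _ (512%:E * ((k.+1%:R^-1)%:E + e%:E * area A))%E).
    apply: (zoom_image Z) => //.
    - exact: cball_cmeas.
    - move=> z zA; rewrite /kball /cball /= subr0.
      have := ler_cnormD (z - z1) z1; rewrite subrK => hh; apply: (le_lt_trans hh).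
      by apply: lt_le_trans zqk; rewrite addrC ltrD2l.
    - by move=> z zA; have [_ gz] := uM z (cball_le rhor1 zA); exists (u k z).
    - move=> y yE.
      (* On the circle of radius rho/2, [v] moves by at least cl rho/2. Two errors of at most cl
         rho/16 leave 3 cl rho/8, which is 2 e4. *)
      pose e4 : R := 3 * (cl * rho) / 16.
      have cr : 0 < cl * rho by rewrite mulr_gt0.
      have e40 : 0 < e4 by rewrite /e4; clear - Z cr; lra.
      have r2 : 0 < rho / 2 by clear - Z rho0; lra.
      have r2r : rho / 2 < r by clear - Z rho0 rhor1; lra.
      have z10 : cnorm (z1 - z1) <= rho by rewrite subrr cnorm0 ltW.
      have x1 := s1 z1 z10.
      have [||z zr uz] := @open_mapping_quant _ z1 r (rho / 2) e4 (u k) (u' k) r2 r2r hu e40 _ y.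
      + move=> z zr; have zr1 : cnorm (z - z1) <= rho by clear - Z zr rho0; lra.
        have x2 := s1 z zr1.
        have l1 : cl * (rho / 2) <= cnorm (v z - v z1).
          rewrite -zr; apply: low; first exact: cball_center.
          by rewrite /cball /= zr; clear - Z rho0 rhod; lra.
        have t1 := cnorm_dist (u k z) (v z) (v z1); have t2 := cnorm_dist (u k z1) (u k z) (v z1).
        rewrite (cnormB (v z) (u k z)) in t1; rewrite /e4.
        have {}x1 := lt_le_trans x1 e3a; have {}x2 := lt_le_trans x2 e3a; clear - Z x1 x2 t1 t2 l1 cr; lra.
      + have yE1 : cnorm (y - v z1) < cl * rho / 16.
          by apply: lt_le_trans (yE : cnorm (y - v z1) < E0) _; rewrite ge_min lexx.
        have t := cnorm_dist (v z1) y (u k z1); rewrite (cnormB (v z1) (u k z1)) in t; rewrite /e4.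
        have {}x1 := lt_le_trans x1 e3a; clear - Z x1 t yE1 cr; lra.
      exists z; first by rewrite /A /cball /=; clear - Z zr rho0; lra.
      by have [_ ->] := uM z (le_lt_trans zr r2r); rewrite uz.
    - move=> z zA; have [_ gz] := uM z (cball_le rhor1 zA).
      have -> : dfin (g k) z = u' k z.
        apply: hasd_dfin; apply: hasd_ball hu _ _ (cball_le rhor1 zA) => w wb.
        by have [] := uM w wb.
      rewrite gz /= => pk; have [Uu _] := AU z zA.
      rewrite /H asboolT// -cnormX -cnormM.
      have -> : (psi (u k z) - c * q' (u k z) ^+ 2) * u' k z ^+ 2 =
         (p k z - c) + c * (1 - (q' (u k z) * u' k z) ^+ 2) by rewrite -pk; ring.
      apply: le_trans (ler_cnormD _ _) _; rewrite lerD2l cnormM.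
      by apply: le_trans e1P; apply: ler_wpM2l; [exact: cnorm_ge0|exact: AX].
  apply: (@le_trans _ _ (512%:E * (e%:E + e%:E * (4 * rho ^+ 2)%:E))%E).
    apply: lee_wpmul2l; first by rewrite lee_fin ler0n.
    apply: leeD; first by rewrite lee_fin.
    by apply: lee_wpmul2l; [rewrite lee_fin|exact: area_cball (ltW rho0)].
  rewrite -(EFinM e) -EFinD -EFinM lee_fin; apply: eqW; ring.
have IH0 : cint E H = 0%E.
  apply/eqP; rewrite eq_le cint_ge0// andbT; apply/lee_addgt0Pr => e e0.
  have q0 : 0 < 512 + 2048 * rho ^+ 2.
    by apply: ltr_pwDl; [rewrite ltr0n|apply: mulr_ge0; [exact: ler0n|exact: exprn_ge0 (ltW rho0)]].
  rewrite add0e; have := small _ (divr_gt0 e0 q0); rewrite (divfK (lt0r_neq0 q0)); exact.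
have mHE : cmfun E H by exact: cmfun_sub mH.
have HE0 := cint_eq0 mE mHE (fun z _ => H0 z) IH0.
have [d2 /andP[d20 d2r] d2P] := hol_cont r0 hv E00.
pose t : R := Num.min d2 rho.
have t0 : 0 < t by rewrite lt_min d20.
have tr : t <= rho by rewrite ge_min lexx orbT.
have td2 : t <= d2 by rewrite ge_min lexx.
exists t => //.
(* The exceptional set is null in the target; the lower bound [cl] on the dilatation of [v] brings
   it back to the source. *)
apply: (@area_preimage0 _ _ v).
  apply: area_sub0 HE0 => _ [z [zt hz] <-]; split; first by apply: d2P; exact: cball_le td2 _ zt.
  apply/eqP => Hz; apply: hz; have zr : cball z1 r z by exact: cball_le (le_trans tr rhor1) _ zt.
  have vU : U (v z).
    have h2 : cnorm (v z - v z1) < s / 2 by apply: vs2; exact: cball_le (le_trans tr rhod1) _ zt.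
    by rewrite /U /cball /=; apply: lt_trans h2 _; lra.
  have -> : dfin h z = v' z.
    by apply: hasd_dfin; apply: hasd_ball hv _ _ zr => w wb; have [] := hP w wb.
  have [-> _ _] := hP z zr.
  have {}Hz : cnorm (psi (v z) - c * q' (v z) ^+ 2) = 0 by move: Hz; rewrite /H asboolT.
  move/eqP: Hz; rewrite cnorm_eq0 subr_eq0 => /eqP /= ->.
  by rewrite -mulrA -exprMn (qv z _ vU) ?expr1n ?mulr1//; exact: cball_le (le_trans tr rhod) _ zt.
move=> z [zt _]; have zd : cball z1 d z by exact: cball_le (le_trans tr rhod) _ zt.
exists cl, 1; split => // w [wt _] _; apply: low => //.
exact: cball_le (le_trans tr rhod) _ wt.
Qed.

End OdeLimit.

(** * Rigidity of the solutions *)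

Section Rigidity.
Variable R : realType.
Local Notation C := R[i].
Local Notation S := (sphere R).
Implicit Types (z w v y : C) (E X N : set C) (h : C -> S).

Lemma area_cball_ge z (r : R) : 0 <= r -> ((r ^+ 2 / 4)%:E <= area (cball z r))%E.
Proof.
rewrite le_eqVlt => /orP[/eqP <-|r0]; first by rewrite expr0n mul0r; exact: area_ge0.
have ar x : x - r / 4 <= x + r / 4 by lra.
have [_] := area_rect (ar (Re z)) (ar (Im z)).
have -> : (Re z + r / 4 - (Re z - r / 4)) * (Im z + r / 4 - (Im z - r / 4)) = r ^+ 2 / 4 by field.
move=> <-; apply: le_area => w [/andP[a1 a2] /andP[b1 b2]].
rewrite /cball /=; apply: le_lt_trans (normc_le_ReIm _) _.
have h1 : `|Re (w - z)| <= r / 4 by rewrite raddfB /= ler_norml; apply/andP; split; lra.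
have h2 : `|Im (w - z)| <= r / 4 by rewrite raddfB /= ler_norml; apply/andP; split; lra.
by clear - h1 h2 r0; lra.
Qed.

Lemma null_dense z (r : R) X : 0 < r -> area (cball z r `&` X) = 0%E ->
  exists2 w, cball z r w & ~ X w.
Proof.
move=> r0 a0; apply: contrapT => nex.
have : ((r ^+ 2 / 4)%:E <= 0%:E)%E.
  rewrite -[0%:E]a0; apply: le_trans (area_cball_ge z (ltW r0)) _; apply: le_area => w wz.
  by split => //; apply: contrapT => nX; apply: nex; exists w.
by rewrite lee_fin leNgt divr_gt0 ?exprn_gt0// ltr0n.
Qed.

Lemma gen_null_preimage h N : area N = 0%E -> area [set w | gen h w /\ N (fin (h w))] = 0%E.
Proof.
move=> N0; apply: (@area_preimage0 _ _ (fun w => fin (h w))).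
  by apply: area_sub0 N0 => _ [w [_ ?] <-].
move=> z [gz _]; have [c [d [c0 d0 cd]]] := gen_lower gz.
by exists c, d; split => // w _; exact: cd.
Qed.

Lemma gen_ball h z : gen h z -> exists (r : R) (v v' : C -> C), [/\ 0 < r, hol z r v v',
  (forall w, cball z r w -> h w = Some (v w)) & forall w, cball z r w -> v' w != 0].
Proof.
move=> [a a0 [r [v [v' [r0 hv hh va]]]]]; rewrite -va in a0.
have [d [s [c [q [q' [[/andP[d0 dr] _ _] [_ nz _ _]]]]]]] := hol_inverse r0 hv a0.
exists d, v, v'; split => //; first exact: hol_shrink dr hv.
by move=> w wd; apply: hh; exact: cball_le dr _ wd.
Qed.

Lemma gen_near h z : gen h z -> exists2 r : R, 0 < r & forall w, cball z r w -> gen h w.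
Proof.
move=> /gen_ball[r [v [v' [r0 hv hh nz]]]]; exists r => // w wr.
by exists (v' w); [exact: nz|exact: hasd_ball hv hh _ wr].
Qed.

Lemma gen_affine h a b z : a != 0 -> gen h (a * z + b) -> gen (fun z => h (a * z + b)) z.
Proof.
by move=> a0 [D D0 hD]; exists (D * a); [rewrite mulf_neq0|exact: hasd_affine].
Qed.

Variables (psi : C -> C).

Lemma odeat_affine c h a b z : a != 0 -> odeat psi c h (a * z + b) ->
  odeat psi (a ^+ 2 * c) (fun z => h (a * z + b)) z.
Proof.
move=> a0 [gz [r r0 N0]]; split; first exact: gen_affine.
have a1 : 0 < cnorm a by rewrite cnorm_gt0.
have [s s0 sP] := gen_near gz.
exists (Num.min r s / cnorm a); first by rewrite divr_gt0// lt_min r0.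
apply: (@area_preimage0 _ _ (fun w => a * w + b)).
  apply: area_sub0 N0 => _ [w [wz nw] <-].
  have wb : cnorm (a * w + b - (a * z + b)) < Num.min r s.
    have -> : a * w + b - (a * z + b) = a * (w - z) by ring.
    by rewrite cnormM mulrC -ltr_pdivlMr.
  move: (wb); rewrite lt_min => /andP[w1 w2]; split => // e; apply: nw.
  have [D _ hD] := sP _ w2.
  by rewrite (hasd_dfin (hasd_affine hD)) exprMn mulrCA mulrA -e (hasd_dfin hD); ring.
move=> w _; exists (cnorm a), 1; split => // y _ _.
have -> : a * y + b - (a * w + b) = a * (y - w) by ring.
by rewrite cnormM.
Qed.

(** Composition with R multiplies the constant by d, through the equation of [psi] at good
    points. *)
Lemma odeat_comp (f : ratmap R) c h z y : area [set z | ~ good_point f psi z] = 0%E ->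
  h z = Some y -> gen (reval f \o Some) y -> odeat psi c h z ->
  odeat psi ((rdeg f)%:R * c) (reval f \o h) z.
Proof.
move=> good0 hz gy [gz [r r0 N0]].
have [D [D0 hD] [D' D'0 hD']] : exists2 D, D != 0 /\ hasd h z D & gen (reval f \o Some) y.
  by have [D D0 hD] := gz; exists D.
split; first by exists (D' * D); [rewrite mulf_neq0|exact: hasd_compS hD hz hD'].
have [s s0 sP] := gen_near gz.
exists (Num.min r s); first by rewrite lt_min r0.
apply: area_sub0 (areaU0 N0 (gen_null_preimage h good0)) => w [].
rewrite {1}/cball /= lt_min => /andP[w1 w2] nw.
have [E E0 hE] := sP w w2; have [u hu] := hasd_fin hE.
have [gu|ngu] := pselect (good_point f psi u); last first.
  by right; split; [exact: sP|rewrite hu].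
left; split => // e; apply: nw; move: e; rewrite hu /=.
have [v [a [Fu a0 ha pv]]] := gu; rewrite Fu /= (hasd_dfin hE) (hasd_dfin (hasd_compS hE hu ha)).
by move=> <-; rewrite exprMn [LHS]mulrA pv mulrA.
Qed.

(** The transition k = h2^(-1) o h1 satisfies k'^2 = 1 almost everywhere, hence everywhere by
    continuity. So k' is locally a constant sign, k is affine, and the identity theorem globalizes
    the relation. *)
Lemma ode_rigid c h1 h2 z1 z2 : c != 0 -> mero h1 -> mero h2 ->
  odeat psi c h1 z1 -> odeat psi c h2 z2 -> h1 z1 = h2 z2 ->
  exists2 e : C, e ^+ 2 = 1 & forall z, h1 z = h2 (z2 + e * (z - z1)).
Proof.
move=> c0 m1 m2 [g1 [s1 s10 N1]] [g2 [s2 s20 N2]] e12.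
have [r1 [v1 [v1' [r10 hv1 h1v nz1]]]] := gen_ball g1.
have [r2 [v2 [v2' [r20 hv2 h2v nz2]]]] := gen_ball g2.
have c1 := cball_center z1 r10; have c2 := cball_center z2 r20.
have v12 : v2 z2 = v1 z1 by move: e12; rewrite h1v// h2v// => -[].
pose t2 := Num.min r2 s2; have t20 : 0 < t2 by rewrite lt_min r20.
have t2r : t2 <= r2 by rewrite ge_min lexx.
have t2s : t2 <= s2 by rewrite ge_min lexx orbT.
have [d [s [cl [q [q' [[/andP[d0 dr] s0 cl0] [low vd hq qP]]]]]]] :=
  hol_inverse t20 (hol_shrink t2r hv2) (nz2 _ c2).
rewrite v12 in hq qP.
have [r [/andP[r0 rr1]] [rs hk]] := hol_comp r10 s0 hv1 hq.
set k := (fun z => q (v1 z)) in hk; set k' := (fun z => _) in hk.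
have kz1 : k z1 = z2.
  have [qd vq _] := qP _ (cball_center (v1 z1) s0).
  apply: cnorm_le0_eq.
  rewrite -(ler_pM2l cl0) mulr0; apply: le_trans (low _ _ (cball_center _ d0) qd) _.
  by rewrite vq v12 subrr cnorm0.
have kP z : cball z1 r z -> [/\ cball z2 d (k z), v2 (k z) = v1 z & k' z * v2' (k z) = v1' z].
  move=> zr; have [qd vq q'E] := qP _ (rs z zr); split => //.
  by rewrite /k' q'E mulrAC mulVf ?mul1r//; exact: vd.
have h12 z : cball z1 r z -> h2 (k z) = h1 z.
  move=> zr; have [kd vk _] := kP z zr; rewrite (h1v z (cball_le rr1 zr)) h2v ?vk//.
  by apply: cball_le kd; exact: le_trans dr t2r.
have k'0 z : cball z1 r z -> k' z != 0.
  move=> zr; have [kd _ kk] := kP z zr; apply: contraTneq (nz1 z (cball_le rr1 zr)) => e.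
  by rewrite -kk e mul0r eqxx.
pose B2 := cball z2 s2 `&` [set w | psi (fin (h2 w)) * dfin h2 w ^+ 2 <> c].
have K0 : area (cball z1 r `&` [set z | B2 (k z)]) = 0%E.
  apply: (@area_preimage0 _ _ k); first by apply: area_sub0 N2 => _ [z [_ ?] <-].
  move=> z [zr _]; have gk : gen (fun w => Some (k w) : S) z.
    exists (k' z); first exact: k'0.
    by apply: hasd_ball hk _ _ zr.
  have [a [b [a0 b0 ab]]] := gen_lower gk.
  by exists a, b; split => // w _; exact: ab.
have sq z : cball z1 r z -> cball z1 s1 z -> ~ (cball z1 s1 `&`
    [set w | psi (fin (h1 w)) * dfin h1 w ^+ 2 <> c]) z -> ~ B2 (k z) -> k' z ^+ 2 = 1.
  move=> zr zs n1 n2; have [kd vk kk] := kP z zr.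
  have e1 : psi (v1 z) * v1' z ^+ 2 = c.
    apply: contrapT => h; apply: n1; split => //=.
    have zr1 := cball_le rr1 zr.
    by rewrite h1v// (hasd_dfin (hasd_ball hv1 h1v zr1)).
  have e2 : psi (v1 z) * v2' (k z) ^+ 2 = c.
    apply: contrapT => h; apply: n2; split; first by apply: cball_le kd; exact: le_trans dr t2s.
    have kr2 : cball z2 r2 (k z) by apply: cball_le kd; exact: le_trans dr t2r.
    by rewrite /= h2v// (hasd_dfin (hasd_ball hv2 h2v kr2)) /= vk.
  apply: (mulfI c0); rewrite mulr1; transitivity (psi (v1 z) * v2' (k z) ^+ 2 * k' z ^+ 2).
    by rewrite e2.
  by rewrite -[RHS]e1 -kk; move: (k' z) (v2' (k z)) => x y; ring.
pose r' : R := Num.min r s1; have r'0 : 0 < r' by rewrite lt_min r0.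
have r'r : r' <= r by rewrite ge_min lexx.
have r's : r' <= s1 by rewrite ge_min lexx orbT.
have [L L0 lip] := hol_deriv_lip hk.
have [M M0 kM] : exists2 M : R, 0 <= M & forall z, cball z1 r z -> cnorm (k' z) <= M.
  by have [M M0 MP] := hk; exists M => // z /MP[].
(* Points where the square is 1 are dense, and k' is Lipschitz. *)
have all1 z : cball z1 r' z -> k' z ^+ 2 = 1.
  move=> zr'; apply: cnorm_small_eq => e e0.
  have [b b0 bP] := cball_inner zr'.
  pose b' : R := Num.min b (e / (2 * M * L + 1)).
  have ML : 0 < 2 * M * L + 1 by rewrite ltr_wpDl// !mulr_ge0.
  have b'0 : 0 < b' by rewrite lt_min b0 divr_gt0.
  have [|w wb nw] := @null_dense z b' ([set w | ~ (k' w ^+ 2 = 1)]) b'0.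
    apply: area_sub0 (areaU0 N1 K0) => w [wb nk].
    have wr' : cball z1 r' w by apply: bP; apply: cball_le wb; rewrite ge_min lexx.
    apply: contrapT => /not_orP[n1 n2]; apply: nk; 
    apply: (sq w (cball_le r'r wr') (cball_le r's wr') n1) => h; apply: n2.
    by split; [exact: cball_le r'r _ wr'|exact: h].
  move/contrapT: nw => <-.
  have wr : cball z1 r w by apply: cball_le r'r _ (bP _ (cball_le _ wb)); rewrite ge_min lexx.
  have zr : cball z1 r z by exact: cball_le r'r _ zr'.
  have -> : k' z ^+ 2 - k' w ^+ 2 = (k' z - k' w) * (k' z + k' w) by ring.
  rewrite cnormM; apply: (@le_trans _ _ (L * b' * (M + M))).
    apply: ler_pM; rewrite ?cnorm_ge0//.
      apply: le_trans (lip w z wr zr) _; apply: ler_wpM2l => //.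
      by rewrite cnormB ltW.
    by apply: le_trans (ler_cnormD _ _) _; apply: lerD; exact: kM.
  apply: (@le_trans _ _ (b' * (2 * M * L + 1))); last by rewrite -ler_pdivlMr// ge_min lexx orbT.
  have -> : b' * (2 * M * L + 1) = L * b' * (M + M) + b' by ring.
  by rewrite lerDl ltW.
pose e := k' z1; have e1 : e ^+ 2 = 1 by apply: all1; exact: cball_center.
exists e => //.
pose t : R := Num.min r' (1 / (L + 1)).
have L1 : 0 < L + 1 by rewrite ltr_wpDl.
have t0 : 0 < t by rewrite lt_min r'0 divr_gt0.
have tr' : t <= r' by rewrite ge_min lexx.
have tr : t <= r by exact: le_trans tr' r'r.
have tL : t * (L + 1) <= 1 by rewrite -ler_pdivlMr// ge_min lexx orbT.
(* The opposite sign lies at distance 2, while on this ball k' varies by at most L t, which is at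
   most 1. *)
have ke z : cball z1 t z -> k' z = e.
  move=> zt; have /eqP := all1 z (cball_le tr' zt); rewrite -e1 eqf_sqr => /orP[/eqP//|/eqP ee].
  have l1 : cnorm (k' z - e) <= L * cnorm (z - z1).
    by apply: lip; [exact: cball_center|exact: cball_le tr _ zt].
  have l2 : cnorm (z - z1) < t by exact: zt.
  have l3 : cnorm e = 1.
    have := congr1 (@Normc.normc R) e1; rewrite cnormX cnorm1 => /eqP.
    by rewrite sqrf_eq1 => /orP[/eqP//|/eqP h]; have := cnorm_ge0 e; rewrite h lerNr oppr0 ler10.
  have l4 : cnorm (k' z - e) = 2.
    rewrite ee; have -> : - e - e = - (2 * e) by ring.
    by rewrite cnormN cnormM (cnorm_nat R 2) l3 mulr1.
  have l5 : L * cnorm (z - z1) <= L * t by rewrite ler_wpM2l// ltW.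
  by move: l1; rewrite l4 => l1; exfalso; clear - l1 l5 tL t0; nra.
have hc : hol z1 t (fun z => k z - e * z) (fun=> 0).
  have := holB (hol_shrink tr hk) (holM (hol_cst z1 t e) (hol_id z1 t)).
  apply: eq_hol => // z zt; rewrite ke//; ring.
have kE z : cball z1 t z -> k z = z2 + e * (z - z1).
  move=> zt; have := hol_const_ball hc zt (cball_center _ t0); rewrite kz1 => h.
  by rewrite -[LHS](subrK (e * z)) h; ring.
apply: (mero_identity (r := t) (z0 := z1)) => //.
  rewrite (_ : (fun z => _) = (fun z => h2 (e * z + (z2 - e * z1)))); first exact: mero_affine.
  by apply/funext => z; congr h2; ring.
by move=> z zt; rewrite -kE// h12//; exact: cball_le tr _ zt.
Qed.

End Rigidity.

(** * Existence of the developing map *)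

Section LimitMap.
Variable R : realType.
Local Notation C := R[i].
Local Notation S := (sphere R).
Implicit Types (z w y : C) (h g : C -> S).
Variables (f : ratmap R) (sigma : set S) (D : 'I_(rdeg f) -> set S) (phi : L1 R).
Local Notation F := (reval f).
Local Notation d := (rdeg f).
Local Notation psi := (cfun (repr phi)).
Hypotheses (d2 : (2 <= d)%N) (hD : sheets sigma D) (sigma0 : null sigma).
Hypothesis good0 : area [set z | ~ good_point f psi z] = 0%E.
Hypothesis phi0 : phi <> 0.

Lemma area_affine0 (a b : C) (N : set C) : a != 0 -> area N = 0%E ->
  area [set z | N (a * z + b)] = 0%E.
Proof.
move=> a0 N0; apply: (@area_preimage0 _ _ (fun z => a * z + b)).
  by apply: area_sub0 N0 => _ [z Nz <-].
move=> z _; exists (cnorm a), 1; split; rewrite ?cnorm_gt0// => w _ _.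
have -> : a * w + b - (a * z + b) = a * (w - z) by ring.
by rewrite cnormM.
Qed.

(** The maps are z -> R^n(scale z + x) at the return times of [orbit_point]; the squared scale
    cancels the factor d^n of the iterated equation. *)
Lemma exists_zooming : exists T c (g : nat -> C -> S) p, zooming psi T c g p.
Proof.
have [T [x [nu [T1 trapT gx px nuP]]]] := orbit_point d2 hD sigma0 good0 phi0.
pose s k : C := (scale f (nu k))%:C.
have s0 k : s k != 0 by rewrite -cnorm_gt0 cnorm_real normr_gt0 gt_eqF// scale_gt0.
pose g k z := iter (nu k) F (Some (s k * z + x)).
have gD k z : gog f sigma phi (s k * z + x) -> exists y a, [/\ g k z = Some y,
    hasd (g k) z a & psi y * a ^+ 2 = psi (x + s k * z)].
  move=> /(gog_deriv (nu k))[y [a [gy _ _ ha ea]]].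
  exists y, (a * s k); split; [exact: gy|exact: hasd_affine ha|].
  have s2 : s k ^+ 2 = ((d%:R : C) ^+ nu k)^-1.
    have -> : s k ^+ 2 = (scale f (nu k) ^+ 2)%:C by rewrite rmorphXn.
    by rewrite scale_sqr// fmorphV rmorphXn rmorph_nat.
  rewrite exprMn mulrA ea s2 (addrC x) mulrAC divff ?mul1r//.
  by rewrite expf_neq0// pnatr_eq0 -lt0n ltnW.
exists T, (psi x), g, (fun k z => psi (x + s k * z)); split => //.
- exact: cintegrableP.
- have m0 := total_mass_gt0 phi0; exists (3 / 4 * total_mass phi).
    by apply: mulr_gt0 => //; lra.
  have mT := @trap_cmeas _ phi T.
  have fT := mass_fin phi mT; have fC := mass_fin phi (cmeasC mT).
  have e := cint_setD mT (@cmeasT R) (@subsetT _ _) (mass_cmfun phi) (fun z _ => mass_ge0 phi z).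
  rewrite setTD in e.
  have e2 : total_mass phi = fine (cint (trap phi T) (mass phi)) + fine (cint (~` trap phi T) (mass phi)).
    by rewrite /total_mass e; exact: fineD fT fC.
  have -> : cint (trapped psi T) (fun y => cnorm (psi y)) = (fine (cint (trap phi T) (mass phi)))%:E.
    by rewrite fineK.
  by rewrite lee_fin; lra.
- move=> k z0 r; rewrite /g; elim: (nu k) => [|n [A [B AB]]].
    by do 2 eexists; apply: pairhol_Some; exact: holx_affine.
  have [A1 [B1 h]] := pairhol_reval f AB; exists A1, B1.
  by move: h; congr pairhol; apply/funext => z.
- move=> k; apply: area_sub0 (area_affine0 x (s0 k) (gog_ae d2 sigma0 good0)) => z nz gz.
  apply: nz; have [y [a [gy ha ea]]] := gD k z gz; split; first by exists y.
  by rewrite gy (hasd_dfin ha).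
- move=> k; have [m1 m2] := cintegrable_cmfunc (cintegrableP (repr phi)).
  by split; under eq_fun do rewrite addrC; [exact: cmfun_affine m1|exact: cmfun_affine m2].
- by move=> k; have [_ _] := nuP k.
- move=> k; have [|y [a [gy ha ea]]] := gD k 0; first by rewrite mulr0 add0r.
  have [_ [y' Ty' gy'] _] := nuP k.
  exists y, a; split => //; last by rewrite ea mulr0 addr0.
  by move: gy; rewrite /g mulr0 add0r gy' => -[<-].
Qed.

Lemma limit_map : exists (c : C) h, [/\ c != 0, mero h, gen h 0 & forall z, gen h z -> odeat psi c h z].
Proof.
have [T [c [g [p Z]]]] := exists_zooming.
have [V [h [[VV Voo] mh g0 cv]]] := zoom_limit Z.
exists c, h; split => //; first exact: zoom_c Z.
by move=> z gz; apply: (zoom_odeat Z VV) => // w; exact: cv.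
Qed.

End LimitMap.

(** * Symmetries of the limit map *)

Section Developing.
Variable R : realType.
Local Notation C := R[i].
Local Notation S := (sphere R).
Implicit Types (z w v y s : C) (A E X N : set C).

(** Countably many grid cells cover [N], each small enough to lie in a ball where [N] is null. *)
Lemma locally_null N : (forall z, N z -> exists2 r : R, 0 < r & area (cball z r `&` N) = 0%E) ->
  area N = 0%E.
Proof.
move=> loc; pose M n := [set z | N z /\ area (cball z (2 / n.+1%:R) `&` N) = 0%E].
apply: (@area_sub0 _ _ (\bigcup_n \bigcup_j (M n `&` grid n j))).
  move=> z Nz; have [r r0 zr] := loc z Nz; have [n nr] := invSn_lt (divr_gt0 r0 (ltr0n R 2)).
  have [j zj] := grid_cover n z; exists n => //; exists j => //; split => //; split => //.
  apply: area_sub0 zr => w [wz Nw]; split => //; apply: lt_le_trans wz _.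
  by rewrite mulrC -ler_pdivlMr// ltW.
apply: area_bigcup0 => n; apply: area_bigcup0 => j.
have [[z [[Nz az] zj]]|nz] := pselect ((M n `&` grid n j) !=set0).
  apply: area_sub0 az => w [[Nw _] wj]; split => //.
  exact: grid_dist wj zj.
by apply: area_sub0 (@area0 R) => w wM; apply: nz; exists w.
Qed.

Lemma cont_cmfunc X (u : C -> C) : copen X -> (forall z, X z -> forall e : R, 0 < e ->
  exists2 d : R, 0 < d & forall w, cnorm (w - z) < d -> cnorm (u w - u z) < e) -> cmfunc X u.
Proof.
move=> oX uc; split; apply: (cont_cmfun oX) => z Xz e e0; have [d d0 dP] := uc z Xz e e0;
  exists d => // w /dP; apply: le_lt_trans; rewrite -raddfB.
  exact: ler_cnorm_Re.
exact: ler_cnorm_Im.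
Qed.

Variables (psi : C -> C) (c : C) (h : C -> S).
Hypotheses (ipsi : cintegrable psi) (c0 : c != 0) (mh : mero h) (gen0 : gen h 0).
Hypothesis ode : forall z, gen h z -> odeat psi c h z.

Let hn : nlc h := gen_nlc mh gen0.

Lemma gen_copen : copen (gen h).
Proof. by move=> z /gen_near. Qed.

Lemma area_nongen : area [set z | ~ gen h z] = 0%E.
Proof.
apply: locally_null => z _; have [r r0 rP] := mero_generic mh hn z; exists r => //.
apply: area_sub0 (area1 z) => w [wr ng]; apply/eqP; apply: contrapT => /negP wz.
by apply: ng; exact: rP.
Qed.

Lemma area_ode_bad : area [set z | gen h z /\ psi (fin (h z)) * dfin h z ^+ 2 <> c] = 0%E.
Proof.
apply: locally_null => z [gz _]; have [_ [r r0 rP]] := ode gz; exists r => //.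
by apply: area_sub0 rP => w [wr [_ ?]].
Qed.

Lemma image_null X : (X `<=` gen h) -> area X = 0%E -> area [set y | exists2 z, X z & h z = Some y] = 0%E.
Proof.
move=> Xg X0; apply: (@area_sub0 _ _ ((fun z => fin (h z)) @` X)).
  by move=> y [z Xz hz]; exists z => //; rewrite hz.
apply: area_image0 => // z /Xg[D _ /hasd_pd/pd_lip[d d0 dP]].
by exists (cnorm D + 1), d; split => // w _; exact: dP.
Qed.

(** The change of variables is applied to the inverse [q] of [h] on the image [A] of [X]: there |c|
    |q'|^2 equals |psi|, so the area of [X] is controlled by the finite mass of [psi]. *)
Lemma inj_area X : copen X -> X `<=` gen h -> {in X &, injective h} ->
  ((cnorm c)%:E * area X <= 512%:E * cint setT (fun y => cnorm (psi y)))%E.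
Proof.
move=> oX Xg hinj.
have {}hinj z w : X z -> X w -> h z = h w -> z = w by move=> Xz Xw; apply: hinj; rewrite inE.
pose A := [set y | exists2 z, X z & h z = Some y].
have /choice[q qP] y : exists z, A y -> X z /\ h z = Some y.
  by have [[z Xz hz]|nA] := pselect (A y); [exists z|exists 0].
have loc y : A y -> exists (s : R) (k k' : C -> C), [/\ 0 < s, hol y s k k' &
    forall w, cball y s w -> [/\ A w, q w = k w & k' w = (dfin h (q w))^-1]].
  move=> Ay; have [Xq hq] := qP y Ay.
  have [r [v [v' [r0 hv hh nz]]]] := gen_ball (Xg _ Xq); have [r1 r10 r1X] := oX _ Xq.
  pose m : R := Num.min r r1; have m0 : 0 < m by rewrite lt_min r0.
  have mr : m <= r by rewrite ge_min lexx.
  have mr1 : m <= r1 by rewrite ge_min lexx orbT.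
  have [d [s [cl [k [k' [[/andP[d0 dm] s0 cl0] [low vd hk kP]]]]]]] :=
    hol_inverse m0 (hol_shrink mr hv) (nz _ (cball_center _ r0)).
  have vy : v (q y) = y by move: hq; rewrite (hh _ (cball_center _ r0)) => -[].
  rewrite vy in hk kP; exists s, k, k'; split => // w ws; have [kd vk ek] := kP w ws.
  have Xk : X (k w) by apply: r1X; apply: cball_le kd; exact: le_trans dm mr1.
  have kr : cball (q y) r (k w) by apply: cball_le kd; exact: le_trans dm mr.
  have hkw : h (k w) = Some w by rewrite hh// vk.
  have Aw : A w by exists (k w).
  have [Xqw hqw] := qP w Aw; have qk : q w = k w by apply: hinj; rewrite // hqw hkw.
  split => //; rewrite ek qk; congr (_^-1); apply/esym; apply: hasd_dfin.
  exact: hasd_ball hv hh _ kr.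
have oA : copen A.
  by move=> y /loc[s [k [k' [s0 _ sP]]]]; exists s => // w /sP[].
have mA := copen_cmeas oA.
pose u y := (dfin h (q y))^-1.
have qc : cmfunc A q.
  apply: cont_cmfunc oA _ => y Ay e e0; have [s [k [k' [s0 hk sP]]]] := loc y Ay.
  have [d /andP[d0 ds] dP] := hol_cont s0 hk e0; exists d => // w wd.
  have [_ -> _] := sP w (cball_le ds wd); have [_ -> _] := sP y (cball_center _ s0).
  exact: dP.
have uc : cmfunc A u.
  apply: cont_cmfunc oA _ => y Ay e e0; have [s [k [k' [s0 hk sP]]]] := loc y Ay.
  have [L L0 lip] := hol_deriv_lip hk; have L1 : 0 < L + 1 by rewrite ltr_wpDl.
  exists (Num.min s (e / (L + 1))); first by rewrite lt_min s0 divr_gt0.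
  move=> w; rewrite lt_min ltr_pdivlMr// => /andP[ws we].
  have uk x : cball y s x -> u x = k' x by move=> xs; have [_ _ ->] := sP x xs.
  rewrite (uk w ws) (uk y (cball_center _ s0)).
  apply: le_lt_trans (lip _ _ (cball_center _ s0) ws) _; apply: le_lt_trans we.
  by rewrite mulrC ler_wpM2l ?cnorm_ge0// lerDl.
have mJ : cmfun A (fun y => cnorm (u y)) by exact: cmfunc_cnorm uc.
have pl : plip A q (fun y => cnorm (u y)).
  move=> y Ay e e0; have [s [k [k' [s0 hk sP]]]] := loc y Ay.
  have [d d0 dP] := pd_growth (hol_pd hk (cball_center _ s0)) e0.
  exists (Num.min s d); first by rewrite lt_min s0.
  move=> w Aw; rewrite lt_min => /andP[ws wd].
  have [_ -> _] := sP w ws; have [_ qy uy] := sP y (cball_center _ s0).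
  have {}uy : u y = k' y by rewrite uy.
  by rewrite uy qy; exact: dP.
have mX := copen_cmeas oX.
have XqA : X `<=` q @` A.
  move=> z Xz; have [y hz] : exists y, h z = Some y by have [D _ /hasd_fin] := Xg z Xz.
  have Ay : A y by exists z.
  by exists y => //; have [Xq hq] := qP y Ay; apply: hinj; rewrite // hq hz.
have big := cint_image mA mJ (fun y _ => cnorm_ge0 (u y)) pl (fun B mB => cmeas_comp mA qc mB) mX XqA
  (@cmfun_cst _ setT (cnorm c)) (fun=> cnorm_ge0 c).
rewrite cint_cst// in big; apply: (le_trans big).
apply: lee_wpmul2l; first by rewrite lee_fin ler0n.
have mpsi : cmfun setT (fun y => cnorm (psi y)) by apply: cmfunc_cnorm; exact: cintegrable_cmfunc.
have mu2 : cmfun A (fun y => cnorm c * cnorm (u y) ^+ 2).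
  by apply: cmfunM; [exact: cmfun_cst|exact: cmfunM].
have bad0 : area [set z | X z /\ psi (fin (h z)) * dfin h z ^+ 2 <> c] = 0%E.
  by apply: area_sub0 area_ode_bad => z [/Xg].
have [N [mN bN N0]] := area_hull [set y | exists2 z, (X z /\ psi (fin (h z)) * dfin h z ^+ 2 <> c) & h z = Some y].
rewrite image_null in N0 => //; last by move=> z [/Xg].
have AN : A `\` N `<=` A by move=> z [].
have A10 : area (A `\` (A `\` N)) = 0%E.
  by apply: area_sub0 N0 => y [Ay nAy]; apply: contrapT => nN; apply: nAy.
have mAN := cmeasD mA mN.
rewrite (cint_null_eq mAN mA AN mu2 _ A10); last first.
  by move=> y _; rewrite mulr_ge0 ?cnorm_ge0// exprn_ge0// cnorm_ge0.
apply: (@le_trans _ _ (cint (A `\` N) (fun y => cnorm (psi y)))).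
  apply: cint_le => //.
  - exact: cmfunS mA AN mu2.
  - exact: cmfun_sub mpsi.
  - move=> y [Ay nN]; rewrite mulr_ge0 ?cnorm_ge0 ?exprn_ge0 ?cnorm_ge0//=.
    have [Xq hq] := qP y Ay.
    have e : psi y * dfin h (q y) ^+ 2 = c.
      apply: contrapT => ne; apply: nN; apply: bN; exists (q y) => //; split => //.
      by rewrite hq.
    have D0 : dfin h (q y) != 0.
      by apply: contraNneq c0 => D0; rewrite -e D0 expr0n mulr0.
    rewrite /u -cnormX -cnormM -e; apply: eqW; congr cnorm.
    by field.
apply: cint_subset => //; first exact: cmeasT.
by move=> y _; exact: cnorm_ge0.
Qed.

End Developing.

(** * Discrete cocompact subgroups of the plane *)

Section Periods.
Variable R : realType.
Local Notation C := R[i].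
Implicit Types (z v y t : C) (E X N : set C).

(** A minimizing sequence is bounded, hence converges along an ultrafilter; separation makes it
    equal to one of its terms for almost all indices. *)
Lemma separated_min (Q : set C) (phi : C -> R) (delta K : R) : 0 < delta -> Q !=set0 ->
  (forall x y, Q x -> Q y -> cnorm (x - y) < delta -> x = y) ->
  (forall x, 0 <= phi x) -> (forall x, Q x -> cnorm x <= phi x + K) ->
  exists2 x, Q x & forall y, Q y -> phi x <= phi y.
Proof.
move=> de0 [x0 Qx0] sep phi0 bd.
pose E : set R := phi @` Q.
have hE : has_inf E.
  split; first by exists (phi x0); exists x0.
  by exists 0 => _ [x _ <-].
have /choice[x xP] (n : nat) : exists x, Q x /\ phi x < inf E + n.+1%:R^-1.
  have [_ [x Qx <-] h] := @inf_adherent _ E n.+1%:R^-1 (ltac:(by rewrite invr_gt0 ltr0n)) hE.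
  by exists x.
have [V [VV Voo]] := ex_ultra.
have [|l lP] := @ucvg_bounded _ _ VV x (inf E + 1 + K).
  apply: filterE => n /=; have [Qx lx] := xP n; apply: (le_trans (bd _ Qx)).
  rewrite lerD2r; apply: le_trans (ltW lx) _; rewrite lerD2l invf_le1 ?ltr0n//.
  by rewrite ler1n.
have V1 := lP (delta / 2) (divr_gt0 de0 (ltr0n R 2)).
have [n0 n0P] := @filter_ex _ V _ _ V1.
exists (x n0); first by have [] := xP n0.
have small : phi (x n0) <= inf E.
  apply/ler_addgt0Pr => e e0; have [m mP] := invSn_lt e0.
  have V2 : V [set n | (m <= n)%N] by apply: Voo; exists m.
  have [n [nP mn]] := @filter_ex _ V _ _ (filterI V1 V2).
  have [Qn ln] := xP n; have [Q0 _] := xP n0.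
  have -> : x n0 = x n.
    apply: sep => //; apply: le_lt_trans (cnorm_dist l _ _) _; rewrite (cnormB l).
    by rewrite [delta]splitr ltrD.
  apply: le_trans (ltW ln) _; rewrite lerD2l; apply: le_trans (ltW mP).
  by rewrite lef_pV2 ?posrE ?ltr0n// ler_nat.
by move=> y Qy; apply: (le_trans small); apply: ge_inf => //; [by case: hE|exists y].
Qed.

(* After division by a shortest vector, a vector of least positive height
   completes a basis: rounding coordinates leaves a vector of height less than
   the minimum, hence a real one of modulus at most 1/2. *)
Lemma discrete_lattice (P : set C) (delta rho : R) : P 0 ->
  (forall x y, P x -> P y -> P (x - y)) -> 0 < delta ->
  (forall x, P x -> cnorm x < delta -> x = 0) ->
  (forall z, exists2 t, P t & cnorm (z - t) <= rho) -> lattice P.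
Proof.
move=> P0 PB de0 sep cocpt.
have PN x : P x -> P (- x) by move=> Px; rewrite -sub0r; exact: PB.
have PD x y : P x -> P y -> P (x + y) by move=> Px Py; rewrite -[y]opprK; apply: PB => //; exact: PN.
have Pnat (n : nat) x : P x -> P (x *+ n).
  by move=> Px; elim: n => [//|n IH]; rewrite mulrS; exact: PD.
have Pint (m : int) x : P x -> P (m%:~R * x).
  move=> Px; rewrite mulrzl; case: m => n; first exact: Pnat.
  by rewrite NegzE mulrNz; apply: PN; exact: Pnat.
have rho0 : 0 <= rho by have [t _ h] := cocpt 0; exact: le_trans (cnorm_ge0 _) h.
have PS x y : P x -> P y -> cnorm (x - y) < delta -> x = y.
  by move=> Px Py xy; apply/eqP; rewrite -subr_eq0; apply/eqP; apply: sep => //; exact: PB.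
have [|x y [Px _] [Py _]|||w1 [Pw1 w10] w1min] := @separated_min [set x | P x /\ x != 0] (@Normc.normc R) delta 0 de0.
- have [t Pt zt] := cocpt ((rho + 1)%:C); exists t; split => //.
  apply/eqP => t0; move: zt; rewrite t0 subr0 cnorm_real ger0_norm ?addr_ge0// leNgt ltrDl ltr01.
  by [].
- exact: PS.
- exact: cnorm_ge0.
- by move=> x _; rewrite addr0.
have w1n : 0 < cnorm w1 by rewrite cnorm_gt0.
(* The normalization of the real part bounds an element of [Q] by its height plus 1/2, as
   [separated_min] needs. *)
pose Q := [set u : C | P (u * w1) /\ (Im u != 0 /\ `|Re u| <= 1 / 2)].
have round (x : R) : exists m : int, `|x - m%:~R| <= 1 / 2.
  exists (Num.floor (x + 1 / 2)).
  have := floor_le (x + 1 / 2); have := floorD1_gt (x + 1 / 2); rewrite intrD1.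
  by move=> h1 h2; rewrite ler_norml; apply/andP; split; lra.
have red u : P (u * w1) -> Im u != 0 -> exists2 u', Q u' & Im u' = Im u.
  move=> Pu iu; have [m mP] := round (Re u); exists (u - m%:~R).
    split; first by rewrite mulrBl; apply: PB => //; exact: Pint.
    have -> : (m%:~R : C) = (m%:~R : R)%:C by rewrite rmorph_int.
    by rewrite !raddfB /= subr0; split.
  have -> : (m%:~R : C) = (m%:~R : R)%:C by rewrite rmorph_int.
  by rewrite raddfB /= subr0.
have divn x : cnorm (x / w1) = cnorm x / cnorm w1 by rewrite cnormM cnormV.
have [||||w2 [Pw2 [iw2 rw2]] w2min] := @separated_min Q (fun u => `|Im u|) (delta / cnorm w1) (1 / 2) (divr_gt0 de0 w1n).
(* A point too far from the real line to be within the cocompactness radius of a real multiple of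
   [w1]: it yields a nonreal period. *)
- pose z : C := 'i * ((rho / cnorm w1 + 1)%:C).
  have [t Pt zt] := cocpt (z * w1).
  have [||u Qu _] := red (t / w1); [by rewrite divfK| |by exists u].
  apply/eqP => it; move: zt; rewrite leNgt => /negP; apply.
  have -> : z * w1 - t = (z - t / w1) * w1 by rewrite mulrBl divfK.
  rewrite cnormM -ltr_pdivrMr//; apply: lt_le_trans (ler_cnorm_Im _).
  rewrite raddfB /= it subr0 /z.
  rewrite mul0r add0r mul1r.
  by rewrite ger0_norm ?addr_ge0 ?divr_ge0// ?ltrDl// ltW.
- move=> x y [Px _] [Py _] xy; apply: (mulIf w10); apply: PS => //.
  by rewrite -mulrBl cnormM -ltr_pdivlMr.
- by move=> x; exact: normr_ge0.
- move=> x [_ [_ rx]]; apply: le_trans (normc_le_ReIm x) _; by rewrite addrC lerD2l.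
have i0 : 0 < `|Im w2| by rewrite normr_gt0.
have basis u : P (u * w1) -> exists m n : int, u = m%:~R + n%:~R * w2.
  move=> Pu; have [n nP] := round (Im u / Im w2).
  pose u' := u - n%:~R * w2.
  have Pu' : P (u' * w1) by rewrite mulrBl; apply: PB => //; rewrite -mulrA; exact: Pint.
  have nE : (n%:~R : C) = (n%:~R : R)%:C by rewrite rmorph_int.
  have iu' : Im u' = (Im u / Im w2 - n%:~R) * Im w2.
    rewrite /u' raddfB /= nE mulrBl divfK//; congr (_ - _).
    by case: (w2) => a b /=; ring.
  have real : Im u' = 0.
    apply/eqP; apply: contrapT => /negP iu; have [v Qv vu] := red u' Pu' iu.
    have := w2min v Qv; rewrite vu iu' normrM => h.
    have : `|Im u / Im w2 - n%:~R| * `|Im w2| <= 1 / 2 * `|Im w2| by rewrite ler_wpM2r// ltW.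
    move=> h2; have := le_trans h h2; clear - i0; lra.
  have [m mP] := round (Re u'); exists m, n.
  have mE : (m%:~R : C) = (m%:~R : R)%:C by rewrite rmorph_int.
  suff : u' - m%:~R = 0 by move/eqP; rewrite subr_eq0 /u' subr_eq => /eqP.
  apply/eqP; apply: contrapT => /negP ne.
  have Pd : P ((u' - m%:~R) * w1) by rewrite mulrBl; apply: PB => //; exact: Pint.
  have := w1min _ (conj Pd (mulf_neq0 ne w10)); rewrite cnormM.
  rewrite -[X in X <= _ -> _]mul1r (ler_pM2r w1n) => h.
  have h2 : cnorm (u' - m%:~R) <= 1 / 2.
    move: (u') real mP => v rv mv.
    by apply: le_trans (normc_le_ReIm _) _; rewrite !raddfB /= mE /= rv subr0 normr0 addr0.
  by clear - h h2; lra.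
exists w1, (w2 * w1); split.
  move=> a b ab; have {}ab : a%:C + b%:C * w2 = 0.
    by apply: (mulIf w10); rewrite mul0r -ab; ring.
  have ib : b * Im w2 = 0.
    have := congr1 (@complex.Im R) ab; case: (w2) => x y /=; rewrite !mul0r !addr0 add0r.
    by move=> <-; ring.
  have b0 : b = 0 by apply/eqP; move/eqP: ib; rewrite mulf_eq0 (negbTE iw2) orbF.
  by split => //; move: ab; rewrite b0 mul0r addr0 => -[].
apply/seteqP; split => [x Px|x [m [n ->]]].
  have [|m [n mn]] := basis (x / w1); first by rewrite divfK.
  by exists m, n; rewrite mulrA -mulrDl -mn divfK.
by apply: PD; [exact: Pint|exact: Pint].
Qed.

End Periods.

(** * The symmetries of the developing map and its period lattice *)

Section Symmetries.
Variable R : realType.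
Local Notation C := R[i].
Local Notation S := (sphere R).
Implicit Types (z w y t s : C) (A E X N : set C) (h : C -> S).

Definition period h : set C := [set t | forall z, h (z + t) = h z].
(** Point reflections z -> s - z, with centre s/2, are indexed by [s]. *)
Definition flip h : set C := [set s | forall z, h (s - z) = h z].

Lemma period0 h : period h 0.
Proof. by move=> z; rewrite addr0. Qed.

Lemma periodB h t t' : period h t -> period h t' -> period h (t - t').
Proof. by move=> Pt Pt' z; rewrite -(Pt' (z + (t - t'))) addrA subrK Pt. Qed.

Lemma flipB h s s' : flip h s -> flip h s' -> period h (s - s').
Proof.
move=> Fs Fs' z; rewrite -(Fs (z + (s - s'))) -(Fs' z).
by congr h; ring.
Qed.

Lemma period_near h : gen h 0 -> exists2 e : R, 0 < e <= 1 &
  forall t, period h t -> cnorm t < e -> t = 0.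
Proof.
move=> /gen_lower[c [d [c0 d0 cd]]].
exists (Num.min d 1); first by rewrite lt_min d0 ltr01 ge_min lexx orbT.
move=> t Pt; rewrite lt_min => /andP[td _].
have := cd t; rewrite subr0 => /(_ td); have := Pt 0; rewrite add0r => ->.
by rewrite subrr cnorm0 pmulr_rle0// => t0; apply/eqP; rewrite -cnorm_eq0 eq_le t0 cnorm_ge0.
Qed.

Variables (psi : C -> C) (c : C) (h : C -> S).
Hypotheses (ipsi : cintegrable psi) (c0 : c != 0) (mh : mero h) (gen0 : gen h 0).
Hypothesis ode : forall z, gen h z -> odeat psi c h z.

Lemma gen_same z1 z2 : gen h z1 -> gen h z2 -> h z1 = h z2 ->
  period h (z2 - z1) \/ flip h (z1 + z2).
Proof.
move=> g1 g2 e; have [k k2 kP] := ode_rigid c0 mh mh (ode g1) (ode g2) e.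
have /eqP := k2; rewrite sqrf_eq1 => /orP[]/eqP k1; [left|right] => z.
  by rewrite [RHS]kP k1 mul1r; congr h; ring.
by rewrite [RHS]kP k1; congr h; ring.
Qed.

(* Translates of a small ball avoiding all symmetries of [h] have disjoint
   images of equal mass. *)
Lemma spread_bound (r : R) (w : nat -> C) n : 0 < r -> r <= 1 / 2 ->
  (forall t, period h t -> cnorm t < 2 * r -> t = 0) ->
  (forall i j t, (i < n)%N -> (j < n)%N -> i != j -> period h t -> 1 < cnorm (w i - w j - t)) ->
  (forall i j s, (i < n)%N -> (j < n)%N -> flip h s -> 2 * r < cnorm (w i + w j - s)) ->
  ((cnorm c * (n%:R * (r ^+ 2 / 4)))%:E <= 512%:E * cint setT (fun y => cnorm (psi y)))%E.
Proof.
move=> r0 r2 sep wP wF.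
pose A i := cball (w i) r `&` gen h.
pose X := \bigcup_(i in [set i | (i < n)%N]) A i.
have oA i : copen (A i) by apply: copenI; [exact: cball_copen|exact: gen_copen].
have oX : copen X.
  move=> z [i iN Az]; have [d d0 dP] := oA i z Az; exists d => // y /dP Ay; by exists i.
have mX := copen_cmeas oX.
have hinj z z' : X z -> X z' -> h z = h z' -> z = z'.
  move=> [i iN [zi gz]] [j jN [zj gz']] e.
  have [Pt|Fs] := gen_same gz gz' e.
    have [ij|ij] := eqVneq i j.
      apply/esym/eqP; rewrite -subr_eq0; apply/eqP; apply: sep => //.
      apply: le_lt_trans (cnorm_dist (w i) _ _) _; rewrite (cnormB (w i)) mulr_natl mulr2n.
      by apply: ltrD => //; rewrite ij.
    have := wP _ _ _ jN iN (ltac:(by rewrite eq_sym)) Pt.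
    have -> : w j - w i - (z' - z) = (z - w i) - (z' - w j) by ring.
    move=> h1; exfalso; have h2 := ler_cnormD (z - w i) (- (z' - w j)); rewrite cnormN in h2.
    have z1 : cnorm (z - w i) < r by exact: zi.
    have z2 : cnorm (z' - w j) < r by exact: zj.
    have := lt_le_trans h1 h2; have := ltrD z1 z2; move: r2 => r2.
    move: (cnorm (z - w i)) (cnorm (z' - w j)) => x y; lra.
  have := wF _ _ _ iN jN Fs.
  have -> : w i + w j - (z + z') = - ((z - w i) + (z' - w j)) by ring.
  rewrite cnormN => h1; exfalso; have h2 := ler_cnormD (z - w i) (z' - w j).
  have z1 : cnorm (z - w i) < r by exact: zi.
  have z2 : cnorm (z' - w j) < r by exact: zj.
  have := lt_le_trans h1 h2; have := ltrD z1 z2.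
  move: (cnorm (z - w i)) (cnorm (z' - w j)) => x y; lra.
have Xg : X `<=` gen h by move=> z [i _ []].
have hX : {in X &, injective h} by move=> z z'; rewrite !inE; exact: hinj.
apply: (le_trans _ (inj_area ipsi c0 ode oX Xg hX)).
rewrite EFinM; apply: lee_wpmul2l; first by rewrite lee_fin cnorm_ge0.
have disj i j z : A i z -> A j z -> (i < n)%N -> (j < n)%N -> i = j.
  move=> [zi _] [zj _] iN jN; apply/eqP; apply: contrapT => /negP ij.
  have := wP _ _ _ iN jN ij (@period0 h); rewrite subr0 => h1.
  have h2 := cnorm_dist z (w i) (w j); rewrite (cnormB (w i) z) in h2.
  have z1 : cnorm (z - w i) < r by exact: zi.
  have z2 : cnorm (z - w j) < r by exact: zj.
  have := lt_le_trans h1 h2; have := ltrD z1 z2; move: r2 => r2.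
  move: (cnorm (z - w i)) (cnorm (z - w j)) => x y; lra.
have one : cmfun X (fun=> 1 : R) by exact: cmfun_cst.
have := @cint_disjoint_sum _ 'I_n (index_enum 'I_n) (fun i => A i) X (fun=> 1)
  (index_enum_uniq _) (fun i => copen_cmeas (oA i)) _ _ mX one (fun _ _ => ler01).
rewrite cint_cst// mul1e => big; apply: le_trans (big _ _).
- apply: (@le_trans _ _ (\sum_(i < n) (r ^+ 2 / 4)%:E)%E).
    by rewrite sumEFin sumr_const card_ord -[(r ^+ 2 / 4) *+ n]mulr_natl.
  apply: lee_sum => i _; rewrite cint_cst ?mul1e; last exact: copen_cmeas.
  apply: le_trans (area_cball_ge (w i) (ltW r0)) _.
  apply: (@le_trans _ _ (area (A i `|` [set z | ~ gen h z]))).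
    by apply: le_area => z zi; have [g|ng] := pselect (gen h z); [left|right].
  by apply: le_trans (areaU _ _) _; rewrite area_nongen// adde0.
- by move=> i j z Ai Aj; apply: val_inj; exact: disj Ai Aj (ltn_ord i) (ltn_ord j).
- by move=> i z Az; exists i => //=.
Qed.

Lemma mass_finite : (cint setT (fun y => cnorm (psi y)) < +oo)%E.
Proof.
have := integrable_fin_num measurableT (integrable_normc (CIntegrableFun (asboolT ipsi))).
by rewrite ge0_fin_numE//; apply: integral_ge0 => u _; rewrite lee_fin cnorm_ge0.
Qed.

(** Otherwise arbitrarily many points could be chosen far apart modulo the symmetries, and
    [spread_bound] would exceed the finite mass of [psi]. *)
Lemma cocompact : exists rho : R, forall z, exists2 t, period h t & cnorm (z - t) <= rho.
Proof.
apply: contrapT => nco.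
have far (rho : R) : exists z, forall t, period h t -> rho < cnorm (z - t).
  apply: contrapT => nz; apply: nco; exists rho => z; apply: contrapT => nt; apply: nz.
  by exists z => t Pt; rewrite ltNge; apply/negP => zt; apply: nt; exists t.
have [e /andP[e0 e1] eP] := period_near gen0.
(* If 2z is within 2r = e/16 of a reflection [s1], shifting [z] by e/8 moves 2z by e/4, to distance
   at least 3e/16. Other reflections differ from [s1] by at least [e] and remain at distance at
   least 11e/16. *)
pose r := e / 32.
have r0 : 0 < r by rewrite divr_gt0 ?ltr0n.
have e8 : cnorm (e / 8)%:C = e / 8 by rewrite cnorm_real ger0_norm// divr_ge0 ?ltW.
have shift (rho : R) s0 : exists z, (forall t, period h t -> rho < cnorm (z - t) /\ (flip h s0 -> rho < cnorm (z - s0 - t))) /\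
    forall s, flip h s -> 2 * r < cnorm (z + z - s).
  have [z zP] := far (rho + 1 + cnorm s0).
  have near z' : cnorm (z' - z) <= 1 -> forall t, period h t ->
      rho < cnorm (z' - t) /\ (flip h s0 -> rho < cnorm (z' - s0 - t)).
    move=> z1 t Pt; have h1 := zP t Pt; have s00 := cnorm_ge0 s0.
    have h2 := cnorm_dist z' z t; rewrite (cnormB z z') in h2; split; first by clear - z1 h1 h2 s00 ipsi c0 mh gen0 ode; lra.
    move=> _; have h3 := ler_cnormD (z' - s0 - t) s0.
    have e3 : z' - s0 - t + s0 = z' - t by ring.
    by rewrite e3 in h3; clear - z1 h1 h2 h3 ipsi c0 mh gen0 ode; lra.
  have [ok|] := pselect (forall s, flip h s -> 2 * r < cnorm (z + z - s)).
    by exists z; split => //; apply: near; rewrite subrr cnorm0.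
  move=> /existsNP[s1 /not_implyP[Fs1 /negP]]; rewrite -leNgt => close.
  exists (z + (e / 8)%:C); split.
    by apply: near; rewrite addrC addKr e8; clear - e1 ipsi c0 mh gen0 ode; lra.
  move=> s Fs; have Pt := flipB Fs Fs1.
  have dbl : cnorm ((e / 8)%:C + (e / 8)%:C) = e / 4.
    by rewrite -rmorphD cnorm_real ger0_norm; clear - e0 ipsi c0 mh gen0 ode; lra.
  have [ts|ts] := eqVneq s s1.
    have h1 := ler_cnormD (z + (e / 8)%:C + (z + (e / 8)%:C) - s) (- (z + z - s1)).
    have h2 : z + (e / 8)%:C + (z + (e / 8)%:C) - s + - (z + z - s1) = (e / 8)%:C + (e / 8)%:C.
      by rewrite ts; ring.
    rewrite h2 dbl cnormN in h1; rewrite /r in close *; clear - close h1 e0 ipsi c0 mh gen0 ode; lra.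
  have big : e <= cnorm (s - s1).
    by rewrite leNgt; apply/negP => /(eP _ Pt)/eqP; rewrite subr_eq0 (negbTE ts).
  have h1 := ler_cnormD (- (z + (e / 8)%:C + (z + (e / 8)%:C) - s)) (z + z - s1 + ((e / 8)%:C + (e / 8)%:C)).
  have h2 : - (z + (e / 8)%:C + (z + (e / 8)%:C) - s) + (z + z - s1 + ((e / 8)%:C + (e / 8)%:C)) = s - s1 by ring.
  have h3 := ler_cnormD (z + z - s1) ((e / 8)%:C + (e / 8)%:C).
  rewrite dbl in h3; rewrite h2 cnormN in h1; rewrite /r in close *.
  by clear - close h1 h3 big e0 ipsi c0 mh gen0 ode; lra.
(* Any two reflections differ by a period, so being far from the periods both before and after
   subtracting one [s0] handles all of them. *)
have [s0 s0P] : exists s0, forall s, flip h s -> flip h s0.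
  have [[s Fs]|n] := pselect (flip h !=set0); first by exists s.
  by exists 0 => s Fs; exfalso; apply: n; exists s.
have seqs n : exists w : nat -> C,
  (forall i j t, (i < n)%N -> (j < n)%N -> i != j -> period h t -> 1 < cnorm (w i - w j - t)) /\
  (forall i j s, (i < n)%N -> (j < n)%N -> flip h s -> 2 * r < cnorm (w i + w j - s)).
  elim: n => [|n [w [wP wF]]]; first by exists (fun=> 0); split.
  pose M := \sum_(i < n) cnorm (w i).
  have wM i : (i < n)%N -> cnorm (w i) <= M.
    move=> iN; rewrite /M (bigD1 (Ordinal iN)) //= lerDl; apply: sumr_ge0 => j _.
    exact: cnorm_ge0.
  have [z [zP zF]] := shift (M + 1) s0.
  pose w' i := if (i < n)%N then w i else z.
  have r1 : 2 * r <= 1 by rewrite /r; clear - e1 ipsi c0 mh gen0 ode; lra.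
  have zw i t : (i < n)%N -> period h t -> 1 < cnorm (z - w i - t).
    move=> iN Pt; have [h1 _] := zP t Pt; have h2 := wM i iN.
    have h3 := ler_cnormD (z - w i - t) (w i).
    have e3 : z - w i - t + w i = z - t by ring.
    by rewrite e3 in h3; clear - h1 h2 h3 ipsi c0 mh gen0 ode; lra.
  have zf i s : (i < n)%N -> flip h s -> 2 * r < cnorm (z + w i - s).
    move=> iN Fs; have [_ h1] := zP _ (flipB Fs (s0P _ Fs)); have {}h1 := h1 (s0P _ Fs).
    have h2 := wM i iN; have h3 := ler_cnormD (z + w i - s) (- w i).
    have e3 : z + w i - s + - w i = z - s0 - (s - s0) by ring.
    by rewrite e3 cnormN in h3; clear - h1 h2 h3 r1 ipsi c0 mh gen0 ode; lra.
  exists w'; split => i j x; rewrite !ltnS /w' => iN jN.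
    move=> ij Px; have [i1|i1] := ltnP i n; have [j1|j1] := ltnP j n.
    - exact: wP.
    - have -> : w i - z - x = - (z - w i - (- x)) by ring.
      by rewrite cnormN; apply: zw => //; rewrite -sub0r; apply: periodB => //; exact: period0.
    - exact: zw.
    - have e2 : i = j by apply/eqP; rewrite eqn_leq (leq_trans iN j1) (leq_trans jN i1).
      by rewrite e2 eqxx in ij.
  move=> Fx; have [i1|i1] := ltnP i n; have [j1|j1] := ltnP j n.
  - exact: wF.
  - by rewrite addrC; rewrite (addrC (w i)) ; rewrite addrC; exact: zf.
  - exact: zf.
  - exact: zF.
have mfin : cint setT (fun y => cnorm (psi y)) \is a fin_num.
  by rewrite ge0_fin_numE ?mass_finite//; apply: cint_ge0 => z _; exact: cnorm_ge0.
pose m := fine (cint setT (fun y => cnorm (psi y))).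
have q0 : 0 < cnorm c * (r ^+ 2 / 4).
  by rewrite mulr_gt0 ?cnorm_gt0// divr_gt0 ?ltr0n// exprn_gt0.
pose n := (Num.truncn (512 * m / (cnorm c * (r ^+ 2 / 4)))).+1.
have [w [wP wF]] := seqs n.
have := @spread_bound r w n r0 _ _ wP wF; rewrite -(fineK mfin) -EFinM lee_fin => bd.
have : 512 * m < n%:R * (cnorm c * (r ^+ 2 / 4)).
  by rewrite -ltr_pdivrMr// truncnS_gt.
rewrite mulrCA ltNge bd//.
  by rewrite /r; clear - e1 ipsi c0 mh gen0 ode; lra.
move=> t Pt tr; apply: eP => //; apply: lt_le_trans tr _.
by rewrite /r; clear - e0 ipsi c0 mh gen0 ode; lra.
Qed.

Lemma period_lattice : lattice (period h).
Proof.
have [e /andP[e0 _] eP] := period_near gen0; have [rho rhoP] := cocompact.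
exact: discrete_lattice (period0 h) (@periodB h) e0 eP rhoP.
Qed.

End Symmetries.

(** * Surjectivity and the functional equation *)

Section Functional.
Variable R : realType.
Local Notation C := R[i].
Local Notation S := (sphere R).
Implicit Types (z w v y t s : C) (E X N : set C).

(** Liouville's argument: if infinity were omitted, the modulus would reach its maximum on a bounded
    set representing all points modulo periods, against the open mapping theorem. *)
Lemma mero_attains_infty (g : C -> S) (rho : R) : mero g -> nlc g ->
  (forall z, exists2 t, period g t & cnorm (z - t) <= rho) -> exists z, g z = None.
Proof.
have aux (s i j p q x e : R) : s - i < p -> p - q <= x -> i <= j -> x < e / 2 ->
    j < e / 2 -> s <= q + e by lra.
move=> mg ng co; apply: contrapT => nN.
have gf z : g z = Some (fin (g z)).
  by case gz : (g z) => [v|] //; exfalso; apply: nN; exists z.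
have [V [VV Voo]] := ex_ultra.
have red z : exists2 z', cnorm z' <= rho & g z' = g z.
  have [t Pt zt] := co z; exists (z - t) => //; by rewrite -(Pt (z - t)) subrK.
have cluster (x : nat -> C) : (forall n, cnorm (x n) <= rho) -> exists l, forall e : R, 0 < e ->
    V [set n | cnorm (fin (g (x n)) - fin (g l)) < e].
  move=> xb; have [|l lP] := @ucvg_bounded _ _ VV x rho; first exact: filterE.
  exists l => e e0; have [|d d0 dP] := mero_cont mg (_ : findom g l) e0; first by exists (fin (g l)).
  by apply: filterS (lP d d0) => n /dP[].
pose B : set R := range (fun z => cnorm (fin (g z))).
have supB : has_sup B.
  split; first by exists (cnorm (fin (g 0))), 0.
  apply: contrapT => nb.
  have /choice[x xP] (n : nat) : exists z, cnorm z <= rho /\ n%:R < cnorm (fin (g z)).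
    apply: contrapT => nz; apply: nb; exists n%:R => _ [z _ <-].
    have [z' zr <-] := red z; rewrite leNgt; apply/negP => h; apply: nz; by exists z'.
  have [l lP] := cluster x (fun n => (xP n).1).
  have V1 := lP 1 ltr01.
  pose m := (Num.truncn (cnorm (fin (g l)) + 1)).+1.
  have V2 : V [set n | (m <= n)%N] by apply: Voo; exists m.
  have [n [h1 mn]] := @filter_ex _ V _ _ (filterI V1 V2).
  have h2 := (xP n).2; have h3 := ler_cnormB (fin (g (x n))) (fin (g l)).
  have h4 : (m%:R : R) <= n%:R by rewrite ler_nat.
  have h5 : cnorm (fin (g l)) + 1 < m%:R by exact: truncnS_gt.
  have h6 := lt_trans (lt_le_trans h5 h4) h2; have h7 := le_lt_trans h3 h1.
  by move: h6; rewrite -ltrBDl => /lt_trans/(_ h7); rewrite ltxx.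
have /choice[x xP] (n : nat) : exists z, cnorm z <= rho /\ sup B - n.+1%:R^-1 < cnorm (fin (g z)).
  have n0 : 0 < (n.+1%:R^-1 : R) by rewrite invr_gt0 ltr0n.
  have [_ [z _ <-] h] := sup_adherent n0 supB.
  by have [z' zr e] := red z; exists z'; rewrite e.
have [l lP] := cluster x (fun n => (xP n).1).
have supl : sup B <= cnorm (fin (g l)).
  apply/ler_addgt0Pr => e e0; have e2 : 0 < e / 2 by rewrite divr_gt0.
  have [m mP] := invSn_lt e2.
  have V2 : V [set n | (m <= n)%N] by apply: Voo; exists m.
  have [n [h1 mn]] := @filter_ex _ V _ _ (filterI (lP _ e2) V2).
  have h2 := (xP n).2; have h3 := ler_cnormB (fin (g (x n))) (fin (g l)).
  have h4 : (n.+1%:R^-1 : R) <= m.+1%:R^-1 by rewrite lef_pV2 ?posrE ?ltr0n// ler_nat.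
  have h5 : cnorm (fin (g (x n)) - fin (g l)) < e / 2 by exact: h1.
  exact: aux h2 h3 h4 h5 mP.
(* [b] has the largest modulus and [a] points outwards: a z + b has larger modulus for small
   positive [z]. *)
pose b := fin (g l); pose a : C := if b == 0 then 1 else b.
have bnd z : cnorm (fin (g z)) <= cnorm b.
  by apply: le_trans supl; apply: ub_le_sup; [case: supB|exists z].
have gl : g l = Some (a * 0 + b) by rewrite mulr0 add0r gf.
have [e e0 eP] := @mero_open _ g (fun z => Some (a * z + b)) l 0 1 mg ng
  (mero_affine a b (@mero_Some R)) gl ltr01.
have e2 : 0 < e / 2 by rewrite divr_gt0.
have [|w _ gw] := eP ((e / 2)%:C).
  change (cnorm ((e / 2)%:C - 0) < e).
  by rewrite subr0 cnorm_real gtr0_norm//; clear - e0; lra.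
have := bnd w; rewrite gw /= leNgt => /negP; apply.
rewrite /a; case: eqVneq => [->|b0]; first by rewrite mul1r addr0 cnorm0 cnorm_real gtr0_norm.
have -> : b * (e / 2)%:C + b = b * (1 + e / 2)%:C by rewrite rmorphD rmorph1 mulrDr mulr1 addrC.
rewrite cnormM cnorm_real ltr_pMr ?cnorm_gt0// gtr0_norm ?ltrDl//.
by rewrite addr_gt0.
Qed.

Lemma mero_image_null (h : C -> S) X : mero h -> area X = 0%E ->
  area [set y | exists2 z, X z & h z = Some y] = 0%E.
Proof.
move=> mh X0; apply: (@area_sub0 _ _ ((fun z => fin (h z)) @` (X `&` findom h))).
  by move=> y [z Xz hz]; exists z; [split => //; exists y|rewrite hz].
apply: area_image0; first by apply: area_sub0 X0 => z [].
move=> z [_ [v hz]]; have [D /hasd_pd/pd_lip[d d0 dP]] := mero_hasd mh hz.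
by exists (cnorm D + 1), d; split => // w _; exact: dP.
Qed.

Variables (f : ratmap R) (psi : C -> C) (c : C) (h : C -> S).
Local Notation F := (reval f).
Local Notation d := (rdeg f).
Hypotheses (d2 : (2 <= d)%N) (good0 : area [set z | ~ good_point f psi z] = 0%E).
Hypotheses (ipsi : cintegrable psi) (c0 : c != 0) (mh : mero h) (gen0 : gen h 0).
Hypothesis ode : forall z, gen h z -> odeat psi c h z.

Let d0 : (0 < d)%N := ltnW d2.

(** A finite value is moved to infinity by the Moebius map w -> 1 / (w - b), which preserves the
    periods. *)
Lemma devel_surj (y : S) : exists z, h z = y.
Proof.
have [rho co] := cocompact ipsi c0 mh gen0 ode; have hn := gen_nlc mh gen0.
case: y => [b|]; last exact: mero_attains_infty mh hn co.
have cp : coprimep (1 : {poly C}) ('X - b%:P) by rewrite coprime1p.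
pose m := RatMap cp.
have mE x : reval m x = if x is Some w then if w == b then None else Some (w - b)^-1 else Some 0.
  case: x => [w|]; rewrite /reval /=.
    by rewrite !hornerE subr_eq0; case: eqP => // _; rewrite mul1r.
  rewrite /rdeg /= size_poly1 size_XsubC /= coef1 coefB coefX coefC /= subr0 oner_eq0.
  by rewrite mul0r.
have minj x x' : reval m x = reval m x' -> x = x'.
  rewrite !mE; case: x x' => [w|] [w'|] //.
  - case: eqP => [->|/eqP wb]; case: eqP => [->|/eqP wb'] // [] /invr_inj e.
    by congr Some; apply: (addIr (- b)).
  - by case: eqP => // /eqP wb [] /eqP; rewrite invr_eq0 subr_eq0 (negbTE wb).
  - by case: eqP => // /eqP wb [] /esym/eqP; rewrite invr_eq0 subr_eq0 (negbTE wb).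
have [||z] := @mero_attains_infty (reval m \o h) rho (mero_reval m mh).
- by move=> z0 r r0; have [z zr ne] := hn z0 r r0; exists z => // /minj.
- by move=> z; have [t Pt zt] := co z; exists t => // w /=; rewrite Pt.
rewrite /= mE; case hz : (h z) => [w|//]; case: eqP => // wb _; exists z.
by rewrite hz wb.
Qed.

(** The regular values of [h], which avoid the images of its critical points. *)
Definition safe y := forall z, h z = Some y -> gen h z.

Lemma area_unsafe : area [set y | ~ safe y] = 0%E.
Proof.
apply: area_sub0 (mero_image_null mh (area_nongen mh gen0)) => y /existsNP[z /not_implyP[hz ng]].
by exists z.
Qed.

Lemma safe_near z0 (r : R) N : 0 < r -> area N = 0%E -> exists z y, [/\ cball z0 r z, gen h z,
  h z = Some y, safe y & ~ N y].
Proof.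
move=> r0 N0.
have [|z zr nz] := @null_dense _ z0 r ([set z | ~ gen h z] `|`
    [set z | gen h z /\ ([set y | ~ safe y] `|` N) (fin (h z))]) r0.
  apply: (@area_sub0 _ _ _ _ (areaU0 (area_nongen mh gen0) (gen_null_preimage h (areaU0 area_unsafe N0)))).
  by move=> z [].
have gz : gen h z by apply: contrapT => ng; apply: nz; left.
have [y hz] : exists y, h z = Some y by have [D _ /hasd_fin] := gz.
exists z, y; split => //.
  by apply: contrapT => ns; apply: nz; right; split => //; left; rewrite hz.
by move=> Ny; apply: nz; right; split => //; right; rewrite hz.
Qed.

(** R o h and z -> h(sqrt(d) z) satisfy the same equation, with constant d c, so [ode_rigid] relates
    them by a translation or a reflection, whence the sign. *)
Lemma functional_equation : exists (e : bool) t,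
  forall z, F (h z) = h ((-1) ^+ e * (Num.sqrt d%:R)%:C * z + t).
Proof.
have dR : 0 < (d%:R : R) by rewrite ltr0n.
pose al : C := (Num.sqrt d%:R)%:C.
have al2 : al ^+ 2 = d%:R by rewrite /al -rmorphXn sqr_sqrtr ?ltW// rmorph_nat.
have al0 : al != 0.
  have : al ^+ 2 != 0 by rewrite al2 pnatr_eq0 -lt0n.
  by rewrite expf_eq0.
(* The starting value must be noncritical for [f] with an image that is regular for [h], so that
   both maps are generic where they agree. *)
have N0 := areaU0 (area_crit d0) (area_fpreimage0 d0 area_unsafe).
have [z1 [y [_ gz hz _ nN]]] := safe_near 0 ltr01 N0.
have gy : gen (F \o Some) y by apply: crit_gen => cy; apply: nN; left.
have [y' Fy] : exists y', F (Some y) = Some y' by have [D _ /hasd_fin] := gy.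
have sy' : safe y' by apply: contrapT => ns; apply: nN; right; exists y'.
have [w hw] := devel_surj (Some y'); have gw := sy' w hw.
have o1 := odeat_comp good0 hz gy (ode gz).
have aw : al * (w / al) + 0 = w by rewrite addr0 mulrC divfK.
have o2 := @odeat_affine _ psi c h al 0 (w / al) al0.
rewrite aw in o2; have {}o2 := o2 (ode gw); rewrite al2 in o2.
have dc0 : d%:R * c != 0 by rewrite mulf_neq0// pnatr_eq0 -lt0n.
have [|e e2 eP] := ode_rigid dc0 (mero_reval f mh) (mero_affine al 0 mh) o1 o2.
  by rewrite /= hz Fy aw hw.
have eE : exists b : bool, e = (-1) ^+ b.
  have /eqP := e2; rewrite sqrf_eq1 => /orP[]/eqP ->; first by exists false; rewrite expr0.
  by exists true; rewrite expr1.
have [b eb] := eE; exists b, (w - e * al * z1) => z.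
by have := eP z; rewrite /= => ->; congr h; rewrite -eb mulrDr addr0 mulrC divfK// /al; ring.
Qed.

End Functional.

(** * Recognizing a Lattes map *)

Section Deficit.
Variable R : realType.
Local Notation C := R[i].
Local Notation S := (sphere R).

(** Infinity belongs to the fibre exactly as a drop of degree, that is, as a vanishing coefficient
    of index [rdeg f]. *)
Lemma fiber_poly (f : ratmap R) (a b : C) : (0 < rdeg f)%N -> (a != 0) || (b != 0) ->
  exists p : {poly C}, [/\ p != 0, p = b *: rnum f - a *: rden f, (size p <= (rdeg f).+1)%N &
    forall x, reval f x = projS a b -> if x is Some z then root p z else p`_(rdeg f) == 0].
Proof.
move=> d0 ab; exists (b *: rnum f - a *: rden f); have [sn sd] := rdeg_size f; split => //.
- apply: contraTneq (wron_neq0 d0) => /eqP; rewrite subr_eq0 => /eqP e; rewrite negbK.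
  have e' := congr1 (@deriv _) e; rewrite !derivZ in e'.
  case/orP: ab => n0; apply/eqP; rewrite /wron.
    apply: (@scalerI _ _ a n0); by rewrite scaler0 scalerBr !scalerAr -e -e' -!scalerAr mulrC subrr.
  by apply: (@scalerI _ _ b n0); rewrite scaler0 scalerBr !scalerAl e e' -!scalerAl mulrC subrr.
- apply: (leq_trans (size_polyD _ _)); rewrite size_polyN geq_max.
  by rewrite (leq_trans (size_scale_leq _ _) sn) (leq_trans (size_scale_leq _ _) sd).
- case=> [z|].
    rewrite reval_Some => /(projS_eq (ratmap_coprime f z) ab) e.
    by rewrite /root !hornerE mulrC e mulrC subrr.
  have -> : reval f None = projS (rnum f)`_(rdeg f) (rden f)`_(rdeg f) by [].
  move=> /(projS_eq (ratmap_infty f) ab) e.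
  by rewrite coefB !coefZ mulrC e mulrC subrr.
Qed.

Lemma roots_list (p : {poly C}) : p != 0 -> exists r : seq C, size r = (size p).-1 /\
  forall z, root p z -> z \in r.
Proof.
move=> p0; have [r rP] := closed_field_poly_normal p; exists r; split.
  by rewrite [in RHS]rP size_scale ?lead_coef_eq0// size_prod_XsubC.
by move=> z; rewrite rP rootZ ?lead_coef_eq0// root_prod_XsubC.
Qed.

(** The coefficient of degree 2d - 2, where the two terms of degree 2d - 1 have cancelled; its
    vanishing detects a critical point at infinity. *)
Lemma wron_top (f : ratmap R) : (2 <= rdeg f)%N -> (wron f)`_((rdeg f).-1).*2 =
  (rnum f)`_(rdeg f) * (rden f)`_(rdeg f).-1 - (rnum f)`_(rdeg f).-1 * (rden f)`_(rdeg f).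
Proof.
have [] := rdeg_size f; case: (rdeg f) => [|[|e]] // sn sd _ /=.
have top (p q : {poly C}) : (size p <= e.+2)%N -> (size q <= e.+3)%N ->
    (p * q)`_(e.+1).*2 = p`_e * q`_e.+2 + p`_e.+1 * q`_e.+1.
  move=> sp sq; rewrite coefM.
  have l1 : (e < (e.+1).*2.+1)%N by lia.
  have l2 : (e.+1 < (e.+1).*2.+1)%N by lia.
  rewrite (bigD1 (Ordinal l1)) //= (bigD1 (Ordinal l2)) //=; last first.
    by apply/eqP => /(congr1 val) /=; lia.
  rewrite big1 ?addr0.
    congr (_ * _`__ + _ * _`__); lia.
  move=> [j jl] /= /andP[/eqP j1 /eqP j2].
  have {}j1 : j <> e by move=> je; apply: j1; apply: val_inj.
  have {}j2 : j <> e.+1 by move=> je; apply: j2; apply: val_inj.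
  have [je|je] := ltnP j e; last by rewrite (nth_default 0 (s := p)) ?mul0r//; apply: leq_trans sp _; lia.
  by rewrite (nth_default 0 (s := q)) ?mulr0//; apply: leq_trans sq _; lia.
have sdn (p : {poly C}) : (size p <= e.+3)%N -> (size p^`() <= e.+2)%N.
  by move=> sp; apply/leq_sizeP => j ej; rewrite coef_deriv nth_default ?mul0rn//; apply: leq_trans sp _.
rewrite /wron coefB top ?sdn// [rnum f * _]mulrC top ?sdn// !coef_deriv !mulrS.
by ring.
Qed.

(** A critical point exists: a root of the Wronskian or, when the latter is constant, infinity,
    because 2d - 2 > 0. The fibre polynomial through it has a double root, or a degree lowered by
    two, so its distinct points number fewer than d. *)
Lemma fiber_deficit (f : ratmap R) : (2 <= rdeg f)%N -> exists (y0 : S) (s : seq S),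
  (size s < rdeg f)%N /\ forall x, reval f x = y0 -> x \in s.
Proof.
move=> d2; have d0 := ltnW d2.
have [/eqP W1|/closed_rootP[z0 Wz]] := boolP (size (wron f) == 1%N).
  have [p [p0 pE ps pP]] := fiber_poly d0 (ratmap_infty f).
  exists (reval f None).
  have W0 := wron_top d2; rewrite nth_default in W0; last by rewrite W1; case: (rdeg f) d2 => [|[]].
  have pd : p`_(rdeg f) = 0 by rewrite pE coefB !coefZ mulrC subrr.
  have pd1 : p`_(rdeg f).-1 = 0.
    move/esym/eqP: W0; rewrite subr_eq0 => /eqP W0.
    by rewrite pE coefB !coefZ [X in X - _]mulrC -W0 subrr.
  have sp : (size p <= (rdeg f).-1)%N.
    apply/leq_sizeP => j; rewrite leq_eqVlt => /orP[/eqP <-//|].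
    case: (rdeg f) d2 pd ps => [//|e] _ pd ps /=; rewrite leq_eqVlt => /orP[/eqP <-//|ej].
    by apply: nth_default; apply: leq_trans ps _.
  have [r [rs rP]] := roots_list p0; exists (None :: map Some r); split.
    by rewrite /= size_map rs; move: sp d2 (size_poly_gt0 p); rewrite p0; lia.
  case=> [z|]; rewrite inE //= => /pP /rP zr.
  by rewrite map_f ?orbT.
have [p [p0 pE ps pP]] := fiber_poly d0 (ratmap_coprime f z0).
have pz : root p z0 by rewrite pE /root !hornerE mulrC subrr.
have /factor_theorem[q pq] := pz.
have qz : root q z0.
  have := congr1 (fun p : {poly C} => p^`().[z0]) pq.
  rewrite derivM derivXsubC !hornerE subrr mulr0 add0r pE derivB !derivZ !hornerE => e.
  move: Wz; rewrite /root /wron !hornerE => /eqP W0; rewrite -e -W0; apply/eqP; ring.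
have /factor_theorem[q2 qq] := qz.
have q20 : q2 != 0 by apply: contra_neq p0 => q20; rewrite pq qq q20 !mul0r.
have sq : size p = (size q2).+2.
  by rewrite pq size_Mmonic ?qq ?monicXsubC ?mulf_neq0 ?polyXsubC_eq0// size_Mmonic ?monicXsubC// !size_XsubC !addn2.
have [r [rs rP]] := roots_list q20.
have inr z : root p z -> (z == z0) || (z \in r).
  rewrite pq rootM root_XsubC qq rootM root_XsubC => /orP[/orP[/rP ->|->]|->] //.
  by rewrite orbT.
pose l : seq S := Some z0 :: map Some r.
exists (reval f (Some z0)), (if p`_(rdeg f) == 0 then None :: l else l); split.
  have q2s : (0 < size q2)%N by rewrite size_poly_gt0.
  case: eqP => [pd|_]; rewrite /= size_map rs prednK//; last by rewrite sq in ps.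
  have : (size p <= rdeg f)%N.
    apply/leq_sizeP => j; rewrite leq_eqVlt => /orP[/eqP <-//|jd].
    by apply: nth_default; apply: leq_trans ps _.
  by rewrite sq.
move=> x xy; have := pP x; rewrite -reval_Some => /(_ xy).
case: x xy => [z|] _; last by move=> ->; rewrite inE.
move=> /inr zr; have : Some z \in l.
  by rewrite inE; case/orP: zr => [/eqP ->|zr]; rewrite ?eqxx// map_f// orbT.
by case: eqP => // _ zl; rewrite inE zl orbT.
Qed.

End Deficit.

(** * Meromorphic maps are holomorphic maps to the sphere *)

Section Bridge.
Variable R : realType.
Local Notation C := R[i].
Local Notation S := (sphere R).
Implicit Types (z w v : C) (g : C -> S).

Lemma compact_cball (K : set C) : compact K -> exists M : R, forall z, K z -> cnorm z <= M.
Proof.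
move=> /compact_near_coveringP /(_ nat \oo (fun n z => cnorm z <= n%:R) _) cK.
have [|N _ NP] := cK; last by exists N%:R => z; exact: (NP N (leqnn N)).
move=> x _; pose m := (Num.truncn (cnorm x + 1)).+1.
exists (cball x 1, [set n | (m <= n)%N]).
  by split => /=; [apply/nbhs_cball; exists 1|exists m].
move=> [z n] /= [zx mn]; have h1 := ler_cnormD (z - x) x; rewrite subrK in h1.
apply: (le_trans h1); apply: (@le_trans _ _ m%:R); last by rewrite ler_nat.
apply: le_trans (ltW (truncnS_gt _)); rewrite addrC lerD2l; exact: ltW.
Qed.

(** At a pole, neighbourhoods are complements of compact sets; a compact set is bounded, so it is
    avoided as soon as the inverse of [g] is small. *)
Lemma mero_holomorphic g : mero g -> plane_holomorphic_on setT g.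
Proof.
move=> mg z _; case gz : (g z) => [v|]; split.
- rewrite /prop_for /continuous_at gz => U /nbhs_cball[e e0 eU].
  have [d d0 dP] := mero_cont mg (ex_intro _ v gz) e0.
  have [r [u [u' [r0 hu gu]]]] := mero_chart mg gz.
  apply/nbhs_cball; exists (Num.min d r); first by rewrite lt_min d0.
  move=> w; rewrite /cball /= lt_min => /andP[wd wr].
  have [+ _] := dP w wd; rewrite (gu w wr) gz /= => h; exact: eU.
- have [D hd] := mero_hasd mg gz; exact: (pd_derive (hasd_pd hd)).1.
- rewrite /prop_for /continuous_at gz => U [K [cK _] KU].
  have [M MP] := compact_cball cK.
  have si : sinv (g z) = Some 0 by rewrite gz.
  have mi := mero_sinv mg.
  have M1 : 0 < (`|M| + 1)^-1 by rewrite invr_gt0 ltr_wpDl.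
  have [d d0 dP] := mero_cont mi (ex_intro _ 0 si) M1.
  have [r [u [u' [r0 hu gu]]]] := mero_chart mi si.
  apply/nbhs_cball; exists (Num.min d r); first by rewrite lt_min d0.
  move=> w; rewrite /cball /= lt_min => /andP[wd wr]; apply: KU.
  case gw : (g w) => [y|]; last by right.
  left; exists y => //; move=> Ky; have [+ _] := dP w wd.
  have := gu w wr; rewrite /= gz gw /=; case: eqP => [//|/eqP y0] _ /=.
  have q0 : 0 < `|M| + 1 by rewrite ltr_wpDl.
  have y1 : 0 < cnorm y by rewrite cnorm_gt0.
  rewrite subr0 cnormV; apply/negP; rewrite -leNgt lef_pV2 ?posrE//.
  by apply: le_trans (MP y Ky) _; apply: le_trans (ler_norm M) _; rewrite lerDl.
- have si : sinv (g z) = Some 0 by rewrite gz.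
  by have [D hd] := mero_hasd (mero_sinv mg) si; exact: (pd_derive (hasd_pd hd)).1.
Qed.

End Bridge.

(** * The involution and the Lattes structure *)

Section Involution.
Variable R : realType.
Local Notation C := R[i].
Local Notation S := (sphere R).
Implicit Types (z w v y t s : C) (E N : set C).

(** The periods being separated, a sequence of them converging along the ultrafilter equals its
    limit for almost all indices. *)
Lemma period_closed (V : set_system nat) (VV : UltraFilter V) (h : C -> S) (x : nat -> C) l :
  gen h 0 -> (forall n, period h (x n)) -> ucvg V x l -> period h l.
Proof.
move=> g0 Px xl; have [e /andP[e0 _] eP] := period_near g0.
have V1 := xl (e / 2) (divr_gt0 e0 (ltr0n R 2)).
have [n0 n0P] := @filter_ex _ V _ _ V1.
suff -> : l = x n0 by [].
apply: (ucvg_unique VV xl); apply: (eq_ucvg VV _ (ucvg_cst VV (x n0))).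
apply: filterS V1 => n nP; apply/eqP; rewrite -subr_eq0; apply/eqP; apply: eP; first exact: periodB.
apply: le_lt_trans (cnorm_dist l _ _) _; rewrite (cnormB l) [e]splitr; apply: ltrD => //.
Qed.

Variables (f : ratmap R) (sigma : set S) (D : 'I_(rdeg f) -> set S) (psi : C -> C) (c : C) (h : C -> S).
Local Notation F := (reval f).
Local Notation d := (rdeg f).
Hypotheses (d2 : (2 <= d)%N) (hD : sheets sigma D) (sigma0 : null sigma).
Hypothesis good0 : area [set z | ~ good_point f psi z] = 0%E.
Hypotheses (ipsi : cintegrable psi) (c0 : c != 0) (mh : mero h) (gen0 : gen h 0).
Hypothesis ode : forall z, gen h z -> odeat psi c h z.

(* Without involution, [F] would be locally injective; but some point has fewer
   than [d] preimages, so that two of the [d] preimages of nearby points merge. *)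
Lemma flip_nonempty : exists s, flip h s.
Proof.
apply: contrapT => nF.
have same z z' : gen h z -> gen h z' -> h z = h z' -> period h (z' - z).
  move=> g g' e; have [//|Fs] := gen_same c0 mh ode g g' e.
  by exfalso; apply: nF; exists (z + z').
have [y0 [l [ls lP]]] := fiber_deficit d2.
have surj := devel_surj ipsi c0 mh gen0 ode.
have [v0 hv0] := surj y0.
have [b [t fe]] := functional_equation d2 good0 ipsi c0 mh gen0 ode.
set al : C := (-1) ^+ b * (Num.sqrt d%:R)%:C in fe.
have al0 : al != 0.
  apply: mulf_neq0; first by rewrite signr_eq0.
  by rewrite -cnorm_gt0 cnorm_real normr_gt0 gt_eqF// sqrtr_gt0 ltr0n ltnW.
have [rho co] := cocompact ipsi c0 mh gen0 ode.
have /null_area sig0 := sigma0.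
have /choice[v vP] (n : nat) : exists z, cnorm (z - v0) < n.+1%:R^-1 /\ exists y, [/\ gen h z,
    h z = Some y, safe h y & ~ sigma (Some y)].
  have [|z [y [zv gz hz sy ny]]] := safe_near mh gen0 v0 (_ : 0 < n.+1%:R^-1) sig0.
    by rewrite invr_gt0 ltr0n.
  by exists z; split => //; exists y.
have /choice[u uP] (n : nat) : exists u : 'I_d -> C, forall i, [/\ cnorm (u i) <= rho, D i (h (u i)),
    F (h (u i)) = h (v n) & period h (al * u i + t - v n)].
  have [_ [y [gv hv sy ny]]] := vP n.
  suff /choice[u uP] : forall i : 'I_d, exists u, [/\ cnorm u <= rho, D i (h u), F (h u) = h (v n) &
      period h (al * u + t - v n)] by exists u.
  move=> i.
  have [_ _ _ hb] := hD; have [[_ _ sb] _ _] := hb i.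
  have [x Dx Fx] := sb (Some y) ny; have [z hz] := surj x.
  have [p Pp zp] := co z; exists (z - p).
  have hzp : h (z - p) = x by rewrite -hz -(Pp (z - p)) subrK.
  have Fz : F (h (z - p)) = h (v n) by rewrite hzp Fx hv.
  split; rewrite ?hzp//; first by rewrite -hzp.
  by apply: same => //; [apply: sy; rewrite -fe Fz|rewrite -fe Fz].
have [V [VV Voo]] := ex_ultra.
have /choice[ul ulP] i : exists l, ucvg V (u ^~ i) l.
  by apply: (@ucvg_bounded _ _ VV _ rho); apply: filterE => n; have [] := uP n i.
have vv : ucvg V v v0.
  move=> e e0; have [m mP] := invSn_lt e0; apply: Voo; exists m => // n /= mn.
  apply: lt_trans (vP n).1 _; apply: le_lt_trans mP.
  by rewrite lef_pV2 ?posrE ?ltr0n// ler_nat.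
have Pl i : period h (al * ul i + t - v0).
  apply: (@period_closed V VV h (fun n => al * u n i + t - v n)) => //; first by move=> n; have [] := uP n i.
  exact: (ucvgB VV (ucvgD VV (ucvgM VV (ucvg_cst VV al) (ulP i)) (ucvg_cst VV t)) vv).
have inl i : h (ul i) \in l.
  by apply: lP; rewrite fe -hv0 -[RHS](Pl i v0); congr h; ring.
(* The [d] limits [ul i] all lie over [y0], which has fewer than [d] preimages. *)
have [i [j [ij hij]]] : exists i j, i != j /\ h (ul i) = h (ul j).
  apply: contrapT => nij.
  have inj : injective (fun i => h (ul i)).
    move=> i j e; apply/eqP; apply: contrapT => /negP ij; apply: nij; by exists i, j.
  have := @uniq_leq_size _ [seq h (ul i) | i <- enum 'I_d] l.
  rewrite (map_inj_uniq inj) enum_uniq size_map size_enum_ord leqNgt ls.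
  move=> /(_ isT) H; suff: ~~ true by [].
  by apply: H => _ /mapP[i _ ->]; exact: inl.
have [e /andP[e0 _] eP] := period_near gen0.
have an : 0 < cnorm al by rewrite cnorm_gt0.
have et0 : 0 < e / (2 * cnorm al) by rewrite divr_gt0// mulr_gt0.
(* As h(ul i) = h(ul j), the value h(u n j) is also taken at some [w] near [u n i]. Both [w] and
   [u n i] solve al x + t = v n modulo periods, hence coincide, although their values lie in
   different sheets. *)
have [eps eps0 epsP] := mero_open mh (gen_nlc mh gen0) mh hij et0.
have [n [n1 n2]] := @filter_ex _ V _ _ (filterI (ulP j _ eps0) (ulP i _ et0)).
have [w wi hw] := epsP (u n j) n1.
have [_ Dj Fj _] := uP n j; have [_ Di Fi Pi] := uP n i.
have [_ [y [gv hv sy ny]]] := vP n.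
have Fw : h (al * w + t) = h (v n) by rewrite -fe hw Fj.
have Pw : period h (al * w + t - v n) by apply: same => //; apply: sy; rewrite Fw.
have := periodB Pw Pi.
have -> : al * w + t - v n - (al * u n i + t - v n) = al * (w - u n i) by ring.
move=> Pwu; have small : cnorm (al * (w - u n i)) < e.
  rewrite cnormM mulrC -ltr_pdivlMr//; apply: le_lt_trans (cnorm_dist (ul i) _ _) _.
  rewrite (cnormB (ul i)) (_ : e / cnorm al = e / (2 * cnorm al) + e / (2 * cnorm al)).
    exact: ltrD.
  by field; rewrite gt_eqF.
have /eqP := eP _ Pwu small; rewrite mulf_eq0 (negbTE al0) subr_eq0 => /eqP wu.
apply/negP: ij; rewrite negbK; apply/eqP; apply: (sheet_disjoint hD Di).
by rewrite -wu hw.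
Qed.

(** Known at generic points by [gen_same]; regular values are dense, [h] is open and the periods are
    closed under limits, so it extends to all points. *)
Lemma same_value z1 z2 s : flip h s -> h z1 = h z2 ->
  period h (z2 - z1) \/ period h (z1 + z2 - s).
Proof.
move=> Fs e.
have /choice[x xP] (n : nat) : exists x : C * C, [/\ cnorm (x.1 - z1) < n.+1%:R^-1,
    cnorm (x.2 - z2) < n.+1%:R^-1 & period h (x.2 - x.1) \/ period h (x.1 + x.2 - s)].
  have n0 : 0 < (n.+1%:R^-1 : R) by rewrite invr_gt0 ltr0n.
  have [e1 e10 eP] := mero_open mh (gen_nlc mh gen0) mh (esym e) n0.
  have m0 : 0 < Num.min e1 n.+1%:R^-1 by rewrite lt_min e10.
  have [z [y [zb gz hz sy _]]] := safe_near mh gen0 z1 m0 (@area0 R).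
  move: zb; rewrite /cball /= lt_min => /andP[ze zn].
  have [w wz hw] := eP z ze; exists (z, w); split => //=.
  have gw : gen h w by apply: sy; rewrite hw.
  have [Pt|Ft] := gen_same c0 mh ode gz gw (esym hw); first by left.
  by right; exact: flipB.
have [V [VV Voo]] := ex_ultra.
have lim (y : nat -> C) l : (forall n, cnorm (y n - l) < n.+1%:R^-1) -> ucvg V y l.
  move=> yl e1 e10; have [m mP] := invSn_lt e10; apply: Voo; exists m => // n /= mn.
  apply: lt_trans (yl n) _; apply: le_lt_trans mP.
  by rewrite lef_pV2 ?posrE ?ltr0n// ler_nat.
have l1 : ucvg V (fun n => (x n).1) z1 by apply: lim => n; have [] := xP n.
have l2 : ucvg V (fun n => (x n).2) z2 by apply: lim => n; have [] := xP n.
have closed (y : nat -> C) l : V [set n | period h (y n)] -> ucvg V y l -> period h l.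
  move=> Vy yl; pose y' n := if `[< period h (y n) >] then y n else 0.
  apply: (@period_closed V VV h y') => //.
    by move=> n; rewrite /y'; case: asboolP => // _; exact: period0.
  by apply: (eq_ucvg VV _ yl); apply: filterS Vy => n Py /=; rewrite /y' asboolT.
have [V1|V1] := in_ultra_setVsetC [set n | period h ((x n).2 - (x n).1)] VV.
  by left; apply: closed V1 _; exact: ucvgB.
right; apply: (closed (fun n => (x n).1 + (x n).2 - s)).
  by apply: filterS V1 => n nP; have [_ _ []] := xP n.
by apply: ucvgB; [exact: ucvgD|exact: ucvg_cst].
Qed.

Lemma lattes_of_development : flexible_lattes f.
Proof.
have [s Fs] := flip_nonempty.
have [e [t fe]] := functional_equation d2 good0 ipsi c0 mh gen0 ode.
have latP := period_lattice ipsi c0 mh gen0 ode.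
pose ar : R := (-1) ^+ e * Num.sqrt d%:R; pose al : C := ar%:C.
have {}fe z : F (h z) = h (al * z + t).
  by rewrite fe /al /ar rmorphM rmorphXn rmorphN rmorph1.
have alP p : period h p -> period h (al * p).
  have ar0 : al != 0.
    rewrite -cnorm_gt0 cnorm_real normr_gt0 mulf_neq0 ?signr_eq0// gt_eqF// sqrtr_gt0 ltr0n.
    exact: ltnW.
  move=> Pp z; have := fe ((z - t) / al + p); rewrite Pp fe.
  by rewrite mulrDr mulrC divfK// subrK addrAC subrK => ->.
(* al w1 is an integral combination of the basis w1, w2; since al is real, independence over the
   reals makes it the coefficient of w1. *)
have [a aE] : exists a : int, ar = a%:~R.
  have [w1 [w2 [ind LE]]] := latP.
  have Pw1 : period h w1 by rewrite LE; exists 1, 0; rewrite mul1r mul0r addr0.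
  have := alP _ Pw1; rewrite LE => -[m [n mn]]; exists m.
  have [|+ _] := ind (ar - m%:~R) (- n%:~R).
    rewrite rmorphB rmorphN !rmorph_int mulrBl mulNr; have -> : ar%:C * w1 = al * w1 by [].
    by rewrite mn; ring.
  by move/eqP; rewrite subr_eq0 => /eqP.
have alE : al = a%:~R by rewrite /al aE rmorph_int.
have a2 : a ^+ 2 = d%:Z.
  apply/eqP; rewrite -(eqr_int R) rmorphXn /= -aE /ar exprMn sqrr_sign mul1r sqr_sqrtr//.
(* Recentring at the fixed point of a reflection makes the map even. *)
pose tau := s / 2%:R; have tau2 : tau + tau = s.
  by rewrite /tau; field.
pose Th z := h (z + tau).
have Theven z : Th (- z) = Th z.
  by rewrite /Th -(Fs (z + tau)); congr h; rewrite -tau2; ring.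
exists (period h), Th, a, (al * tau + t - tau).
have fTh z : F (Th z) = Th (a%:~R * z + (al * tau + t - tau)).
  by rewrite /Th fe -alE; congr h; ring.
have mTh : mero Th.
  have := mero_affine 1 tau mh; congr mero; apply/funext => z.
  by rewrite mul1r.
split => //.
- split; first exact: mero_holomorphic.
    move=> y _; have [z hz] := devel_surj ipsi c0 mh gen0 ode y.
    by exists (z - tau) => //; rewrite /Th subrK.
  move=> z w; split => [|[Pz|Pz]].
  + move=> /(same_value Fs)[Pt|Pt]; [left|right].
      have := periodB (@period0 _ h) Pt.
      by have -> : 0 - (w + tau - (z + tau)) = z - w by ring.
    by move: Pt; have -> : z + tau + (w + tau) - s = z + w by rewrite -tau2; ring.
  + by rewrite /Th -(Pz (w + tau)); congr h; ring.
  + by rewrite -(Theven w) /Th -(Pz (- w + tau)); congr h; ring.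
- rewrite leNgt; apply/negP => a1.
  have : (`|a| ^+ 2 <= 1) by rewrite expr_le1//; move: a1; lia.
  by rewrite real_normK ?num_real// a2; move: d2; lia.
(* Comparing the functional equation at two opposite points, through evenness, shows that 2b is a
   period. *)
- move=> z; set b := al * tau + t - tau in fTh *.
  have al0 : (a%:~R : C) != 0.
    rewrite intr_eq0; apply/eqP => az; move: a2; rewrite az expr0n /= => dz.
    by move: d2; lia.
  have := fTh (- ((z + b - tau) / a%:~R)); rewrite Theven fTh.
  rewrite mulrN [a%:~R * _]mulrC divfK// -[RHS]Theven /Th.
  have -> : - (- (z + b - tau) + b) + tau = z by ring.
  have -> : z + b - tau + b + tau = z + 2 * b by ring.
  by [].
Qed.

Lemma moebius_conjugate_refl : moebius_conjugate f f.
Proof.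
have cp : coprimep ('X : {poly C}) 1 by rewrite coprimep1.
exists (RatMap cp); split; first by rewrite /rdeg /= size_polyX size_poly1.
have E x : reval (RatMap cp) x = x.
  case: x => [z|]; rewrite /reval /=; first by rewrite !hornerE oner_eq0 divr1.
  by rewrite /rdeg /= size_polyX size_poly1 /= coefX coef1 eqxx.
by apply/funext => x /=; rewrite !E.
Qed.

End Involution.

(** * Moebius inverses and differentiability in charts *)

Section Moebius.
Variable R : realType.
Local Notation C := R[i].
Local Notation S := (sphere R).
Implicit Types (z w v : C) (x : S).

Lemma sphere_proj x : exists a b : C, ((a != 0) || (b != 0)) /\ x = projS a b.
Proof.
case: x => [z|]; first by exists z, 1; rewrite oner_eq0 orbT projS1.
by exists 1, 0; rewrite oner_eq0 projS_None.
Qed.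

(** The inverse has the adjugate matrix; the determinant is the Wronskian of [m], hence nonzero. *)
Lemma moebius_inverse (m : ratmap R) : rdeg m = 1%N -> exists2 m' : ratmap R,
  (forall x, reval m' (reval m x) = x) & forall x, reval m (reval m' x) = x.
Proof.
move=> m1.
set p0 := (rnum m)`_0; set p1 := (rnum m)`_1; set q0 := (rden m)`_0; set q1 := (rden m)`_1.
pose det := p1 * q0 - p0 * q1.
have [sn sd] := rdeg_size m; rewrite m1 in sn sd.
have homE (p : {poly C}) (a b : C) : hom p 1 a b = p`_0 * b + p`_1 * a.
  by rewrite /hom !big_ord_recl big_ord0 /= addr0 !expr0 !expr1 mul1r mulr1.
have pE (p : {poly C}) : (size p <= 2)%N -> p = p`_1 *: 'X + (p`_0)%:P.
  move=> sp; apply/polyP => -[|[|i]]; rewrite coefD coefZ coefX coefC /= ?mulr0 ?mulr1 ?add0r ?addr0//.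
  by rewrite nth_default// (leq_trans sp).
have det0 : det != 0.
  have := wron_neq0 (f := m); rewrite m1 => /(_ isT); apply: contraNneq => d0.
  rewrite /wron {1 2}(pE _ sn) {1 2}(pE _ sd) !derivD !derivZ derivX !derivC !addr0.
  rewrite -/p0 -/p1 -/q0 -/q1 -!mul_polyC.
  have -> : p1%:P * 1 * (q1%:P * 'X + q0%:P) - (p1%:P * 'X + p0%:P) * (q1%:P * 1) = det%:P.
    by rewrite /det polyCB !polyCM; ring.
  by rewrite d0.
pose P := q0 *: 'X - p0%:P : {poly C}; pose Q := - (q1 *: 'X) + p1%:P : {poly C}.
have cp : coprimep P Q.
  apply/Bezout_coprimepP; exists (q1%:P, q0%:P) => /=.
  have -> : q1%:P * P + q0%:P * Q = det%:P.
    by rewrite /P /Q /det -!mul_polyC polyCB !polyCM; ring.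
  by rewrite polyC_eqp1.
have P0 : P`_0 = - p0 by rewrite /P coefB coefZ coefX coefC mulr0 sub0r.
have P1 : P`_1 = q0 by rewrite /P coefB coefZ coefX coefC mulr1 subr0.
have Q0 : Q`_0 = p1 by rewrite /Q coefD coefN coefZ coefX coefC mulr0 oppr0 add0r.
have Q1 : Q`_1 = - q1 by rewrite /Q coefD coefN coefZ coefX coefC mulr1 addr0.
pose m' := RatMap cp.
have m'1 : rdeg m' = 1%N.
  have sP : (size P <= 2)%N.
    apply/leq_sizeP => -[|[|j]] // _; rewrite /P coefB coefZ coefX coefC /=; ring.
  have sQ : (size Q <= 2)%N.
    apply/leq_sizeP => -[|[|j]] // _; rewrite /Q coefD coefN coefZ coefX coefC /=; ring.
  rewrite /rdeg /=; apply/eqP; rewrite eqn_leq -ltnS; apply/andP; split.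
    have : (maxn (size P) (size Q) <= 2)%N by rewrite geq_max sP.
    by case: (maxn _ _).
  suff : (1 < maxn (size P) (size Q))%N by case: (maxn _ _).
  rewrite ltnNge geq_max; apply/negP => /andP[s1 s2]; move/eqP: det0; apply.
  have {}s1 : q0 = 0 by rewrite -P1 nth_default.
  have {}s2 : q1 = 0 by rewrite -[q1]opprK -Q1 nth_default ?oppr0.
  by rewrite /det s1 s2 !mulr0 subrr.
exists m' => x; have [a [b [ab ->]]] := sphere_proj x.
- have n1 := hom_neq0 m ab; rewrite !m1 in n1.
  rewrite reval_projS// m1 reval_projS// m'1 /= !homE P0 P1 Q0 Q1 -/p0 -/p1 -/q0 -/q1.
  set A := (- p0 * _ + _); set B := (p1 * _ + _).
  have AE : A = det * a by rewrite /A /det; ring.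
  have BE : B = det * b by rewrite /B /det; ring.
  apply/projS_eq => //; first by rewrite AE BE !mulf_eq0 !negb_or det0.
  by rewrite AE BE; ring.
- have n1 := hom_neq0 m' ab; rewrite !m'1 in n1.
  rewrite reval_projS// m'1 reval_projS// m1 /= !homE P0 P1 Q0 Q1 -/p0 -/p1 -/q0 -/q1.
  set A := (p0 * _ + _); set B := (q0 * _ + _).
  have AE : A = det * a by rewrite /A /det; ring.
  have BE : B = det * b by rewrite /B /det; ring.
  apply/projS_eq => //; first by rewrite AE BE !mulf_eq0 !negb_or det0.
  by rewrite AE BE; ring.
Qed.

(** Finiteness near [z] and a derivative at [z] alone: a given torus quotient is only known to be
    differentiable pointwise, with no uniform Taylor bound. *)
Definition pdat (k : C -> S) z := exists (D : C) (r : R), [/\ 0 < r,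
  forall w, cball z r w -> findom k w & pd (fun w => fin (k w)) z D].

Lemma pd_cont (u : C -> C) z D : pd u z D -> forall e : R, 0 < e ->
  exists2 d : R, 0 < d & forall w, cnorm (w - z) < d -> cnorm (u w - u z) < e.
Proof.
move=> /pd_lip[d d0 dP] e e0; have D1 : 0 < cnorm D + 1 by rewrite ltr_wpDl ?cnorm_ge0.
exists (Num.min d (e / (cnorm D + 1))); first by rewrite lt_min d0 divr_gt0.
move=> w; rewrite lt_min ltr_pdivlMr// mulrC => /andP[wd we].
exact: le_lt_trans (dP w wd) we.
Qed.

Lemma pdat_comp (k : S -> S) (kap : S -> S) (Th : C -> S) z D (r : R) :
  (forall x, kap (kap x) = x) -> 0 < r ->
  (forall w, cball z r w -> findom (fun w => kap (Th w)) w) ->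
  pd (fun w => fin (kap (Th w))) z D -> mero (fun w => k (kap (Some w))) ->
  findom (fun w => k (Th w)) z -> pdat (fun w => k (Th w)) z.
Proof.
move=> kk r0 rP hpd mk [v kv].
have kz w : cball z r w -> Th w = kap (Some (fin (kap (Th w)))).
  by move=> /rP[y ky]; rewrite ky /= -ky kk.
have zc := cball_center z r0.
have kv' : k (kap (Some (fin (kap (Th z))))) = Some v by rewrite -kz.
have [E [s [u [u' [s0 hu ku _]]]]] := mero_hasd mk kv'.
have [d d0 dP] := pd_cont hpd s0.
exists (u' (fin (kap (Th z))) * D), (Num.min r d); split; first by rewrite lt_min r0.
  move=> w; rewrite /cball /= lt_min => /andP[wr wd].
  by exists (u (fin (kap (Th w)))); rewrite {1}(kz w wr) ku//; exact: dP.
have hu1 : pd u (fin (kap (Th z))) (u' (fin (kap (Th z)))) := hol_pd hu (cball_center _ s0).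
have h1 := pd_comp hpd hu1.
have m0 : 0 < Num.min r d by rewrite lt_min r0.
apply: (pd_eq m0 _ h1) => w; rewrite /cball /= lt_min => /andP[wr wd].
have e : k (Th w) = Some (u (fin (kap (Th w)))) by rewrite {1}(kz w wr) ku//; exact: dP.
by rewrite e.
Qed.

(** The given derivative is in the chart at [Th z]. Continuity keeps [Th] in that chart nearby, and
    [k] read in it is meromorphic. *)
Lemma plane_holomorphic_pdat (Th : C -> S) (k : S -> S) z : plane_holomorphic_on setT Th ->
  mero (fun w => k (Some w)) -> mero (fun w => k (sinv (Some w))) ->
  findom (fun w => k (Th w)) z -> pdat (fun w => k (Th w)) z.
Proof.
move=> /(_ z I)[cont der] m1 m2 kf.
case Tz : (Th z) cont der => [v|]; rewrite /prop_for /continuous_at Tz => cont der.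
  have nb : nbhs (Some v : S) (fun x : S => x <> None).
    by apply/nbhs_cball; exists 1.
  have /nbhs_cball[r r0 rP] := cont _ nb.
  apply: (@pdat_comp k id Th z _ r) => //; last exact: derivable_pd der.
  by move=> w /rP; rewrite /=; case Tw : (Th w) => [y|] // _; exists y.
have nb : nbhs (None : S) (fun x : S => x <> Some 0).
  exists [set 0]; first split; first exact: compact_set1.
    rewrite -[X in closed X]setCK; apply: open_closedC; rewrite openE => x /eqP x0.
    apply/nbhs_cball; exists (cnorm x); first by rewrite cnorm_gt0.
    by move=> w wx /= w0; move: wx; rewrite w0 /cball /= sub0r cnormN ltxx.
  by move=> x [[y y0 <-] [] /y0|->].
have /nbhs_cball[r r0 rP] := cont _ nb.
apply: (@pdat_comp k (@sinv R) Th z _ r) => //; [exact: sinvK| |exact: derivable_pd der].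
move=> w /rP; rewrite /findom /=; case Tw : (Th w) => [y|] /=; last by exists 0.
by case: eqP => [->|_] // _; exists y^-1.
Qed.

End Moebius.

(** * The fixed point of a Lattes map *)

Section Parallelogram.
Variable R : realType.
Local Notation C := R[i].
Implicit Types (z w v : C) (E : set C).

Definition cross z w : R := Re z * Im w - Im z * Re w.

Lemma crossDl z z' w : cross (z + z') w = cross z w + cross z' w.
Proof. by case: z z' => [x y] [x' y']; rewrite /cross /=; ring. Qed.

Lemma crossDr z w w' : cross z (w + w') = cross z w + cross z w'.
Proof. by case: w w' => [x y] [x' y']; rewrite /cross /=; ring. Qed.

Lemma crossZl (t : R) z w : cross (t%:C * z) w = t * cross z w.
Proof. by case: z => x y; rewrite /cross /=; ring. Qed.

Lemma crossZr (t : R) z w : cross z (t%:C * w) = t * cross z w.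
Proof. by case: w => x y; rewrite /cross /=; ring. Qed.

Lemma cross_le z w : `|cross z w| <= 2 * cnorm z * cnorm w.
Proof.
apply: le_trans (ler_normB _ _) _; rewrite !normrM -mulrA [2 * _]mulr_natl mulr2n.
by apply: lerD; apply: ler_pM; rewrite ?normr_ge0// ?ler_cnorm_Re ?ler_cnorm_Im.
Qed.

Variables (w1 w2 : C).
Hypothesis ind : forall s t : R, s%:C * w1 + t%:C * w2 = 0 -> s = 0 /\ t = 0.

Let D := cross w1 w2.

Let D0 : D != 0.
Proof.
apply/eqP => d0; have d1 : Re w1 * Im w2 = Im w1 * Re w2 by apply/eqP; rewrite -subr_eq0; apply/eqP.
have [|r2 /eqP] := ind (s := Re w2) (t := - Re w1).
  by move: d1; case: (w1) (w2) => [x y] [x' y'] /= d1; apply/eqP; rewrite eq_complex /=; apply/andP; split; apply/eqP; lra.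
rewrite oppr_eq0 => /eqP r1.
have [|i2 /eqP] := ind (s := Im w2) (t := - Im w1).
  by move: d1; case: (w1) (w2) => [x y] [x' y'] /= d1; apply/eqP; rewrite eq_complex /=; apply/andP; split; apply/eqP; lra.
rewrite oppr_eq0 => /eqP i1.
have [|/eqP] := ind (s := 1) (t := 0); last by rewrite oner_eq0.
by move: r1 i1; case: (w1) => x y /= -> ->; rewrite mul0r addr0 mulr0.
Qed.

(** [abscissa] and [ordinate] are the coordinates in the real basis w1, w2, by Cramer's rule. *)
Definition abscissa z := cross z w2 / D.
Definition ordinate z := cross w1 z / D.
Local Notation X := abscissa.
Local Notation Y := ordinate.

Lemma coordE z : z = (X z)%:C * w1 + (Y z)%:C * w2.
Proof.
have eC : (D%:C : C) != 0 by rewrite -cnorm_gt0 cnorm_real normr_gt0.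
apply: (mulfI eC); rewrite /X /Y mulrDr !mulrA -!rmorphM /= ![D * (_ / _)]mulrCA divff// !mulr1.
by rewrite /D; case: z (w1) (w2) => [x y] [x1 y1] [x2 y2]; rewrite /cross; apply/eqP; rewrite eq_complex /=;
  apply/andP; split; apply/eqP; ring.
Qed.

Lemma XD z w : X (z + w) = X z + X w. Proof. by rewrite /X crossDl mulrDl. Qed.
Lemma YD z w : Y (z + w) = Y z + Y w. Proof. by rewrite /Y crossDr mulrDl. Qed.

Lemma XY_comb (s t : R) : X (s%:C * w1 + t%:C * w2) = s /\ Y (s%:C * w1 + t%:C * w2) = t.
Proof.
have c11 z : cross z z = 0 by rewrite /cross; ring.
by rewrite /X /Y crossDl crossDr !crossZl !crossZr !c11 !mulr0 addr0 add0r -!mulrA divff// !mulr1.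
Qed.

Lemma XZ (s : R) z : X (s%:C * z) = s * X z. Proof. by rewrite /X crossZl mulrA. Qed.
Lemma YZ (s : R) z : Y (s%:C * z) = s * Y z. Proof. by rewrite /Y crossZr mulrA. Qed.
Lemma XN z : X (- z) = - X z.
Proof. by have := XZ (-1) z; rewrite rmorphN rmorph1 !mulN1r. Qed.
Lemma YN z : Y (- z) = - Y z.
Proof. by have := YZ (-1) z; rewrite rmorphN rmorph1 !mulN1r. Qed.

Definition Lat := [set z | exists m n : int, z = m%:~R * w1 + n%:~R * w2].

Lemma LatE z : Lat z <-> exists m n : int, X z = m%:~R /\ Y z = n%:~R.
Proof.
split=> [[m [n ->]]|[m [n [Xz Yz]]]]; exists m, n.
  have -> : m%:~R * w1 + n%:~R * w2 = (m%:~R : R)%:C * w1 + (n%:~R : R)%:C * w2.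
    by rewrite !rmorph_int.
  exact: XY_comb.
by rewrite [LHS]coordE Xz Yz !rmorph_int.
Qed.

Lemma LatD z w : Lat z -> Lat w -> Lat (z + w).
Proof.
move=> [m [n ->]] [m' [n' ->]]; exists (m + m'), (n + n'); rewrite !intrD; ring.
Qed.

Lemma LatN z : Lat z -> Lat (- z).
Proof. by move=> [m [n ->]]; exists (- m), (- n); rewrite !intrN; ring. Qed.

(** The interior of half a period parallelogram: a fundamental domain for the lattice translations
    together with z -> -z, up to the null set [grid_lines]. *)
Definition open_half := [set z | 0 < X z < 1 / 2 /\ 0 < Y z < 1].
Definition grid_lines := [set z | exists k : int, X z = k%:~R / 2 \/ Y z = k%:~R].
Local Notation O1 := open_half.

Let K : R := 2 * (cnorm w1 + cnorm w2) / `|D|.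

Let K0 : 0 <= K. Proof. by rewrite divr_ge0// mulr_ge0// addr_ge0// cnorm_ge0. Qed.

Lemma X_le z : `|X z| <= K * cnorm z.
Proof.
rewrite /X normrM normfV /K mulrAC ler_pM2r ?invr_gt0 ?normr_gt0//; apply: le_trans (cross_le _ _) _.
have := cnorm_ge0 w1; have := cnorm_ge0 z; move: (cnorm w1) (cnorm w2) (cnorm z) => p q r r0 p0; nra.
Qed.

Lemma Y_le z : `|Y z| <= K * cnorm z.
Proof.
rewrite /Y normrM normfV /K mulrAC ler_pM2r ?invr_gt0 ?normr_gt0//; apply: le_trans (cross_le _ _) _.
have := cnorm_ge0 w2; have := cnorm_ge0 z; move: (cnorm w1) (cnorm w2) (cnorm z) => p q r r0 p0; nra.
Qed.

Lemma open_half_copen : copen O1.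
Proof.
move=> z [/andP[x0 x1] /andP[y0 y1]].
pose e : R := Num.min (Num.min (X z) (1 / 2 - X z)) (Num.min (Y z) (1 - Y z)).
have e0 : 0 < e by rewrite !lt_min x0 y0 !subr_gt0 x1.
have e1 : e <= X z by rewrite !ge_min lexx.
have e2 : e <= 1 / 2 - X z by rewrite !ge_min lexx orbT.
have e3 : e <= Y z by rewrite !ge_min lexx !orbT.
have e4 : e <= 1 - Y z by rewrite !ge_min lexx !orbT.
have K1 : 0 < K + 1 by rewrite ltr_wpDl.
exists (e / (K + 1)); first by rewrite divr_gt0.
move=> w; rewrite /cball /= ltr_pdivlMr// => wz.
have ww : K * cnorm (w - z) < e.
  by apply: le_lt_trans wz; rewrite mulrC ler_wpM2l ?cnorm_ge0// lerDl.
have := le_lt_trans (X_le (w - z)) ww; have := le_lt_trans (Y_le (w - z)) ww.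
rewrite XD YD XN YN !ltr_norml => /andP[h1 h2] /andP[h3 h4].
change (0 < X w < 1 / 2 /\ 0 < Y w < 1); move: (X z) (X w) (Y z) (Y w) e1 e2 e3 e4 h1 h2 h3 h4 {x0 x1 y0 y1 ww wz} => xz xw yz yw e1 e2 e3 e4 h1 h2 h3 h4.
by split; apply/andP; split; lra.
Qed.

Lemma open_half_bounded z : O1 z -> cnorm z <= cnorm w1 + cnorm w2.
Proof.
move=> [/andP[x0 x1] /andP[y0 y1]]; rewrite {1}[z]coordE; apply: le_trans (ler_cnormD _ _) _.
rewrite !cnormM !cnorm_real !gtr0_norm//; apply: lerD; rewrite ler_piMl ?cnorm_ge0//.
  by move: x1; move: (X z) => x x1; lra.
exact: ltW.
Qed.

Let int_small (m : int) : `|m%:~R : R| < 1 -> m = 0.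
Proof.
by rewrite -intr_norm ltrz1 => h; apply/eqP; rewrite -normr_eq0; move: h; have := normr_ge0 m; lia.
Qed.

Lemma open_half_inj z w : O1 z -> O1 w -> Lat (z - w) \/ Lat (z + w) -> z = w.
Proof.
move=> [/andP[x0 x1] /andP[y0 y1]] [/andP[x0' x1'] /andP[y0' y1']] [] /LatE[m [n]].
  rewrite !XD !YD !XN !YN => -[xm yn].
  have m0 : m = 0 by apply: int_small; rewrite -xm ltr_norml; apply/andP; split; lra.
  have n0 : n = 0 by apply: int_small; rewrite -yn ltr_norml; apply/andP; split; lra.
  apply/eqP; rewrite -subr_eq0 [z - w]coordE XD YD XN YN xm yn m0 n0.
  by rewrite !mul0r addr0.
rewrite XD => -[xm _]; exfalso.
have m0 : m = 0 by apply: int_small; rewrite -xm ltr_norml; apply/andP; split; lra.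
by move: xm; rewrite m0 => xm; lra.
Qed.

(** After reduction modulo the lattice, the half with abscissa above 1/2 is sent to the other one by
    z' -> w1 + w2 - z'. *)
Lemma reduce_open_half z : ~ grid_lines z -> exists w, O1 w /\ (Lat (z - w) \/ Lat (z + w)).
Proof.
move=> nz; pose m := Num.floor (X z); pose n := Num.floor (Y z).
pose z' := z - (m%:~R * w1 + n%:~R * w2).
have L0 : Lat (m%:~R * w1 + n%:~R * w2) by exists m, n.
have [Xl Yl] : X (m%:~R * w1 + n%:~R * w2) = m%:~R /\ Y (m%:~R * w1 + n%:~R * w2) = n%:~R.
  have := XY_comb m%:~R n%:~R; by rewrite !rmorph_int.
have Xz' : X z' = X z - m%:~R by rewrite XD XN Xl.
have Yz' : Y z' = Y z - n%:~R by rewrite YD YN Yl.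
have x0 : 0 < X z' < 1.
  have h1 := floor_le (X z); have h2 := floorD1_gt (X z); rewrite -/m intrD1 in h1 h2.
  have : X z != m%:~R by apply/eqP => e; apply: nz; exists (2 * m); left; rewrite e intrM; field.
  move=> ne; have h3 : m%:~R < X z by rewrite lt_def ne.
  by rewrite Xz'; move: (X z) h2 h3 => x h2 h3; apply/andP; split; lra.
have y0 : 0 < Y z' < 1.
  have h1 := floor_le (Y z); have h2 := floorD1_gt (Y z); rewrite -/n intrD1 in h1 h2.
  have : Y z != n%:~R by apply/eqP => e; apply: nz; exists n; right.
  move=> ne; have h3 : n%:~R < Y z by rewrite lt_def ne.
  by rewrite Yz'; move: (Y z) h2 h3 => x h2 h3; apply/andP; split; lra.
have /andP[x1 x2] := x0; have /andP[y1 y2] := y0.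
have [xh|xh|xh] := ltgtP (X z') (1 / 2).
- exists z'; split; first by split; rewrite ?x1 ?y1.
  by left; have -> : z - z' = m%:~R * w1 + n%:~R * w2 by rewrite /z'; ring.
- exists (w1 + w2 - z'); split.
    have [X1 Y1] : X (w1 + w2) = 1 /\ Y (w1 + w2) = 1 by have := XY_comb 1 1; rewrite !rmorph1 !mul1r.
    split; rewrite ?XD ?YD -?XD -?YD.
      by rewrite XD X1 XN; move: (X z') xh x2 => x xh x2; apply/andP; split; lra.
    by rewrite YD Y1 YN; move: (Y z') y1 y2 => y y3 y4; apply/andP; split; lra.
  right; exists (m + 1), (n + 1); rewrite /z' !intrD; ring.
- exfalso; apply: nz; exists (2 * m + 1); left; move: xh; rewrite Xz' => xh.
  by rewrite intrD intrM; move: (X z) xh => x xh; lra.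
Qed.

Lemma area_vertical (k : R) : area [set z : C | Re z = k] = 0%E.
Proof.
apply: (@area_sub0 _ _ (\bigcup_n [set z : C | k <= Re z <= k /\ - n%:R <= Im z <= n%:R])).
  move=> z /= zk; exists (Num.truncn `|Im z|).+1 => //=; rewrite zk lexx; split => //.
  rewrite -ler_norml; exact: ltW (truncnS_gt _).
apply: area_bigcup0 => n; have h : - n%:R <= n%:R :> R by rewrite ge0_cp// ler0n.
by have [_ ->] := area_rect (lexx k) h; rewrite subrr mul0r.
Qed.

Lemma area_horizontal (k : R) : area [set z : C | Im z = k] = 0%E.
Proof.
apply: (@area_sub0 _ _ (\bigcup_n [set z : C | - n%:R <= Re z <= n%:R /\ k <= Im z <= k])).
  move=> z /= zk; exists (Num.truncn `|Re z|).+1 => //=; rewrite zk lexx; split => //.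
  rewrite -ler_norml; exact: ltW (truncnS_gt _).
apply: area_bigcup0 => n; have h : - n%:R <= n%:R :> R by rewrite ge0_cp// ler0n.
by have [_ ->] := area_rect h (lexx k); rewrite subrr mulr0.
Qed.

Lemma area_grid_lines : area grid_lines = 0%E.
Proof.
pose u z : C := (X z) +i* (Y z).
have ulow z w : cnorm (w - z) <= (cnorm w1 + cnorm w2) * cnorm (u w - u z).
  rewrite {1}[w - z]coordE; apply: le_trans (ler_cnormD _ _) _; rewrite !cnormM !cnorm_real.
  have r1 := ler_cnorm_Re (u w - u z); have r2 := ler_cnorm_Im (u w - u z).
  have -> : X (w - z) = Re (u w - u z) by rewrite XD XN.
  have -> : Y (w - z) = Im (u w - u z) by rewrite YD YN.
  rewrite mulrDl; apply: lerD; rewrite mulrC ler_wpM2l ?cnorm_ge0//.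
have M1 : 0 < cnorm w1 + cnorm w2 + 1 by rewrite ltr_wpDl// addr_ge0// cnorm_ge0.
have pre E : area E = 0%E -> area [set z | E (u z)] = 0%E.
  move=> E0; apply: (@area_preimage0 _ _ u).
    by apply: area_sub0 E0 => _ [z Ez <-].
  move=> z _; exists (cnorm w1 + cnorm w2 + 1)^-1, 1; split; rewrite ?invr_gt0// => w _ _.
  rewrite mulrC ler_pdivrMr// mulrC; apply: le_trans (ulow z w) _.
  by rewrite ler_wpM2r ?cnorm_ge0// lerDl.
apply: (@area_sub0 _ _ (\bigcup_n if @unpickle int n is Some k then
    [set z | [set v : C | Re v = k%:~R / 2] (u z)] `|` [set z | [set v : C | Im v = k%:~R] (u z)] else set0)).
  move=> z [k kz]; exists (pickle k); [exact: I|rewrite pickleK].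
  by case: kz => kz; [left|right].
apply: area_bigcup0 => n; case: unpickle => [k|]; last exact: area0.
by apply: areaU0; apply: pre; [exact: area_vertical|exact: area_horizontal].
Qed.

End Parallelogram.

Lemma sq_invE (K : fieldType) (x y : K) : x ^+ 2 = y ^+ 2 -> (x ^+ 2)^-1 = (y ^+ 2)^-1.
Proof. by move=> ->. Qed.

Lemma density_term (K : fieldType) (E t s s' e : K) : E != 0 -> e != 0 -> s' != 0 ->
  E * t = s * e -> s ^+ 2 = s' ^+ 2 -> (t ^+ 2)^-1 / E ^+ 2 = (s' ^+ 2)^-1 / e ^+ 2.
Proof.
move=> E0 e0 s0 Et ss; rewrite -!invfM; congr (_^-1).
by rewrite -ss -!exprMn [t * E]mulrC Et.
Qed.

(** * The invariant density of a torus quotient *)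

Section TorusMap.
Variable R : realType.
Local Notation C := R[i].
Local Notation S := (sphere R).
Local Notation mu := (@planar_measure R).
Local Notation tp := (@to_plane R).
Implicit Types (z w v y : C) (E X N : set C).
Variables (H : C -> S) (w1 w2 : C).
Hypothesis ind : forall s t : R, s%:C * w1 + t%:C * w2 = 0 -> s = 0 /\ t = 0.
Hypothesis Hsame : forall z w, H z = H w <-> Lat w1 w2 (z - w) \/ Lat w1 w2 (z + w).
Hypothesis Hpd : forall z, findom H z -> pdat H z.
Hypothesis Hpi : forall z, findom (fun z => sinv (H z)) z -> pdat (fun z => sinv (H z)) z.
Local Notation O1 := (open_half w1 w2).
Local Notation T := (dfin H).

Lemma torus_pd z : findom H z -> pd (fun w => fin (H w)) z (T z).
Proof. by move=> /Hpd[D [r [_ _ hp]]]; rewrite /dfin (pd_derive hp).2. Qed.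

Lemma torus_cont z (e : R) : findom H z -> 0 < e -> exists2 d : R, 0 < d &
  forall w, cnorm (w - z) < d -> findom H w /\ cnorm (fin (H w) - fin (H z)) < e.
Proof.
move=> /Hpd[D [r [r0 rP hp]]] e0; have [d d0 dP] := pd_cont hp e0.
exists (Num.min d r); first by rewrite lt_min d0.
by move=> w; rewrite lt_min => /andP[wd wr]; split; [exact: rP|exact: dP].
Qed.

Lemma torus_pole z (M : R) : H z = None -> exists2 d : R, 0 < d &
  forall w v, cnorm (w - z) < d -> H w = Some v -> M < cnorm v.
Proof.
move=> Hz; have fz : findom (fun z => sinv (H z)) z by exists 0; rewrite Hz.
have [D [r [r0 rP hp]]] := Hpi fz.
have M0 : 0 < (`|M| + 1)^-1 by rewrite invr_gt0 ltr_wpDl.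
have [d d0 dP] := pd_cont hp M0.
exists (Num.min d r); first by rewrite lt_min d0.
move=> w v; rewrite lt_min => /andP[wd wr] Hw.
have [y] := rP w wr; have := dP w wd; rewrite Hz Hw /=; case: eqP => // /eqP v0.
rewrite /= subr0 cnormV ltf_pV2 ?posrE ?cnorm_gt0// ?ltr_wpDl// => h _.
by apply: le_lt_trans (ler_norm M) _; apply: lt_trans h; rewrite ltrDl.
Qed.

Lemma findom_torus_copen : copen (findom H).
Proof. by move=> z /torus_cont /(_ ltr01)[d d0 dP]; exists d => // w /dP[]. Qed.

Lemma cmfunc_torus : cmfunc setT (fun z => fin (H z)).
Proof.
have mF := copen_cmeas findom_torus_copen.
have [m1 m2] : cmfunc (findom H) (fun z => fin (H z)).
  apply: cont_cmfunc findom_torus_copen _ => z fz e e0.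
  by have [d d0 dP] := torus_cont fz e0; exists d => // w /dP[].
have E (p : C -> R) : p 0 = 0 -> (fun z => p (fin (H z))) =
    (fun z => if `[< findom H z >] then p (fin (H z)) else 0).
  move=> p0; apply/funext => z; case: asboolP => // nf; case Hz : (H z) => [v|] //.
  by exfalso; apply: nf; exists v.
by split; rewrite (E _ erefl); exact: cmfun_setT_if.
Qed.

(** The derivative is known only pointwise; it is measurable as a limit of difference quotients. *)
Lemma cmfunc_torus_derive : cmfunc (findom H) T.
Proof.
pose Dn (n : nat) z : C := (n.+1%:R : R)%:C * (fin (H (z + (n.+1%:R^-1 : R)%:C)) - fin (H z)).
have mD n : cmfunc setT (Dn n).
  apply: cmfuncM; first by split; exact: cmfun_cst.
  apply: cmfuncB cmfunc_torus.
  exact: (cmfunc_shift (n.+1%:R^-1 : R)%:C cmfunc_torus).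
have lim z (e : R) : findom H z -> 0 < e -> exists n0, forall n, (n0 <= n)%N -> cnorm (Dn n z - T z) < e.
  move=> fz e0; have e2 : 0 < e / 2 by rewrite divr_gt0.
  have [d d0 dP] := torus_pd fz e2.
  have [n0 n0P] := invSn_lt d0; exists n0 => n nn.
  have q0 : 0 < (n.+1%:R : R) by rewrite ltr0n.
  have h0 : cnorm ((n.+1%:R^-1 : R)%:C) = n.+1%:R^-1 by rewrite cnorm_real gtr0_norm// invr_gt0.
  have := dP (z + (n.+1%:R^-1 : R)%:C); rewrite addrC addKr h0 => h.
  have qd : (n.+1%:R^-1 : R) < d.
    by apply: le_lt_trans n0P; rewrite lef_pV2 ?posrE ?ltr0n// ler_nat.
  have {}h := h qd.
  have -> : Dn n z - T z = (n.+1%:R : R)%:C * (fin (H (z + (n.+1%:R^-1 : R)%:C)) - fin (H z) - T z * (n.+1%:R^-1 : R)%:C).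
    rewrite /Dn [in RHS]mulrBr; congr (_ - _).
    by rewrite mulrCA -rmorphM divff ?gt_eqF// rmorph1 mulr1.
  rewrite cnormM cnorm_real gtr0_norm// mulrC -ltr_pdivlMr//; apply: (le_lt_trans h).
  by rewrite ltr_pM2r ?invr_gt0//; clear - e0 ind Hsame Hpd Hpi; lra.
have mF := copen_cmeas findom_torus_copen.
have gen (p : C -> R) : (forall u v, p (u - v) = p u - p v) -> (forall u, `|p u| <= cnorm u) ->
    (forall n, cmfun setT (fun z => p (Dn n z))) -> cmfun (findom H) (fun z => p (T z)).
  move=> pB pn mp; apply: (@measurable_fun_cvg _ _ _ _ (fun n u => p (Dn n (tp u)))).
    by move=> n; exact: cmfun_sub (mp n).
  move=> u fu; apply/cvgrPdist_lt => e e0; have [n0 n0P] := lim _ _ fu e0.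
  exists n0 => // n /= nn; rewrite distrC -pB; exact: le_lt_trans (pn _) (n0P n nn).
split.
- by apply: (gen (@complex.Re R)) => [u v|u|n]; [rewrite raddfB|exact: ler_cnorm_Re|have [] := mD n].
- by apply: (gen (@complex.Im R)) => [u v|u|n]; [rewrite raddfB|exact: ler_cnorm_Im|have [] := mD n].
Qed.

(** Preimages of values tending to [y] have a limit in the bounded closed set [E]. The map is finite
    there, because near a pole its values would exceed every bound. *)
Lemma image_closed E (M : R) : copen (~` E) -> (forall z, E z -> cnorm z <= M) ->
  copen (~` [set y | exists2 z, E z & H z = Some y]).
Proof.
move=> cE bE y ny; apply: contrapT => nball.
have /choice[x xP] (n : nat) : exists x : C * C, [/\ E x.1, H x.1 = Some x.2 & cnorm (x.2 - y) < n.+1%:R^-1].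
  apply: contrapT => nx; apply: nball; exists n.+1%:R^-1; first by rewrite invr_gt0 ltr0n.
  by move=> v vy [z Ez Hz]; apply: nx; exists (z, v).
have [V [VV Voo]] := ex_ultra.
have [|l lP] := @ucvg_bounded _ _ VV (fun n => (x n).1) M.
  by apply: filterE => n; have [Ex _ _] := xP n; exact: bE.
have El : E l.
  apply: contrapT => nl; have [d d0 dP] := cE l nl.
  have [n nd] := @filter_ex _ V _ _ (lP d d0).
  by have [Ex _ _] := xP n; exact: dP nd Ex.
case Hl : (H l) => [v|].
  apply: ny; exists l => //; rewrite Hl; congr Some; apply: cnorm_small_eq => e e0.
  have e2 : 0 < e / 2 by rewrite divr_gt0.
  have [d d0 dP] := torus_cont (ex_intro _ v Hl) e2.
  have [m mP] := invSn_lt e2.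
  have Vm : V [set n | (m <= n)%N] by apply: Voo; exists m.
  have [n [nd mn]] := @filter_ex _ V _ _ (filterI (lP d d0) Vm).
  have [_ Hx xy] := xP n; have [_] := dP _ nd; rewrite Hx Hl /= => h.
  have q : (n.+1%:R^-1 : R) <= m.+1%:R^-1 by rewrite lef_pV2 ?posrE ?ltr0n// ler_nat.
  have h2 := cnorm_dist (x n).2 v y; rewrite (cnormB v (x n).2) in h2.
  have h3 := lt_le_trans xy (le_trans q (ltW mP)).
  by move: (cnorm (v - y)) (cnorm ((x n).2 - v)) (cnorm ((x n).2 - y)) h h2 h3 => p q' r' h h2 h3; clear - h h2 h3 ind Hsame Hpd Hpi; lra.
have [d d0 dP] := torus_pole (cnorm y + 1) Hl.
have [n nd] := @filter_ex _ V _ _ (lP d d0).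
have [_ Hx xy] := xP n; have h := dP _ _ nd Hx.
have h2 := ler_cnormD ((x n).2 - y) y; rewrite subrK in h2.
have h3 : cnorm ((x n).2 - y) < 1.
  by apply: lt_le_trans xy _; rewrite invf_le1 ?ltr0n// ler1n.
by move: (cnorm y) (cnorm ((x n).2 - y)) (cnorm (x n).2) h h2 h3 => p q r h h2 h3; clear - h h2 h3 ind Hsame Hpd Hpi; lra.
Qed.

(** The open half parallelogram is exhausted by the bounded closed sets [G n], whose images are
    closed. *)
Lemma image_cmeas E : copen (~` E) -> cmeas [set y | exists2 z, O1 z /\ E z & H z = Some y].
Proof.
move=> cE; have oO := open_half_copen ind.
pose G (n : nat) := [set z | forall w, cnorm (w - z) < n.+1%:R^-1 -> O1 w].
have q0 (n : nat) : 0 < (n.+1%:R^-1 : R) by rewrite invr_gt0 ltr0n.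
have GO n : G n `<=` O1 by move=> z; apply; rewrite subrr cnorm0.
have cG n : copen (~` G n).
  move=> z /existsNP[w /not_implyP[wz nw]].
  exists (n.+1%:R^-1 - cnorm (w - z)); first by rewrite subr_gt0.
  move=> z' zz Gz'; apply: nw; apply: Gz'; apply: le_lt_trans (cnorm_dist z _ _) _.
  by rewrite (cnormB z z') -ltrBrDl.
rewrite (_ : [set y | _] = \bigcup_n [set y | exists2 z, (G n `&` E) z & H z = Some y]).
  apply: cmeas_bigcup => n; rewrite -[X in cmeas X]setCK; apply: cmeasC; apply: copen_cmeas.
  apply: (@image_closed _ (cnorm w1 + cnorm w2)).
    rewrite setCI => z [nG|nE].
      by have [d d0 dP] := cG n z nG; exists d => // w /dP; left.
    by have [d d0 dP] := cE z nE; exists d => // w /dP; right.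
  by move=> z [/GO Oz _]; exact: open_half_bounded.
apply/seteqP; split => y.
  move=> [z [Oz Ez] Hz]; have [r r0 rP] := oO z Oz; have [n nr] := invSn_lt r0.
  exists n => //; exists z => //; split => // w wz; apply: rP; exact: lt_trans wz nr.
by move=> [n _ [z [/GO Oz Ez] Hz]]; exists z.
Qed.

Definition torus_image := [set y | exists2 z, O1 z & H z = Some y].

Lemma cmfunc_inv X (u : C -> C) : cmeas X -> cmfunc X u -> cmfunc X (fun z => (u z)^-1).
Proof.
move=> mX mu.
have oU : copen [set z : C | z != 0].
  move=> z z0; exists (cnorm z); first by rewrite cnorm_gt0.
  by move=> w; rewrite /cball /=; apply: contraTneq => ->; rewrite sub0r cnormN ltxx.
have [m1 m2] : cmfunc [set z : C | z != 0] (fun z => z^-1).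
  apply: cont_cmfunc oU _ => z z0 e e0.
  have z2 : 0 < cnorm z / 2 by rewrite divr_gt0// cnorm_gt0.
  have low w : cball z (cnorm z / 2) w -> cnorm z / 2 <= cnorm (id w).
    move=> wz; have h := ler_cnormB z (z - w); rewrite opprB addrCA subrr addr0 in h.
    have h2 : cnorm (w - z) < cnorm z / 2 by exact: wz.
    rewrite (cnormB z w) in h.
    by move: (cnorm z) (cnorm w) (cnorm (w - z)) h h2 => p q r h h2; clear - h h2 ind Hsame Hpd Hpi; lra.
  have hz := holV z2 low (hol_id z (cnorm z / 2)).
  exact: (pd_cont (hol_pd hz (cball_center _ z2)) e0).
have E (p : C -> R) : p 0 = 0 -> cmfun [set z : C | z != 0] (fun z => p z^-1) ->
    cmfun setT (fun z : C => p z^-1).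
  move=> p0 mp; have := cmfun_setT_if (copen_cmeas oU) mp; congr cmfun; apply/funext => z.
  by case: asboolP => //= /negP; rewrite negbK => /eqP ->; rewrite invr0.
by split; [apply: (cmfun_comp mX mu (E _ erefl m1))|apply: (cmfun_comp mX mu (E _ erefl m2))].
Qed.

(** [H] is injective on the half parallelogram, and its inverse [s] defines T^(-2) on the image,
    extended by 0. Preimages of closed sets under [s] are images under [H], whence measurability. *)
Lemma torus_density : exists q : C -> C, cintegrable q /\
  forall z y, O1 z -> H z = Some y -> q y = (T z ^+ 2)^-1.
Proof.
pose A := torus_image.
have /choice[s sP] y : exists z, A y -> O1 z /\ H z = Some y.
  by have [[z Oz Hz]|nA] := pselect (A y); [exists z|exists 0].
have sE z y : O1 z -> H z = Some y -> s y = z.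
  move=> Oz Hz; have Ay : A y by exists z.
  have [Os Hs] := sP y Ay; apply: (open_half_inj ind Os Oz).
  by apply/Hsame; rewrite Hs.
have mA : cmeas A.
  have := @image_cmeas setT (ltac:(by rewrite setCT => z)); congr cmeas.
  by apply/seteqP; split => y [z h Hz]; exists z => //; case: h.
have ms (p : C -> R) : (forall t : R, copen (~` [set z | t <= p z])) -> cmfun A (fun y => p (s y)).
  move=> cp mD; apply: (measurability _ (RGenCInfty.measurableE R)) => //.
  move=> /= _ [_ [t ->] <-].
  have := image_cmeas (cp t); congr measurable; apply/seteqP; split => u.
    move=> [z [Oz tz] Hz]; split; first by exists z.
    by rewrite /= in_itv/= andbT (sE z _ Oz Hz).
  rewrite /= in_itv/= andbT => -[Au tu]; have [Os Hs] := sP _ Au.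
  by exists (s (tp u)).
have mS : cmfunc A s.
  have op (p : C -> R) : (forall u v, p (u - v) = p u - p v) -> (forall u, `|p u| <= cnorm u) ->
      forall t : R, copen (~` [set z | t <= p z]).
    move=> pB pn t z /= /negP; rewrite -ltNge => zt; exists (t - p z); first by rewrite subr_gt0.
    move=> w wz; apply/negP; rewrite -ltNge; have := le_lt_trans (pn (w - z)) wz.
    by rewrite pB => /(le_lt_trans (ler_norm _)); rewrite ltrBlDr subrK.
  split; apply: ms; apply: op; try exact: raddfB; [exact: ler_cnorm_Re|exact: ler_cnorm_Im].
pose T' z := if `[< findom H z >] then T z else 0.
have mT' : cmfunc setT T'.
  have [m1 m2] := cmfunc_torus_derive; have mF := copen_cmeas findom_torus_copen.
  split.
    have := cmfun_setT_if mF m1; congr cmfun; apply/funext => z; rewrite /T'.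
    by case: asboolP.
  have := cmfun_setT_if mF m2; congr cmfun; apply/funext => z; rewrite /T'.
  by case: asboolP.
have mTs : cmfunc A (fun y => T' (s y)).
  by split; [exact: (cmfun_comp mA mS mT'.1)|exact: (cmfun_comp mA mS mT'.2)].
have mq1 : cmfunc A (fun y => (T' (s y) ^+ 2)^-1).
  by apply: cmfunc_inv => //; exact: cmfuncM.
pose q y : C := if `[< A y >] then (T' (s y) ^+ 2)^-1 else 0.
have qE z y : O1 z -> H z = Some y -> q y = (T z ^+ 2)^-1.
  move=> Oz Hz; rewrite /q asboolT; last by exists z.
  by rewrite (sE z y Oz Hz) /T' asboolT//; exists y.
have mq : cmfunc setT q.
  have [m1 m2] := mq1; split.
    have := cmfun_setT_if mA m1; congr cmfun; apply/funext => z; rewrite /q.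
    by case: asboolP.
  have := cmfun_setT_if mA m2; congr cmfun; apply/funext => z; rewrite /q.
  by case: asboolP.
exists q; split => //.
have mqn := cmfunc_cnorm mq.
(* The density pulled back by [H] and multiplied by |T|^2 is at most 1, so its mass is at most 512
   times the area of the half parallelogram. *)
have fin_int : (cint setT (fun y => cnorm (q y)) < +oo)%E.
  have q0 y : ~ A y -> cnorm (q y) = 0 by move=> nA; rewrite /q asboolF// cnorm0.
  rewrite (cint_support (@cmeasT R) mA (@subsetT _ _) mqn (fun z _ => cnorm_ge0 _) (fun z _ => @q0 z)).
  pose O2 := O1 `&` findom H.
  have oO2 : copen O2 by apply: copenI; [exact: open_half_copen|exact: findom_torus_copen].
  have mO2 := copen_cmeas oO2.
  have mJ : cmfun O2 (fun z => cnorm (T z)).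
    have := cmfunc_cnorm cmfunc_torus_derive.
    by apply: cmfunS (copen_cmeas findom_torus_copen) _ => z [].
  have pl : plip O2 (fun z => fin (H z)) (fun z => cnorm (T z)).
    move=> z [_ fz] e e0; have [d d0 dP] := pd_growth (torus_pd fz) e0.
    by exists d => // w _; exact: dP.
  have mg : cmfunc O2 (fun z => fin (H z)).
    by have [m1 m2] := cmfunc_torus; split; [exact: cmfun_sub m1|exact: cmfun_sub m2].
  have AO2 : A `<=` (fun z => fin (H z)) @` O2.
    by move=> y [z Oz Hz]; exists z; [split => //; exists y|rewrite Hz].
  have big := cint_image mO2 mJ (fun z _ => cnorm_ge0 _) pl (fun B mB => cmeas_comp mO2 mg mB) mA AO2 mqn
    (fun y => cnorm_ge0 _).
  apply: (le_lt_trans big).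
  have mqg : cmfun O2 (fun z => cnorm (q (fin (H z))) * cnorm (T z) ^+ 2).
    by apply: cmfunM; [exact: (cmfun_comp mO2 mg mqn)|exact: cmfunM].
  have le1 : (cint O2 (fun z => cnorm (q (fin (H z))) * cnorm (T z) ^+ 2)%R <= cint O2 (fun=> 1%R : R))%E.
    apply: cint_le => //; first exact: cmfun_cst.
    move=> z [Oz [y Hz]]; rewrite mulr_ge0 ?cnorm_ge0 ?exprn_ge0 ?cnorm_ge0//=.
    rewrite Hz /= (qE z y Oz Hz) cnormV cnormX.
    have [->|T0] := eqVneq (T z) 0; first by rewrite cnorm0 expr0n /= mulr0.
    by rewrite mulVf// expf_neq0// gt_eqF// cnorm_gt0.
  rewrite cint_cst// mul1e in le1.
  pose M : R := cnorm w1 + cnorm w2 + 1.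
  have M0 : 0 <= M by rewrite !addr_ge0// cnorm_ge0.
  have aO : (area O2 <= (4 * M ^+ 2)%:E)%E.
    apply: le_trans (area_cball 0 M0); apply: le_area => z [Oz _].
    by rewrite /cball /= subr0; apply: le_lt_trans (open_half_bounded ind Oz) _; rewrite ltrDl.
  apply: (@le_lt_trans _ _ (512%:E * (4 * M ^+ 2)%:E)%E); last by rewrite -EFinM ltry.
  apply: lee_wpmul2l; first by rewrite lee_fin ler0n.
  exact: le_trans le1 aO.
have iq : mu.-integrable setT (fun u => (cnorm (q (tp u)))%:E).
  apply/integrableP; split; first exact/measurable_EFinP.
  apply: le_lt_trans fin_int; rewrite /cint; apply: eqW.
  by apply: eq_integral => u _ /=; rewrite ger0_norm// cnorm_ge0.
have [m1 m2] := mq.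
split; apply: (le_integrable measurableT _ _ iq); try exact/measurable_EFinP.
- by move=> u _ /=; rewrite lee_fin [leRHS]ger0_norm ?cnorm_ge0// ler_cnorm_Re.
- by move=> u _ /=; rewrite lee_fin [leRHS]ger0_norm ?cnorm_ge0// ler_cnorm_Im.
Qed.

Variables (f : ratmap R) (a : int) (b : C).
Local Notation F := (reval f).
Local Notation L := (Lat w1 w2).
Hypotheses (d0 : (0 < rdeg f)%N) (Hsurj : forall y : S, exists z, H z = y) (a2 : 2 <= `|a|) (Lb : L (2 * b)).
Hypothesis Feq : forall z, F (H z) = H (a%:~R * z + b).
Local Notation X := (abscissa w1 w2).
Local Notation Y := (ordinate w1 w2).

Let a0 : (a%:~R : C) != 0.
Proof. by rewrite intr_eq0; apply/eqP => e; move: a2; rewrite e; lia. Qed.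

Lemma pd_affine (u : C -> C) (e l : C) z D : pd u (e * z + l) D -> pd (fun w => u (e * w + l)) z (D * e).
Proof.
move=> hu.
have h1 := hol_pd (holD (holM (hol_cst z 1 e) (hol_id z 1)) (hol_cst z 1 l)) (cball_center z ltr01).
by rewrite mul0r add0r mulr1 addr0 in h1; exact: pd_comp h1 hu.
Qed.

Lemma derive_same z w : findom H z -> H w = H z -> T w ^+ 2 = T z ^+ 2.
Proof.
move=> fz e; have fw : findom H w by move: fz => [v hv]; exists v; rewrite e.
have tz := torus_pd fz; have tw := torus_pd fw.
have [Lw|Lw] := (Hsame w z).1 e.
  have per u : H (1 * u + (w - z)) = H u by apply/Hsame; left; have -> : 1 * u + (w - z) - u = w - z by ring.
  have ew : 1 * z + (w - z) = w by ring.
  have h := @pd_affine (fun u => fin (H u)) 1 (w - z) z (T w); rewrite ew in h.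
  have h1 := h tw; rewrite mulr1 in h1.
  have -> : T z = T w by apply: (pd_unique tz); apply: (pd_eq ltr01 _ h1) => u _; rewrite per.
  by [].
have per u : H (-1 * u + (w + z)) = H u by apply/Hsame; right; have -> : -1 * u + (w + z) + u = w + z by ring.
have ew : -1 * z + (w + z) = w by ring.
have h := @pd_affine (fun u => fin (H u)) (-1) (w + z) z (T w); rewrite ew in h.
have h1 := h tw.
have -> : T z = T w * -1 by apply: (pd_unique tz); apply: (pd_eq ltr01 _ h1) => u _; rewrite per.
by rewrite mulrN1 sqrrN.
Qed.

Definition torus_bad := [set y | exists2 z, (grid_lines w1 w2 z \/ T z = 0) & H z = Some y].

Lemma area_torus_bad : area torus_bad = 0%E.
Proof.
pose g z := fin (H z).
apply: (@area_sub0 _ _ (g @` (grid_lines w1 w2 `&` findom H) `|` g @` ([set z | T z = 0] `&` findom H))).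
  move=> y [z [gz|tz] Hz]; have fz : findom H z by exists y.
    by left; exists z => //; rewrite /g Hz.
  by right; exists z => //; rewrite /g Hz.
apply: areaU0.
  apply: area_image0; first by apply: area_sub0 (area_grid_lines ind) => z [].
  move=> z [_ fz]; have [d dd dP] := pd_lip (torus_pd fz).
  by exists (cnorm (T z) + 1), d; split => // w _; exact: dP.
apply: (@area_image_critical _ _ _ (fun z => cnorm (T z))).
  move=> z [_ fz] e e0; have [d dd dP] := pd_growth (torus_pd fz) e0.
  by exists d => // w _; exact: dP.
by move=> z [tz _]; rewrite tz cnorm0.
Qed.

Lemma good_density (q : C -> C) : (forall z y, open_half w1 w2 z -> H z = Some y -> q y = (T z ^+ 2)^-1) ->
  forall z y, ~ torus_bad y -> H z = Some y -> T z != 0 /\ q y = (T z ^+ 2)^-1.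
Proof.
move=> qP z y ny Hz.
have tz : T z != 0 by apply/eqP => t0; apply: ny; exists z => //; right.
have nl : ~ grid_lines w1 w2 z by move=> gz; apply: ny; exists z => //; left.
split => //; have [w [Ow zw]] := reduce_open_half ind nl.
have Hw : H w = H z by apply/esym/Hsame.
rewrite (qP w y Ow); last by rewrite Hw.
have fz : findom H z by exists y.
exact: (@sq_invE C (T w) (T z) (derive_same fz Hw)).
Qed.

(** Over y = H(w) the fibre consists of the points H((w + l - b) / a), with [l] running through the
    a^2 classes of the lattice modulo [a]. By the chain rule each contributes q(y) / a^2. *)
Lemma fixed_density (q p : C -> C) : (forall z y, open_half w1 w2 z -> H z = Some y -> q y = (T z ^+ 2)^-1) ->
  area [set y | p y <> q y] = 0%E ->
  area [set y | q y <> \sum_(x \in [set x | F (Some x) = Some y]) p x / planar_derive F x ^+ 2] = 0%E.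
Proof.
move=> qP pq; have gd := good_density qP.
pose N := torus_bad `|` [set y | p y <> q y].
have N0 : area N = 0%E by apply: areaU0 => //; exact: area_torus_bad.
apply: (@area_sub0 _ _ ((torus_bad `|` fimage f N) `|` [set y | F None = Some y])); last first.
  apply: areaU0; first by apply: areaU0; [exact: area_torus_bad|exact: area_fimage0].
  case FN : (F None) => [v|]; last by apply: area_sub0 (@area0 R) => y.
  by apply: area_sub0 (area1 v) => y [->].
move=> y ny; apply: contrapT => /not_orP[/not_orP[nb nf] nN]; apply: ny.
have [w Hw] := Hsurj (Some y); have [Tw qw] := gd w y nb Hw.
pose n := `|a|%N; have n0 : (0 < n)%N by rewrite /n; lia.
pose l (i : 'I_n * 'I_n) : C := (i.1 : nat)%:R * w1 + (i.2 : nat)%:R * w2.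
have Ll i : L (l i) by exists (i.1 : nat)%:Z, (i.2 : nat)%:Z; rewrite -!pmulrn.
pose u i : C := (w + l i - b) / a%:~R.
have au i : a%:~R * u i + b = w + l i by rewrite /u mulrC divfK// subrK.
have FH i : F (H (u i)) = Some y.
  by rewrite Feq au -Hw; apply/Hsame; left; rewrite addrAC subrr add0r.
have /choice[t tP] i : exists x, H (u i) = Some x.
  case e : (H (u i)) => [x|]; first by exists x.
  by exfalso; apply: nN; change (F None = Some y); rewrite -(FH i) e.
have Ft i : F (Some (t i)) = Some y by rewrite -tP.
have nt i : ~ N (t i) by move=> Nt; apply: nf; exists (t i).
have term i : p (t i) / planar_derive F (t i) ^+ 2 = q y / (a%:~R) ^+ 2.
  have pt : p (t i) = q (t i) by apply: contrapT => h; apply: (nt i); right.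
  have nbt : ~ torus_bad (t i) by move=> h; apply: (nt i); left.
  have [Tu qu] := gd _ _ nbt (tP i).
  have [E hE] := mero_hasd (mero_reval f (@mero_Some R)) (Ft i).
  have -> : planar_derive F (t i) = E by apply: planar_derive_hasd.
  have fu : findom H (u i) by exists (t i).
  have [D [r [r0 rP _]]] := Hpd fu; have hu := torus_pd fu.
  have hE' := hasd_pd hE.
  have hu1 : pd (fun x => fin (F (Some x))) (fin (H (u i))) E by rewrite tP.
  have c1 := pd_comp hu hu1.
  have fwl : findom H (a%:~R * u i + b) by exists y; rewrite -Feq FH.
  have c2 := pd_affine (torus_pd fwl).
  have ET : E * T (u i) = T (a%:~R * u i + b) * a%:~R.
    apply: (pd_unique _ c2); apply: (pd_eq r0 _ c1) => x /rP[v Hx].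
    by rewrite -Feq /= Hx.
  have Twl : T (a%:~R * u i + b) ^+ 2 = T w ^+ 2.
    by apply: derive_same; [exists y|rewrite -Feq FH Hw].
  have E0 : E != 0.
    apply/eqP => E0; move: ET; rewrite E0 mul0r => /esym/eqP; rewrite mulf_eq0 (negbTE a0) orbF => /eqP t0.
    by move: Twl; rewrite t0 expr0n /= => /esym/eqP; rewrite sqrf_eq0 (negbTE Tw).
  rewrite pt qu qw.
  exact: (@density_term C E (T (u i)) (T (a%:~R * u i + b)) (T w) (a%:~R) E0 a0 Tw ET Twl).
have aR : (a%:~R : C) = (a%:~R : R)%:C by rewrite rmorph_int.
have Xl i : X (l i) = (i.1 : nat)%:R /\ Y (l i) = (i.2 : nat)%:R.
  by have := XY_comb ind (i.1 : nat)%:R (i.2 : nat)%:R; rewrite !rmorph_nat.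
have small (i j : 'I_n) (m : int) : (i : nat)%:R - (j : nat)%:R = a%:~R * m%:~R :> R -> i = j.
  move=> e; have {}e : (i : nat)%:Z - (j : nat)%:Z = a * m.
    by apply/eqP; rewrite -(eqr_int R) intrB intrM -!pmulrn e.
  apply: val_inj => /=; have := ltn_ord i; have := ltn_ord j; rewrite /n => lj li.
  have [m0|m0] := eqVneq m 0; first by move: e; rewrite m0 mulr0 => /eqP; rewrite subr_eq0 => /eqP[].
  have h : `|a * m| = `|(i : nat)%:Z - (j : nat)%:Z| by rewrite e.
  rewrite normrM in h; have m1 : 1 <= `|m| by lia.
  have : `|a| <= `|(i : nat)%:Z - (j : nat)%:Z| by rewrite -h ler_peMr.
  move: (i : nat) (j : nat) li lj; clear; lia.
have aX z : X (a%:~R * z) = a%:~R * X z by rewrite aR XZ.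
have aY z : Y (a%:~R * z) = a%:~R * Y z by rewrite aR YZ.
have tinj : injective t.
  move=> i j e; have Hij : H (u i) = H (u j) by rewrite !tP e.
  have [/(LatE ind)[m [k [Xm Yk]]]|/(LatE ind)[m [k [Xm _]]]] := (Hsame _ _).1 Hij.
    have e1 : l i - l j = a%:~R * (u i - u j).
      by rewrite mulrBr -[l i](addKr w) -au -[l j](addKr w) -au; ring.
    have e2 : X (l i) - X (l j) = a%:~R * m%:~R by rewrite -Xm -aX -e1 XD XN.
    have e3 : Y (l i) - Y (l j) = a%:~R * k%:~R by rewrite -Yk -aY -e1 YD YN.
    move: e2 e3; rewrite !(Xl _).1 !(Xl _).2 => /small e2 /small e3.
    exact: injective_projections.
  (* If two of these points were opposite modulo the lattice, multiplying by [a] would make 2w a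
     lattice vector, and [w] would lie on the grid lines. *)
  exfalso; apply: nb; exists w => //; left.
  have [m' [_ [Xb _]]] := (LatE ind _).1 Lb.
  exists (a * m - (i.1 : nat)%:Z - (j.1 : nat)%:Z + m'); left.
  have e1 : a%:~R * (u i + u j) = w + w + (l i + l j) - 2 * b.
    by rewrite mulrDr -[a%:~R * u i](addrK b) -[a%:~R * u j](addrK b) !au; ring.
  have := congr1 X e1; rewrite aX Xm (XD w1 w2 (_ + (l i + l j))) (XD w1 w2 (w + w)) (XD w1 w2 w) (XD w1 w2 (l i)) XN Xb !(Xl _).1 => e2.
  by rewrite intrD !intrB intrM -!pmulrn e2; field.
(* Euclidean division of both lattice coordinates by [a] finds the class of the preimage. *)
have main v x : H v = Some x -> L (a%:~R * v + b - w) -> exists j, x = t j.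
  move=> Hv [m [k mk]].
  have an0 : a != 0 by apply/eqP => e; move: a2; rewrite e; lia.
  have modn (m' : int) : exists i : 'I_n, ((i : nat)%:Z = m' %% a)%Z.
    have h1 := ltz_mod m' an0; have h2 := modz_ge0 m' an0.
    have h3 : (`|(m' %% a)%Z|%N < n)%N by rewrite /n; lia.
    by exists (Ordinal h3) => /=; lia.
  have [i iP] := modn m; have [j jP] := modn k.
  exists (i, j); have : H v = H (u (i, j)); last by rewrite Hv tP => -[].
  apply/Hsame; left; exists (m %/ a)%Z, (k %/ a)%Z.
  apply: (mulfI a0); rewrite mulrBr.
  have -> : a%:~R * v = w - b + (m%:~R * w1 + k%:~R * w2) by rewrite -mk; ring.
  have -> : a%:~R * u (i, j) = w - b + l (i, j) by rewrite -[LHS](addrK b) au; ring.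
  rewrite {1}(divz_eq m a) {1}(divz_eq k a) -iP -jP /l /= !intrD !intrM -!pmulrn; ring.
have At x : [set x | F (Some x) = Some y] x <-> exists j, x = t j.
  split=> [/= Fx|[j ->]]; last exact: Ft.
  have [v Hv] := Hsurj (Some x).
  have : H (a%:~R * v + b) = H w by rewrite -Feq Hv Fx Hw.
  move=> /Hsame[]; first exact: main.
  move=> Lv; apply: (main (- v)).
    by rewrite -Hv; apply/Hsame; right; rewrite addNr; exists 0, 0; rewrite !mul0r addr0.
  have -> : a%:~R * - v + b - w = 2 * b - (a%:~R * v + b + w) by ring.
  by apply: LatD => //; exact: LatN.
rewrite (fsum_const tinj At term) card_prod !card_ord natrM.
have nn : (n%:R : C) * n%:R = (a%:~R) ^+ 2.
  rewrite -natrM -rmorphXn /= (_ : (a ^+ 2) = (n * n)%N%:Z) -?pmulrn//.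
  by rewrite /n expr2 PoszM abszE -normrM ger0_norm// -expr2 sqr_ge0.
by rewrite nn mulrC divfK// expf_neq0.
Qed.

Lemma torus_fixed_point : exists phi : L1 R, phi <> 0 /\ ruelle f phi = phi.
Proof.
have [q [iq qP]] := torus_density.
pose qf := CIntegrableFun (asboolT iq : q \in @cintegrable_pred R).
have rq : cae_eq (repr (\pi_(L1 R) qf)) q by exact: L1_reprP.
have pq : area [set y | repr (\pi_(L1 R) qf) y <> q y] = 0%E by apply/negligible_area.
exists (\pi_(L1 R) qf); split.
  move=> p0.
  have zero : cae_eq q (cst 0).
    have /L1_eqP : \pi_(L1 R) qf = \pi_(L1 R) 0 by rewrite p0 piE.
    by [].
  have q0 : area [set y | q y <> 0] = 0%E by apply/negligible_area.
  have [|y _ ny] := @null_dense R 0 1 ([set y | q y <> 0] `|` torus_bad) ltr01.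
    by apply: (@area_sub0 _ _ _ _ (areaU0 q0 area_torus_bad)) => y [].
  have [z Hz] := Hsurj (Some y).
  have nb : ~ torus_bad y by move=> h; apply: ny; right.
  have [Tz qy] := good_density qP nb Hz; apply: ny; left => qy0.
  by move/eqP: qy; rewrite qy0 eq_sym invr_eq0 sqrf_eq0 (negbTE Tz).
apply: L1_of_repr.
have /negligible_area h0 : area [set y | repr (\pi_(L1 R) qf) y <> \sum_(x \in [set x | F (Some x) = Some y])
    repr (\pi_(L1 R) qf) x / planar_derive F x ^+ 2] = 0%E; last exact: h0.
apply: (@area_sub0 _ _ _ _ (areaU0 pq (fixed_density qP pq))) => y ny.
by apply: contrapT => /not_orP[/contrapT h1 /contrapT h2]; apply: ny; rewrite /= h1 h2.
Qed.

End TorusMap.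

(** Following the torus quotient by the inverse Moebius map gives a quotient that semiconjugates [f]
    itself to the affine map, so no density has to be transported. *)
Lemma lattes_fixed_point (R : realType) (f g : ratmap R) : (2 <= rdeg f)%N ->
  flexible_lattes g -> moebius_conjugate f g -> exists phi : L1 R, phi <> 0 /\ ruelle f phi = phi.
Proof.
move=> d2 [L [Th [a [b [[w1 [w2 [ind LE]]] [hol surj same] a2 Lb Teq]]]]] [m [m1 conj]].
have [m' mK m'K] := moebius_inverse m1.
have LatL : L = Lat w1 w2 by [].
rewrite LatL in same Lb.
pose H z := reval m' (Th z).
have m'inj x y : reval m' x = reval m' y -> x = y by move=> e; rewrite -(m'K x) e m'K.
have mm : mero (fun z => reval m' (Some z)) := mero_reval m' (@mero_Some R).
have ms : mero (fun z => reval m' (sinv (Some z))) := mero_reval m' (mero_sinv (@mero_Some R)).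
apply: (@torus_fixed_point R H w1 w2 ind _ _ _ f a b (ltnW d2)) => //.
- move=> z w; split => [/m'inj/same //|h]; by congr reval; apply/same.
- by move=> z fz; exact: (plane_holomorphic_pdat hol mm ms fz).
- move=> z fz; apply: (@plane_holomorphic_pdat R Th (@sinv R \o reval m') z hol _ _ fz).
    exact: (mero_sinv mm).
  exact: (mero_sinv ms).
- by move=> y; have [z _ hz] := surj (reval m y) I; exists z; rewrite /H hz mK.
- move=> z; have := congr1 (fun h => h (H z)) conj; rewrite /= /H m'K Teq => e.
  by rewrite -e mK.
Qed.

Theorem theorem5 (R : realType) (f : ratmap R) (hdeg : (2 <= rdeg f)%N)
    (sigma : set (sphere R)) (hsigma : analytic_arc sigma)
    (hcrit : critical_values f `<=` sigma)
    (D : 'I_(rdeg f) -> set (sphere R)) (hD : sheets sigma D)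
    (rho : deck_semigroup D -> L1 R -> L1 R)
    (hrho : ruelle_representation rho)
    (hamen : left_amenable rho) :
  (exists phi : L1 R, phi <> 0 /\ ruelle f phi = phi) <->
  (exists g : ratmap R, flexible_lattes g /\ moebius_conjugate f g).
Proof.
have d0 := ltnW hdeg; have sigma0 := null_arc hsigma.
split=> [[phi [phi0 fix_phi]]|[g [lg fg]]]; last exact: lattes_fixed_point lg fg.
have deck := amenable_deck_fixed d0 hD hrho hamen fix_phi.
have good0 := fundamental_equation d0 hD sigma0 phi0 fix_phi deck.
have [c [h [c0 mh gen0 ode]]] := limit_map hdeg hD sigma0 good0 phi0.
(* The developing map was built for [f] itself, so the conjugacy is the identity. *)
exists f; split; last exact: moebius_conjugate_refl.
exact: lattes_of_development hdeg hD sigma0 good0 (cintegrableP _) c0 mh gen0 ode.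
Qed.
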